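(* Let $X$ be a normal domain of finite type over a field $k$ of characteristic zero and let $\mathscr{F}$ be a locally free saturated foliation on $X$. Suppose that $\mathscr{F}$ has at worst terminal singularities. Then $X$ is regular and $\mathscr{F}$ is regular.
   Context: ''Normal domain of finite type over $k$'' means an integral normal scheme of finite type over $k$. A foliation $\mathscr{F}$ on $X$ is a coherent subsheaf $\mathscr{F}\subseteq\mathscr{T}_{X/k}$ of the tangent sheaf closed under the Lie bracket; it is saturated if $\mathscr{T}_{X/k}/\mathscr{F}$ is torsion-free; it is locally free if it is a locally free $\mathscr{O}_X$-module (of finite rank $r$). Canonical sheaf and discrepancies: $\omega_{\mathscr{F}}=(\Lambda^r\mathscr{F})^{\vee}$ (reflexive dual), with associated divisor $K_{\mathscr{F}}$; it is invertible here since $\mathscr{F}$ is locally free. For a proper birational morphism $\pi:\tilde X\to X$ with $\tilde X$ normal, the foliation $\mathscr{F}$ induces a pull-back foliation $\tilde{\mathscr{F}}$ on $\tilde X$, namely the saturated foliation on $\tilde X$ agreeing with $\mathscr{F}$ over the locus where $\pi$ is an isomorphism, and one writes $K_{\tilde{\mathscr{F}}}=\pi^*K_{\mathscr{F}}+\sum_E a(E,\mathscr{F})E$, the sum being over $\pi$-exceptional prime divisors. $\mathscr{F}$ has at worst terminal singularities if $a(E,\mathscr{F})>0$ for every exceptional prime divisor $E$ on every such $\tilde X$. $\mathscr{F}$ is regular if, for every $x\in X$, the map $\Omega^1_{X/k,x}\to\mathscr{F}^{\vee}_x$ dual to the inclusion $\mathscr{F}\subseteq\mathscr{T}_{X/k}$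 is surjective. *)

(* Defs.v *)
From mathcomp Require Import all_boot all_algebra.
From mathcomp Require Import boolp classical_sets topology.

Set Implicit Arguments.
Unset Strict Implicit.
Unset Printing Implicit Defensive.

Import GRing.Theory Num.Theory.

Local Open Scope classical_set_scope.
Local Open Scope ring_scope.

Section CommutativeAlgebra.
Context {R : comNzRingType}.
Implicit Types (P : set R) (n : nat).

Definition is_ideal P : Prop :=
  [/\ P 0, forall a b, P a -> P b -> P (a + b) & forall a b, P b -> P (a * b)].

Definition is_prime P : Prop :=
  [/\ is_ideal P, ~ P 1 & forall a b, P (a * b) -> P a \/ P b].

Definition ideal_gen n (g : 'I_n -> R) : set R :=
  [set a | exists c : 'I_n -> R, a = \sum_(i < n) c i * g i].

Definition is_noetherian : Prop :=
  forall P, is_ideal P -> exists n (g : 'I_n -> R), P = ideal_gen g.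

Definition has_prime_chain n : Prop :=
  exists P : nat -> set R,
    (forall i, (i <= n)%N -> is_prime (P i)) /\
    (forall i, (i < n)%N -> P i `<` P i.+1).

Definition krull_dim n : Prop := has_prime_chain n /\ ~ has_prime_chain n.+1.

Definition is_domain : Prop := forall a b : R, a * b = 0 -> a = 0 \/ b = 0.

(* A domain that is integrally closed in its field of fractions: an integral
   equation for the fraction a / b is written after clearing denominators. *)
Definition is_normal_domain : Prop :=
  is_domain /\
  forall (a b : R) n (c : 'I_n -> R), b != 0 ->
    a ^+ n = \sum_(i < n) c i * a ^+ i * b ^+ (n - i) ->
    exists d, a = b * d.

Definition is_subring P : Prop :=
  [/\ P 1, forall a b, P a -> P b -> P (a - b)
    & forall a b, P a -> P b -> P (a * b)].

End CommutativeAlgebra.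

Arguments is_noetherian : clear implicits.
Arguments has_prime_chain : clear implicits.
Arguments krull_dim : clear implicits.
Arguments is_domain : clear implicits.
Arguments is_normal_domain : clear implicits.

Definition is_regular_local (R : comUnitRingType) : Prop :=
  is_noetherian R /\
  exists d, krull_dim R d /\
    exists g : 'I_d -> R, [set a : R | a \isn't a GRing.unit] = ideal_gen g.

(* B is generated, as an algebra over A through h, by finitely many elements. *)
Definition finitely_generated_algebra (A B : comNzRingType) (h : A -> B) : Prop :=
  exists n (b : 'I_n -> B), forall S : set B,
    is_subring S -> (forall a, S (h a)) -> (forall i, S (b i)) -> S = setT.

(* A sheaf of rings is given by its stalks together with, for every open U,
   the families of germs (s x), x in U, that are sections over U. A family is
   defined on the whole space, but for U only its values on U matter. *)

Record ringed_space := RingedSpace {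
  space :> topologicalType;
  stalk : space -> comUnitRingType;
  sec : set space -> set (forall x, stalk x);
  sec_ext : forall U s t, open U ->
    (forall x, U x -> s x = t x) -> sec U s -> sec U t;
  sec_restrict : forall U V s, open U -> open V -> V `<=` U ->
    sec U s -> sec V s;
  sec_glue : forall U s, open U ->
    (forall x, U x -> exists V, [/\ open V, V x & sec V s]) -> sec U s;
  sec_one : forall U, open U -> sec U (fun x => 1);
  sec_sub : forall U s t, open U -> sec U s -> sec U t ->
    sec U (fun x => s x - t x);
  sec_mul : forall U s t, open U -> sec U s -> sec U t ->
    sec U (fun x => s x * t x);
  sec_germ : forall x (a : stalk x), exists U s,
    [/\ open U, U x, sec U s & s x = a];
  sec_germ0 : forall U s x, open U -> U x -> sec U s -> s x = 0 ->
    exists V, [/\ open V, V x & forall y, V y -> s y = 0] }.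

Arguments stalk {_} _.
Arguments sec {_} _ _.

Definition germ_family (X : ringed_space) := forall x : X, stalk x.

(* The maps rho x, x in U, identify the open subspace U with Spec A: points
   correspond to primes of A, the sets D(a) form a base of the topology of U,
   and stalk x is the localization of A at the prime of x. The axioms of a
   ringed space then force the sections to be those of Spec A. The values
   rho x for x outside U are irrelevant. *)
Record affine_chart (X : ringed_space) (U : set X) (A : comNzRingType)
    (rho : forall x : X, A -> stalk x) : Prop := AffineChart {
  chart_open : open U;
  chart_one : forall x, U x -> rho x 1 = 1;
  chart_sub : forall x a b, U x -> rho x (a - b) = rho x a - rho x b;
  chart_mul : forall x a b, U x -> rho x (a * b) = rho x a * rho x b;
  chart_sec : forall a, sec U (fun x => rho x a);
  chart_prime : forall x, U x ->
    is_prime [set a | rho x a \isn't a GRing.unit];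
  chart_points : forall P : set A, is_prime P ->
    exists! x, U x /\ P = [set a | rho x a \isn't a GRing.unit];
  chart_base : forall V x, open V -> V x -> U x -> exists a,
    rho x a \is a GRing.unit /\
    forall y, U y -> rho y a \is a GRing.unit -> V y;
  chart_basic_open : forall a, open [set x | U x /\ rho x a \is a GRing.unit];
  chart_frac : forall x (b : stalk x), U x -> exists a d,
    rho x d \is a GRing.unit /\ b = rho x a / rho x d;
  chart_ker : forall x a, U x -> rho x a = 0 -> exists d,
    rho x d \is a GRing.unit /\ d * a = 0 }.

Record scheme := Scheme {
  scheme_space :> ringed_space;
  scheme_affine : forall x : scheme_space,
    exists (U : set scheme_space) (A : comNzRingType)
      (rho : forall y : scheme_space, A -> stalk y),
    U x /\ affine_chart U rho }.

Record morphism (Y X : scheme) := Morphism {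
  mor :> Y -> X;
  mor_stalk : forall y : Y, {rmorphism stalk (mor y) -> stalk y};
  mor_continuous : continuous mor;
  mor_local : forall y (a : stalk (mor y)),
    mor_stalk y a \is a GRing.unit -> a \is a GRing.unit;
  mor_sec : forall U s, open U -> sec U s ->
    sec (mor @^-1` U) (fun y => mor_stalk y (s (mor y))) }.

Arguments mor_stalk {_ _} _ _.

Definition pull (Y X : scheme) (f : morphism Y X) (s : germ_family X) :
    germ_family Y :=
  fun y => mor_stalk f y (s (f y)).

(* The stalk maps of f and g at y have different types unless f y and g y are
   identified; they are compared on arbitrary families of germs. *)
Definition mor_eq (Y X : scheme) (f g : morphism Y X) : Prop :=
  (forall y, f y = g y) /\ forall s y, pull f s y = pull g s y.

Section Composition.
Variables (Z Y X : scheme) (f : morphism Y X) (g : morphism Z Y).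

Let comp_stalk (z : Z) : {rmorphism stalk (f (g z)) -> stalk z} :=
  mor_stalk g z \o mor_stalk f (g z).

Fact comp_continuous : continuous (f \o g).
Proof.
by move=> z; apply: continuous_comp; [exact: mor_continuous|exact: mor_continuous].
Qed.

Fact comp_local z (a : stalk (f (g z))) :
  comp_stalk z a \is a GRing.unit -> a \is a GRing.unit.
Proof. by move=> /mor_local /mor_local. Qed.

Fact comp_sec U s : open U -> sec U s ->
  sec ((f \o g) @^-1` U) (fun z => comp_stalk z (s (f (g z)))).
Proof.
move=> oU Us; have oV : open (f @^-1` U).
  by move: oU; apply: open_comp => y _; exact: mor_continuous.
exact: (mor_sec g oV (mor_sec f oU Us)).
Qed.

Definition mor_comp : morphism Z X :=
  @Morphism Z X (f \o g) comp_stalk comp_continuous comp_local comp_sec.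
End Composition.

Section Identity.
Variable X : scheme.

Fact id_continuous : continuous (@idfun X).
Proof. by move=> x; exact: cvg_id. Qed.

Fact id_local (x : X) (a : stalk x) :
  (idfun : {rmorphism stalk x -> stalk x}) a \is a GRing.unit ->
  a \is a GRing.unit.
Proof. by []. Qed.

Fact id_sec (U : set X) (s : germ_family X) : open U -> sec U s ->
  sec (idfun @^-1` U)
    (fun x => (idfun : {rmorphism stalk x -> stalk x}) (s x)).
Proof. by []. Qed.

Definition mor_id : morphism X X :=
  @Morphism X X idfun (fun x => idfun) id_continuous id_local id_sec.
End Identity.

(* P, with projections p and q, is the fibre product of f and g. *)
Definition is_fibre_product (X Y Z P : scheme) (f : morphism Y X)
    (g : morphism Z X) (p : morphism P Y) (q : morphism P Z) : Prop :=
  mor_eq (mor_comp f p) (mor_comp g q) /\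
  forall (T : scheme) (u : morphism T Y) (v : morphism T Z),
    mor_eq (mor_comp f u) (mor_comp g v) ->
    exists w : morphism T P,
      [/\ mor_eq (mor_comp p w) u, mor_eq (mor_comp q w) v
        & forall w' : morphism T P, mor_eq (mor_comp p w') u ->
            mor_eq (mor_comp q w') v -> mor_eq w' w].

Definition closed_immersion (Y X : scheme) (f : morphism Y X) : Prop :=
  [/\ injective f, forall C : set Y, closed C -> closed (f @` C)
    & forall y (b : stalk y), exists a, mor_stalk f y a = b].

Definition separated (Y X : scheme) (f : morphism Y X) : Prop :=
  forall (P : scheme) (p q : morphism P Y) (delta : morphism Y P),
    is_fibre_product f f p q ->
    mor_eq (mor_comp p delta) (mor_id Y) ->
    mor_eq (mor_comp q delta) (mor_id Y) ->
    closed_immersion delta.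

Definition universally_closed (Y X : scheme) (f : morphism Y X) : Prop :=
  forall (Z P : scheme) (g : morphism Z X) (p : morphism P Y)
    (q : morphism P Z), is_fibre_product f g p q ->
    forall C : set P, closed C -> closed (q @` C).

Definition finite_type (Y X : scheme) (f : morphism Y X) : Prop :=
  (forall U : set X, open U -> compact U -> compact (f @^-1` U)) /\
  forall y : Y, exists (U : set X) (A : comNzRingType)
      (rho : forall x : X, A -> stalk x) (V : set Y) (B : comNzRingType)
      (sigma : forall z : Y, B -> stalk z) (h : {rmorphism A -> B}),
    [/\ affine_chart U rho, affine_chart V sigma, V y, V `<=` f @^-1` U
      & (forall z a, V z -> sigma z (h a) = mor_stalk f z (rho (f z) a)) /\
        finitely_generated_algebra h].

Definition proper_morphism (Y X : scheme) (f : morphism Y X) : Prop :=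
  [/\ separated f, finite_type f & universally_closed f].

Definition integral_scheme (X : scheme) : Prop :=
  [set: X] !=set0 /\
  forall U : set X, open U -> U !=set0 -> forall s t, sec U s -> sec U t ->
    (forall x, U x -> s x * t x = 0) ->
    (forall x, U x -> s x = 0) \/ (forall x, U x -> t x = 0).

Definition normal_scheme (X : scheme) : Prop :=
  forall x : X, is_normal_domain (stalk x).

Definition regular_scheme (X : scheme) : Prop :=
  forall x : X, is_regular_local (stalk x).

Definition generic_point (X : scheme) (eta : X) : Prop :=
  closure [set eta] = setT.

(* For integral schemes: f maps the generic point to the generic point and
   induces an isomorphism of function fields. *)
Definition birational (Y X : scheme) (f : morphism Y X) : Prop :=
  forall eta : Y, generic_point eta ->
    generic_point (f eta) /\ bijective (mor_stalk f eta).

(* f restricts to an isomorphism from the preimage of U to U. *)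
Definition iso_over (Y X : scheme) (f : morphism Y X) (U : set X) : Prop :=
  [/\ open U, forall x, U x -> exists! y, f y = x,
      forall V, open V -> V `<=` f @^-1` U -> open (f @` V)
    & forall y, U (f y) -> bijective (mor_stalk f y)].

(* Schemes over a field: the structure morphism to Spec k is given by the
   corresponding ring homomorphisms from k to the sections. *)

Record kscheme (k : fieldType) := KScheme {
  kscheme_scheme :> scheme;
  scalar : forall x : kscheme_scheme, {rmorphism k -> stalk x};
  scalar_sec : forall c, sec setT (fun x => scalar x c) }.

Arguments scalar {_ _} _.

Definition finite_type_over (k : fieldType) (X : kscheme k) : Prop :=
  compact [set: X] /\
  forall x : X, exists (U : set X) (A : comNzRingType)
      (rho : forall y : X, A -> stalk y) (h : {rmorphism k -> A}),
    [/\ affine_chart U rho, U x, forall y c, U y -> rho y (h c) = scalar y c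
      & finitely_generated_algebra h].

Definition is_kmorphism (k : fieldType) (Y X : kscheme k) (f : morphism Y X) :
    Prop :=
  forall y c, mor_stalk f y (scalar (f y) c) = scalar y c.

Section Foliations.
Variables (k : fieldType) (X : kscheme k).

Definition is_derivation (x : X) (d : stalk x -> stalk x) : Prop :=
  [/\ forall a b, d (a + b) = d a + d b,
      forall a b, d (a * b) = a * d b + b * d a
    & forall c, d (scalar x c) = 0].

Definition vfield := forall x : X, stalk x -> stalk x.

(* The sections over U of the tangent sheaf, that is of the sheaf dual to the
   Kaehler differentials of X over k: the k-derivations of the sheaf of rings
   restricted to U. *)
Definition tangent (U : set X) : set vfield :=
  [set D | (forall x, U x -> is_derivation (D x)) /\
     forall V s, open V -> V `<=` U -> sec V s -> sec V (fun x => D x (s x))].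

Definition vadd (D E : vfield) : vfield := fun x a => D x a + E x a.
Definition vscale (s : germ_family X) (D : vfield) : vfield :=
  fun x a => s x * D x a.
Definition vcomb n (s : 'I_n -> germ_family X) (D : 'I_n -> vfield) : vfield :=
  fun x a => \sum_(i < n) s i x * D i x a.
Definition lie_bracket (D E : vfield) : vfield :=
  fun x a => D x (E x a) - E x (D x a).
Definition vf_eq_on (U : set X) (D E : vfield) : Prop :=
  forall x, U x -> D x =1 E x.

Implicit Types F : set X -> set vfield.

(* Subsheaves of modules of the tangent sheaf; F U is the set of sections
   over U, with the same convention on values outside U as for sec. *)
Record tangent_submodule F : Prop := TangentSubmodule {
  fol_tangent : forall U, open U -> F U `<=` tangent U;
  fol_ext : forall U D E, open U -> vf_eq_on U D E -> F U D -> F U E;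
  fol_restrict : forall U V D, open U -> open V -> V `<=` U -> F U D -> F V D;
  fol_glue : forall U D, open U ->
    (forall x, U x -> exists V, [/\ open V, V x & F V D]) -> F U D;
  fol_zero : forall U, open U -> F U (fun x a => 0);
  fol_add : forall U D E, open U -> F U D -> F U E -> F U (vadd D E);
  fol_scale : forall U s D, open U -> sec U s -> F U D -> F U (vscale s D) }.

Definition locally_finitely_generated F : Prop :=
  forall x : X, exists (U : set X) n (D : 'I_n -> vfield),
    [/\ open U, U x, forall i, F U (D i)
      & forall V E, open V -> V `<=` U -> F V E -> forall y, V y ->
        exists (W : set X) (s : 'I_n -> germ_family X),
          [/\ open W, W y, W `<=` V, forall i, sec W (s i)
            & vf_eq_on W E (vcomb s D)]].

(* The sheaf of relations between sections D of F over U. *)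
Definition relation n (D : 'I_n -> vfield) (V : set X)
    (s : 'I_n -> germ_family X) : Prop :=
  (forall i, sec V (s i)) /\ vf_eq_on V (vcomb s D) (fun x a => 0).

Definition relations_finitely_generated F : Prop :=
  forall (U : set X) n (D : 'I_n -> vfield), open U -> (forall i, F U (D i)) ->
  forall x, U x ->
  exists (V : set X) m (t : 'I_m -> 'I_n -> germ_family X),
    [/\ open V, V x, V `<=` U, forall j, relation D V (t j)
      & forall W s, open W -> W `<=` V -> relation D W s -> forall y, W y ->
        exists (W' : set X) (c : 'I_m -> germ_family X),
          [/\ open W', W' y, W' `<=` W, forall j, sec W' (c j)
            & forall i z, W' z -> s i z = \sum_(j < m) c j z * t j i z]].

Definition coherent F : Prop :=
  locally_finitely_generated F /\ relations_finitely_generated F.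

Definition foliation F : Prop :=
  [/\ tangent_submodule F, coherent F
    & forall U D E, open U -> F U D -> F U E -> F U (lie_bracket D E)].

(* The quotient of the tangent sheaf by F is torsion-free at every point. *)
Definition saturated F : Prop :=
  forall (U : set X) x s D, open U -> U x -> sec U s -> s x != 0 ->
    tangent U D -> F U (vscale s D) ->
    exists V, [/\ open V, V x & F V D].

Definition locally_free (r : nat) F : Prop :=
  forall x : X, exists (U : set X) (e : 'I_r -> vfield),
    [/\ open U, U x, forall i, F U (e i),
        forall V D, open V -> V `<=` U -> F V D ->
          exists s, (forall i, sec V (s i)) /\ vf_eq_on V D (vcomb s e)
      & forall V s, open V -> V `<=` U -> relation e V s ->
          forall i x, V x -> s i x = 0].

(* Germs at y of the sections, respectively of the sections of F, defined
   near x. For y = x these are the stalks at x; on an integral scheme, for y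
   the generic point, these are the stalks at x viewed inside the generic
   stalk. On a scheme of finite type the stalk at x of the tangent sheaf is
   the module of k-derivations of stalk x, so that the stalk of F at x is
   faithfully represented by derivations. *)
Definition near_sec (x y : X) : set (stalk y) :=
  [set a | exists U s, [/\ open U, U x, U y, sec U s & a = s y]].
Definition near_fol F (x y : X) : set (stalk y -> stalk y) :=
  [set d | exists U D, [/\ open U, U x, U y, F U D & d = D y]].
Arguments near_sec : clear implicits.
Arguments near_fol : clear implicits.

(* Every functional phi on the stalk of F at x comes from a differential,
   that is from a finite sum of a_j db_j, which sends d to the sum of the
   a_j * d b_j. *)
Definition regular_foliation F : Prop :=
  forall (x : X) (phi : (stalk x -> stalk x) -> stalk x),
    (forall c d e, near_fol F x x d -> near_fol F x x e ->
       phi (fun b => c * d b + e b) = c * phi d + phi e) ->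
    exists n (a b : 'I_n -> stalk x), forall d, near_fol F x x d ->
      phi d = \sum_(j < n) a j * d (b j).

(* The canonical sheaf omega_F, dual of the r-th exterior power of F. Its
   rational sections are the alternating r-linear forms on the generic stalk
   of F, eta being the generic point, and its stalk at x consists of those
   that are regular on the stalk of F at x. *)
Definition rational_form r F (eta : X)
    (w : ('I_r -> (stalk eta -> stalk eta)) -> stalk eta) : Prop :=
  (forall v i c d e, (forall j, near_fol F eta eta (v j)) ->
     near_fol F eta eta d -> near_fol F eta eta e ->
     w [eta v with i |-> (fun a => c * d a + e a)] =
       c * w [eta v with i |-> d] + w [eta v with i |-> e]) /\
  (forall v i j, (forall l, near_fol F eta eta (v l)) -> i != j -> v i = v j ->
     w v = 0).

Definition canonical_stalk r F (eta x : X)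
    (w : ('I_r -> (stalk eta -> stalk eta)) -> stalk eta) : Prop :=
  rational_form F w /\
  forall v, (forall i, near_fol F x eta (v i)) -> near_sec x eta (w v).

(* h is a local equation at x of the divisor of the rational section w of
   omega_F: the section h^-1 w generates the stalk of omega_F at x. *)
Definition divisor_at r F (eta x : X)
    (w : ('I_r -> (stalk eta -> stalk eta)) -> stalk eta) (h : stalk eta) :
    Prop :=
  [/\ rational_form F w, h \is a GRing.unit
    & forall w', rational_form F w' ->
        (canonical_stalk F x w' <->
         exists g, near_sec x eta g /\
           forall v, (forall i, near_fol F eta eta (v i)) ->
             w' v = g * (h^-1 * w v))].

(* The order of vanishing of the rational function f along the prime divisor
   with generic point x. *)
Definition order_along (eta x : X) (f : stalk eta) (n : int) : Prop :=
  let O := near_sec x eta in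
  let Ounit := [set a | O a /\ exists2 b, O b & a * b = 1] in
  exists t u,
    [/\ O t, forall a, O a -> (~ Ounit a <-> exists2 b, O b & a = t * b),
        Ounit u & f = u * t ^ n].

End Foliations.

Arguments near_sec {k X} x y _.
Arguments near_fol {k X} F x y _.

Section Discrepancies.
Variables (k : fieldType) (X Y : kscheme k) (pi : morphism Y X).
Variables (F : set X -> set (vfield X)) (G : set Y -> set (vfield Y)).

(* The vector fields D on U and E on the preimage of U are compatible. *)
Definition pi_related (U : set X) (D : vfield X) (E : vfield Y) : Prop :=
  forall y, U (pi y) -> forall a,
    E y (mor_stalk pi y a) = mor_stalk pi y (D (pi y) a).

(* G is the saturated foliation on Y that agrees with F over the locus where
   pi is an isomorphism. *)
Definition pullback_foliation : Prop :=
  [/\ foliation G, saturated G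
    & forall U, iso_over pi U -> forall D E, pi_related U D E ->
        (F U D <-> G (pi @^-1` U) E)].

Definition exceptional_prime_divisor (e : Y) : Prop :=
  krull_dim (stalk e) 1 /\ has_prime_chain (stalk (pi e)) 2.

(* w' is the rational section w of omega_F viewed as a section of omega_G. *)
Definition same_form r (eta : Y)
    (w : ('I_r -> (stalk (pi eta) -> stalk (pi eta))) -> stalk (pi eta))
    (w' : ('I_r -> (stalk eta -> stalk eta)) -> stalk eta) : Prop :=
  forall v v', (forall i, near_fol F (pi eta) (pi eta) (v i)) ->
    (forall i, near_fol G eta eta (v' i)) ->
    (forall i a, v' i (mor_stalk pi eta a) = mor_stalk pi eta (v i a)) ->
    w' v' = mor_stalk pi eta (w v).

(* a is the coefficient, along the prime divisor with generic point e, of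
   K_G - pi^* K_F, where K_F and K_G are the divisors of one and the same
   rational section. *)
Definition discrepancy r (e : Y) (a : int) : Prop :=
  exists (eta : Y)
    (w : ('I_r -> (stalk (pi eta) -> stalk (pi eta))) -> stalk (pi eta))
    (w' : ('I_r -> (stalk eta -> stalk eta)) -> stalk eta) h h',
    [/\ generic_point eta, same_form w w', divisor_at F (pi e) w h,
        divisor_at G e w' h'
      & order_along e (h' / mor_stalk pi eta h) a].

End Discrepancies.

(* F is assumed to be locally free of rank r. *)
Definition terminal (k : fieldType) (X : kscheme k) (r : nat)
    (F : set X -> set (vfield X)) : Prop :=
  forall (Y : kscheme k) (pi : morphism Y X) (G : set Y -> set (vfield Y)),
    is_kmorphism pi -> integral_scheme Y -> normal_scheme Y ->
    proper_morphism pi -> birational pi -> pullback_foliation pi F G ->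
    forall e, exceptional_prime_divisor pi e ->
      exists2 a, discrepancy pi F G r e a & 0 < a.

(* Main.v *)
(* Everything takes place in the function field K of X: points are local subrings of K, vector fields are
   derivations of K, and F is a K-subspace L of Der_k(K).
   The key point is that no point xi of codimension at least two has a maximal ideal stable under the
   derivations of L preserving O_xi.  Otherwise (Seidenberg) these derivations lift to the normalised
   blow-up of the closure of xi; F then pulls back without zeros along an exceptional divisor, whose
   discrepancy is therefore at most 0.
   Hence every prime stable under L is locally principal, by normality.  For a Lie-closed space L' of
   derivations containing L, the ideal generated by the determinants of D_i(b_j), with D_i in L' regular,
   is stable under L' and not contained in a locally principal stable prime, so it is the unit ideal:
   locally, L' has a basis dual to functions b_j.  For L' = L this is regularity of F, for L' = Der_k(K)
   it gives regularity of X in characteristic 0.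
   The blow-up is shown to be universally closed by Manis valuations of ultraproducts of residue fields. *)

(* Saturation means that L is closed under division: if a combination of derivations of L maps a
   local ring into a principal maximal ideal (t), its quotient by t is again in L and regular. This
   lowers the t-order of a determinant, which is why the determinants cannot all lie in a locally
   principal stable prime. For the discrepancy, one rational form is evaluated on a basis of F
   below. Divided by its equation h there, it is a unit; divided by its equation h' above, it is
   still regular, because the basis lifts. Hence h'/h cannot have positive order. Properness
   quantifies over all fibre products, and none is constructed. Points of a fibre product are
   obtained from its universal property alone, by mapping spectra of subrings of products of residue
   fields into it. Regularity of X is reached without completions: a coefficient ring modulo the
   square of the maximal ideal takes the place of Cohen's theorem, and differential simplicity of
   the local ring kills its differentials relative to k[b_1,...,b_n]. *)
Require Import Defs.
From HB Require Import structures.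
From mathcomp Require Import all_boot all_algebra ring.
From mathcomp Require Import perm boolp classical_sets topology.
Require Import Defs.

Set Implicit Arguments.
Unset Strict Implicit.
Unset Printing Implicit Defensive.

Import GRing.Theory.

Local Open Scope classical_set_scope.
Local Open Scope ring_scope.

(** * Subrings given as sets, and adjunction of elements *)

Section Closure.
Context {R : comNzRingType}.
Variables (A : set R) (Asub : is_subring A).

Lemma subring1 : A 1. Proof. by case: Asub. Qed.
Lemma subringB a b : A a -> A b -> A (a - b). Proof. by case: Asub => _ h _; apply: h. Qed.
Lemma subringM a b : A a -> A b -> A (a * b). Proof. by case: Asub => _ _ h; apply: h. Qed.
Lemma subring0 : A 0.
Proof. by rewrite -(subrr (1 : R)); apply: subringB; exact: subring1. Qed.
Lemma subringN a : A a -> A (- a).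
Proof. by rewrite -sub0r; apply: subringB; exact: subring0. Qed.
Lemma subringD a b : A a -> A b -> A (a + b).
Proof. by move=> ha /subringN; rewrite -{2}[b]opprK; apply: subringB. Qed.
Lemma subringX a n : A a -> A (a ^+ n).
Proof.
by move=> ha; elim: n => [|n IH]; [exact: subring1|rewrite exprS; exact: subringM].
Qed.
Lemma subring_sum (I : Type) (r : seq I) (P : pred I) (F : I -> R) :
  (forall i, P i -> A (F i)) -> A (\sum_(i <- r | P i) F i).
Proof.
by move=> h; elim/big_ind: _ => //; [exact: subring0|exact: subringD].
Qed.
Lemma subring_prod (I : Type) (r : seq I) (P : pred I) (F : I -> R) :
  (forall i, P i -> A (F i)) -> A (\prod_(i <- r | P i) F i).
Proof.
by move=> h; elim/big_ind: _ => //; [exact: subring1|exact: subringM].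
Qed.
Lemma subring_nat n : A n%:R.
Proof.
by elim: n => [|n IH]; [exact: subring0|rewrite -addn1 natrD; apply: subringD; [|exact: subring1]].
Qed.
Lemma subring_mulrn a n : A a -> A (a *+ n).
Proof. by move=> ha; rewrite -mulr_natr; apply: subringM => //; exact: subring_nat. Qed.
Lemma subring_sign n : A ((-1) ^+ n).
Proof. by apply/subringX/subringN/subring1. Qed.
Lemma subring_det n (M : 'M[R]_n) : (forall i j, A (M i j)) -> A (\det M).
Proof.
move=> h; apply: subring_sum => s _; apply: subringM; first exact: subring_sign.
by apply: subring_prod.
Qed.
End Closure.

Section Subrings.
Context {R : comNzRingType}.
Implicit Types (A B : set R) (p q : {poly R}).

Definition polyin A p := forall i, A p`_i.

Lemma polyinC A a : is_subring A -> A a -> polyin A a%:P.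
Proof. by move=> As Aa i; rewrite coefC; case: ifP => // _; exact: subring0. Qed.
Lemma polyinX A : is_subring A -> polyin A 'X.
Proof. by move=> As i; rewrite coefX; exact: subring_nat. Qed.
Lemma polyin_subring A : is_subring A -> is_subring (polyin A).
Proof.
move=> As; split=> [|p q hp hq i|p q hp hq i].
- by apply: polyinC => //; exact: subring1.
- by rewrite coefB; exact: subringB.
- by rewrite coefM; apply: subring_sum => // j _; exact: subringM.
Qed.
Lemma polyin_horner A p x (B : set R) : is_subring B -> A `<=` B -> polyin A p ->
  B x -> B p.[x].
Proof.
move=> Bs AB hp Bx; rewrite horner_coef; apply: subring_sum => // i _.
by apply: subringM => //; [exact: AB|exact: subringX].
Qed.
Lemma polyin_sub A B p : A `<=` B -> polyin A p -> polyin B p.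
Proof. by move=> AB hp i; exact: AB. Qed.

Definition adj A x : set R := [set p.[x] | p in polyin A].

Lemma adj_subring A x : is_subring A -> is_subring (adj A x).
Proof.
move=> As; have Ps := polyin_subring As; split.
- by exists 1%:P; [apply: polyinC => //; exact: subring1|rewrite hornerC].
- by move=> _ _ [p hp <-] [q hq <-]; exists (p - q); [exact: (subringB Ps hp hq)|rewrite !hornerE].
- by move=> _ _ [p hp <-] [q hq <-]; exists (p * q); [exact: (subringM Ps hp hq)|rewrite hornerM].
Qed.
Lemma sub_adj A x : is_subring A -> A `<=` adj A x.
Proof. by move=> As a Aa; exists a%:P; [exact: polyinC|rewrite hornerC]. Qed.
Lemma mem_adj A x : is_subring A -> adj A x x.
Proof. by move=> As; exists 'X; [exact: polyinX|rewrite hornerX]. Qed.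
Lemma adj_min A x B : is_subring B -> A `<=` B -> B x -> adj A x `<=` B.
Proof. by move=> Bs AB Bx _ [p hp <-]; exact: (polyin_horner Bs AB). Qed.

Definition adjs A (s : seq R) := foldl adj A s.

Lemma adjs_subring A s : is_subring A -> is_subring (adjs A s).
Proof. by elim: s A => //= x s IH A As; exact/IH/adj_subring. Qed.
Lemma sub_adjs A s : is_subring A -> A `<=` adjs A s.
Proof.
elim: s A => [A As a //|x s IH A As a Aa /=].
by apply: IH; [exact: adj_subring|exact: sub_adj].
Qed.
Lemma mem_adjs A s x : is_subring A -> x \in s -> adjs A s x.
Proof.
elim: s A => //= y s IH A As; rewrite inE => /orP[/eqP->|xs].
  by apply: sub_adjs; [exact: adj_subring|exact: mem_adj].
by apply: IH => //; exact: adj_subring.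
Qed.
Lemma adjs_min A s B : is_subring B -> A `<=` B -> (forall x, x \in s -> B x) ->
  adjs A s `<=` B.
Proof.
move=> Bs; elim: s A => //= x s IH A AB sB; apply: IH => [|y ys].
  by apply: adj_min => //; apply: sB; rewrite inE eqxx.
by apply: sB; rewrite inE ys orbT.
Qed.
Lemma adjs_rcons A s x : adjs A (rcons s x) = adj (adjs A s) x.
Proof. by rewrite /adjs foldl_rcons. Qed.
Lemma adjs_mono A B s : is_subring A -> is_subring B -> A `<=` B -> adjs A s `<=` adjs B s.
Proof.
move=> As Bs AB; apply: adjs_min => [||x xs]; first exact: adjs_subring.
  by apply: subset_trans AB _; exact: sub_adjs.
exact: mem_adjs.
Qed.
End Subrings.

(** * Noetherian modules and the Hilbert basis theorem *)

Section Modules.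
Context {R : comNzRingType} {M : lmodType R}.
Implicit Types (A : set R) (s : seq M) (N I : set M).

(** The coefficients form a total sequence in A, also beyond the length of s; this avoids casts
    between ordinals when the list changes. *)
Definition lspan A s : set M :=
  [set x | exists2 c : nat -> R, (forall i, A (c i)) & x = \sum_(i < size s) c i *: s`_i].

Definition is_submod A N :=
  [/\ N 0, forall x y, N x -> N y -> N (x + y) & forall a x, A a -> N x -> N (a *: x)].

Lemma submod_sum A N (I : Type) (r : seq I) (P : pred I) (F : I -> M) :
  is_submod A N -> (forall i, P i -> N (F i)) -> N (\sum_(i <- r | P i) F i).
Proof. by case=> N0 ND _ h; elim/big_ind: _. Qed.

Lemma submodN A N x : is_subring A -> is_submod A N -> N x -> N (- x).
Proof. by move=> As [_ _ NZ] Nx; rewrite -scaleN1r; apply: NZ => //; apply: subringN => //; exact: subring1. Qed.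
Lemma submodB A N x y : is_subring A -> is_submod A N -> N x -> N y -> N (x - y).
Proof. by move=> As Nm Nx Ny; case: (Nm) => _ ND _; apply: ND => //; exact: (submodN As Nm). Qed.

Lemma lspan_submod A s : is_subring A -> is_submod A (lspan A s).
Proof.
move=> As; split.
- exists (fun=> 0) => [_|]; first exact: subring0.
  by rewrite big1 // => i _; rewrite scale0r.
- move=> _ _ [c hc ->] [d hd ->]; exists (fun i => c i + d i) => [i|]; first exact: subringD.
  by rewrite -big_split; apply: eq_bigr => i _; rewrite scalerDl.
- move=> a _ Aa [c hc ->]; exists (fun i => a * c i) => [i|]; first exact: subringM.
  by rewrite scaler_sumr; apply: eq_bigr => i _; rewrite scalerA.
Qed.
Lemma mem_lspan A s x : is_subring A -> x \in s -> lspan A s x.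
Proof.
move=> As xs; exists (fun i => (i == index x s)%:R) => [i|]; first exact: subring_nat.
have h : (index x s < size s)%N by rewrite index_mem.
rewrite (bigD1 (Ordinal h)) //= eqxx scale1r nth_index // big1 ?addr0 // => i /negPf ih.
by rewrite (_ : (i == index x s :> nat) = false) ?scale0r //; rewrite -val_eqE /= in ih.
Qed.
Lemma lspan_min A s N : is_submod A N -> (forall x, x \in s -> N x) -> lspan A s `<=` N.
Proof.
move=> Nm sN _ [c hc ->]; apply: (submod_sum _ Nm) => i _.
by case: Nm => _ _ NZ; apply: NZ => //; apply: sN; exact: mem_nth.
Qed.
Lemma lspan_sub A s t : is_subring A -> {subset s <= t} -> lspan A s `<=` lspan A t.
Proof.
by move=> As st; apply: lspan_min; [exact: lspan_submod|move=> x /st; exact: mem_lspan].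
Qed.

Definition noethm A N := forall I, is_submod A I -> I `<=` N ->
  exists2 s, (forall x, x \in s -> I x) & I `<=` lspan A s.

(** The ascending chain condition for the spans of the initial segments of u. Applied to powers or
    to leading coefficients, it yields integral equations and reductions of degree. *)
Lemma noethm_seq A N (u : nat -> M) : is_subring A -> noethm A N ->
  is_submod A N -> (forall i, N (u i)) -> exists n, lspan A (mkseq u n) (u n).
Proof.
move=> As noe Nm uN; pose I := [set x | exists n, lspan A (mkseq u n) x].
have mono m n : (m <= n)%N -> lspan A (mkseq u m) `<=` lspan A (mkseq u n).
  move=> mn; apply: lspan_sub => // x /mapP[i]; rewrite mem_iota /= => im ->.
  by apply/mapP; exists i => //; rewrite mem_iota /=; exact: leq_trans im mn.
have Im : is_submod A I.
  split.
  - by exists 0%N; case: (lspan_submod (mkseq u 0) As).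
  - move=> x y [m xm] [n yn]; exists (maxn m n).
    case: (lspan_submod (mkseq u (maxn m n)) As) => _ h _; apply: h.
      by apply: mono xm; exact: leq_maxl.
    by apply: mono yn; exact: leq_maxr.
  - by move=> a x Aa [n xn]; exists n; case: (lspan_submod (mkseq u n) As) => _ _; apply.
have IN : I `<=` N.
  by move=> x [n]; apply: lspan_min => // y /mapP[i _ ->].
have [s sI Is] := noe I Im IN.
have [n hn] : exists n, forall x, x \in s -> lspan A (mkseq u n) x.
  elim: s sI {Is} => [|x s IH] sI; first by exists 0%N.
  have [n hn] : exists n, forall x, x \in s -> lspan A (mkseq u n) x.
    by apply: IH => y ys; apply: sI; rewrite inE ys orbT.
  have [m hm] : I x by apply: sI; rewrite inE eqxx.
  exists (maxn m n) => y; rewrite inE => /orP[/eqP->|/hn].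
    by apply: mono hm; exact: leq_maxl.
  by apply: mono; exact: leq_maxr.
exists n; have : I (u n).
  exists n.+1; apply: mem_lspan => //; apply/mapP; exists n => //.
  by rewrite mem_iota /=.
by move=> /Is; apply: lspan_min => //; exact: lspan_submod.
Qed.

(** A family without a maximal element yields, by dependent choice, an increasing sequence of
    submodules with elements [u n] that are new at each stage; this contradicts [noethm_seq]. *)
Lemma noethm_max A N (F : set (set M)) : is_subring A -> noethm A N -> is_submod A N ->
  (exists I, F I) -> (forall I, F I -> is_submod A I /\ I `<=` N) ->
  exists I, F I /\ forall J, F J -> I `<=` J -> J = I.
Proof.
move=> As noe Nm [I0 FI0] FN; apply: contrapT => nomax.
have step (I : {I | F I}) : exists J : {I | F I} * M,
    [/\ sval I `<=` sval J.1, sval J.1 J.2 & ~ sval I J.2].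
  apply: contrapT => hI; apply: nomax; exists (sval I); split=> [|J FJ IJ].
    exact: svalP.
  apply/seteqP; split=> // x Jx; apply: contrapT => nIx.
  by apply: hI; exists (exist _ J FJ, x).
have [f hf] := choice step.
pose J := fix J n := if n is n'.+1 then (f (J n')).1 else exist _ I0 FI0.
pose u n := (f (J n)).2.
have Jmono m n : (m <= n)%N -> sval (J m) `<=` sval (J n).
  move=> /subnK<-; elim: (n - m)%N => // d IH; apply: subset_trans IH _.
  by rewrite addSn /=; case: (hf (J (d + m)%N)).
have uJ n : sval (J n.+1) (u n) by case: (hf (J n)).
have [n] := noethm_seq As noe Nm (u := u) (fun i => (FN _ (svalP (J i.+1))).2 _ (uJ i)).
have [_ _ nJ] := hf (J n); move=> h; apply: nJ; move: h.
apply: lspan_min; first by case: (FN _ (svalP (J n))).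
by move=> _ /mapP[i + ->]; rewrite mem_iota /= add0n => lin; apply: Jmono (uJ i).
Qed.
End Modules.

Section Extension.
Context {R : comNzRingType} {M M' : lmodType R}.

(** Generators of the image are lifted through f and completed by generators of the kernel. *)
Lemma noethm_ext (A : set R) (N : set M) (N' : set M') (f : M -> M') :
  is_subring A -> (forall x y, f (x + y) = f x + f y) -> (forall a x, A a -> f (a *: x) = a *: f x) ->
  (forall x, N x -> N' (f x)) -> noethm A N' ->
  noethm A [set x | N x /\ f x = 0] -> noethm A N.
Proof.
move=> As fD fZ NN' noe' noe I Im IN.
have f0 : f 0 = 0 by rewrite -(scale0r 0) fZ ?scale0r //; exact: subring0.
have fN x : f (- x) = - f x.
  by rewrite -scaleN1r fZ ?scaleN1r //; apply: subringN => //; exact: subring1.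
have fsum n (F : 'I_n -> M) : f (\sum_i F i) = \sum_i f (F i).
  exact: (big_morph f fD f0).
have [I0 ID IZ] := Im.
have [t tI It] : exists2 s, (forall x, x \in s -> [set f x | x in I] x) &
    [set f x | x in I] `<=` lspan A s.
  apply: noe' => [|_ [x Ix <-]]; last exact/NN'/IN.
  split; first by exists 0.
  - by move=> _ _ [x Ix <-] [y Iy <-]; exists (x + y); [exact: ID|].
  - by move=> a _ Aa [x Ix <-]; exists (a *: x); [exact: IZ|exact: fZ].
have [t' [st' t'I t'E]] : exists t', [/\ size t' = size t,
    (forall x, x \in t' -> I x) & forall i, (i < size t)%N -> f t'`_i = t`_i].
  have h i : exists x, I x /\ ((i < size t)%N -> f x = t`_i).
    have [it|it] := ltnP i (size t); last by exists 0.
    by have [x Ix fx] := tI _ (mem_nth 0 it); exists x.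
  have [g hg] := choice h; exists (mkseq g (size t)); split.
  - by rewrite size_mkseq.
  - by move=> _ /mapP[i _ ->]; case: (hg i).
  - by move=> i it; rewrite nth_mkseq //; exact: (hg i).2.
have [s sI Is] : exists2 s, (forall x, x \in s -> [set x | I x /\ f x = 0] x) &
    [set x | I x /\ f x = 0] `<=` lspan A s.
  apply: noe => [|x [Ix fx]]; last by split=> //; exact: IN.
  split; first by split.
  - by move=> x y [Ix fx] [Iy fy]; split; [exact: ID|rewrite fD fx fy addr0].
  - by move=> a x Aa [Ix fx]; split; [exact: IZ|rewrite fZ // fx scaler0].
exists (s ++ t') => [x|x Ix].
  by rewrite mem_cat => /orP[/sI[]|/t'I].
have [c hc fx] : lspan A t (f x) by apply: It; exists x.
pose y := \sum_(i < size t') c i *: t'`_i.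
have ty : lspan A t' y by exists c.
have Iy : I y by move: ty; apply: lspan_min.
have fxy : f (x - y) = 0.
  rewrite fD fN fx fsum st' -sumrB big1 // => i _.
  by rewrite fZ // t'E // subrr.
have [_ spD _] := lspan_submod (s ++ t') As.
rewrite -(subrK y x); apply: spD.
  apply: lspan_sub (Is _ _) => //; first by move=> z zs; rewrite mem_cat zs.
  by split=> //; exact: (submodB As Im).
by apply: lspan_sub ty => // z zs; rewrite mem_cat zs orbT.
Qed.
End Extension.

Section NoetherianSubrings.
Context {R : comNzRingType}.
Implicit Types (A : set R).

Definition noeth A := @noethm R R^o A A.

(** The functions [f j] embed N in A^n; peeling off the last one reduces n through [noethm_ext].
    They are entries of row vectors in one use and trace forms in another. *)
Lemma noethm_coord (M : lmodType R) A (N : set M) (f : nat -> M -> R^o) n :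
  is_subring A -> noeth A ->
  (forall j x y, f j (x + y) = f j x + f j y) -> (forall j a x, A a -> f j (a *: x) = a *: f j x) ->
  (forall j x, N x -> A (f j x)) -> (forall x, N x -> (forall j, (j < n)%N -> f j x = 0) -> x = 0) ->
  noethm A N.
Proof.
move=> As noe fD fZ NA; elim: n N NA => [|n IH] N NA Ninj.
  move=> I Im IN; exists [::] => // x Ix; exists (fun=> 0) => [_|]; first exact: subring0.
  by rewrite big_ord0; apply: Ninj => //; exact: IN.
apply: (@noethm_ext R M R^o A N A (f n) As (fD n) (fZ n)) => //; first by move=> x /NA.
apply: IH => [j x [/NA //]|x [Nx fx] fj]; apply: Ninj => // j.
by rewrite ltnS leq_eqVlt => /orP[/eqP->|/fj].
Qed.

Lemma noethm_rV A n : is_subring A -> noeth A ->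
  noethm A [set v : 'rV[R]_n | forall j, A (v 0 j)].
Proof.
move=> As noe; case: n => [|n].
  move=> I _ _; exists [::] => // x _; exists (fun=> 0) => [_|]; first exact: subring0.
  by apply/rowP; case.
apply: (@noethm_coord 'rV[R]_n.+1 A _ (fun j v => v 0 (inord j)) n.+1) => //.
- by move=> j x y; rewrite mxE.
- by move=> j a x _; rewrite mxE.
- by move=> x _ h; apply/rowP => j; rewrite mxE -[j]inord_val h.
Qed.

(** Hilbert's basis theorem, run on values at a, since a may be algebraic over A. Elements of I
    outside the span already reached are represented by polynomials of least size. *)
Lemma noeth_adj A a : is_subring A -> noeth A -> noeth (adj A a).
Proof.
move=> As noe I Im IA; have Bs := adj_subring a As; have Ps := polyin_subring As.
apply: contrapT => nfg.
pose good (s : seq R^o) (p : {poly R}) := [/\ polyin A p, I p.[a], ~ lspan (adj A a) s p.[a]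
  & forall q, polyin A q -> I q.[a] -> ~ lspan (adj A a) s q.[a] -> (size p <= size q)%N].
have next (s : seq R^o) : exists p, (forall x, x \in s -> I x) -> good s p.
  have [sI|] := pselect (forall x, x \in s -> I x); last by exists 0.
  have [x [Ix nx]] : exists x, I x /\ ~ lspan (adj A a) s x.
    apply: contrapT => h; apply: nfg; exists s => // x Ix.
    by apply: contrapT => nx; apply: h; exists x.
  have [p0 hp0 p0x] := IA x Ix.
  pose P m := `[< exists q, [/\ polyin A q, I q.[a], ~ lspan (adj A a) s q.[a] & size q = m] >].
  have exP : exists m, P m by exists (size p0); apply/asboolP; exists p0; rewrite p0x.
  case: (ex_minnP exP) => m /asboolP[p [hp Ip np pm]] mmin; exists p => _; split=> // q hq Iq nq.
  by rewrite pm; apply: mmin; apply/asboolP; exists q.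
have [f hf] := choice next.
pose L := fix L n : seq R^o := if n is n'.+1 then rcons (L n') (f (L n')).[a] else [::].
pose p n := f (L n).
have LE n : L n = mkseq (fun i => (p i).[a]) n.
  by elim: n => // n IH; rewrite /mkseq -addn1 iotaD map_cat /= cats1 -/(mkseq _ _) -IH addn1.
have LI n x : x \in L n -> I x.
  elim: n x => // n IH x; rewrite /= mem_rcons inE => /orP[/eqP->|/IH //].
  by case: (hf _ IH).
have pg n : good (L n) (p n) by apply: hf; exact: LI.
have pA n : polyin A (p n) by case: (pg n).
have szp i n : (i <= n)%N -> (size (p i) <= size (p n))%N.
  move=> le_in; case: (pg i) => _ _ _; apply; first by case: (pg n).
    by case: (pg n).
  case: (pg n) => _ _ + _; apply: contra_not; apply: lspan_sub => // x.
  rewrite !LE => /mapP[j]; rewrite mem_iota => /= ji ->; apply/mapP; exists j => //.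
  by rewrite mem_iota; exact: leq_trans ji le_in.
have Am : @is_submod R R^o A A.
  by split=> [|x y|x y]; [exact: subring0|exact: subringD|exact: subringM].
have [n [c hc lc]] := noethm_seq As noe Am (u := fun n => lead_coef (p n) : R^o) (fun i => pA i _).
rewrite size_mkseq in lc.
have [hp Ip np pmin] := pg n.
(* The relation between leading coefficients cancels the top term of [p n]. The value of q at a
   differs from that of [p n] by an element of the span, so q contradicts the minimality of
   [p n]. *)
pose q := p n - \sum_(i < n) (c i)%:P * (p i * 'X^(size (p n) - size (p i))).
have qA : polyin A q.
  apply: (subringB Ps) => //; apply: (subring_sum Ps) => // i _; apply: (subringM Ps).
    exact: polyinC.
  apply: (subringM Ps) => //; apply: (subringX Ps); exact: polyinX.
have [_ spD spZ] := lspan_submod (L n) Bs.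
have spq : lspan (adj A a) (L n) (q.[a] - (p n).[a]).
  rewrite /q hornerD addrAC subrr add0r hornerN horner_sum -sumrN.
  apply: (submod_sum _ (lspan_submod (L n) Bs)) => i _; rewrite !hornerE -mulrN.
  rewrite [X in lspan _ _ X](_ : _ =
    ((- (c i * a ^+ (size (p n) - size (p i)))) : R) *: ((p i).[a] : R^o)); last first.
    by rewrite /GRing.scale /=; ring.
  apply: spZ.
    apply/(subringN Bs)/(subringM Bs); first by apply: sub_adj.
    by apply: (subringX Bs); exact: mem_adj.
  apply: mem_lspan => //; rewrite LE; apply/mapP; exists (i : nat) => //.
  by rewrite mem_iota /=.
have nq : ~ lspan (adj A a) (L n) q.[a].
  move=> h; apply: np; rewrite (_ : (p n).[a] = q.[a] - (q.[a] - (p n).[a])); last by ring.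
  exact: (@submodB R R^o _ _ q.[a] (q.[a] - (p n).[a]) Bs (lspan_submod (L n) Bs)).
have Iq : I q.[a].
  rewrite -(subrK (p n).[a] q.[a]); case: (Im) => _ ID _; apply: ID => //.
  by apply: lspan_min spq => //; exact: LI.
have := pmin q qA Iq nq; apply/negP; rewrite -ltnNge.
have p0 : p n != 0.
  apply/eqP => h; apply: np; rewrite h horner0; by case: (lspan_submod (L n) Bs).
have szpn : (0 < size (p n))%N by rewrite size_poly_gt0.
rewrite -(prednK szpn) ltnS; apply/leq_sizeP => j; rewrite leq_eqVlt => /orP[/eqP<-|hj].
  rewrite /q coefB coef_sum.
  have -> : \sum_(i < n) ((c i)%:P * (p i * 'X^(size (p n) - size (p i))))`_(size (p n)).-1
     = lead_coef (p n); last by rewrite -lead_coefE subrr.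
  rewrite lc; apply: eq_bigr => i _; rewrite nth_mkseq //.
  rewrite coefCM coefMXn /GRing.scale /=; congr (_ * _).
  have le_pi := szp i n (ltnW (ltn_ord i)).
  (* The shift by [size (p n) - size (p i)] overshoots the top index only when [p i] is zero. *)
  case: ltnP => [h|h].
    have pi0 : p i = 0.
      apply/eqP; rewrite -size_poly_eq0 -leqn0.
      by move: h le_pi szpn; case: (size (p n)) => // m; case: (size (p i)) => // l; rewrite /= subSS => + _ _; rewrite ltnNge leq_subr.
    by rewrite pi0 lead_coef0.
  rewrite lead_coefE; congr (_`_ _).
  by rewrite -subn1 subnAC subKn // subn1.
rewrite /q coefB nth_default; last by move: hj; rewrite prednK.
rewrite coef_sum big1 ?subrr // => i _; rewrite coefCM coefMXn.
have le_pi := szp i n (ltnW (ltn_ord i)).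
case: ltnP => h; first by rewrite mulr0.
rewrite nth_default ?mulr0 // leq_subRL; last exact: leq_trans h _.
by rewrite subnK // -(prednK szpn).
Qed.

Lemma noeth_adjs A s : is_subring A -> noeth A -> noeth (adjs A s).
Proof.
by elim: s A => //= x s IH A As noe; apply: IH; [exact: adj_subring|exact: noeth_adj].
Qed.
End NoetherianSubrings.

(** * The determinant trick and integral closure *)

Section DeterminantTrick.
Context {R : comNzRingType}.
Implicit Types (W p : set R).

Lemma det_trick n (C : 'M[R]_n) (v : 'I_n -> R) x :
  (forall i, x * v i = \sum_j C i j * v j) -> forall i, \det (x%:M - C) * v i = 0.
Proof.
move=> h i; pose V : 'cV[R]_n := \col_j v j.
have h0 : (x%:M - C) *m V = 0.
  apply/matrixP => a b; rewrite mulmxBl mul_scalar_mx !mxE.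
  rewrite (_ : \sum_j C a j * V j b = x * v a) ?subrr // h.
  by apply: eq_bigr => j _; rewrite mxE.
have : \adj (x%:M - C) *m ((x%:M - C) *m V) = 0 by rewrite h0 mulmx0.
by rewrite mulmxA mul_adj_mx mul_scalar_mx => /matrixP/(_ i 0); rewrite !mxE.
Qed.

Lemma horner_char_poly n (C : 'M[R]_n) x : (char_poly C).[x] = \det (x%:M - C).
Proof.
rewrite -[LHS]/(horner_eval x (char_poly C)) /char_poly -det_map_mx; congr (\det _).
apply/matrixP => a b; rewrite !mxE -[LHS]/(('X *+ (a == b) - (C a b)%:P).[x]) hornerD hornerN hornerC.
by case: (a == b); rewrite ?mulr1n ?mulr0n ?hornerX ?horner0.
Qed.

Lemma submodM W p a x : is_submod W (p : set R^o) -> W a -> p x -> p (a * x).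
Proof. by case=> _ _ h; exact: (h a x). Qed.

Lemma prod_cong W p (I : Type) (r : seq I) (F G : I -> R) : is_subring W ->
  is_submod W (p : set R^o) -> p `<=` W -> (forall i, W (F i)) -> (forall i, p (F i - G i)) ->
  p (\prod_(i <- r) F i - \prod_(i <- r) G i).
Proof.
move=> Ws Pm pW WF FG; have [p0 pD pZ] := Pm.
have WG i : W (G i).
  by rewrite (_ : G i = F i - (F i - G i)); [apply: subringB => //; exact: pW|ring].
elim: r => [|i r IH]; first by rewrite !big_nil subrr.
rewrite !big_cons.
have -> : F i * \prod_(j <- r) F j - G i * \prod_(j <- r) G j =
  F i * (\prod_(j <- r) F j - \prod_(j <- r) G j) + (\prod_(j <- r) G j) * (F i - G i) by ring.
apply: pD; first exact: (pZ (F i)).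
by apply: (pZ (\prod_(j <- r) G j)) => //; apply: subring_prod.
Qed.

Lemma det_cong W p n (A B : 'M[R]_n) : is_subring W ->
  is_submod W (p : set R^o) -> p `<=` W -> (forall i j, W (A i j)) ->
  (forall i j, p (A i j - B i j)) -> p (\det A - \det B).
Proof.
move=> Ws Pm pW WA AB; have [p0 pD pZ] := Pm; rewrite /determinant -sumrB.
apply: (submod_sum (M := R^o) _ Pm) => s _; rewrite -mulrBr.
by apply: (submodM Pm); [exact: subring_sign|exact: (@prod_cong W)].
Qed.
End DeterminantTrick.

Section Integral.
Context {R : comNzRingType}.
Implicit Types (A B S : set R).

Definition integral A : set R :=
  [set x | exists n (c : nat -> R), (forall i, A (c i)) /\ x ^+ n = \sum_(i < n) c i * x ^+ i].

Definition fin A S := [/\ is_subring S, A `<=` S &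
  exists s : seq R^o, (forall x, x \in s -> S x) /\ S `<=` lspan A s].

Lemma subring_submod A B : is_subring B -> A `<=` B -> is_submod A (B : set R^o).
Proof.
by move=> Bs AB; split=> [|x y|a x /AB]; [exact: subring0|exact: subringD|exact: subringM].
Qed.

Lemma integral_mono A B : A `<=` B -> integral A `<=` integral B.
Proof. by move=> AB x [n [c [hc xn]]]; exists n, c; split=> // i; exact: AB. Qed.

(** Multiplication by x on the finite module S has a matrix over A. The value at x of its
    characteristic polynomial kills the generators, hence kills 1. *)
Lemma fin_integral A S x : is_subring A -> fin A S -> S x -> integral A x.
Proof.
move=> As [Ss AS [s [sS Ss']]] Sx.
have h i : exists c : nat -> R, (forall j, A (c j)) /\
    ((i < size s)%N -> x * s`_i = \sum_(j < size s) c j * s`_j).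
  have [it|it] := ltnP i (size s); last by exists (fun=> 0); split=> // _; exact: subring0.
  have /Ss'[c hc E] : S (x * s`_i) by apply: subringM => //; apply: sS; exact: mem_nth.
  by exists c.
have [c hc] := choice h.
pose C : 'M[R]_(size s) := \matrix_(i, j) c i j.
have E := @det_trick _ _ C (fun i => s`_i) x.
have {}E i : \det (x%:M - C) * s`_i = 0.
  have [it|it] := ltnP i (size s); last by rewrite nth_default // mulr0.
  apply: (E _ (Ordinal it)) => j; rewrite (hc j).2 //.
  by apply: eq_bigr => l _; rewrite mxE.
have root : (char_poly C).[x] = 0.
  have [d hd e1] : lspan A s (1 : R^o) by apply: Ss'; exact: subring1.
  rewrite -[LHS]mulr1 [X in _ * X]e1 mulr_sumr big1 // => i _.
  by rewrite horner_char_poly /GRing.scale /= mulrCA E mulr0.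
have CA : polyin A (char_poly C).
  apply: (subring_det (polyin_subring As)) => i j; rewrite !mxE.
  apply: (subringB (polyin_subring As)); last by apply: polyinC => //; exact: (hc i).1.
  apply: (subring_mulrn (polyin_subring As)); exact: polyinX.
exists (size s), (fun i => - (char_poly C)`_i); split=> [i|]; first exact: subringN.
have := root; rewrite horner_coef size_char_poly big_ord_recr /=.
have := monicP (char_poly_monic C); rewrite lead_coefE size_char_poly /= => ->.
rewrite mul1r => /eqP; rewrite addrC addr_eq0 => /eqP->; rewrite -sumrN.
by apply: eq_bigr => i _; rewrite mulNr.
Qed.

Lemma lspan_mulP A (s : seq R^o) y x : is_subring A ->
  (forall i, (i < size s)%N -> lspan A s (y * s`_i : R^o)) -> lspan A s x -> lspan A s (y * x : R^o).
Proof.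
move=> As h [c hc ->]; rewrite mulr_sumr.
apply: (submod_sum (M := R^o) _ (lspan_submod s As)) => i _.
rewrite /GRing.scale /= mulrCA; case: (lspan_submod s As) => _ _ spZ.
by apply: (spZ (c i)) => //; exact: h.
Qed.

Lemma integral_fin A x : is_subring A -> integral A x -> fin A (adj A x).
Proof.
move=> As [n [c [hc xn]]]; split; [exact: adj_subring|exact: sub_adj|].
pose s : seq R^o := mkseq (fun i => x ^+ i) n.
have sn : size s = n by rewrite size_mkseq.
exists s; split=> [y /mapP[i _ ->]|].
  by apply: subringX; [exact: adj_subring|exact: mem_adj].
have hx y : lspan A s y -> lspan A s (x * y : R^o).
  apply: lspan_mulP => // i; rewrite sn => lin; rewrite nth_mkseq // -exprS.
  move: lin; rewrite leq_eqVlt => /orP[/eqP->|lin].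
    by rewrite xn; exists c => //; rewrite sn; apply: eq_bigr => j _; rewrite nth_mkseq.
  by apply: mem_lspan => //; apply/mapP; exists i.+1 => //; rewrite mem_iota /=.
have hX m : lspan A s (x ^+ m : R^o).
  elim: m => [|m IH]; last by rewrite exprS; exact: hx.
  case: n xn @s sn hx => [|n] xn s sn hx.
    by move/eqP: xn; rewrite expr0 big_ord0 oner_eq0.
  by apply: mem_lspan => //; apply/mapP; exists 0%N => //; rewrite mem_iota.
move=> _ [p hp <-]; rewrite horner_coef.
apply: (submod_sum (M := R^o) _ (lspan_submod s As)) => i _.
by case: (lspan_submod s As) => _ _ spZ; apply: (spZ p`_i).
Qed.

Lemma fin_trans A S T : is_subring A -> fin A S -> fin S T -> fin A T.
Proof.
move=> As [Ss AS [s [sS spS]]] [Ts ST [t [tT spT]]]; split=> //.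
  exact: subset_trans ST.
pose st : seq R^o := [seq (a : R) * b | a <- s, b <- t].
exists st; split=> [_ /allpairsP[[a b] /= [sa tb ->]]|_ /spT[c hc ->]].
  by apply: subringM => //; [apply/ST/sS|exact: tT].
apply: (submod_sum (M := R^o) _ (lspan_submod st As)) => i _.
have [d hd ->] := spS _ (hc i); rewrite scaler_suml.
apply: (submod_sum (M := R^o) _ (lspan_submod st As)) => j _.
rewrite -scalerA; case: (lspan_submod st As) => _ _ spZ; apply: (spZ (d j)) => //.
apply: mem_lspan => //; apply/allpairsP; exists (s`_j, t`_i) => /=.
by split=> //; exact: mem_nth.
Qed.

Lemma fin_refl A : is_subring A -> fin A A.
Proof.
move=> As; split=> //; exists [:: 1]; split=> [x|a Aa].
  by rewrite inE => /eqP->; exact: subring1.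
by exists (fun=> a) => //; rewrite big_ord1 /= /GRing.scale /= mulr1.
Qed.

Lemma fin_adjs A s : is_subring A -> (forall x, x \in s -> integral A x) -> fin A (adjs A s).
Proof.
elim/last_ind: s => [|s x IH] As hs; first exact: fin_refl.
rewrite adjs_rcons.
have fs : fin A (adjs A s) by apply: IH => // y ys; apply: hs; rewrite mem_rcons inE ys orbT.
apply: (fin_trans As fs); apply: integral_fin; first by case: fs.
by apply: integral_mono (@sub_adjs _ _ s As) _ _; apply: hs; rewrite mem_rcons inE eqxx.
Qed.

Lemma sub_integral A : is_subring A -> A `<=` integral A.
Proof.
move=> As x Ax; exists 1%N, (fun=> x); split=> //.
by rewrite expr1 big_ord1 expr0 mulr1.
Qed.

Lemma integral_subring A : is_subring A -> is_subring (integral A).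
Proof.
move=> As; have h x y : integral A x -> integral A y ->
    exists S, [/\ fin A S, S x & S y].
  move=> ix iy; exists (adjs A [:: x; y]); split.
  - by apply: fin_adjs => // z; rewrite !inE => /orP[]/eqP->.
  - by apply: mem_adjs => //; rewrite inE eqxx.
  - by apply: mem_adjs => //; rewrite !inE eqxx orbT.
split=> [|x y ix iy|x y ix iy].
- by apply: sub_integral => //; exact: subring1.
- have [S [fS Sx Sy]] := h _ _ ix iy; apply: (fin_integral As fS).
  by case: fS => Ss _ _; exact: subringB.
- have [S [fS Sx Sy]] := h _ _ ix iy; apply: (fin_integral As fS).
  by case: fS => Ss _ _; exact: subringM.
Qed.

(** Only finitely many coefficients matter: they generate a finite algebra over A, over which x is
    integral, and finiteness is transitive. *)
Lemma integral_trans A : is_subring A -> integral (integral A) `<=` integral A.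
Proof.
move=> As x [n [c [hc xn]]].
have fs : fin A (adjs A (mkseq c n)) by apply: fin_adjs => // y /mapP[i _ ->].
apply: (fin_integral As (S := adj (adjs A (mkseq c n)) x)).
  apply: (fin_trans As fs); apply: integral_fin; first by case: fs.
  exists n, (fun i => if (i < n)%N then c i else 0); split=> [i|].
    case: ifP => lin; last by apply: subring0; case: fs.
    by apply: mem_adjs => //; apply/mapP; exists i => //; rewrite mem_iota.
  by rewrite xn; apply: eq_bigr => i _; rewrite ltn_ord.
by apply: mem_adj; case: fs.
Qed.
End Integral.

(** * Prime ideals and Manis valuations *)

Section Primes.
Context {R : comNzRingType}.
Implicit Types (W p q M : set R).

Definition prime_in W p := [/\ p `<=` W, is_submod W (p : set R^o), ~ p 1
  & forall a b, W a -> W b -> p (a * b) -> p a \/ p b].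

Lemma prime_inX W p a n : is_subring W -> prime_in W p -> W a -> p (a ^+ n) -> p a.
Proof.
move=> Ws [pW pm p1 pP] Wa; elim: n => // n IH.
by rewrite exprS => /pP[] //; exact: subringX.
Qed.

(** An ideal that contains I and is maximal among those avoiding M is prime: if neither a nor b lay
    in it, enlarging it by each would give two elements of M whose product lies in it. *)
Lemma prime_avoid W I M : is_subring W -> is_submod W (I : set R^o) -> I `<=` W ->
  M `<=` W -> M 1 -> (forall a b, M a -> M b -> M (a * b)) -> (forall a, I a -> ~ M a) ->
  exists q, [/\ prime_in W q, I `<=` q & forall a, q a -> ~ M a].
Proof.
move=> Ws Im IW MW M1 MM IM.
pose ok (J : set R) := [/\ is_submod W (J : set R^o), I `<=` J, J `<=` W & forall a, J a -> ~ M a].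
pose P (J : set R) := J = set0 \/ ok J.
have [F FP Ftot|A [PA Amax]] := @Zorn_bigcup R P.
  have [[J0 [FJ0 okJ0]]|none] := pselect (exists J, F J /\ ok J); last first.
    left; apply/seteqP; split=> // x [J FJ Jx].
    by case: (FP J FJ) => [J0|okJ]; [rewrite J0 in Jx|case: none; exists J].
  right; have FJ J x : F J -> J x -> ok J.
    by move=> FJ Jx; case: (FP J FJ) => // J00; rewrite J00 in Jx.
  have [[J00 _ _] IJ0 _ _] := okJ0; split.
  - split; first by exists J0.
    + move=> x y [J FJ' Jx] [J' FJ'' J'y].
      have [JJ|JJ] := Ftot _ _ FJ' FJ''.
        exists J' => //; case: (FJ _ _ FJ'' J'y) => -[_ h _] _ _ _; apply: h => //; exact: JJ.
      exists J => //; case: (FJ _ _ FJ' Jx) => -[_ h _] _ _ _; apply: h => //; exact: JJ.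
    + move=> a x Wa [J FJ' Jx]; exists J => //.
      by case: (FJ _ _ FJ' Jx) => -[_ _ h] _ _ _; exact: h.
  - by move=> x Ix; exists J0 => //; exact: IJ0.
  - by move=> x [J FJ' Jx]; case: (FJ _ _ FJ' Jx) => _ _ + _; apply.
  - by move=> x [J FJ' Jx]; case: (FJ _ _ FJ' Jx) => _ _ _; apply.
have okA : ok A.
  case: PA => // A0; exfalso; apply: (Amax I); last by right; split.
  rewrite A0; split; first by move=> x [].
  by move=> h; have [I0 _ _] := Im; exact: (h 0 I0).
have [[A0 AD AZ] IA AW AM] := okA; exists A; split=> //; split=> //.
  by move=> A1; exact: (AM 1).
move=> a b Wa Wb Aab; apply: contrapT => /not_orP[na nb].
have key c : W c -> ~ A c -> exists x y, [/\ A x, W y & M (x + y * c)].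
  move=> Wc nc; apply: contrapT => no.
  apply: (Amax [set z | exists x y, [/\ A x, W y & z = x + y * c]]).
    split; first by move=> x Ax; exists x, 0; split=> //; [exact: subring0|rewrite mul0r addr0].
    move=> h; apply: nc; apply: h; exists 0, 1; split=> //; first exact: subring1.
    by rewrite mul1r add0r.
  right; split.
  - split; first by exists 0, 0; split=> //; [exact: subring0|rewrite mul0r addr0].
    + move=> _ _ [x [y [Ax Wy ->]]] [x' [y' [Ax' Wy' ->]]]; exists (x + x'), (y + y').
      by split; [exact: AD|exact: subringD|ring].
    + move=> d _ Wd [x [y [Ax Wy ->]]]; exists (d * x), (d * y).
      by split; [exact: (AZ d)|exact: subringM|rewrite /GRing.scale /=; ring].
  - by move=> x Ix; exists x, 0; split=> //; [exact: IA|exact: subring0|rewrite mul0r addr0].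
  - by move=> _ [x [y [Ax Wy ->]]]; apply: subringD => //; [exact: AW|exact: subringM].
  - by move=> _ [x [y [Ax Wy ->]]] h; apply: no; exists x, y.
have [x [y [Ax Wy Mx]]] := key a Wa na; have [x' [y' [Ax' Wy' Mx']]] := key b Wb nb.
apply: (AM ((x + y * a) * (x' + y' * b))); last exact: MM.
rewrite (_ : _ * _ = (x' + y' * b) * x + ((y * a) * x' + (y * y') * (a * b))); last by ring.
have Wx' := AW _ Ax'.
apply: (AD); first by apply: (AZ (x' + y' * b)) => //; apply: subringD => //; exact: subringM.
apply: (AD); first by apply: (AZ (y * a)) => //; exact: subringM.
by apply: (AZ (y * y')) => //; exact: subringM.
Qed.

Definition dominates W p W' p' := W `<=` W' /\ forall a, W a -> (p a <-> p' a).

(* Maximal pairs for domination, in a ring that need not be a field. *)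
Definition manis W p := [/\ is_subring W, prime_in W p &
  forall W' p', is_subring W' -> prime_in W' p' -> dominates W p W' p' -> W' `<=` W].

(** A pair (W, p) is coded as the graph of the membership test of p on W, with values in [bool].
    Inclusion of graphs is then exactly domination, and Zorn's lemma for inclusion applies. *)
Lemma manis_exists W0 p0 : is_subring W0 -> prime_in W0 p0 ->
  exists W p, manis W p /\ dominates W0 p0 W p.
Proof.
move=> W0s p0P.
pose Wof (G : set (R * bool)) := [set a | exists b, G (a, b)].
pose pof (G : set (R * bool)) := [set a | G (a, true)].
pose ok G := [/\ is_subring (Wof G), prime_in (Wof G) (pof G) & forall a, G (a, true) -> ~ G (a, false)].
pose gr (W p : set R) : set (R * bool) := [set ab : R * bool | W ab.1 /\ (p ab.1 <-> ab.2)].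
have grW W p : Wof (gr W p) = W.
  apply/seteqP; split=> [a [b []] //|a Wa].
  by have [pa|pa] := pselect (p a); [exists true|exists false]; split.
have grp W p : p `<=` W -> pof (gr W p) = p.
  move=> pW; apply/seteqP; split=> [a [_ [_ h]]|a pa]; first exact: h.
  by split=> //; exact: pW.
have gr_ok W p : is_subring W -> prime_in W p -> ok (gr W p).
  move=> Ws pP; have [pW _ _ _] := pP; split; rewrite ?grW ?grp //.
  by move=> a [_ h1] [_ h2]; have := h2.1 (h1.2 isT).
pose G0 := gr W0 p0.
have G0ok : ok G0 by exact: gr_ok.
(* Adding [G0] inside the predicate makes the empty chain harmless and forces the maximal pair to
   dominate (W0, p0). *)
pose P G := ok (G `|` G0).
have [F FP Ftot|A [PA Amax]] := @Zorn_bigcup (R * bool) P.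
  have [[G1 FG1]|none] := pselect (exists G, F G); last first.
    rewrite /P (_ : _ `|` _ = G0) //; apply/seteqP; split=> [x [[G FG _]|//]|x Gx].
      by case: none; exists G.
    by right.
  rewrite /P; set U := _ `|` G0.
  have Usub G : F G -> G `|` G0 `<=` U.
    by move=> FG x [Gx|G0x]; [left; exists G|right].
  have UE x : U x -> exists2 G, F G & (G `|` G0) x.
    by case=> [[G FG Gx]|G0x]; [exists G => //; left|exists G1 => //; right].
  have U2 x y : U x -> U y -> exists2 G, F G & (G `|` G0) x /\ (G `|` G0) y.
    move=> /UE[G FG Gx] /UE[G' FG' G'y]; have [h|h] := Ftot _ _ FG FG'.
      by exists G' => //; split=> //; case: Gx => [/h|]; [left|right].
    by exists G => //; split=> //; case: G'y => [/h|]; [left|right].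
  split.
  - split.
    + have [h _ _] := FP _ FG1; have [b Gb] := subring1 h; exists b; exact: Usub Gb.
    + move=> a b [c Ua] [d Ub]; have [G FG [Ga Gb]] := U2 _ _ Ua Ub.
      have [h _ _] := FP _ FG; have [||e Ge] := @subringB _ _ h a b; [by exists c|by exists d|].
      by exists e; exact: Usub Ge.
    + move=> a b [c Ua] [d Ub]; have [G FG [Ga Gb]] := U2 _ _ Ua Ub.
      have [h _ _] := FP _ FG; have [||e Ge] := @subringM _ _ h a b; [by exists c|by exists d|].
      by exists e; exact: Usub Ge.
  - split.
    + by move=> a Ua; exists true.
    + split.
      * have [_ [_ [h _ _] _ _] _] := FP _ FG1; exact: Usub h.
      * move=> a b Ua Ub; have [G FG [Ga Gb]] := U2 _ _ Ua Ub.
        have [_ [_ [_ h _] _ _] _] := FP _ FG; exact: (Usub _ FG _ (h a b Ga Gb)).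
      * move=> a b [c Ua] Ub; have [G FG [Ga Gb]] := U2 _ _ Ua Ub.
        have [_ [_ [_ _ h] _ _] _] := FP _ FG; apply: (Usub _ FG); apply: (h a b) => //.
        by exists c.
    + move=> /UE[G FG G1']; by have [_ [_ _ h _] _] := FP _ FG.
    + move=> a b [c Ua] [d Ub] Uab; have [G FG [Ga Gb]] := U2 _ _ Ua Ub.
      have [G' FG' G'ab] := UE _ Uab.
      have [H FH [HG HG']] : exists2 H, F H & G `<=` H /\ G' `<=` H.
        have [h|h] := Ftot _ _ FG FG'; first by exists G' => //; split.
        by exists G => //; split.
      have up K x : K `<=` H -> (K `|` G0) x -> (H `|` G0) x.
        by move=> KH [/KH|]; [left|right].
      have [_ [_ _ _ h] _] := FP _ FH.
      have [|||h1|h1] := h a b; first by exists c; exact: up Ga.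
      * by exists d; exact: up Gb.
      * exact: up G'ab.
      * by left; exact: Usub h1.
      * by right; exact: Usub h1.
  - move=> a Ut Uf; have [G FG [Gt Gf]] := U2 _ _ Ut Uf.
    by have [_ _ /(_ a Gt)] := FP _ FG.
have [As Ap Adisj] := PA; set B := A `|` G0 in As Ap Adisj.
exists (Wof B), (pof B); split.
  split=> // W' p' W's p'P [BW Bp].
  have BG : B `<=` gr W' p'.
    move=> [a [] Bab]; split=> /=; try by apply: BW; eexists; exact: Bab.
      by split=> // _; apply/Bp => //; exists true.
    split=> // p'a; exfalso; suff pa : pof B a by exact: (Adisj a pa Bab).
    by apply/Bp => //; exists false.
  have [AG|nAG] := pselect (gr W' p' `<=` A).
    move=> a W'a; have [p'a|p'a] := pselect (p' a).
      by exists true; left; apply: AG; split.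
    by exists false; left; apply: AG; split.
  exfalso; apply: (Amax (gr W' p')).
    by split=> // x Ax; apply: BG; left.
  rewrite /P setUidl; first exact: gr_ok.
  by move=> x G0x; apply: BG; right.
split=> [a W0a|a W0a].
  by have [pa|pa] := pselect (p0 a); [exists true|exists false]; right; split.
split=> [pa|Ba]; first by right; split.
apply: contrapT => npa; apply: (Adisj a Ba); right; by split.
Qed.

Section Manis.
Variables (W p : set R) (Wp : manis W p).

Let Ws : is_subring W. Proof. by case: Wp. Qed.
Let pP : prime_in W p. Proof. by case: Wp. Qed.
Let pW : p `<=` W. Proof. by case: pP. Qed.
Let pm : is_submod W (p : set R^o). Proof. by case: pP. Qed.

(** Otherwise the ideal p W[x] avoids W minus p, so it lies in a prime of W[x] over p, and W[x]
    would strictly dominate W. *)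
Lemma manis_lying x : ~ W x -> exists2 f, polyin p f & W f.[x] /\ ~ p f.[x].
Proof.
move=> nx; apply: contrapT => no; have [p0 pD pZ] := pm.
pose I := [set f.[x] | f in polyin p].
have [||||||a [f hf <-] [Wf nf]|q [qP Iq qM]] := @prime_avoid (adj W x) I (fun a => W a /\ ~ p a).
- exact: adj_subring.
- split; first by exists 0; [move=> i; rewrite coef0|rewrite horner0].
  + move=> _ _ [f hf <-] [g hg <-]; exists (f + g); last by rewrite hornerD.
    by move=> i; rewrite coefD; exact: pD.
  + move=> _ _ [g hg <-] [f hf <-]; exists (g * f); last by rewrite hornerM.
    move=> i; rewrite coefM; apply: (submod_sum (M := R^o) _ pm) => j _.
    by apply: (pZ g`_j).
- by move=> _ [f hf <-]; exists f => //; apply: polyin_sub hf.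
- by move=> a [Wa _]; exact: sub_adj.
- by split; [exact: subring1|case: pP].
- move=> a b [Wa na] [Wb nb]; split; first exact: subringM.
  by case: pP => _ _ _ h /h[].
- by apply: no; exists f.
apply: nx; have [_ _ max] := Wp.
apply: (max (adj W x) q) => //; [exact: adj_subring| |exact: mem_adj].
split=> [|a Wa]; first exact: sub_adj.
split=> [pa|qa]; first by apply: Iq; exists a%:P; [move=> i; rewrite coefC; case: ifP|rewrite hornerC].
by apply: contrapT => npa; exact: (qM a qa).
Qed.

(** An integral x outside W makes W[x] a finite W-module. The element u of p W[x] given by
    [manis_lying] maps this module into p times itself, so the determinant trick modulo p puts a
    power of u in p. *)
Lemma manis_integral : integral W `<=` W.
Proof.
move=> x [n [c [hc xn]]]; apply: contrapT => nx.
have [f hf [Wu nu]] := manis_lying nx; set u := f.[x] in Wu nu.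
have [_ _ [t [tB spt]]] : fin W (adj W x) by apply: integral_fin => //; exists n, c.
have Bs := adj_subring x Ws; have [p0 pD pZ] := pm.
have pspan y a : p a -> lspan W t y -> lspan p t (a * y : R^o).
  move=> pa [d hd ->]; exists (fun i => d i * a) => [i|]; first by apply: (pZ (d i)).
  rewrite mulr_sumr; apply: eq_bigr => i _; rewrite /GRing.scale /=; ring.
have pspanD y z : lspan p t y -> lspan p t z -> lspan p t (y + z).
  move=> [d hd ->] [e he ->]; exists (fun i => d i + e i) => [i|]; first exact: pD.
  by rewrite -big_split; apply: eq_bigr => i _; rewrite scalerDl.
have h i : exists c : nat -> R, (forall j, p (c j)) /\
    ((i < size t)%N -> u * t`_i = \sum_(j < size t) c j * t`_j).
  have [it|it] := ltnP i (size t); last by exists (fun=> 0); split.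
  suff [d hd E] : lspan p t (u * t`_i : R^o) by exists d.
  rewrite /u horner_coef mulr_suml; elim/big_ind: _ => [||j _].
  - by exists (fun=> 0) => //; rewrite big1 // => j _; rewrite scale0r.
  - exact: pspanD.
  - rewrite -mulrA; apply: pspan; first exact: hf.
    apply: spt; apply: subringM => //; last by apply: tB; exact: mem_nth.
    by apply: subringX => //; exact: mem_adj.
have [d hd] := choice h.
pose C : 'M[R]_(size t) := \matrix_(i, j) d i j.
have E i : \det (u%:M - C) * t`_i = 0.
  have [it|it] := ltnP i (size t); last by rewrite nth_default // mulr0.
  apply: (@det_trick _ _ C (fun i => t`_i) u _ (Ordinal it)) => j; rewrite (hd j).2 //.
  by apply: eq_bigr => l _; rewrite mxE.
have det0 : \det (u%:M - C) = 0.
  have [e he e1] : lspan W t (1 : R^o) by apply: spt; exact: subring1.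
  rewrite -[LHS]mulr1 [X in _ * X]e1 mulr_sumr big1 // => i _.
  by rewrite /GRing.scale /= mulrCA E mulr0.
apply: nu; apply: (@prime_inX W p u (size t) Ws pP Wu); rewrite -det_scalar.
rewrite -[\det _]subr0 -det0; apply: (@det_cong _ W) => // i j; rewrite !mxE.
  by case: (i == j); rewrite ?mulr1n ?mulr0n //; exact: subring0.
by rewrite opprB addrC subrK; exact: (hd i).1.
Qed.

(** Take f over p of least size with f(x) in W but not in p, and let a be its leading coefficient.
    Then x a is integral over W; if it were in p, the top term could be absorbed into the next
    coefficient, giving a shorter f. *)
Lemma manisP x : ~ W x -> exists y, [/\ p y, W (x * y) & ~ p (x * y)].
Proof.
move=> nx; have [p0 pD pZ] := pm.
pose P m := `[< exists f, [/\ polyin p f, W f.[x], ~ p f.[x] & size f = m] >].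
have exP : exists m, P m.
  by have [f hf [Wf nf]] := manis_lying nx; exists (size f); apply/asboolP; exists f.
case: (ex_minnP exP) => m /asboolP[f [hf Wu nu fm]] mmin.
set u := f.[x] in Wu nu.
case: m fm mmin => [|n] fm mmin.
  have f0 : f = 0 by apply/eqP; rewrite -size_poly_eq0 fm.
  by exfalso; apply: nu; rewrite /u f0 horner0.
pose a := f`_n; have pa : p a := hf n.
have uE : u = \sum_(i < n) f`_i * x ^+ i + a * x ^+ n by rewrite /u horner_coef fm big_ord_recr.
case: n fm mmin @a pa uE => [|n] fm mmin a pa uE.
  by exfalso; apply: nu; rewrite uE big_ord0 add0r expr0 mulr1.
have Wax : W (x * a).
  (* Multiplying u = f(x) by a^n turns it into a monic equation of degree n + 1 for x a. *)
  apply: manis_integral; exists n.+1, (fun i => (if i == 0%N then a ^+ n * u else 0) - f`_i * a ^+ (n - i)).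
  split=> [i|].
    apply: subringB => //.
      by case: ifP => _; [apply: subringM => //; apply: subringX => //; exact: pW|exact: subring0].
    by apply: subringM => //; [exact: pW|apply: subringX => //; exact: pW].
  have -> : (x * a) ^+ n.+1 = a ^+ n * (u - \sum_(i < n.+1) f`_i * x ^+ i).
    by rewrite uE addrC addKr exprMn [a ^+ n.+1]exprSr; ring.
  rewrite mulrBr mulr_sumr.
  under [RHS]eq_bigr do rewrite mulrBl.
  rewrite sumrB; congr (_ - _).
    by rewrite big_ord_recl /= expr0 mulr1 big1 ?addr0 // => i _; rewrite mul0r.
  apply: eq_bigr => i _; rewrite exprMn.
  have lin : (i <= n)%N by rewrite -ltnS.
  rewrite -{1}(subnK lin) exprD; ring.
have [pax|pax] := pselect (p (x * a)); last by exists a.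
pose g := \poly_(i < n.+1) (f`_i + (if i == n then x * a else 0)).
have : P (size g).
  apply/asboolP; exists g; split=> //.
  - move=> i; rewrite coef_poly; case: ifP => // _; apply: pD => //.
    by case: ifP.
  - suff -> : g.[x] = u by [].
    rewrite horner_poly uE; under eq_bigr do rewrite mulrDl.
    rewrite big_split /=; congr (_ + _); rewrite big_ord_recr /= eqxx big1 ?add0r.
      by rewrite exprS; ring.
    by move=> i _; rewrite (ltn_eqF (ltn_ord i)) mul0r.
  - suff -> : g.[x] = u by [].
    rewrite horner_poly uE; under eq_bigr do rewrite mulrDl.
    rewrite big_split /=; congr (_ + _); rewrite big_ord_recr /= eqxx big1 ?add0r.
      by rewrite exprS; ring.
    by move=> i _; rewrite (ltn_eqF (ltn_ord i)) mul0r.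
by move=> /mmin; rewrite ltnNge size_poly.
Qed.

(** This plays the role of dividing by an element of least value: after scaling by y, the element 1
    and all of s are in W, and they are not all in p. *)
Lemma manis_min (s : seq R) : exists y, [/\ W y, forall g, g \in s -> W (y * g)
  & ~ p y \/ exists2 g, g \in s & ~ p (y * g)].
Proof.
have [p0 pD pZ] := pm; elim: s => [|g s [y [Wy ys yn]]].
  by exists 1; split=> //; [exact: subring1|left; case: pP].
have [Wg|nWg] := pselect (W (y * g)).
  exists y; split=> // [h|]; first by rewrite inE => /orP[/eqP->|/ys].
  by case: yn => [|[h hs nh]]; [left|right; exists h => //; rewrite inE hs orbT].
have [z [pz Wz nz]] := manisP nWg; exists (y * z); split.
- by apply: subringM => //; exact: pW.
- move=> h; rewrite inE => /orP[/eqP->|/ys Wh]; first by rewrite mulrAC.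
  by rewrite mulrAC; apply: subringM => //; exact: pW.
- by right; exists g; rewrite ?inE ?eqxx // mulrAC.
Qed.
End Manis.
End Primes.

(** * Algebraic independence and Noether normalization *)

Section FieldSubrings.
Context {K : fieldType}.
Implicit Types (A B R E W p : set K) (s t : seq K) (q : {poly K}).

Definition fracs A : set K := [set x | exists a b, [/\ A a, A b, b != 0 & x = a / b]].

Definition subfield E := is_subring E /\ forall x, E x -> E x^-1.

Lemma sub_fracs A : is_subring A -> A `<=` fracs A.
Proof.
move=> As a Aa; exists a, 1; split=> //; [exact: subring1|exact: oner_neq0|].
by rewrite divr1.
Qed.

Lemma fracs_subfield A : is_subring A -> subfield (fracs A).
Proof.
move=> As; split; first split.
- by apply: sub_fracs => //; exact: subring1.
- move=> _ _ [a [b [Aa Ab b0 ->]]] [c [d [Ac Ad d0 ->]]].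
  exists (a * d - c * b), (b * d); split; [|exact: subringM|by rewrite mulf_neq0|].
    by apply: subringB => //; exact: subringM.
  by field; rewrite b0 d0.
- move=> _ _ [a [b [Aa Ab b0 ->]]] [c [d [Ac Ad d0 ->]]].
  exists (a * c), (b * d); split; [exact: subringM|exact: subringM|by rewrite mulf_neq0|].
  by field; rewrite b0 d0.
- move=> _ [a [b [Aa Ab b0 ->]]]; have [->|a0] := eqVneq a 0.
    by rewrite mul0r invr0; apply: sub_fracs => //; exact: subring0.
  by exists b, a; rewrite invf_div.
Qed.

Lemma subfield_noeth E : subfield E -> noeth E.
Proof.
move=> [Es Ei] I Im IE; have [[x [Ix x0]]|no] := pselect (exists x, I x /\ x != 0).
  exists [:: x] => [y|y Iy]; first by rewrite inE => /eqP->.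
  exists (fun=> y / x) => [_|]; first by apply: subringM; [|exact: IE|exact/Ei/IE].
  by rewrite big_ord1 /= /GRing.scale /= divfK.
exists [::] => // y Iy; exists (fun=> 0) => [_|]; first exact: subring0.
rewrite big_ord0; apply: contrapT => /eqP y0; apply: no; by exists y.
Qed.

Definition trans A x := forall f : {poly K}, polyin A f -> f.[x] = 0 -> f = 0.
(** Algebraic independence of s over A, stated one element at a time so that it follows the order of
    adjunction in [adjs]. *)
Definition seqtr A s := forall i, (i < size s)%N -> trans (adjs A (take i s)) s`_i.

Lemma seqtr_rcons A s x : seqtr A (rcons s x) <-> seqtr A s /\ trans (adjs A s) x.
Proof.
split=> [h|[h1 h2] i].
  split=> [i lis|].
    have := h i; rewrite size_rcons ltnS (ltnW lis) nth_rcons lis -cats1 takel_cat; last exact: ltnW.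
    exact.
  have := h (size s); rewrite size_rcons ltnS leqnn nth_rcons ltnn eqxx -cats1 takel_cat //.
  by rewrite take_size; exact.
rewrite size_rcons ltnS => lis; rewrite nth_rcons -cats1 takel_cat //.
move: lis; rewrite leq_eqVlt => /orP[/eqP->|lis]; last by rewrite lis; exact: h1.
by rewrite ltnn eqxx take_size.
Qed.

Section Leading.
Variables (B : set K) (Bs : is_subring B) (z : K).

(** g is a polynomial in z over B of degree at most d, with coefficient c in degree d. This is a
    relation, because z may satisfy equations over B, and then d and c are not determined by g. *)
Definition lead d c g := exists2 q, polyin B q & (size q <= d)%N /\ g = c * z ^+ d + q.[z].

Lemma lead_mul d c g e c' g' : B c -> B c' -> lead d c g -> lead e c' g' ->
  lead (d + e) (c * c') (g * g').
Proof.
move=> Bc Bc' [q hq [sq ->]] [q' hq' [sq' ->]]; have Ps := polyin_subring Bs.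
have PX n : polyin B (GRing.exp (R := {poly K}) 'X n) by apply: (subringX Ps); exact: polyinX.
exists (c%:P * 'X^d * q' + (c'%:P * 'X^e + q') * q).
  apply: (subringD Ps); apply: (subringM Ps) => //.
    by apply: (subringM Ps) => //; exact: polyinC.
  by apply: (subringD Ps) => //; apply: (subringM Ps) => //; exact: polyinC.
split; last by rewrite !(hornerD, hornerM, hornerC, hornerXn) exprD; ring.
have szM (f h : {poly K}) m n : (size f <= m.+1)%N -> (size h <= n)%N -> (size (f * h)%R <= m + n)%N.
  move=> hf hg; apply: leq_trans (size_polyMleq _ _) _.
  by rewrite -ltnS -addSn; case: (size f + size h)%N (leq_add hf hg) => // N; rewrite /= => /leqW.
have szc a n : (size (a%:P * 'X^n : {poly K})%R <= n.+1)%N.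
  by rewrite mul_polyC; apply: leq_trans (size_scale_leq _ _) _; rewrite size_polyXn.
apply: leq_trans (size_polyD _ _) _; rewrite geq_max; apply/andP; split; first exact: szM.
rewrite addnC; apply: szM => //; apply: leq_trans (size_polyD _ _) _.
by rewrite geq_max szc (leq_trans sq').
Qed.

Lemma lead_lt d c g e : B c -> lead d c g -> (d < e)%N -> lead e 0 g.
Proof.
move=> Bc [q hq [sq ->]] de; have Ps := polyin_subring Bs.
exists (c%:P * 'X^d + q); last first.
  split; last by rewrite !hornerE ?mul0r ?add0r.
  apply: leq_trans (size_polyD _ _) _; rewrite geq_max (leq_trans sq (ltnW de)) andbT.
  by rewrite mul_polyC; apply: leq_trans (size_scale_leq _ _) _; rewrite size_polyXn.
apply: (subringD Ps) => //; apply: (subringM Ps); first exact: polyinC.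
by apply: (subringX Ps); exact: polyinX.
Qed.

Lemma leadD d c g c' g' : lead d c g -> lead d c' g' -> lead d (c + c') (g + g').
Proof.
move=> [q hq [sq ->]] [q' hq' [sq' ->]]; exists (q + q').
  exact: (subringD (polyin_subring Bs)).
by split; [apply: leq_trans (size_polyD _ _) _; rewrite geq_max sq|rewrite hornerD; ring].
Qed.

Lemma lead0 d : lead d 0 0.
Proof.
exists 0; first by move=> i; rewrite coef0; exact: subring0.
by rewrite size_poly0 horner0 mul0r addr0.
Qed.

Lemma lead1 : lead 0 1 1.
Proof.
exists 0; first by move=> i; rewrite coef0; exact: subring0.
by rewrite size_poly0 horner0 mul1r addr0 expr0.
Qed.

Lemma leadX d c g m : B c -> lead d c g -> lead (m * d) (c ^+ m) (g ^+ m).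
Proof.
move=> Bc h; elim: m => [|m IH]; first exact: lead1.
by rewrite !exprS mulSn; apply: lead_mul => //; exact: subringX.
Qed.

Lemma lead_sum n d c (g : nat -> K) m : (m < n)%N -> lead d c (g m) ->
  (forall i, (i < n)%N -> i != m -> lead d 0 (g i)) -> lead d c (\sum_(i < n) g i).
Proof.
move=> mn hm hg; rewrite (bigD1 (Ordinal mn)) //= -[c]addr0; apply: leadD; first exact: hm.
elim/big_ind: _ => [|x y hx hy|i im].
- exact: lead0.
- by rewrite -[0]addr0; exact: leadD.
- by apply: hg => //; rewrite -val_eqE in im.
Qed.

(** An expression of 0 with invertible top coefficient is a monic equation for z after division. *)
Lemma lead_integral d c : (exists2 c', B c' & c * c' = 1) -> lead d c 0 -> integral B z.
Proof.
move=> [c' Bc' cc'] [q hq [sq e]].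
exists d, (fun i => - c' * q`_i); split=> [i|].
  by apply: subringM => //; exact: subringN.
rewrite -[LHS]mul1r -cc' [c * c']mulrC -mulrA.
rewrite (_ : c * z ^+ d = - q.[z]); last by apply/eqP; rewrite -addr_eq0 -e.
rewrite (horner_coef_wide _ sq) mulrN -mulNr mulr_sumr; apply: eq_bigr => i _; ring.
Qed.
End Leading.

Lemma lead_sub B B' z d c g : B `<=` B' -> lead B z d c g -> lead B' z d c g.
Proof. by move=> BB [q hq h]; exists q => //; exact: polyin_sub hq. Qed.

Section NoetherNormalization.
Variables (k0 : set K) (k0f : subfield k0).
Let k0s : is_subring k0. Proof. by case: k0f. Qed.

(** Nagata's change of variables. *)
Definition shift s z N := mkseq (fun i => s`_i - z ^+ (N ^ i)) (size s).

(** After the substitution, the degree in z of a monomial of g has its exponents as digits in base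
    N. For large N these degrees differ, so one monomial dominates, with a nonzero constant as
    coefficient. The bound d < N^(size s) keeps the digit of the next variable apart. *)
Lemma nagata s : seqtr k0 s -> forall g, adjs k0 s g -> g != 0 -> exists N0, forall N, (N0 <= N)%N ->
  exists d c, [/\ k0 c, c != 0, (d < N ^ size s)%N &
    forall z, lead (adjs k0 (shift s z N)) z d c g].
Proof.
elim/last_ind: s => [|s x IH].
  move=> _ g kg g0; exists 0%N => N _; exists 0%N, g; split=> // z.
  exists 0; first by move=> i; rewrite coef0; exact: subring0.
  by rewrite size_poly0 horner0 expr0 mulr1 addr0.
move=> /seqtr_rcons[str xtr]; rewrite adjs_rcons => _ [f hf <-] g0.
have f0 : f != 0 by apply: contraNneq g0 => ->; rewrite horner0.
have hNf m : exists N0 : nat, f`_m != 0 -> forall N, (N0 <= N)%N ->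
    exists d c, [/\ k0 c, c != 0, (d < N ^ size s)%N &
    forall z, lead (adjs k0 (shift s z N)) z d c f`_m].
  have [->|fm0] := eqVneq f`_m 0; first by exists 0%N => /eqP.
  by have [N0 h] := IH str f`_m (hf m) fm0; exists N0.
have [Nf {}hNf] := choice hNf.
(* N exceeds the degree in the last variable and the bounds required by all coefficients. *)
exists (\max_(m < size f) Nf m + size f).+1 => N hN.
have hNm m : (m < size f)%N -> (Nf m <= N)%N.
  move=> mf; apply: leq_trans (ltnW hN); apply: leq_trans (leq_addr _ _).
  exact: (leq_bigmax (Ordinal mf)).
have hNs : (size f < N)%N by apply: leq_trans hN; rewrite ltnS leq_addl.
have N_gt0 : (0 < N)%N by apply: leq_trans hNs.
have hdc m : exists dc : nat * K, (m < size f)%N -> [/\ k0 dc.2, f`_m != 0 -> dc.2 != 0,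
    (dc.1 < N ^ size s)%N & forall z, lead (adjs k0 (shift s z N)) z dc.1 dc.2 f`_m].
  have [mf|_] := ltnP m (size f); last by exists (0%N, 0).
  have [fm0|fm0] := eqVneq f`_m 0.
    exists (0%N, 0) => _; split=> //=; [exact: subring0|by rewrite expn_gt0 N_gt0|] => z.
    by rewrite fm0; apply: lead0; exact: adjs_subring.
  by have [d [c [kc c0 dN h]]] := hNf m fm0 N (hNm m mf); exists (d, c).
have [dc {}hdc] := choice hdc.
pose M := (size f).-1; have sf : size f = M.+1 by rewrite prednK // size_poly_gt0.
pose d m := ((dc m).1 + m * N ^ size s)%N.
have MsN : (M < size f)%N by rewrite sf.
exists (d M), (dc M).2; have [kM cM dM _] := hdc M MsN; split=> //.
- by apply: cM; rewrite -lead_coefE lead_coef_eq0.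
- rewrite size_rcons expnS /d; apply: leq_trans (_ : M.+1 * N ^ size s <= _)%N.
    by rewrite mulSn ltn_add2r.
  by rewrite leq_mul2r; apply/orP; right; rewrite -sf ltnW.
move=> z; have Bs := adjs_subring (shift (rcons s x) z N) k0s.
set B := adjs k0 _ in Bs *.
have shE : shift (rcons s x) z N = rcons (shift s z N) (x - z ^+ (N ^ size s)).
  rewrite /shift size_rcons -addn1 /mkseq iotaD map_cat /= cats1 add0n nth_rcons ltnn eqxx.
  congr (rcons _ _); apply/eq_in_map => i; rewrite mem_iota /= => lis.
  by rewrite nth_rcons lis.
have sB : adjs k0 (shift s z N) `<=` B.
  by rewrite /B shE adjs_rcons; apply: sub_adj; exact: adjs_subring.
have xB : lead B z (N ^ size s) 1 x.
  exists (x - z ^+ (N ^ size s))%:P; last first.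
    rewrite hornerC mul1r [RHS]addrC subrK; split=> //; apply: leq_trans (size_polyC_leq1 _) _.
    by rewrite expn_gt0 N_gt0.
  by apply: polyinC => //; apply: mem_adjs => //; rewrite shE mem_rcons inE eqxx.
have leadm m : (m < size f)%N -> lead B z (d m) (dc m).2 (f`_m * x ^+ m).
  move=> mf; have [km _ _ hm] := hdc m mf; rewrite -[(dc m).2]mulr1 -(expr1n _ m).
  have k0B : k0 `<=` B by exact: sub_adjs.
  apply: lead_mul => //; first exact: k0B.
  - by rewrite expr1n; exact: subring1.
  - exact: lead_sub sB (hm z).
  - by apply: leadX => //; exact: subring1.
rewrite horner_coef.
apply: (@lead_sum B Bs z (size f) (d M) _ (fun i => f`_i * x ^+ i) M) => //; first exact: leadm.
move=> i lif iM; have [ki _ di _] := hdc i lif.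
have k0B : k0 `<=` B by exact: sub_adjs.
apply: (lead_lt Bs (k0B _ ki) (leadm i lif)).
have iM' : (i < M)%N by rewrite ltn_neqAle iM -ltnS -sf.
apply: leq_trans (leq_addl _ _); apply: leq_trans (_ : i.+1 * N ^ size s <= _)%N.
  by rewrite mulSn ltn_add2r.
by rewrite leq_mul2r iM' orbT.
Qed.

Lemma lead_pow B z N d c g : is_subring B -> (0 < N)%N -> lead B (z ^+ N) d c g -> lead B z (N * d) c g.
Proof.
move=> Bs N0 [q hq [sq ->]]; exists (q \Po 'X^N).
  have Ps := polyin_subring Bs.
  rewrite comp_polyE; apply: (subring_sum Ps) => i _; rewrite -mul_polyC.
  apply: (subringM Ps); first exact: polyinC.
  by apply/(subringX Ps)/(subringX Ps); exact: polyinX.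
split; last by rewrite horner_comp hornerXn exprM.
have [->|q0] := eqVneq q 0; first by rewrite comp_poly0 size_poly0.
apply: leq_trans (size_comp_poly_leq _ _) _; rewrite size_polyXn /= mulnC.
have sq0 : (0 < size q)%N by rewrite size_poly_gt0.
apply: leq_trans (_ : N * size q <= _)%N; last by rewrite leq_mul2l sq orbT.
by rewrite -{2}(prednK sq0) mulnS -add1n leq_add2r.
Qed.

(** The first element x of s that is algebraic over its predecessors xs becomes integral after a
    change of variables on xs. It is then dropped, and the shorter list is treated by induction. *)
Lemma noether s : exists t, [/\ seqtr k0 t, forall x, x \in t -> adjs k0 s x
  & forall x, x \in s -> integral (adjs k0 t) x].
Proof.
have [n] := ubnP (size s); elim: n s => // n IH s; rewrite ltnS => sn.
have [str|nstr] := pselect (seqtr k0 s).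
  exists s; split=> // x xs; first exact: mem_adjs.
  by apply: sub_integral; [exact: adjs_subring|exact: mem_adjs].
pose P i := `[< (i < size s)%N /\ ~ trans (adjs k0 (take i s)) s`_i >].
have exP : exists i, P i.
  apply: contrapT => no; apply: nstr => i lis; apply: contrapT => nt.
  by apply: no; exists i; apply/asboolP.
case: (ex_minnP exP) => i /asboolP[lis nt] imin.
set xs := take i s in nt; set x := s`_i in nt.
have sxs : size xs = i by rewrite size_takel // ltnW.
have xstr : seqtr k0 xs.
  move=> j; rewrite sxs => ji; rewrite /xs nth_take // take_takel; last exact: ltnW.
  apply: contrapT => ntj; have : P j by apply/asboolP; split=> //; exact: ltn_trans lis.
  by move=> /imin; rewrite leqNgt ji.
have [p [hp px p0]] : exists p : {poly K}, [/\ polyin (adjs k0 xs) p, p.[x] = 0 & p != 0].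
  apply: contrapT => no; apply: nt => f hf fx; apply: contrapT => /eqP f0.
  by apply: no; exists f.
have hNf m : exists N0 : nat, p`_m != 0 -> forall N, (N0 <= N)%N ->
    exists d c, [/\ k0 c, c != 0, (d < N ^ size xs)%N &
    forall z, lead (adjs k0 (shift xs z N)) z d c p`_m].
  have [->|fm0] := eqVneq p`_m 0; first by exists 0%N => /eqP.
  by have [N0 h] := nagata xstr (hp m) fm0; exists N0.
have [Nf {}hNf] := choice hNf.
pose N := (\max_(m < size p) Nf m + size p).+1.
have hNm m : (m < size p)%N -> (Nf m <= N)%N.
  move=> mp; apply: leq_trans (leqnSn _); apply: leq_trans (leq_addr _ _).
  exact: (leq_bigmax (Ordinal mp)).
have hNs : (size p < N)%N by rewrite ltnS leq_addl.
(* Shifting by powers of x^N makes the degrees of the coefficients multiples of N. The exponent of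
   x, which is less than N, can then be read off modulo N, so no two terms have the same degree. *)
set ys := shift xs (x ^+ N) N; pose B := adjs k0 ys.
have Bs : is_subring B by exact: adjs_subring.
have k0B : k0 `<=` B by exact: sub_adjs.
have hdc m : exists dc : nat * K, (m < size p)%N -> p`_m != 0 ->
    [/\ k0 dc.2, dc.2 != 0 & lead B x (N * dc.1) dc.2 p`_m].
  have [mp|_] := ltnP m (size p); last by exists (0%N, 0).
  have [pm0|pm0] := eqVneq p`_m 0; first by exists (0%N, 0).
  have [d [c [kc c0 _ h]]] := hNf m pm0 N (hNm m mp); exists (d, c) => _ _; split=> //=.
  by apply: lead_pow => //; exact: h.
have [dc {}hdc] := choice hdc.
pose D (m : 'I_(size p)) := (N * (dc m).1 + m)%N.
have sp : (0 < size p)%N by rewrite size_poly_gt0.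
have m0P : ((size p).-1 < size p)%N by rewrite prednK.
have pm0 : p`_(Ordinal m0P) != 0 by rewrite /= -lead_coefE lead_coef_eq0.
case: (@arg_maxnP _ (Ordinal m0P) (fun m : 'I_(size p) => p`_m != 0) D pm0) => m pmn mmax.
have [km cm lm] := hdc m (ltn_ord m) pmn.
have leadx j : lead B x j 1 (x ^+ j).
  exists 0; first by move=> l; rewrite coef0; exact: subring0.
  by rewrite size_poly0 horner0 mul1r addr0.
have leadm (j : 'I_(size p)) : p`_j != 0 -> lead B x (D j) (dc j).2 (p`_j * x ^+ j).
  move=> pj; have [kj _ lj] := hdc j (ltn_ord j) pj; rewrite -[(dc j).2]mulr1.
  by apply: lead_mul => //; [exact: k0B|exact: subring1].
have xint : integral B x.
  apply: (@lead_integral B Bs x (D m) (dc m).2).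
    by exists (dc m).2^-1; [apply/k0B; case: k0f => _; exact|rewrite divff].
  rewrite -px horner_coef.
  apply: (@lead_sum B Bs x (size p) (D m) _ (fun i => p`_i * x ^+ i) m) => //; first exact: leadm.
  move=> j jp jm; have [->|pj] := eqVneq p`_j 0; first by rewrite mul0r; exact: lead0.
  have [kj _ _] := hdc j jp pj.
  apply: (lead_lt Bs (k0B _ kj) (leadm (Ordinal jp) pj)).
  have : (D (Ordinal jp) <= D m)%N by exact: mmax.
  rewrite leq_eqVlt => /orP[/eqP E|//].
  suff jmE : j = m by exfalso; move/negP: jm; apply; apply/eqP.
  have hmod (l a : nat) : (l < size p)%N -> ((N * a + l) %% N = l)%N.
    by move=> lp; rewrite mulnC modnMDl modn_small // (ltn_trans lp).
  by rewrite -(hmod j (dc j).1 jp) -(hmod m (dc m).1 (ltn_ord m)) -/(D m) -E.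
have szs : (size (ys ++ drop i.+1 s) < n)%N.
  rewrite size_cat size_mkseq sxs size_drop; apply: leq_trans sn.
  by rewrite -addSn subnKC.
have [t [ttr ts ti]] := IH _ szs.
have As := adjs_subring s k0s.
have xsA y : y \in xs -> adjs k0 s y by move=> yxs; apply: mem_adjs => //; exact: mem_take yxs.
have xA : adjs k0 s x by apply: mem_adjs => //; exact: mem_nth.
have ysA : forall y, y \in ys ++ drop i.+1 s -> adjs k0 s y.
  move=> y; rewrite mem_cat => /orP[/mapP[j]|yd]; last by apply: mem_adjs => //; exact: mem_drop yd.
  rewrite mem_iota /= => jx ->; apply: subringB => //; first by apply: xsA; exact: mem_nth.
  by do 2 apply: subringX => //.
have Ts := adjs_subring t k0s.
have Is := integral_subring Ts.
have k0I : k0 `<=` integral (adjs k0 t).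
  by move=> a ka; apply: sub_integral => //; exact: sub_adjs.
have xI : integral (adjs k0 t) x.
  apply: integral_trans => //; apply: integral_mono xint; apply: adjs_min => // y yys.
  by apply: ti; rewrite mem_cat yys.
exists t; split=> // [y yt|y].
  by apply: (adjs_min _ _ ysA) (ts y yt) => //; exact: sub_adjs.
rewrite -(cat_take_drop i s) -/xs (drop_nth 0 lis) -/x mem_cat inE => /or3P[yxs|/eqP->//|yd].
  have [j jx <-] : exists2 j, (j < size xs)%N & xs`_j = y by exists (index y xs); rewrite ?index_mem ?nth_index.
  rewrite -[xs`_j](subrK ((x ^+ N) ^+ (N ^ j))); apply: (subringD Is).
    by apply: ti; rewrite mem_cat; apply/orP; left; apply/mapP; exists j; rewrite ?mem_iota.
  by do 2 apply: (subringX Is).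
by apply: ti; rewrite mem_cat yd orbT.
Qed.
End NoetherNormalization.
End FieldSubrings.

(** * Gauss's lemma and normality of polynomial rings *)

Section Normalization.
Context {K : fieldType}.
Implicit Types (A B R E W p : set K) (s t : seq K).

Lemma expr_split (R : comNzRingType) (x : R) i n : (i <= n)%N -> x ^+ n = x ^+ i * x ^+ (n - i).
Proof. by move=> lin; rewrite -exprD subnKC. Qed.

(** The first coefficients of f and of g outside p produce a term outside p in a coefficient of f g
    all of whose other terms lie in p. *)
Lemma polyin_prime W p (f g : {poly K}) : is_subring W -> prime_in W p -> polyin W f -> polyin W g ->
  polyin p (f * g) -> polyin p f \/ polyin p g.
Proof.
move=> Ws [pW pm p1 pP] hf hg hfg; apply: contrapT => /not_orP[nf ng].
have least (h : {poly K}) : ~ polyin p h -> exists i, ~ p h`_i /\ forall j, (j < i)%N -> p h`_j.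
  move=> nh; have exP : exists i, `[< ~ p h`_i >].
    by move: nh => /existsNP[i hi]; exists i; apply/asboolP.
  case: (ex_minnP exP) => i /asboolP hi imin; exists i; split=> // j ji.
  by apply: contrapT => nj; have := imin j; rewrite leqNgt ji /=; case/(_ _)/negP => //; apply/asboolP.
have [i [ni hi]] := least f nf; have [j [nj hj]] := least g ng.
have := hfg (i + j)%N; rewrite coefM.
have li : (i < (i + j).+1)%N by rewrite ltnS leq_addr.
rewrite (bigD1 (Ordinal li)) //= addKn => h.
have h2 : p (\sum_(l < (i + j).+1 | l != Ordinal li) f`_l * g`_(i + j - l)).
  apply: (submod_sum (M := K^o) _ pm) => l; rewrite -val_eqE /= => li'.
  have [ll|ll] := ltnP l i; first by rewrite mulrC; apply: (submodM pm) => //; exact: hi.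
  apply: (submodM pm) => //; apply: hj.
  have {}ll : (i < l)%N by rewrite ltn_neqAle eq_sym li'.
  by rewrite ltn_subLR ?ltn_add2r // -ltnS.
have : p (f`_i * g`_j).
  rewrite (_ : f`_i * g`_j = f`_i * g`_j + \sum_(l < (i + j).+1 | l != Ordinal li) f`_l * g`_(i + j - l)
    - \sum_(l < (i + j).+1 | l != Ordinal li) f`_l * g`_(i + j - l)); last by rewrite addrK.
  exact: (submodB Ws pm).
by move=> /pP[].
Qed.

Lemma manis_unit W p a : manis W p -> W a -> ~ p a -> W a^-1.
Proof.
move=> Wp Wa na; apply: contrapT => nW; have [y [py Wy ny]] := manisP Wp nW.
have [Ws [pW pm p1 pP] _] := Wp; have a0 : a != 0.
  by apply/eqP => a0; apply: na; rewrite a0; case: pm.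
apply: ny; have := py; rewrite -{1}[y](mulVKf a0) => h.
by case: (pP a (a^-1 * y) Wa Wy h).
Qed.

(** If x is not integral, 1/x is not invertible in A[1/x], because 1 = b/x with b in A[1/x] clears
    to a monic equation for x. A maximal pair whose prime contains 1/x excludes x. *)
Lemma manis_sep A x : is_subring A -> ~ integral A x ->
  exists W p, [/\ manis W p, A `<=` W & ~ W x].
Proof.
move=> As nx; have x0 : x != 0.
  by apply/eqP => x0; apply: nx; apply: sub_integral => //; rewrite x0; exact: subring0.
pose B := adj A x^-1; have Bs : is_subring B by exact: adj_subring.
have Bx : B x^-1 by exact: mem_adj.
pose I := [set x^-1 * b | b in B].
have nB : ~ I 1.
  move=> [b [f hf fb] e]; apply: nx.
  exists (size f).+1, (fun i => if (i <= size f)%N then f`_(size f - i) else 0); split=> [i|].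
    by case: ifP => _; [exact: hf|exact: subring0].
  have bx : b = x by rewrite -(mulVKf x0 b) e mulr1.
  rewrite exprS -{1}bx -fb horner_coef mulr_suml big_ord_recl /= subn0 nth_default // mul0r add0r.
  rewrite (reindex_inj rev_ord_inj) /=; apply: eq_bigr => i _.
  rewrite /= /bump leq0n add1n (ltn_ord i) -mulrA; congr (_ * _).
  by rewrite [x ^+ size f](expr_split _ (ltn_ord i)) exprVn mulrCA mulVf ?mulr1 // expf_neq0.
have [|||||a Ia a1|q [qP Iq qM]] := @prime_avoid K B I [set 1] Bs.
- split; first by exists 0; [exact: subring0|rewrite mulr0].
  + by move=> _ _ [b Bb <-] [c Bc <-]; exists (b + c); [exact: subringD|rewrite mulrDr].
  + move=> a _ Ba [b Bb <-]; exists (a * b); [exact: subringM|rewrite /GRing.scale /=; ring].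
- by move=> _ [b Bb <-]; exact: subringM.
- by move=> _ ->; exact: subring1.
- by [].
- by move=> _ _ -> ->; rewrite mul1r.
- by apply: nB; rewrite -a1.
have [W [p [Wp [BW qp]]]] := manis_exists Bs qP; exists W, p; split=> //.
  by apply: subset_trans BW; exact: sub_adj.
move=> Wx; have [Ws [pW pm p1 pP] _] := Wp; apply: p1; rewrite -(mulfV x0).
apply: (submodM pm) => //; apply/qp => //; apply: Iq; exists 1; [exact: subring1|exact: mulr1].
Qed.

(** This replaces the content of f: unless f is already over W, a multiple of f by an element of p
    is primitive. *)
Lemma primitive W p (f : {poly K}) : manis W p -> polyin W f \/
  exists a, [/\ p a, polyin W (a *: f) & ~ polyin p (a *: f)].
Proof.
move=> Wp; have [Ws [pW pm p1 pP] _] := Wp.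
have [a [Wa aW an]] := manis_min Wp f.
have h : polyin W (a *: f).
  move=> i; rewrite coefZ; have [il|il] := ltnP i (size f); first by apply: aW; exact: mem_nth.
  by rewrite nth_default // mulr0; exact: subring0.
have [pa|na] := pselect (p a); last first.
  have a0 : a != 0 by apply/eqP => a0; apply: na; rewrite a0; case: pm.
  left=> i; rewrite -[f`_i](mulKf a0) -coefZ; apply: subringM => //; exact: manis_unit Wp _ _.
right; exists a; split=> //; case: an => // -[g gf ng] hp; apply: ng.
by have := hp (index g f); rewrite coefZ nth_index.
Qed.

(** Gauss's lemma. If f were not over W, its multiple a f with a in p and a multiple b g would be
    primitive, hence also their product; but a b (f g) has its coefficients in p. *)
Lemma monic_factor W p (f g : {poly K}) : manis W p -> f \is monic -> g \is monic -> polyin W (f * g) ->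
  polyin W f.
Proof.
move=> Wp fm gm hfg; have [Ws pP _] := Wp; have [pW pm p1 _] := pP.
have [//|[a [pa haf naf]]] := primitive f Wp.
exfalso; have [b [Wb hbg nbg]] : exists b, [/\ W b, polyin W (b *: g) & ~ polyin p (b *: g)].
  have [hg|[b [pb hbg nbg]]] := primitive g Wp; last by exists b; split=> //; exact: pW.
  exists 1; rewrite scale1r; split=> // [|h]; first exact: subring1.
  by apply: p1; rewrite -(monicP gm); exact: h.
suff hab : polyin p ((a *: f) * (b *: g)) by case: (polyin_prime Ws pP haf hbg hab).
move=> i; rewrite -scalerAl -scalerAr scalerA coefZ mulrC.
by apply: (submodM pm) => //; rewrite mulrC; apply: (submodM pm).
Qed.

Definition normalin A := forall x, fracs A x -> integral A x -> A x.

Lemma normal_manis A x : is_subring A -> normalin A -> fracs A x ->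
  (forall W p, manis W p -> A `<=` W -> W x) -> A x.
Proof.
move=> As An fx h; apply: An => //; apply: contrapT => nx.
by have [W [p [Wp AW nW]]] := manis_sep As nx; apply: nW; exact: h Wp AW.
Qed.

Lemma subfield_normal E : subfield E -> normalin E.
Proof. by move=> [Es Ei] _ [a [b [Ea Eb b0 ->]]] _; apply: subringM => //; exact: Ei. Qed.

Lemma polyin_div E (f g : {poly K}) : subfield E -> polyin E f -> polyin E (f * g) -> f != 0 -> polyin E g.
Proof.
move=> [Es Ei] hf + f0; have [n] := ubnP (size g); elim: n g => // n IH g sg hfg.
have [->|g0] := eqVneq g 0; first by move=> i; rewrite coef0; exact: subring0.
have Ps := polyin_subring Es.
have lg : E (lead_coef g).
  have -> : lead_coef g = lead_coef (f * g) / lead_coef f.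
    by rewrite lead_coefM mulrC mulKf // lead_coef_eq0.
  apply: subringM => //; [exact: hfg|exact/Ei/hf].
pose h := lead_coef g *: 'X^((size g).-1).
have hh : polyin E h.
  by rewrite /h -mul_polyC; apply: (subringM Ps); [exact: polyinC|apply: (subringX Ps); exact: polyinX].
rewrite -(subrK h g); apply: (subringD Ps) => //; apply: IH; last first.
  by rewrite mulrBr; apply: (subringB Ps) => //; exact: (subringM Ps).
have sg0 : (0 < size g)%N by rewrite size_poly_gt0.
move: sg; rewrite ltnS; apply: leq_trans; rewrite -(prednK sg0) ltnS.
apply/leq_sizeP => j; rewrite leq_eqVlt => /orP[/eqP<-|hj].
  by rewrite coefB coefZ coefXn eqxx mulr1 -lead_coefE subrr.
rewrite coefB coefZ coefXn (gtn_eqF hj) mulr0 subr0 nth_default //.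
by rewrite -(prednK sg0).
Qed.

Lemma trans_eq A x (f g : {poly K}) : is_subring A -> trans A x -> polyin A f -> polyin A g -> f.[x] = g.[x] -> f = g.
Proof.
move=> As xt hf hg e; apply/eqP; rewrite -subr_eq0; apply/eqP/xt.
  exact: (subringB (polyin_subring As)).
by rewrite hornerD hornerN e subrr.
Qed.

Lemma trans_fracs A x : is_subring A -> trans A x -> trans (fracs A) x.
Proof.
move=> As xt f hf fx; have [d [Ad d0 df]] : exists d, [/\ A d, d != 0 & polyin A (d *: f)].
  have [n hn] : exists n, (size f <= n)%N by exists (size f).
  have : exists d, [/\ A d, d != 0 & forall i, (i < n)%N -> A (d * f`_i)].
    elim: n {hn} => [|n [d [Ad d0 dn]]]; first by exists 1; split=> //; [exact: subring1|exact: oner_neq0].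
    have [a [b [Aa Ab b0 fn]]] := hf n; exists (d * b); split; [exact: subringM|exact: mulf_neq0|].
    move=> i; rewrite ltnS leq_eqVlt => /orP[/eqP->|lin].
      by rewrite fn (_ : d * b * (a / b) = d * a); [exact: subringM|field].
    by rewrite mulrAC; apply: subringM => //; exact: dn.
  move=> [d [Ad d0 dn]]; exists d; split=> // i; rewrite coefZ.
  have [lin|lin] := ltnP i n; first exact: dn.
  by rewrite nth_default ?mulr0; [exact: subring0|exact: leq_trans lin].
have /eqP : d *: f = 0 by apply: xt => //; rewrite hornerZ fx mulr0.
by rewrite scaler_eq0 (negPf d0) => /eqP.
Qed.

(** A fraction integral over A[x] is first shown to be a polynomial f in x, by unique factorization
    over K. A content argument then puts the coefficients of f in every valuation ring W containing
    A. *)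
Lemma normal_adj A x : is_subring A -> normalin A -> trans A x -> normalin (adj A x).
Proof.
move=> As An xt y [_ [_ [[a ha <-] [b hb <-] bx0 ->]]] [n [c [hc yn]]].
have Ps := polyin_subring As.
have /choice[C hC] : forall i, exists f, polyin A f /\ f.[x] = c i.
  by move=> i; have [f hf fx] := hc i; exists f.
have b0 : b != 0 by apply: contraNneq bx0 => ->; rewrite horner0.
have e1 : a ^+ n = \sum_(i < n) C i * a ^+ i * b ^+ (n - i).
  apply: (trans_eq As xt); first exact: (subringX Ps).
    apply: (subring_sum Ps) => i _; apply: (subringM Ps); last exact: (subringX Ps).
    by apply: (subringM Ps); [exact: (hC i).1|exact: (subringX Ps)].
  rewrite horner_exp horner_sum -[a.[x]](divfK bx0) exprMn yn mulr_suml.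
  apply: eq_bigr => i _; rewrite !hornerM !horner_exp (hC i).2.
  rewrite (expr_split b.[x] (ltnW (ltn_ord i))) [X in _ = X](_ : _ = c i * ((a.[x] / b.[x]) ^+ i * b.[x] ^+ i) * b.[x] ^+ (n - i)).
    by ring.
  by rewrite -exprMn divfK.
(* After division by the gcd, the denominator b' divides a power of the coprime a', hence is
   constant. *)
have [f fE] : exists f, a = b * f.
  pose d := gcdp a b; have d0 : d != 0 by rewrite gcdp_eq0 negb_and b0 orbT.
  have [da db] : d %| a /\ d %| b by split; [exact: dvdp_gcdl|exact: dvdp_gcdr].
  pose a' := (a %/ d)%R; pose b' := (b %/ d)%R.
  have aE : a = a' * d by rewrite divpK.
  have bE : b = b' * d by rewrite divpK.
  have cop : coprimep a' b' by apply: coprimep_div_gcd; rewrite b0 orbT.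
  have b'0 : b' != 0 by apply: contraNneq b0 => b'0; rewrite bE b'0 mul0r.
  have dv : b' %| a' ^+ n.
    have : d ^+ n * a' ^+ n = d ^+ n * \sum_(i < n) C i * a' ^+ i * b' ^+ (n - i).
      rewrite -exprMn [d * a']mulrC -aE e1 mulr_sumr; apply: eq_bigr => i _.
      rewrite {1}aE {1}bE !exprMn (expr_split d (ltnW (ltn_ord i))); ring.
    move=> /(mulfI (expf_neq0 n d0))->.
    elim/big_ind: _ => [|u v hu hv|i _]; [exact: dvdp0|exact: dvdp_add|].
    by apply: dvdp_mull; rewrite -{1}[b']expr1; apply: dvdp_exp2l; rewrite subn_gt0.
  have b'1 : size b' == 1%N.
    have : coprimep b' (a' ^+ n) by apply/coprimep_expr; rewrite coprimep_sym.
    by rewrite coprimep_def (eqp_size (_ : gcdp b' (a' ^+ n) %= b')) //; exact/dvdp_gcd_idl.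
  move/size_poly1P: b'1 => [u u0 b'u]; exists (u^-1 *: a').
  by rewrite bE b'u mul_polyC -scalerAl -scalerAr scalerA mulfV // scale1r mulrC -aE.
have [Ef Ei] := fracs_subfield As.
have Efs : subfield (fracs A) by split.
have hf : polyin (fracs A) f.
  apply: (polyin_div Efs (f := b)) => //; last rewrite -fE; exact: polyin_sub (sub_fracs As) _.
exists f; last by rewrite fE hornerM mulrAC mulfV ?mul1r.
have e2 : f ^+ n = \sum_(i < n) C i * f ^+ i.
  apply: (mulfI (expf_neq0 n b0)); rewrite -exprMn -fE e1 mulr_sumr; apply: eq_bigr => i _.
  rewrite fE exprMn (expr_split b (ltnW (ltn_ord i))); ring.
move=> j; apply: normal_manis => // W p Wp AW.
have [h|[u [pu huf nuf]]] := primitive f Wp; first exact: h.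
exfalso; apply: nuf; have [Ws pP _] := Wp; have [pW pm p1 _] := pP.
have PWs := polyin_subring Ws.
(* Multiplying the integral equation of f by u^n leaves a positive power of u, an element of p, in
   every lower term. *)
have : polyin p ((u *: f) ^+ n).
  rewrite exprZn e2 scaler_sumr; move=> i; rewrite coef_sum.
  apply: (submod_sum (M := K^o) _ pm) => l _.
  have -> : u ^+ n *: (C l * f ^+ l) = u ^+ (n - l) *: (C l * (u *: f) ^+ l).
    by rewrite exprZn -scalerAr scalerA -exprD subnK // ltnW.
  rewrite coefZ mulrC; apply: (submodM pm).
    apply: (subringM PWs); last exact: (subringX PWs).
    by apply: polyin_sub AW _; exact: (hC l).1.
  have := ltn_ord l; rewrite -subn_gt0; case: (n - l)%N => // m _.
  by rewrite exprSr; apply: (submodM pm) => //; apply: subringX => //; exact: pW.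
elim: n {e1 e2 yn} => [|n IH] h; first by exfalso; apply: p1; have := h 0%N; rewrite expr0 coef1.
rewrite exprS in h; have hn : polyin W ((u *: f) ^+ n) by exact: (subringX PWs).
by case: (polyin_prime Ws pP huf hn h) => // h'; exact: IH.
Qed.

Lemma normal_adjs k0 t : subfield k0 -> seqtr k0 t -> normalin (adjs k0 t).
Proof.
move=> kf; have k0s := kf.1; elim/last_ind: t => [|t x IH]; first by move=> _; exact: subfield_normal.
move=> /seqtr_rcons[tt xt]; rewrite adjs_rcons; apply: normal_adj => //; first exact: adjs_subring.
exact: IH.
Qed.
End Normalization.

(** * Finiteness of normalization in characteristic zero *)

Section FiniteNormalization.
Context {K : fieldType}.
Hypothesis char0 : forall n, n.+1%:R != 0 :> K.
Implicit Types (A B R E W p : set K) (s t : seq K).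

(** Factors X are removed from f until its constant term is nonzero; up to sign, that term is then a
    multiple of a. *)
Lemma algebraic_inv R a (f : {poly K}) : is_subring R -> a != 0 -> f != 0 -> polyin R f -> f.[a] = 0 ->
  exists b r, [/\ adj R a b, R r, r != 0 & a * b = r].
Proof.
move=> Rs a0; have [n sf] : exists n, (size f <= n)%N by exists (size f).
elim: n f sf => [|n IH] f sf f0 hf fa; first by move: sf f0; rewrite size_poly_leq0 => /eqP->; rewrite eqxx.
pose g := \poly_(i < (size f).-1) f`_i.+1.
have fE : f = g * 'X + (f`_0)%:P.
  apply/polyP => i; rewrite coefD coefMX coefC; case: i => [|i]; first by rewrite /= add0r.
  rewrite addr0 coef_poly; case: ifP => // /negbT; rewrite -leqNgt => h.
  by rewrite nth_default // -(prednK (_ : 0 < size f)%N) ?size_poly_gt0.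
have hg : polyin R g by move=> i; rewrite coef_poly; case: ifP => // _; exact: subring0.
have [f00|f00] := eqVneq f`_0 0; last first.
  exists g.[a], (- f`_0); split; [by exists g|exact: subringN|by rewrite oppr_eq0|].
  move: fa; rewrite {1}fE hornerD hornerM hornerX hornerC => /eqP.
  by rewrite addr_eq0 mulrC => /eqP.
have fE' : f = g * 'X by rewrite {1}fE f00 addr0.
have g0 : g != 0 by apply: contraNneq f0 => g0; rewrite fE' g0 mul0r.
apply: (IH g) => //; first by move: sf; rewrite fE' size_mulX ?ltnS.
by apply/eqP; move: fa; rewrite fE' hornerM hornerX => /eqP; rewrite mulf_eq0 (negPf a0) orbF.
Qed.

Lemma integral_inv R a : is_subring R -> integral R a -> a != 0 ->
  exists b r, [/\ adj R a b, R r, r != 0 & a * b = r].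
Proof.
move=> Rs [n [c [hc an]]] a0.
apply: (algebraic_inv (f := 'X^n - \poly_(i < n) c i)) => //.
- rewrite monic_neq0 // monicE lead_coefDl ?lead_coefXn // size_polyXn size_polyN.
  by rewrite ltnS size_poly.
- have Ps := polyin_subring Rs; apply: (subringB Ps).
    by apply: (subringX Ps); exact: polyinX.
  by move=> i; rewrite coef_poly; case: ifP => // _; exact: subring0.
- by rewrite hornerD hornerN hornerXn horner_poly an subrr.
Qed.

(** Denominators in A are moved into R by [integral_inv], so generators of A over R also span the
    fraction field. *)
Lemma fracs_span R A (g : seq K^o) : is_subring R -> fin R A -> A `<=` lspan R g ->
  fracs A `<=` lspan (fracs R) g.
Proof.
move=> Rs fA Ag _ [a [b [Aa Ab b0 ->]]]; have [As RA _] := fA.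
have Es := (fracs_subfield Rs).1.
have [c [r [Ac Rr r0 bc]]] := integral_inv Rs (fin_integral Rs fA Ab) b0.
have Acc : A c by apply: adj_min Ac.
have -> : a / b = r^-1 *: (a * c : K^o).
  rewrite /GRing.scale /= -bc invfM.
  have c0 : c != 0 by apply: contraNneq r0 => c0; rewrite -bc c0 mulr0.
  by field; rewrite b0 c0.
case: (lspan_submod g Es) => _ _ spZ; apply: spZ.
  by apply: (fracs_subfield Rs).2; exact: sub_fracs.
have [d hd ->] : lspan R g (a * c : K^o) by apply: Ag; exact: subringM.
by exists d => // i; exact: sub_fracs.
Qed.

Section Trace.
Variables (E : set K) (Ef : subfield E) (m : nat) (e : 'I_m.+1 -> K).
Hypothesis e_gen : forall x, exists c : 'I_m.+1 -> K, (forall i, E (c i)) /\ x = \sum_i c i * e i.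
Hypothesis e_free : forall c : 'I_m.+1 -> K, (forall i, E (c i)) -> \sum_i c i * e i = 0 -> forall i, c i = 0.

Let Es : is_subring E. Proof. by case: Ef. Qed.

Lemma mulmat_exists x : exists M : 'M[K]_m.+1, (forall i j, E (M i j)) /\
  forall j, x * e j = \sum_i M j i * e i.
Proof.
have /choice[c hc] : forall j, exists c : 'I_m.+1 -> K, (forall i, E (c i)) /\ x * e j = \sum_i c i * e i.
  by move=> j; exact: e_gen.
exists (\matrix_(j, i) c j i); split=> [i j|j]; first by rewrite mxE; exact: (hc i).1.
by rewrite (hc j).2; apply: eq_bigr => i _; rewrite mxE.
Qed.

(** The matrix of multiplication by x in the basis e, acting on rows; hence the reversed order in
    [mulmatM]. *)
Definition mulmat x := projT1 (cid (mulmat_exists x)).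
Lemma mulmatE x i j : E (mulmat x i j).
Proof. by rewrite /mulmat; case: cid => M /= [h _]. Qed.
Lemma mulmatP x j : x * e j = \sum_i mulmat x j i * e i.
Proof. by rewrite /mulmat; case: cid => M /= [_ h]. Qed.

Lemma mulmat_uniq x (M : 'M[K]_m.+1) : (forall i j, E (M i j)) ->
  (forall j, x * e j = \sum_i M j i * e i) -> mulmat x = M.
Proof.
move=> hM h; apply/matrixP => j i; apply/eqP; rewrite -subr_eq0; apply/eqP.
apply: (e_free (c := fun i => mulmat x j i - M j i)) => [l|].
  by apply: subringB => //; exact: mulmatE.
by under eq_bigr do rewrite mulrBl; rewrite sumrB -mulmatP -h subrr.
Qed.

Lemma mulmatD x y : mulmat (x + y) = mulmat x + mulmat y.
Proof.
apply: mulmat_uniq => [i j|j]; first by rewrite mxE; apply: subringD => //; exact: mulmatE.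
rewrite mulrDl !mulmatP -big_split; apply: eq_bigr => i _; by rewrite !mxE mulrDl.
Qed.
Lemma mulmatZ a x : E a -> mulmat (a * x) = a *: mulmat x.
Proof.
move=> Ea; apply: mulmat_uniq => [i j|j]; first by rewrite mxE; apply: subringM => //; exact: mulmatE.
by rewrite -mulrA mulmatP mulr_sumr; apply: eq_bigr => i _; rewrite mxE mulrA.
Qed.
Lemma mulmat1 : mulmat 1 = 1.
Proof.
apply: mulmat_uniq => [i j|j]; first by rewrite mxE; exact: subring_nat.
rewrite mul1r (bigD1 j) //= mxE eqxx mul1r big1 ?addr0 // => i /negPf ij.
by rewrite mxE eq_sym ij mul0r.
Qed.
Lemma mulmatM x y : mulmat (x * y) = mulmat y *m mulmat x.
Proof.
apply: mulmat_uniq => [i j|j].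
  by rewrite mxE; apply: subring_sum => // l _; apply: subringM => //; exact: mulmatE.
rewrite -mulrA mulmatP mulr_sumr.
under eq_bigr do rewrite mulrCA mulmatP mulr_sumr.
rewrite exchange_big; apply: eq_bigr => i _; rewrite mxE mulr_suml.
by apply: eq_bigr => l _; rewrite mulrA.
Qed.
Lemma mulmatX x n : mulmat (x ^+ n) = mulmat x ^+ n.
Proof.
by elim: n => [|n IH]; rewrite ?expr0 ?mulmat1 // exprSr mulmatM IH exprS.
Qed.
Lemma mulmat0 : mulmat 0 = 0.
Proof. by rewrite -(mul0r 0) mulmatZ ?scale0r //; exact: subring0. Qed.
Lemma mulmat_sum n (F : 'I_n -> K) : mulmat (\sum_i F i) = \sum_i mulmat (F i).
Proof. exact: (big_morph mulmat mulmatD mulmat0). Qed.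

Definition trf x := \tr (mulmat x).
Lemma trfD x y : trf (x + y) = trf x + trf y. Proof. by rewrite /trf mulmatD mxtraceD. Qed.
Lemma trfZ a x : E a -> trf (a * x) = a * trf x. Proof. by move=> Ea; rewrite /trf mulmatZ // mxtraceZ. Qed.
Lemma trfE x : E (trf x).
Proof. by apply: subring_sum => // i _; exact: mulmatE. Qed.

(** Since q(M) = 0, the scalar matrix q(X) equals q(X) - q(M), which is a multiple of X - M. Taking
    determinants gives the divisibility. *)
Lemma char_poly_dvd (M : 'M[K]_m.+1) (q : {poly K}) : horner_mx M q = 0 ->
  exists g, q ^+ m.+1 = char_poly M * g.
Proof.
move=> hq; pose X : 'M[{poly K}]_m.+1 := 'X%:M; pose M' := map_mx (@polyC K) M.
pose S := \sum_(i < size q) (q`_i)%:P *: \sum_(j < i) X ^+ (i.-1 - j) * M' ^+ j.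
have comXM : GRing.comm X M' by rewrite /GRing.comm -[X * M']/(X *m M') -[M' * X]/(M' *m X) mul_scalar_mx mul_mx_scalar.
have e1 : (X - M') * S = q%:M.
  have -> : q%:M = \sum_(i < size q) (q`_i)%:P *: (X ^+ i - M' ^+ i).
    under eq_bigr do rewrite scalerBr; rewrite sumrB.
    have -> : \sum_(i < size q) (q`_i)%:P *: M' ^+ i = map_mx (@polyC K) (horner_mx M q).
      transitivity (map_mx (@polyC K) (horner_mx M (\sum_(i < size q) q`_i *: 'X^i))); last first.
        by rewrite -poly_def coefK.
      rewrite !raddf_sum /=; apply: eq_bigr => i _.
      rewrite linearZ /= rmorphXn /= horner_mx_X map_mxZ.
      by rewrite /M' -(rmorphXn (map_mx (@polyC K))).
    rewrite hq map_mx0 subr0 -{1}[q]coefK poly_def raddf_sum /=; apply: eq_bigr => i _.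
    rewrite /X -(rmorphXn (@scalar_mx _ m.+1)) /= -mul_polyC.
    by apply/matrixP => a b; rewrite !mxE mulrnAr.
  rewrite mulr_sumr; apply: eq_bigr => i _; rewrite -scalerAr; congr (_ *: _).
  by rewrite -subrXX_comm.
exists (\det S); rewrite -det_scalar -e1; exact: det_mulmx.
Qed.

(** The characteristic polynomial is a monic factor of a power of a monic equation of x, so its
    coefficients lie in every valuation ring that contains R. Normality of R then brings the trace
    down to R. *)
Lemma trf_integral R x : is_subring R -> normalin R -> E `<=` fracs R -> R `<=` E -> integral R x -> R (trf x).
Proof.
move=> Rs Rn ER RE [n [c [hc xn]]]; apply: normal_manis => //; first exact/ER/trfE.
move=> W p Wp RW; have [Ws _ _] := Wp.
pose q : {poly K} := 'X^n - \poly_(i < n) c i.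
have qm : q \is monic.
  by rewrite monicE lead_coefDl ?lead_coefXn // size_polyXn size_polyN ltnS.
have qW : polyin W q.
  have Ps := polyin_subring Ws; apply: (subringB Ps).
    by apply: (subringX Ps); exact: polyinX.
  by move=> i; rewrite coef_poly; case: ifP => _; [exact: RW|exact: subring0].
have hq : horner_mx (mulmat x) q = 0.
  rewrite rmorphB /= rmorphXn /= horner_mx_X -mulmatX xn mulmat_sum poly_def raddf_sum /=.
  rewrite -sumrB big1 // => i _; rewrite mulmatZ; last exact/RE.
  by rewrite mulmatX linearZ /= rmorphXn /= horner_mx_X subrr.
have [g eg] := char_poly_dvd hq.
have cm : char_poly (mulmat x) \is monic by exact: char_poly_monic.
have gm : g \is monic.
  move: (monic_exp m.+1 qm); rewrite eg !monicE lead_coefM => /eqP.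
  by rewrite (monicP cm) mul1r => ->.
have : polyin W (char_poly (mulmat x)).
  apply: (monic_factor Wp cm gm); rewrite -eg; by apply: (subringX (polyin_subring Ws)).
move=> /(_ m.+1.-1); rewrite char_poly_trace // => /(subringN Ws).
by rewrite opprK.
Qed.

End Trace.

(** Traces against a basis of K over the fraction field of a Noether normalization R embed the
    integral closure in a finite free R-module. Characteristic 0 makes the trace form
    nondegenerate. *)
Theorem finite_normalization k0 s : subfield k0 -> (forall x, fracs (adjs k0 s) x) ->
  exists g : seq K, (forall x, x \in g -> integral (adjs k0 s) x) /\
    integral (adjs k0 s) = adjs (adjs k0 s) g.
Proof.
move=> kf fr; have k0s := kf.1; set A := adjs k0 s.
have As : is_subring A by exact: adjs_subring.
have [t [ttr tA ti]] := noether kf s.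
pose R := adjs k0 t; have Rs : is_subring R by exact: adjs_subring.
have Rn : normalin R by exact: normal_adjs.
have Rnoe : noeth R by apply: noeth_adjs => //; exact: subfield_noeth.
have RA : R `<=` A by apply: adjs_min => //; exact: sub_adjs.
have fA : fin R A.
  have -> : A = adjs R s.
    apply/seteqP; split.
      by apply: adjs_mono => //; exact: sub_adjs.
    by apply: adjs_min => // x xs; exact: mem_adjs.
  exact: fin_adjs.
have Ef : subfield (fracs R) by exact: fracs_subfield.
have Es := Ef.1.
have [g0 [_ spg0]] : exists g : seq K^o, (forall x, x \in g -> A x) /\ A `<=` lspan R g.
  by case: fA.
have [n [g sg [gA gspan]]] : exists n, exists2 g : seq K^o, size g = n &
    (forall x, x \in g -> A x) /\ (forall x, lspan (fracs R) g x).
  have [_ _ [g [gA Ag]]] := fA; exists (size g), g => //; split=> // x.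
  exact: fracs_span fA Ag _ (fr x).
(* A spanning family of least length is a basis. *)
pose P n := `[< exists2 g : seq K^o, size g = n &
    (forall x, x \in g -> A x) /\ (forall x, lspan (fracs R) g x) >].
have exP : exists n, P n by exists n; apply/asboolP; exists g.
case: (ex_minnP exP) => d /asboolP[{sg gA gspan} {}g sg [gA gspan]] dmin.
case: d sg dmin => [|d] sg dmin.
  have [c _ /eqP] := gspan 1; rewrite sg big_ord0 oner_eq0 //.
pose e (i : 'I_d.+1) : K := g`_i.
have e_gen x : exists c : 'I_d.+1 -> K, (forall i, fracs R (c i)) /\ x = \sum_i c i * e i.
  by have [c hc ->] := gspan x; rewrite sg; exists (fun i => c i).
have e_free (c : 'I_d.+1 -> K) : (forall i, fracs R (c i)) -> \sum_i c i * e i = 0 -> forall i, c i = 0.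
  move=> hc ce i; apply: contrapT => /eqP ci.
  suff : P d by move=> /dmin; rewrite ltnn.
  pose g' : seq K^o := [seq e (lift i j) | j <- enum 'I_d].
  have sg' : size g' = d by rewrite size_map -cardE card_ord.
  have memg' j : e (lift i j) \in g' by apply: map_f; rewrite mem_enum.
  apply/asboolP; exists g' => //; split=> [_ /mapP[j _ ->]|x].
    by apply: gA; apply: mem_nth; rewrite sg.
  have spm := lspan_submod g' Es; have [_ spD spZ] := spm.
  have ei : lspan (fracs R) g' (e i : K^o).
    have -> : e i = (- (c i)^-1) *: (\sum_(j < d) c (lift i j) * e (lift i j) : K^o).
      move: ce; rewrite (bigD1_ord i) //= => /eqP; rewrite addrC addr_eq0 => /eqP->.
      by rewrite /GRing.scale /= mulrNN mulKf.
    apply: (spZ); first by apply: subringN => //; exact: Ef.2.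
    by apply: (submod_sum (M := K^o) _ spm) => j _; apply: (spZ (c (lift i j))) => //; exact: mem_lspan.
  have [b [hb ->]] := e_gen x; apply: (submod_sum (M := K^o) _ spm) => j _; apply: (spZ (b j)) => //.
  by case: (unliftP i j) => [l ->|->] //; exact: mem_lspan.
have RE : R `<=` fracs R by exact: sub_fracs.
have IA : integral A `<=` integral R.
  move=> x ix; apply: integral_trans => //; apply: integral_mono ix.
  by move=> y Ay; exact: fin_integral fA Ay.
have noeB : @noethm K K^o R (integral R).
  refine (@noethm_coord K K^o R (integral R) (fun j b => trf e_gen (b * e (inord j))) d.+1 Rs Rnoe _ _ _ _).
  - by move=> j x y; rewrite mulrDl trfD.
  - by move=> j a x Ra; rewrite /GRing.scale /= -mulrA trfZ //; exact: RE.
  - move=> j x ix; apply: trf_integral => //; apply: subringM => //; first exact: integral_subring.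
    by apply: (fin_integral Rs fA); apply: gA; apply: mem_nth; rewrite sg.
  (* If b is orthogonal to the basis, then the trace of b/b = 1 vanishes; but this trace is d + 1,
     which is nonzero in K. *)
  - move=> b ib hb; apply: contrapT => /eqP b0.
    have [c [hc cE]] := e_gen b^-1.
    have : trf e_gen (b * b^-1) = 0.
      rewrite cE mulr_sumr /trf mulmat_sum // raddf_sum big1 //= => i _.
      by rewrite mulrCA -[LHS]/(trf e_gen _) trfZ // -[i]inord_val hb ?mulr0.
    rewrite mulfV // /trf mulmat1 // mxtrace1 => /eqP; exact/negP/char0.
have Im : is_submod R (integral R : set K^o).
  by apply: subring_submod; [exact: integral_subring|exact: sub_integral].
have [h hI Ih] := noeB _ Im (fun x h => h).
exists h; split=> [x /hI|]; first exact: integral_mono.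
apply/seteqP; split.
  move=> x /IA /Ih; apply: lspan_min => [|y yh]; last exact: mem_adjs.
  apply: subring_submod; first exact: adjs_subring.
  by apply: subset_trans RA _; exact: sub_adjs.
apply: adjs_min; [exact: integral_subring|exact: sub_integral|].
by move=> x /hI; exact: integral_mono.
Qed.
End FiniteNormalization.

(** * Derivations *)

Section Derivations.
Context {K : fieldType}.
Hypothesis char0 : forall n, n.+1%:R != 0 :> K.
Variable k0 : set K.
Hypothesis k0f : subfield k0.
Implicit Types (A B O E P Q : set K) (s z : seq K) (D : K -> K).

Let k0s : is_subring k0. Proof. by case: k0f. Qed.

Definition der_on E D := [/\ forall a b, E a -> E b -> D (a + b) = D a + D b,
  forall a b, E a -> E b -> D (a * b) = a * D b + b * D a & forall c, k0 c -> D c = 0].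
Definition der D := der_on setT D.

Section DerOn.
Variables (E : set K) (D : K -> K).
Hypotheses (Es : is_subring E) (dD : der_on E D) (kE : k0 `<=` E).

Lemma der_onD a b : E a -> E b -> D (a + b) = D a + D b. Proof. by case: dD => h _ _; exact: h. Qed.
Lemma der_onM a b : E a -> E b -> D (a * b) = a * D b + b * D a. Proof. by case: dD => _ h _; exact: h. Qed.
Lemma der_onk c : k0 c -> D c = 0. Proof. by case: dD => _ _; exact. Qed.
Lemma der_on0 : D 0 = 0. Proof. by apply: der_onk; exact: subring0. Qed.
Lemma der_on1 : D 1 = 0. Proof. by apply: der_onk; exact: subring1. Qed.
Lemma der_onN a : E a -> D (- a) = - D a.
Proof.
move=> Ea; apply/eqP; rewrite -addr_eq0 -der_onD //; last exact: subringN.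
by rewrite addNr der_on0.
Qed.
Lemma der_onB a b : E a -> E b -> D (a - b) = D a - D b.
Proof. by move=> Ea Eb; rewrite der_onD ?der_onN //; exact: subringN. Qed.
Lemma der_on_sum n (F : 'I_n -> K) : (forall i, E (F i)) -> D (\sum_i F i) = \sum_i D (F i).
Proof.
move=> hF; suff [] : E (\sum_i F i) /\ D (\sum_i F i) = \sum_i D (F i) by [].
elim/big_rec2: _ => [|i y1 y2 _ [h1 h2]]; first by rewrite der_on0; split=> //; exact: subring0.
by split; [exact: subringD|rewrite der_onD ?h2].
Qed.
Lemma der_onX a n : E a -> D (a ^+ n) = n%:R * a ^+ n.-1 * D a.
Proof.
move=> Ea; elim: n => [|n IH]; first by rewrite expr0 der_on1 !mul0r.
rewrite exprS der_onM ?IH; [|by []|exact: subringX].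
case: n {IH} => [|n]; first by rewrite expr0 !mul0r mulr0 add0r !mul1r.
by rewrite -(natr1 n.+1) /= exprS; ring.
Qed.
Lemma der_on_horner (f : {poly K}) u w : (forall i, E f`_i) -> E u -> D u = w ->
  D f.[u] = (\poly_(i < size f) D f`_i).[u] + f^`().[u] * w.
Proof.
move=> hf Eu Du; rewrite horner_coef der_on_sum => [|i]; last by apply: subringM => //; exact: subringX.
rewrite horner_poly /deriv horner_poly mulr_suml.
have -> : \sum_(i < (size f).-1) f`_i.+1 *+ i.+1 * u ^+ i * w = \sum_(i < size f) (f`_i *+ i * u ^+ i.-1 * w).
  case: (size f) => [|n]; first by rewrite !big_ord0.
  by rewrite [RHS]big_ord_recl /= mulr0n !mul0r add0r.
rewrite -big_split; apply: eq_bigr => i _.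
rewrite der_onM ?der_onX ?Du //; last exact: subringX.
by rewrite -[f`_i *+ i]mulr_natr /=; ring.
Qed.
End DerOn.

Let Ts : is_subring (setT : set K). Proof. by []. Qed.

Section Der.
Variables (D : K -> K) (dD : der D).
Lemma derD a b : D (a + b) = D a + D b. Proof. exact: (der_onD dD). Qed.
Lemma derM a b : D (a * b) = a * D b + b * D a. Proof. exact: (der_onM dD). Qed.
Lemma derk c : k0 c -> D c = 0. Proof. exact: (der_onk dD). Qed.
Lemma der0 : D 0 = 0. Proof. exact: (der_on0 dD). Qed.
Lemma der1 : D 1 = 0. Proof. exact: (der_on1 dD). Qed.
Lemma derN a : D (- a) = - D a. Proof. exact: (der_onN Ts dD). Qed.
Lemma derB a b : D (a - b) = D a - D b. Proof. exact: (der_onB Ts dD). Qed.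
Lemma der_sum n (F : 'I_n -> K) : D (\sum_i F i) = \sum_i D (F i). Proof. exact: (der_on_sum Ts dD). Qed.
Lemma derV a : a != 0 -> D a^-1 = - (a^-1 ^+ 2 * D a).
Proof.
move=> a0; have /eqP : D (a * a^-1) = 0 by rewrite mulfV // der1.
rewrite derM addr_eq0 => /eqP h; apply: (mulfI a0); rewrite h; by field.
Qed.
Lemma der_div a b : b != 0 -> D (a / b) = D a / b - a / b * (D b / b).
Proof. by move=> b0; rewrite derM derV //; field. Qed.

Lemma der_iter_leibniz n a b :
  iter n D (a * b) = \sum_(i < n.+1) ('C(n, i))%:R * (iter i D a * iter (n - i) D b).
Proof.
elim: n => [|n IH]; first by rewrite big_ord1 bin0 mul1r.
rewrite iterS IH der_sum.
have E i : D ('C(n, i)%:R * (iter i D a * iter (n - i) D b)) =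
   'C(n, i)%:R * (iter i.+1 D a * iter (n - i) D b) + 'C(n, i)%:R * (iter i D a * iter (n - i).+1 D b).
  by rewrite derM [D _%:R]derk; [rewrite derM /=; ring|exact: subring_nat].
under eq_bigr do rewrite E; rewrite big_split /=.
have -> : \sum_(i < n.+1) 'C(n, i)%:R * (iter i D a * iter (n - i).+1 D b) =
    \sum_(i < n.+2) 'C(n, i)%:R * (iter i D a * iter (n.+1 - i) D b).
  rewrite [RHS]big_ord_recr /= bin_small // mul0r addr0.
  by apply: eq_bigr => i _; rewrite subSn // -ltnS.
rewrite [X in _ + X]big_ord_recl [RHS]big_ord_recl /= !bin0 addrCA; congr (_ + _).
rewrite -big_split /=; apply: eq_bigr => i _.
by rewrite /bump /= !add1n subSS binS natrD mulrDl addrC.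
Qed.

Lemma der_adjs A B s : is_subring B -> A `<=` B -> (forall a, A a -> B (D a)) ->
  (forall x, x \in s -> B x /\ B (D x)) -> forall a, adjs A s a -> B (D a).
Proof.
move=> Bs AB AD sD a; pose C := [set a | B a /\ B (D a)].
have Cs : is_subring C.
  split; first by split; [exact: subring1|rewrite der1; exact: subring0].
  - by move=> x y [Bx BDx] [By BDy]; split; [exact: subringB|rewrite derB; exact: subringB].
  - move=> x y [Bx BDx] [By BDy]; split; first exact: subringM.
    by rewrite derM; apply: subringD => //; exact: subringM.
have AC : A `<=` C by move=> x Ax; split; [exact: AB|exact: AD].
by move=> /(adjs_min Cs AC sD)[].
Qed.
End Der.

(** O is a localization of A. The denominators are asked to be invertible in O, so no prime has to
    be named. *)
Definition loc A O := A `<=` O /\ forall u, O u -> exists a b, [/\ A a, A b, b != 0, O b^-1 & u = a / b].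

Lemma der_loc D A O : der D -> is_subring O -> loc A O -> (forall a, A a -> O (D a)) ->
  forall a, O a -> O (D a).
Proof.
move=> dD Os [AO hO] AD _ /hO[a [b [Aa Ab b0 Ob ->]]]; rewrite der_div //.
have Oa := AO _ Aa; have ODa := AD _ Aa; have ODb := AD _ Ab.
apply: subringB => //; first exact: subringM.
by apply: subringM => //; exact: subringM.
Qed.

Lemma common_denom A (t : seq K) : is_subring A -> (forall x, x \in t -> fracs A x) ->
  exists d, [/\ A d, d != 0 & forall x, x \in t -> A (d * x)].
Proof.
move=> As; elim: t => [|x t IH] ht; first by exists 1; split=> //; [exact: subring1|exact: oner_neq0].
have [d [Ad d0 dt]] : exists d, [/\ A d, d != 0 & forall x, x \in t -> A (d * x)].
  by apply: IH => y yt; apply: ht; rewrite inE yt orbT.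
have [a [b [Aa Ab b0 xE]]] : fracs A x by apply: ht; rewrite inE eqxx.
exists (d * b); split; [exact: subringM|exact: mulf_neq0|move=> y].
rewrite inE => /orP[/eqP->|/dt h]; last by rewrite mulrAC; exact: subringM.
by rewrite xE (_ : d * b * (a / b) = d * a); [exact: subringM|field].
Qed.

(* Seidenberg: compare the coefficients of t^N in d e^{tD}(d) (e^{tD}(b) - b)^N. *)
Lemma seidenberg A D : is_subring A -> noeth A -> k0 `<=` A -> (forall x, fracs A x) -> der D ->
  (forall a, A a -> A (D a)) -> forall b, integral A b -> integral A (D b).
Proof.
move=> As noe kA fr dD AD b ib.
have kV n : k0 (n`!%:R)^-1 by case: k0f => _; apply; exact: subring_nat.
have f0 n : n`!%:R != 0 :> K by have := fact_gt0 n; case: (n`!) => // m _; exact: char0.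
have [_ _ [t [_ spt]]] := integral_fin As ib.
have [d [Ad d0 dt]] := common_denom As (t := t) (fun x _ => fr x).
have dbN N : A (d * b ^+ N).
  have [c hc ->] : lspan A t (b ^+ N : K^o).
    apply: spt; apply: subringX; [exact: adj_subring|exact: mem_adj].
  rewrite mulr_sumr; apply: subring_sum => // i _.
  by rewrite /GRing.scale /= mulrCA; apply: subringM => //; apply: dt; exact: mem_nth.
pose dd n a := iter n D a / n`!%:R.
have ddM n x y : dd n (x * y) = \sum_(i < n.+1) dd i x * dd (n - i)%N y.
  rewrite /dd der_iter_leibniz // mulr_suml; apply: eq_bigr => i _.
  have lin : (i <= n)%N by rewrite -ltnS.
  rewrite -(bin_fact lin) !natrM; field.
  by rewrite !f0 (_ : _%:R != 0) //; have := lin; rewrite -bin_gt0; case: ('C(n, i)) => // m _; exact: char0.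
have ddA n a : A a -> A (dd n a).
  move=> Aa; apply: subringM => //; last exact: kA.
  by elim: n => //= n IH; exact: AD.
(* It is enough that all powers of D b have the common denominator d^2: since A is noetherian, this
   forces an integral equation. *)
suff h N : A (d * d * D b ^+ N).
  have Am : @is_submod K K^o A A by exact: subring_submod.
  have [n [c hc e]] := noethm_seq As noe Am (u := fun N => d * d * D b ^+ N : K^o) h.
  exists n, c; split=> //; apply: (mulfI (mulf_neq0 d0 d0)).
  rewrite e size_mkseq mulr_sumr; apply: eq_bigr => i _; rewrite nth_mkseq // /GRing.scale /=; ring.
pose E a : {poly K} := \poly_(j < N.+1) dd j a.
have EE a j : (j <= N)%N -> (E a)`_j = dd j a by rewrite coef_poly ltnS => ->.
(* Congruence modulo t^(N+1); the truncated exponential [E] is multiplicative only in this sense. *)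
pose cg (p q : {poly K}) := forall j, (j <= N)%N -> p`_j = q`_j.
have cgM p q p' q' : cg p p' -> cg q q' -> cg (p * q) (p' * q').
  move=> h1 h2 j jN; rewrite !coefM; apply: eq_bigr => i _.
  by rewrite h1 ?h2 //; [exact: leq_trans (leq_subr _ _) jN|apply: leq_trans jN; rewrite -ltnS].
have EM x y : cg (E (x * y)) (E x * E y).
  move=> j jN; rewrite EE // ddM coefM; apply: eq_bigr => i _.
  by rewrite !EE //; [exact: leq_trans (leq_subr _ _) jN|apply: leq_trans jN; rewrite -ltnS].
have EX i : cg (E (d * b ^+ i)) (E d * E b ^+ i).
  elim: i => [|i IH]; first by rewrite !expr0 !mulr1.
  have -> : E d * E b ^+ i.+1 = (E d * E b ^+ i) * E b by rewrite exprSr mulrA.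
  have -> : d * b ^+ i.+1 = (d * b ^+ i) * b by rewrite exprSr mulrA.
  by move=> j jN; rewrite (EM _ _ j jN) (cgM _ _ _ _ IH (fun _ _ => erefl) j jN).
pose u := E b - b%:P.
pose g := \poly_(j < N) dd j.+1 b.
have uE : u = g * 'X.
  apply/polyP => j; rewrite coefMX coefB coefC !coef_poly.
  case: j => [|j] /=; last by rewrite ltnS subr0.
  by rewrite /dd /= fact0 divr1 subrr.
have e1 : (d%:P * E d * u ^+ N)`_N = d * d * D b ^+ N.
  rewrite uE exprMn mulrA coefMXn ltnn subnn -horner_coef0 !hornerM horner_exp hornerC !horner_coef0.
  rewrite (EE d 0%N) // /dd /= fact0 divr1; congr (_ * _).
  have [->|N0] := posnP N; first by rewrite !expr0.
  by rewrite coef_poly N0 /dd /= divr1.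
rewrite -e1 /u exprBn mulr_sumr coef_sum; apply: subring_sum => // i _.
have -> : d%:P * E d * (((-1) ^+ i * E b ^+ (N - i) * b%:P ^+ i) *+ 'C(N, i)) =
    ((-1) ^+ i * 'C(N, i)%:R * (d * b ^+ i))%:P * (E d * E b ^+ (N - i)).
  by rewrite -mulr_natr !rmorphM /= !rmorphXn /= rmorph_nat rmorphN rmorph1; ring.
rewrite coefCM -(EX _ N) // EE //; apply: subringM => //; last exact: ddA.
by apply: subringM => //; apply: subringM => //; [exact: subring_sign|exact: subring_nat].
Qed.
Lemma polyin_divmod E (p f : {poly K}) : is_subring E -> E (lead_coef p)^-1 -> polyin E p -> polyin E f -> p != 0 ->
  exists q r, [/\ polyin E q, polyin E r, f = q * p + r & (size r < size p)%N].
Proof.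
move=> Es lp hp hf p0; have Ps := polyin_subring Es.
have [n] := ubnP (size f); elim: n f hf => // n IH f hf; rewrite ltnS => sf.
have [lt|le] := ltnP (size f) (size p).
  by exists 0, f; split=> //; [exact: (subring0 Ps)|rewrite mul0r add0r].
pose c := lead_coef f / lead_coef p; pose h := c *: 'X^(size f - size p).
have sp0 : (0 < size p)%N by rewrite size_poly_gt0.
have f0 : f != 0 by rewrite -size_poly_gt0 (leq_trans sp0).
have c0 : c != 0 by rewrite mulf_neq0 ?invr_eq0 ?lead_coef_eq0.
have hh : polyin E h.
  rewrite /h -mul_polyC; apply: (subringM Ps); last by apply: (subringX Ps); exact: polyinX.
  by apply: polyinC => //; apply: subringM => //; exact: hf.
have hph : polyin E (f - h * p) by apply: (subringB Ps) => //; exact: (subringM Ps).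
have shp : size (h * p) = size f.
  rewrite /h -scalerAl size_scale // mulrC size_mulXn // subnK //.
have sg : (size (f - h * p)%R < n)%N.
  apply: leq_trans sf; have sf0 : (0 < size f)%N by exact: leq_trans sp0 le.
  rewrite -(prednK sf0) ltnS; apply/leq_sizeP => j; rewrite leq_eqVlt => /orP[/eqP<-|hj].
    have e : (h * p)`_(size f).-1 = lead_coef f.
      by rewrite -shp -lead_coefE lead_coefM lead_coefZ lead_coefXn mulr1 divfK ?lead_coef_eq0.
    by rewrite coefB e -lead_coefE subrr.
  have hj' : (size f <= j)%N by rewrite -(prednK sf0).
  by rewrite coefB !nth_default ?subrr // shp.
have [q [r [hq hr e sr]]] := IH _ hph sg.
exists (q + h), r; split=> //; first exact: (subringD Ps).
by rewrite mulrDl addrAC -e subrK.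
Qed.

(** In characteristic 0 the derivative of a polynomial of least size vanishing at u is nonzero and
    shorter, so it cannot vanish at u. *)
Lemma sep_poly E u : is_subring E -> ~ trans E u -> exists p : {poly K},
  [/\ polyin E p, p.[u] = 0, p != 0, p^`().[u] != 0 &
   forall q : {poly K}, polyin E q -> q.[u] = 0 -> q != 0 -> (size p <= size q)%N].
Proof.
move=> Es ntu.
have exP : exists n, `[< exists p : {poly K}, [/\ polyin E p, p.[u] = 0, p != 0 & size p = n] >].
  apply: contrapT => no; apply: ntu => f hf fu; apply: contrapT => /eqP f0.
  by apply: no; exists (size f); apply/asboolP; exists f.
case: (ex_minnP exP) => n /asboolP[p [hp pu p0 pn]] nmin.
have pmin (q : {poly K}) : polyin E q -> q.[u] = 0 -> q != 0 -> (size p <= size q)%N.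
  by move=> hq qu q0; rewrite pn; apply: nmin; apply/asboolP; exists q.
exists p; split=> //; apply/eqP => p'u.
have hp' : polyin E p^`() by move=> i; rewrite coef_deriv; exact: subring_mulrn.
have sp : (1 < size p)%N.
  rewrite ltnNge; apply/negP => /size1_polyC pc; move: p0 pu; rewrite pc hornerC => + c0.
  by rewrite c0 eqxx.
have p'00 : p^`() != 0.
  apply/eqP => h; have := congr1 (fun q : {poly K} => q`_(size p).-2) h.
  rewrite coef_deriv coef0; have -> : (size p).-2.+1 = (size p).-1 by case: (size p) sp => [|[]].
  rewrite -lead_coefE -mulr_natr => /eqP; rewrite mulf_eq0 lead_coef_eq0 (negPf p0) /=.
  by case: (size p) sp => [|[|m]] // _; rewrite (negPf (char0 m)).
by have := pmin _ hp' p'u p'00; rewrite leqNgt lt_size_deriv.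
Qed.

Section OneStep.
Variables (E : set K) (d : K -> K) (u : K).
Hypotheses (Ef : subfield E) (kE : k0 `<=` E) (dD : der_on E d).
Let Es : is_subring E. Proof. by case: Ef. Qed.

(** The value at f(u) that is forced on a derivation extending d and sending u to w. *)
Definition dpoly (w : K) (f : {poly K}) := (\poly_(i < size f) d f`_i).[u] + f^`().[u] * w.

Lemma coef_dcoef (f : {poly K}) i : (\poly_(i < size f) d f`_i)`_i = d f`_i.
Proof. by rewrite coef_poly; case: ltnP => // h; rewrite nth_default // (der_on0 dD). Qed.

Lemma dpolyD w f g : polyin E f -> polyin E g -> dpoly w (f + g) = dpoly w f + dpoly w g.
Proof.
move=> hf hg; rewrite /dpoly derivD hornerD.
have -> : \poly_(i < size (f + g)) d (f + g)`_i =
    \poly_(i < size f) d f`_i + \poly_(i < size g) d g`_i.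
  by apply/polyP => i; rewrite coefD !coef_dcoef coefD (der_onD dD).
by rewrite hornerD; ring.
Qed.

Lemma dpolyB w f g : polyin E f -> polyin E g -> dpoly w (f - g) = dpoly w f - dpoly w g.
Proof.
move=> hf hg; apply/eqP; rewrite eq_sym subr_eq -dpolyD ?subrK //.
exact: (subringB (polyin_subring Es)).
Qed.

Lemma dpolyM w f g : polyin E f -> polyin E g -> dpoly w (f * g) = f.[u] * dpoly w g + g.[u] * dpoly w f.
Proof.
move=> hf hg; rewrite /dpoly derivM !hornerE.
have -> : \poly_(i < size (f * g)) d (f * g)`_i =
    f * \poly_(i < size g) d g`_i + g * \poly_(i < size f) d f`_i.
  apply/polyP => i; rewrite coefD !coef_dcoef [g * _]mulrC !coefM (der_on_sum Es dD).
    rewrite -big_split; apply: eq_bigr => j _; rewrite !coef_dcoef (der_onM dD) //.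
    by rewrite [d f`_j * _]mulrC.
  by move=> j; exact: subringM.
by rewrite !hornerE; ring.
Qed.

Lemma dpolyC w a : E a -> dpoly w a%:P = d a.
Proof.
move=> Ea; rewrite /dpoly derivC horner0 mul0r addr0.
have -> : \poly_(i < size a%:P) d (a%:P)`_i = (d a)%:P.
  apply/polyP => i; rewrite coef_dcoef !coefC; case: ifP => // _; exact: (der_on0 dD).
by rewrite hornerC.
Qed.

Lemma dpolyX w : dpoly w 'X = w.
Proof.
rewrite /dpoly derivX hornerC mul1r.
have -> : \poly_(i < size ('X : {poly K})) d ('X : {poly K})`_i = 0.
  apply/polyP => i; rewrite coef_dcoef coefX coef0.
  by case: eqP => _; [exact: (der_on1 dD)|exact: (der_on0 dD)].
by rewrite horner0 add0r.
Qed.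

(** For transcendental u any w is allowed. For algebraic u the minimal polynomial p forces w' = -
    p^d(u) / p'(u), where p^d has the derived coefficients; every other polynomial vanishing at u is
    a multiple of p. *)
Lemma dpoly_root w : (trans E u -> w = w) -> exists w',
  (trans E u -> w' = w) /\ forall f, polyin E f -> f.[u] = 0 -> dpoly w' f = 0.
Proof.
move=> _; have [tu|ntu] := pselect (trans E u).
  exists w; split=> // f hf /(tu f hf) ->.
  by rewrite -[0]/(0%:P) dpolyC ?(der_on0 dD) //; exact: subring0.
have [p [hp pu p0 p'0 pmin]] := sep_poly Es ntu.
exists (- (\poly_(i < size p) d p`_i).[u] / p^`().[u]); split=> // f hf fu.
have [q [r [hq hr e sr]]] := polyin_divmod Es (Ef.2 _ (hp _)) hp hf p0.
have r0 : r = 0.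
  apply: contrapT => /eqP r0; have := pmin r hr; rewrite leqNgt sr; case/(_ _ _)/negP => //.
  by move: fu; rewrite e hornerD hornerM pu mulr0 add0r.
rewrite e r0 addr0 dpolyM // pu mul0r addr0 (_ : dpoly _ p = 0) ?mulr0 //.
by rewrite /dpoly mulrC divfK // addrC addNr.
Qed.

Lemma der_step w : exists D, [/\ der_on (fracs (adj E u)) D, forall a, E a -> D a = d a
  & trans E u -> D u = w].
Proof.
have [w' [ww' hw]] := @dpoly_root w (fun _ => erefl); set T := dpoly w' in hw *.
have Ps := polyin_subring Es.
(* The quotient rule prescribes D at f(u)/g(u). Two representations of y give the same value because
   [T] vanishes on polynomials that vanish at u. *)
have h y : exists v, forall f g, polyin E f -> polyin E g -> g.[u] != 0 -> y = f.[u] / g.[u] ->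
    v = (T f - y * T g) / g.[u].
  have [[f1 [g1 [hf1 hg1 gu1 y1]]]|no] := pselect (exists f g : {poly K},
      [/\ polyin E f, polyin E g, g.[u] != 0 & y = f.[u] / g.[u]]); last first.
    by exists 0 => f g hf hg gu yE; case: no; exists f, g.
  exists ((T f1 - y * T g1) / g1.[u]) => f g hf hg gu yE.
  have fE : f.[u] = y * g.[u] by rewrite yE divfK.
  have fE1 : f1.[u] = y * g1.[u] by rewrite y1 divfK.
  have hfg := subringM Ps hf hg1; have hgf := subringM Ps hf1 hg.
  have e : T (f * g1 - f1 * g) = 0.
    by apply: hw; [exact: (subringB Ps)|rewrite !hornerE fE fE1; ring].
  move: e; rewrite /T dpolyB // !dpolyM // fE fE1 -/T => e.
  apply/eqP; rewrite eqr_div // -subr_eq0 (_ : _ - _ =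
    - (y * g.[u] * T g1 + g1.[u] * T f - (y * g1.[u] * T g + g.[u] * T f1))); last by ring.
  by rewrite e oppr0.
have [D hD] := choice h.
have kk a : E a -> polyin E a%:P by move=> Ea; exact: polyinC.
have E1 := subring1 Es.
have T1 : T 1%:P = 0 by rewrite /T dpolyC // (der_on1 dD).
have DE a : E a -> D a = d a.
  move=> Ea; rewrite (hD a a%:P 1%:P) ?hornerC ?divr1 //; [|exact: kk|exact: kk|exact: oner_neq0].
  by rewrite T1 mulr0 subr0 /T dpolyC.
have Du : trans E u -> D u = w.
  move=> tu; rewrite (hD u 'X 1%:P) ?hornerC ?hornerX ?divr1 //; [|exact: polyinX|exact: kk|exact: oner_neq0].
  by rewrite T1 mulr0 subr0 /T dpolyX ww'.
have rep y : fracs (adj E u) y -> exists f g : {poly K}, [/\ polyin E f, polyin E g, g.[u] != 0 & y = f.[u] / g.[u]].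
  by move=> [_ [_ [[f hf <-] [g hg <-] gu ->]]]; exists f, g.
exists D; split=> //; split=> [x y|x y|c kc].
- move=> /rep[f [g [hf hg gu xE]]] /rep[f1 [g1 [hf1 hg1 gu1 yE]]].
  rewrite (hD x f g) // (hD y f1 g1) // (hD (x + y) (f * g1 + f1 * g) (g * g1)).
  + rewrite /T dpolyD; [|exact: (subringM Ps)|exact: (subringM Ps)].
    rewrite !dpolyM //.
    by rewrite !hornerE xE yE /=; field; rewrite gu gu1.
  + by apply: (subringD Ps); exact: (subringM Ps).
  + exact: (subringM Ps).
  + by rewrite hornerM mulf_neq0.
  + by rewrite xE yE !hornerE /=; field; rewrite gu gu1.
- move=> /rep[f [g [hf hg gu xE]]] /rep[f1 [g1 [hf1 hg1 gu1 yE]]].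
  rewrite (hD x f g) // (hD y f1 g1) // (hD (x * y) (f * f1) (g * g1)).
  + by rewrite /T !dpolyM // !hornerE xE yE /=; field; rewrite gu gu1.
  + exact: (subringM Ps).
  + exact: (subringM Ps).
  + by rewrite hornerM mulf_neq0.
  + by rewrite xE yE !hornerE /=; field; rewrite gu gu1.
- by rewrite DE ?(der_onk dD) //; exact: kE.
Qed.
End OneStep.

Lemma der_ext s E d : subfield E -> k0 `<=` E -> der_on E d ->
  (forall E', subfield E' -> E `<=` E' -> (forall x, x \in s -> E' x) -> E' = setT) ->
  exists D, der D /\ forall a, E a -> D a = d a.
Proof.
elim: s E d => [|x s IH] E d Ef kE dD gen.
  have ET : E = setT by apply: gen.
  by exists d; split=> //; rewrite /der -ET.
have [D1 [dD1 D1E _]] := der_step x Ef kE dD 0.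
have Es := Ef.1; have As := adj_subring x Es.
have E1f := fracs_subfield As.
have EE1 : E `<=` fracs (adj E x) by move=> a Ea; apply: sub_fracs => //; exact: sub_adj.
have [||D [dDD DE1]] := IH _ D1 E1f _ dD1; first exact: subset_trans EE1.
  move=> E' E'f E1E' sE'; apply: gen => // [|y]; first exact: subset_trans E1E'.
  rewrite inE => /orP[/eqP->|/sE' //]; apply/E1E'/sub_fracs => //; exact: mem_adj.
by exists D; split=> // a Ea; rewrite DE1 ?D1E //; exact: EE1.
Qed.

Section Generators.
Variable z : seq K.
Hypothesis z_gen : forall x, fracs (adjs k0 z) x.

Lemma gen_subfield E : subfield E -> k0 `<=` E -> (forall x, x \in z -> E x) -> E = setT.
Proof.
move=> [Es Ei] kE zE; apply/seteqP; split=> // x _.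
have [a [b [Aa Ab b0 ->]]] := z_gen x; have AE := adjs_min Es kE zE.
by apply: subringM => //; [exact: AE|exact/Ei/AE].
Qed.

(** A transcendental element can be given any derivative while the previous elements stay constant.
    In contrapositive form, this detects algebraic elements. *)
Lemma der_trans s u w : trans (adjs k0 s) u ->
  exists D, [/\ der D, forall x, x \in s -> D x = 0 & D u = w].
Proof.
move=> tu; have As := adjs_subring s k0s.
have Ef := fracs_subfield As; have Es := Ef.1.
have kE : k0 `<=` fracs (adjs k0 s) by move=> a ka; apply: sub_fracs => //; exact: sub_adjs.
have d0 : der_on (fracs (adjs k0 s)) (fun=> 0) by split=> // *; ring.
have [D1 [dD1 D1E D1u]] := der_step u Ef kE d0 w.
have A1s := adj_subring u Es.
have E1f := fracs_subfield A1s.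
have EE1 : fracs (adjs k0 s) `<=` fracs (adj (fracs (adjs k0 s)) u).
  by move=> a Ea; apply: sub_fracs => //; exact: sub_adj.
have [|E' E'f E1E' zE'|D [dD DE1]] := der_ext (s := z) E1f _ dD1.
- exact: subset_trans EE1.
- by apply: gen_subfield => //; apply: subset_trans E1E'; exact: subset_trans EE1.
exists D; split=> // [x xs|].
  have Ex : fracs (adjs k0 s) x by apply: sub_fracs => //; exact: mem_adjs.
  by rewrite DE1 ?D1E //; exact: EE1.
rewrite DE1 ?D1u //; first exact: trans_fracs.
by apply: sub_fracs => //; exact: mem_adj.
Qed.

Lemma der_gen0 D : der D -> (forall x, x \in z -> D x = 0) -> forall x, D x = 0.
Proof.
move=> dD zD x; have [a [b [Aa Ab b0 ->]]] := z_gen x.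
have s0 : is_subring ([set 0] : set K) -> False by move=> [h _ _]; have := oner_neq0 K; rewrite h eqxx.
pose B := [set y | D y = 0]; have Bs : is_subring B.
  split; [exact: der1|by move=> p q Dp Dq; rewrite /B /= derB // Dp Dq subrr|].
  by move=> p q Dp Dq; rewrite /B /= derM // Dp Dq !mulr0 addr0.
have AB : adjs k0 z `<=` B by apply: adjs_min => // c kc; exact: derk.
by rewrite der_div // (AB _ Aa) (AB _ Ab) !mul0r mulr0 subr0.
Qed.
End Generators.

Section Keigher.
Variables (A : set K) (D : K -> K).
Hypotheses (As : is_subring A) (kA : k0 `<=` A) (dD : der D) (AD : forall a, A a -> A (D a)).

Let kV n : k0 (n.+1%:R)^-1. Proof. by case: k0f => _; apply; exact: subring_nat. Qed.

(** The largest D-stable ideal of A contained in P. *)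
Definition core P := [set a | A a /\ forall n, P (iter n D a)].

Lemma iterA n a : A a -> A (iter n D a).
Proof. by move=> Aa; elim: n => //= n IH; exact: AD. Qed.
Lemma iterD n a b : iter n D (a + b) = iter n D a + iter n D b.
Proof. by elim: n => //= n ->; exact: derD. Qed.

(** Keigher's argument. If a and b are outside the core, take the least m and n with D^m a and D^n b
    outside P. In the Leibniz expansion of D^(m+n)(a b) every other term lies in P, and the binomial
    coefficient is invertible. *)
Lemma core_prime P : prime_in A P -> prime_in A (core P).
Proof.
move=> [PA Pm P1 PP]; have [P0 PD PZ] := Pm.
have Psum n (F : 'I_n -> K) : (forall i, P (F i)) -> P (\sum_i F i).
  by move=> h; apply: (submod_sum (M := K^o) _ Pm).
split.
- by move=> a [].
- split.
  + by split=> [|n]; [exact: subring0|elim: n => //= n; rewrite -/(iter n D 0); suff -> : iter n D 0 = 0; [rewrite der0|elim: n => //= n ->; rewrite der0]].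
  + by move=> a b [Aa ha] [Ab hb]; split=> [|n]; [exact: subringD|rewrite iterD; exact: PD].
  + move=> a b Aa [Ab hb]; split=> [|n]; first exact: subringM.
    rewrite -[_ *: _]/(a * b) der_iter_leibniz //; apply: Psum => i.
    apply: (submodM Pm); first by apply: subring_nat.
    by apply: (submodM Pm) => //; exact: iterA.
- by move=> [_ /(_ 0%N)].
move=> a b Aa Ab [_ hab]; apply: contrapT => /not_orP[na nb].
have least c : A c -> ~ core P c -> exists n, ~ P (iter n D c) /\ forall j, (j < n)%N -> P (iter j D c).
  move=> Ac nc; have exP : exists n, `[< ~ P (iter n D c) >].
    apply: contrapT => no; apply: nc; split=> // n; apply: contrapT => h.
    by apply: no; exists n; apply/asboolP.
  case: (ex_minnP exP) => n /asboolP hn nmin; exists n; split=> // j jn.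
  by apply: contrapT => nj; have := nmin j; rewrite leqNgt jn /=; case/(_ _)/negP => //; apply/asboolP.
have [m [nm hm]] := least a Aa na; have [n [nn hn]] := least b Ab nb.
have := hab (m + n)%N; rewrite der_iter_leibniz //.
have lm : (m < (m + n).+1)%N by rewrite ltnS leq_addr.
rewrite (bigD1 (Ordinal lm)) //= addKn => h.
have h2 : P (\sum_(i < (m + n).+1 | i != Ordinal lm) 'C(m + n, i)%:R * (iter i D a * iter (m + n - i) D b)).
  apply: (submod_sum (M := K^o) _ Pm) => i; rewrite -val_eqE /= => im.
  apply: (submodM Pm); first by apply: subring_nat.
  have [il|il] := ltnP i m; first by rewrite mulrC; apply: (submodM Pm) (hm i il); exact: iterA.
  apply: (submodM Pm); first exact: iterA.
  apply: hn; have {}il : (m < i)%N by rewrite ltn_neqAle eq_sym im.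
  by rewrite ltn_subLR ?ltn_add2r // -ltnS.
have {}h := submodB As Pm h h2; rewrite addrK in h.
have : P (iter m D a * iter n D b).
  have := submodM Pm (kA (kV ('C(m + n, m)).-1)) h.
  by rewrite prednK ?bin_gt0 ?leq_addr // mulKf //; case: ('C(m + n, m)) (bin_gt0 (m + n) m) => [|c _]; [rewrite leq_addr|exact: char0].
by move=> /PP[|||] //; exact: iterA.
Qed.

Lemma core_sub P : core P `<=` P.
Proof. by move=> a [_ /(_ 0%N)]. Qed.

Lemma core_stable P a : core P a -> core P (D a).
Proof. by move=> [Aa ha]; split=> [|n]; [exact: AD|rewrite -iterSr; exact: ha]. Qed.

Lemma core_max P I : I `<=` A -> I `<=` P -> (forall a, I a -> I (D a)) -> I `<=` core P.
Proof.
move=> IA IP ID a Ia; split=> [|n]; first exact: IA.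
by apply: IP; elim: n => //= n IH; exact: ID.
Qed.
End Keigher.

(** Zorn's lemma gives maximal elements for inclusion, so it is applied to the complements of primes
    in A. *)
Lemma min_prime A I P : is_subring A -> I `<=` P -> prime_in A P ->
  exists Q, [/\ prime_in A Q, I `<=` Q, Q `<=` P & forall Q', prime_in A Q' -> I `<=` Q' -> Q' `<=` Q -> Q' = Q].
Proof.
move=> As IP pP.
pose ok (C : set K) := exists Q, [/\ prime_in A Q, I `<=` Q, Q `<=` P & C = A `\` Q].
pose OK C := ok (C `|` (A `\` P)).
have okQ C : ok C -> prime_in A (A `\` C) /\ I `<=` A `\` C /\ A `\` C `<=` P.
  move=> [Q [pQ IQ QP ->]]; have QA : Q `<=` A by case: pQ.
  by rewrite setDD (setIidr QA).
have CA C : ok C -> C `<=` A by move=> [Q [_ _ _ ->]] x [].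
have [F FP Ftot|C [okC Cmax]] := @Zorn_bigcup K OK.
  have [[C1 FC1]|none] := pselect (exists C, F C); last first.
    rewrite /OK (_ : _ `|` _ = A `\` P); first by exists P; split.
    by apply/seteqP; split=> [x [[C FC _]|//]|x]; [case: none; exists C|right].
  set U := \bigcup_(X in F) X `|` (A `\` P).
  have UE x : U x -> exists2 C, F C & (C `|` (A `\` P)) x.
    by move=> [[C FC Cx]|h]; [exists C => //; left|exists C1 => //; right].
  have inU C x : F C -> (C `|` (A `\` P)) x -> U x by move=> FC [Cx|]; [left; exists C|right].
  have UA : U `<=` A by move=> x /UE[C FC]; exact: (CA _ (FP C FC)).
  exists (A `\` U); have prC C (FC : F C) := (okQ _ (FP C FC)).1.
  split.
  - split=> [x []//|||].
    + split.
      * split; first exact: subring0.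
        by move=> /UE[C FC]; have [_ [[_ +] _ _] _ _] := prC C FC; apply.
      * move=> x y [Ax nx] [Ay ny]; split; first exact: subringD.
        move=> /UE[C FC Cxy]; have [_ [_ h _] _ _] := prC C FC.
        have [_] : (A `\` (C `|` (A `\` P))) (x + y); last exact.
        by apply: h; split=> // h'; [apply: nx|apply: ny]; exact: inU h'.
      * move=> a x Aa [Ax nx]; split; first exact: subringM.
        move=> /UE[C FC Cax]; have [_ [_ _ h] _ _] := prC C FC.
        have [_] : (A `\` (C `|` (A `\` P))) (a *: (x : K^o)); last exact.
        by apply: h => //; split=> // h'; apply: nx; exact: inU h'.
    + move=> [A1 n1]; apply: n1; apply: (inU C1) => //; apply: contrapT => h.
      by have [_ _ + _] := prC C1 FC1; apply; split.
    + move=> a b Aa Ab [_ nab]; apply: contrapT => /not_orP[na nb].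
      have Ua : U a by apply: contrapT => h; apply: na.
      have Ub : U b by apply: contrapT => h; apply: nb.
      have [C FC Ca] := UE _ Ua; have [C' FC' C'b] := UE _ Ub.
      have [C'' FC'' [C''a C''b]] : exists2 C'', F C'' & (C'' `|` (A `\` P)) a /\ (C'' `|` (A `\` P)) b.
        have [h|h] := Ftot _ _ FC FC'.
          by exists C' => //; split=> //; case: Ca => [/h|]; [left|right].
        by exists C => //; split=> //; case: C'b => [/h|]; [left|right].
      have [_ _ _ h] := prC _ FC''.
      have [|[_ //]|[_ //]] := h a b Aa Ab.
      by split; [exact: subringM|move=> h'; apply: nab; exact: inU h'].
  - move=> x Ix; split; first by case: pP => PA _ _ _; exact/PA/IP.
    by move=> /UE[C FC Cx]; have [_ [h _]] := okQ _ (FP C FC); have [_] := h x Ix.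
  - by move=> x [Ax nx]; apply: contrapT => nPx; apply: nx; right.
  - by rewrite setDD (setIidr UA).
have [pQ [IQ QP]] := okQ _ okC; exists (A `\` (C `|` (A `\` P))); split=> //.
move=> Q' pQ' IQ' Q'Q; apply: contrapT => ne.
apply: (Cmax (A `\` Q')); last first.
  have E : (A `\` Q') `|` (A `\` P) = A `\` Q'.
    apply/seteqP; split=> [x [//|[Ax nx]]|x]; last by left.
    by split=> // /Q'Q[_ h]; apply: h; right.
  by rewrite /OK E; exists Q'; split=> // x /Q'Q /QP.
split.
  move=> x Cx; have Ax : A x by apply: (CA _ okC); left.
  by split=> // /Q'Q[_]; apply; left.
move=> h; apply: ne; apply/seteqP; split=> // x [Ax nx]; apply: contrapT => nQ'x.
by apply: nx; left; apply: h.
Qed.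

(** The core of Q is a prime that contains I and lies in Q, so minimality gives equality. *)
Lemma min_prime_stable A I Q D : is_subring A -> k0 `<=` A -> der D -> (forall a, A a -> A (D a)) ->
  I `<=` A -> (forall a, I a -> I (D a)) -> prime_in A Q -> I `<=` Q ->
  (forall Q', prime_in A Q' -> I `<=` Q' -> Q' `<=` Q -> Q' = Q) -> forall a, Q a -> Q (D a).
Proof.
move=> As kA dD AD IA ID pQ IQ Qmin a Qa.
have E : core A D Q = Q.
  by apply: Qmin; [exact: core_prime|exact: core_max|exact: core_sub].
by move: Qa; rewrite -{1}E => /(core_stable AD); rewrite E.
Qed.
End Derivations.

(** * Subrings, quotients and localizations as types *)

Section ClassicalUnits.
Context {R : comNzRingType}.

(** Units and inverses are chosen classically, so that the rings constructed below can be made into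
    [comUnitRingType]s. *)
Definition cunit : {pred R} := fun x => `[< exists y, y * x = 1 >].
Definition cinv (x : R) : R :=
  if pselect (exists y, y * x = 1) is left h then projT1 (cid h) else x.

Lemma cmulVx : {in cunit, left_inverse 1 cinv *%R}.
Proof. by move=> x /asboolP h; rewrite /cinv; case: pselect => // h'; case: cid. Qed.
Lemma cunitPl : forall x y : R, y * x = 1 -> cunit x.
Proof. by move=> x y h; apply/asboolP; exists y. Qed.
Lemma cinv_out : {in [predC cunit], cinv =1 id}.
Proof. by move=> x /negP h; rewrite /cinv; case: pselect => // h'; case: h; apply/asboolP. Qed.
End ClassicalUnits.

Section SubringType.
Variables (R : comNzRingType) (S : set R) (Ss : is_subring S).

Definition mem_of : {pred R} := fun x => `[< S x >].

Lemma mem_of_closed : subring_closed mem_of.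
Proof.
split; first by apply/asboolP; exact: subring1.
- by move=> x y /asboolP Sx /asboolP Sy; apply/asboolP; exact: subringB.
- by move=> x y /asboolP Sx /asboolP Sy; apply/asboolP; exact: subringM.
Qed.

Record subr := Subr { subr_val : R; _ : mem_of subr_val }.
(** The proof that S is a subring is carried as a parameter of the type, so that the ring structure
    can be inferred from it. *)
Definition subr_of_ (_ : is_subring S) := subr.
Definition subr_of := subr_of_ Ss.
HB.instance Definition _ := [isSub of subr_of for subr_val].
HB.instance Definition _ := [Choice of subr_of by <:].
HB.instance Definition _ := GRing.SubChoice_isSubComNzRing.Build R mem_of subr_of mem_of_closed.
HB.instance Definition _ := GRing.ComNzRing_hasMulInverse.Build subr_of
  (@cmulVx subr_of) (@cunitPl subr_of) (@cinv_out subr_of).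

(** Elements outside S are sent to 0, which makes the map total. *)
Definition tosub (x : R) : subr_of := insubd (0 : subr_of) x.

Lemma subr_valP (x : subr_of) : S (\val x).
Proof. by case: x => x /= /asboolP. Qed.
Lemma tosubK x : S x -> \val (tosub x) = x.
Proof. by move=> Sx; apply: insubdK; apply/asboolP. Qed.
Lemma valtosub (x : subr_of) : tosub (\val x) = x.
Proof. by apply: val_inj; rewrite tosubK //; exact: subr_valP. Qed.
Lemma tosubB x y : S x -> S y -> tosub (x - y) = tosub x - tosub y.
Proof. by move=> Sx Sy; apply: val_inj; rewrite rmorphB /= !tosubK //; exact: subringB. Qed.
Lemma tosubM x y : S x -> S y -> tosub (x * y) = tosub x * tosub y.
Proof. by move=> Sx Sy; apply: val_inj; rewrite rmorphM /= !tosubK //; exact: subringM. Qed.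
Lemma tosub1 : tosub 1 = 1.
Proof. by apply: val_inj; rewrite rmorph1 tosubK //; exact: subring1. Qed.
Lemma subr_unitP (x : subr_of) : x \is a GRing.unit <-> exists2 y, S y & y * \val x = 1.
Proof.
split=> [ux|[y Sy yx]].
  exists (\val (x^-1)); first exact: subr_valP.
  by rewrite -rmorphM mulVr // rmorph1.
apply/(@cunitPl subr_of x (tosub y)); apply: val_inj.
by rewrite rmorphM rmorph1 /= tosubK.
Qed.
End SubringType.

Section FieldOfRing.
Variables (Q : comNzRingType) (inv : Q -> Q).
Hypotheses (mulVf : forall x, x != 0 -> inv x * x = 1) (inv0 : inv 0 = 0).
Definition field_of_ring : fieldType := HB.pack (GRing.ComNzRing.sort Q) (GRing.ComNzRing_isField.Build Q mulVf inv0).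
End FieldOfRing.

Section QuotientRing.
Variables (R : comNzRingType) (I : set R).
Hypotheses (Ii : is_ideal I) (I1 : ~ I 1).

Definition ipred : R -> bool := fun x => `[< I x >].
Lemma ipred_closed : idealr_closed ipred.
Proof.
have [I0 ID IM] := Ii; split; first by apply/asboolP.
  by apply/negP => /asboolP.
by move=> a x y /asboolP Ix /asboolP Iy; apply/asboolP; apply: ID => //; exact: IM.
Qed.

Lemma quotient_ring : exists (Q : comNzRingType) (f : {rmorphism R -> Q}),
  (forall a, f a = 0 <-> I a) /\ forall y, exists a, f a = y.
Proof.
pose J : idealr R := HB.pack ipred (isIdealr.Build R ipred ipred_closed).
pose Q : comNzRingType := {ideal_quot J}.
pose f : {rmorphism R -> Q} := \pi_{ideal_quot J}%qT.
exists Q, f; split=> [a|y]; last by exists (repr (y : {ideal_quot J})); exact: reprK.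
split=> [fa|Ia].
  have : (f a == f 0) by rewrite fa rmorph0.
  by rewrite -[f a == f 0]/(a == 0 %[mod {ideal_quot J}])%qT -Quotient.idealrBE subr0 => /asboolP.
apply/eqP; rewrite -(rmorph0 f) -[f a == f 0]/(a == 0 %[mod {ideal_quot J}])%qT -Quotient.idealrBE subr0.
by apply/asboolP.
Qed.

Lemma quotient_field : (forall a, ~ I a -> exists b, I (b * a - 1)) ->
  exists (F : fieldType) (f : {rmorphism R -> F}),
  (forall a, f a = 0 <-> I a) /\ forall y, exists a, f a = y.
Proof.
move=> Imax; have [Q [f [fE fs]]] := quotient_ring.
have inv_ex (x : Q) : exists y : Q, (x != 0 -> y * x = 1) /\ (x = 0 -> y = 0).
  have [->|x0] := eqVneq x 0; first by exists 0; split=> // /eqP.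
  have [a fa] := fs x; have [|b hb] := Imax a.
    by move=> /fE; rewrite fa => h; rewrite h eqxx in x0.
  exists (f b); split=> // [_|h]; last by rewrite h eqxx in x0.
  by move/fE: hb; rewrite rmorphB rmorphM rmorph1 fa => /subr0_eq.
have [inv hinv] := choice inv_ex.
pose F : fieldType := field_of_ring (fun x => (hinv x).1) ((hinv 0).2 erefl).
pose g : {rmorphism R -> F} := f.
by exists F, g.
Qed.
End QuotientRing.

Section Localization.
Variables (R : comNzRingType) (P : set R) (Pp : is_prime P).

Let nP1 : ~ P 1. Proof. by case: Pp. Qed.
Let nPM a b : ~ P a -> ~ P b -> ~ P (a * b).
Proof. by case: Pp => _ _ h na nb /h[]. Qed.
Let P0 : P 0. Proof. by case: Pp => -[]. Qed.

(** A pair whose denominator lies in P is read as 0/1. The quotient can then be taken on all pairs,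
    without a subtype of admissible ones. *)
Definition lnorm (p : R * R) : R * R := if `[< P p.2 >] then (0, 1) else p.
Lemma lnormP p : ~ P (lnorm p).2.
Proof. by rewrite /lnorm; case: asboolP. Qed.
Lemma lnormE a d : ~ P d -> lnorm (a, d) = (a, d).
Proof. by rewrite /lnorm /= => nd; case: asboolP. Qed.

Definition lequiv (p q : R * R) : bool :=
  `[< exists2 u, ~ P u & u * ((lnorm p).1 * (lnorm q).2) = u * ((lnorm q).1 * (lnorm p).2) >].

Lemma lequiv_equiv : equiv_class_of lequiv.
Proof.
split=> [p|p q|q p r].
- by apply/asboolP; exists 1.
- by apply/asboolP/asboolP => -[u nu e]; exists u.
- move=> /asboolP[u nu e] /asboolP[v nv e']; apply/asboolP.
  exists (u * v * (lnorm q).2); first by apply: nPM; [exact: nPM|exact: lnormP].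
  transitivity (v * (lnorm r).2 * (u * ((lnorm p).1 * (lnorm q).2))); first by ring.
  rewrite e; transitivity (u * (lnorm p).2 * (v * ((lnorm q).1 * (lnorm r).2))); first by ring.
  by rewrite e'; ring.
Qed.

Canonical lequiv_rel := EquivRelPack lequiv_equiv.
Definition locT_ (_ : is_prime P) := {eq_quot lequiv}%qT.
Definition locT := locT_ Pp.
HB.instance Definition _ := Choice.on locT.

Definition lfrac (a d : R) : locT := (\pi_({eq_quot lequiv}) (a, d))%qT.

Lemma lfrac_eq a d b e : ~ P d -> ~ P e ->
  (lfrac a d = lfrac b e <-> exists2 u, ~ P u & u * (a * e) = u * (b * d)).
Proof.
move=> nd ne; have E : lequiv (a, d) (b, e) <-> exists2 u, ~ P u & u * (a * e) = u * (b * d).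
  by rewrite /lequiv !lnormE //; split=> [/asboolP|h]; [|apply/asboolP].
rewrite -E; split=> [|h]; first by move=> /eqmodP.
by apply/eqmodP.
Qed.

Lemma lfracP (x : locT) : exists a d, ~ P d /\ x = lfrac a d.
Proof.
exists (lnorm (repr (x : {eq_quot lequiv}%qT))).1, (lnorm (repr (x : {eq_quot lequiv}%qT))).2.
split; first exact: lnormP.
rewrite /lfrac -[LHS](reprK (x : {eq_quot lequiv}%qT)); apply/eqmodP => /=.
rewrite /lequiv; apply/asboolP; exists 1 => //.
set p := lnorm (repr _); have -> : lnorm (p.1, p.2) = p by rewrite lnormE; [case: (p)|exact: lnormP].
by [].
Qed.

Definition lnum (x : locT) : R := projT1 (cid (lfracP x)).
Definition lden (x : locT) : R := projT1 (cid (projT2 (cid (lfracP x)))).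
Lemma ldenP x : ~ P (lden x).
Proof. by rewrite /lden; case: cid => a /= h; case: cid => d /= []. Qed.
Lemma lnumden x : x = lfrac (lnum x) (lden x).
Proof. by rewrite /lden /lnum; case: cid => a /= h; case: cid => d /= []. Qed.

Definition ladd (x y : locT) := lfrac (lnum x * lden y + lnum y * lden x) (lden x * lden y).
Definition lopp (x : locT) := lfrac (- lnum x) (lden x).
Definition lmul (x y : locT) := lfrac (lnum x * lnum y) (lden x * lden y).

Lemma lfracD a d b e : ~ P d -> ~ P e -> ladd (lfrac a d) (lfrac b e) = lfrac (a * e + b * d) (d * e).
Proof.
move=> nd ne; have nx := @ldenP (lfrac a d); have ny := @ldenP (lfrac b e).
have /lfrac_eq[//|//|u nu hu] := lnumden (lfrac a d).
have /lfrac_eq[//|//|v nv hv] := lnumden (lfrac b e).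
apply/lfrac_eq; try exact: nPM; exists (u * v); first exact: nPM.
set n := lnum _ in hu *; set m := lden _ in hu nx *; set n' := lnum _ in hv *; set m' := lden _ in hv ny *.
transitivity (u * (n * d) * (v * m' * e) + v * (n' * e) * (u * m * d)); first by ring.
by rewrite -hu -hv; ring.
Qed.
Lemma lfracN a d : ~ P d -> lopp (lfrac a d) = lfrac (- a) d.
Proof.
move=> nd; have nx := @ldenP (lfrac a d).
have /lfrac_eq[//|//|u nu hu] := lnumden (lfrac a d).
by apply/lfrac_eq => //; exists u => //; rewrite !mulNr !mulrN hu.
Qed.
Lemma lfracM a d b e : ~ P d -> ~ P e -> lmul (lfrac a d) (lfrac b e) = lfrac (a * b) (d * e).
Proof.
move=> nd ne; have nx := @ldenP (lfrac a d); have ny := @ldenP (lfrac b e).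
have /lfrac_eq[//|//|u nu hu] := lnumden (lfrac a d).
have /lfrac_eq[//|//|v nv hv] := lnumden (lfrac b e).
apply/lfrac_eq; try exact: nPM; exists (u * v); first exact: nPM.
set n := lnum _ in hu *; set m := lden _ in hu nx *; set n' := lnum _ in hv *; set m' := lden _ in hv ny *.
transitivity (u * (n * d) * (v * (n' * e))); first by ring.
by rewrite -hu -hv; ring.
Qed.

Local Ltac lsplit x a d nd := have [a [d [nd ->]]] := lfracP x.
Local Ltac leq := apply/lfrac_eq; [by do ?exact: nPM; auto 10|by do ?exact: nPM; auto 10|exists 1 => //; ring].

Lemma laddA : associative ladd.
Proof.
move=> x y z; lsplit x a d nd; lsplit y b e ne; lsplit z c f nf.
rewrite !lfracD //; try exact: nPM.
apply/lfrac_eq; [by do 2 ?apply: nPM|by do 2 ?apply: nPM|exists 1 => //; ring].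
Qed.
Lemma laddC : commutative ladd.
Proof.
move=> x y; lsplit x a d nd; lsplit y b e ne.
by rewrite !lfracD // [d * e]mulrC addrC.
Qed.
Lemma ladd0 : left_id (lfrac 0 1) ladd.
Proof. by move=> x; lsplit x a d nd; rewrite lfracD // mul0r add0r mulr1 mul1r. Qed.
Lemma laddN : left_inverse (lfrac 0 1) lopp ladd.
Proof.
move=> x; lsplit x a d nd; rewrite lfracN // lfracD //.
by apply/lfrac_eq; [exact: nPM|by []|exists 1 => //; ring].
Qed.
HB.instance Definition _ := GRing.isZmodule.Build locT laddA laddC ladd0 laddN.

Lemma lmulA : associative lmul.
Proof.
move=> x y z; lsplit x a d nd; lsplit y b e ne; lsplit z c f nf.
by rewrite !lfracM //; try exact: nPM; rewrite !mulrA.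
Qed.
Lemma lmulC : commutative lmul.
Proof.
move=> x y; lsplit x a d nd; lsplit y b e ne.
by rewrite !lfracM // [d * e]mulrC [a * b]mulrC.
Qed.
Lemma lmul1 : left_id (lfrac 1 1) lmul.
Proof. by move=> x; lsplit x a d nd; rewrite lfracM // !mul1r. Qed.
Lemma lmulDl : left_distributive lmul ladd.
Proof.
move=> x y z; lsplit x a d nd; lsplit y b e ne; lsplit z c f nf.
rewrite !(lfracD, lfracM) //; try exact: nPM.
apply/lfrac_eq; [by do 2 ?apply: nPM|by do 3 ?apply: nPM|exists 1 => //; ring].
Qed.
Lemma lone_neq0 : lfrac 1 1 != lfrac 0 1.
Proof.
apply/eqP => /lfrac_eq[//|//|u nu]; rewrite mul0r mulr0 !mulr1 => u0.
by apply: nu; rewrite u0.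
Qed.
HB.instance Definition _ := GRing.Zmodule_isComNzRing.Build locT lmulA lmulC lmul1 lmulDl lone_neq0.
HB.instance Definition _ := GRing.ComNzRing_hasMulInverse.Build locT
  (@cmulVx locT) (@cunitPl locT) (@cinv_out locT).

Definition toloc (a : R) : locT := lfrac a 1.
Lemma toloc1 : toloc 1 = 1. Proof. by []. Qed.
Lemma tolocB a b : toloc (a - b) = toloc a - toloc b.
Proof.
by rewrite -[toloc a - toloc b]/(ladd (toloc a) (lopp (toloc b))) /toloc lfracN // lfracD // !mulr1.
Qed.
Lemma tolocM a b : toloc (a * b) = toloc a * toloc b.
Proof. by rewrite /toloc -[RHS]/(lmul _ _) lfracM // mulr1. Qed.
Lemma toloc_unit a : toloc a \is a GRing.unit <-> ~ P a.
Proof.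
split=> [/asboolP[y]|na]; last first.
  apply/(@cunitPl _ _ (lfrac 1 a)); rewrite -[LHS]/(lmul _ _) lfracM //.
  by apply/lfrac_eq => //; [exact: nPM|exists 1 => //; ring].
lsplit y b e ne; rewrite -[_ * _]/(lmul _ _) lfracM // => /lfrac_eq[|//|u nu hu Pa].
  exact: nPM.
have [[_ _ PM] _ _] := Pp; have : P (u * (1 * (e * 1))).
  by rewrite -hu (_ : u * (b * a * 1) = u * b * a); [exact: PM|ring].
by apply: nPM => //; rewrite mul1r mulr1.
Qed.
Lemma toloc_frac (x : locT) : exists a d, ~ P d /\ x = toloc a / toloc d.
Proof.
lsplit x a d nd; exists a, d; split=> //.
have ud : toloc d \is a GRing.unit by apply/toloc_unit.
apply: (mulIr ud); rewrite divrK // -[LHS]/(lmul _ _) lfracM //.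
by apply/lfrac_eq => //; [exact: nPM|exists 1 => //; ring].
Qed.
Lemma toloc_ker a : toloc a = 0 <-> exists2 u, ~ P u & u * a = 0.
Proof.
rewrite -[0 : locT]/(lfrac 0 1); split.
  by move=> /lfrac_eq[//|//|u nu]; rewrite mulr1 mul0r mulr0; exists u.
by move=> [u nu h]; apply/lfrac_eq => //; exists u => //; rewrite mulr1 mul0r mulr0.
Qed.
End Localization.

Section DependentProduct.
Variables (I : Type) (i0 : I) (T : I -> comNzRingType).

(** The index i0 is kept in the type to witness that the index set is inhabited, hence that 1
    differs from 0 in the product. *)
Definition dprod_ (_ : I) := forall i, T i.
Definition dprod := dprod_ i0.
HB.instance Definition _ := gen_eqMixin dprod.
HB.instance Definition _ := gen_choiceMixin dprod.
Implicit Types f g h : dprod.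
Definition dpadd f g : dprod := fun i => f i + g i.
Definition dpopp f : dprod := fun i => - f i.
Definition dpmul f g : dprod := fun i => f i * g i.
Local Ltac dpext l := by move=> *; apply: functional_extensionality_dep => i; exact: l.
Lemma dpaddA : associative dpadd. Proof. dpext addrA. Qed.
Lemma dpaddC : commutative dpadd. Proof. dpext addrC. Qed.
Lemma dpadd0 : left_id ((fun=> 0) : dprod) dpadd. Proof. dpext add0r. Qed.
Lemma dpaddN : left_inverse ((fun=> 0) : dprod) dpopp dpadd. Proof. dpext addNr. Qed.
HB.instance Definition _ := GRing.isZmodule.Build dprod dpaddA dpaddC dpadd0 dpaddN.
Lemma dpmulA : associative dpmul. Proof. dpext mulrA. Qed.
Lemma dpmulC : commutative dpmul. Proof. dpext mulrC. Qed.
Lemma dpmul1 : left_id ((fun=> 1) : dprod) dpmul. Proof. dpext mul1r. Qed.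
Lemma dpmulDl : left_distributive dpmul dpadd. Proof. dpext mulrDl. Qed.
Lemma dpone_neq0 : ((fun=> 1) : dprod) != 0.
Proof. by apply/eqP => /(congr1 (fun f : dprod => f i0)) /eqP; rewrite oner_eq0. Qed.
HB.instance Definition _ := GRing.Zmodule_isComNzRing.Build dprod dpmulA dpmulC dpmul1 dpmulDl dpone_neq0.
End DependentProduct.

(** * Local subrings of a field and their residue fields *)

Section LocalSets.
Context {K : fieldType}.
Implicit Types (A O P Q m : set K).

Definition locz A Q : set K := [set x | exists a b, [/\ A a, A b, ~ Q b & x = a / b]].

Lemma prime_in0 A Q : prime_in A Q -> Q 0. Proof. by case=> _ []. Qed.

Lemma prime_nz A Q b : prime_in A Q -> ~ Q b -> b != 0.
Proof. by move=> pQ nb; apply/eqP => b0; apply: nb; rewrite b0; exact: prime_in0 pQ. Qed.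

Lemma prime_contract A O P : is_subring A -> A `<=` O -> prime_in O P -> prime_in A (A `&` P).
Proof.
move=> As AO [PO Pm P1 Pp]; have [P0 PD _] := Pm.
split=> [a []//||[]//|a b Aa Ab [_ /(Pp _ _ (AO _ Aa) (AO _ Ab))[]]]; try by [left|right].
split=> [|a b [Aa Pa] [Ab Pb]|a b Aa [Ab Pb]]; first by split=> //; exact: subring0.
  by split; [exact: subringD|exact: PD].
by split; [exact: subringM|apply: (submodM Pm) => //; exact: AO].
Qed.

Lemma locz_subring A Q : is_subring A -> prime_in A Q -> is_subring (locz A Q).
Proof.
move=> As pQ; have [QA Qm Q1 QP] := pQ.
have nQM a b : A a -> A b -> ~ Q a -> ~ Q b -> ~ Q (a * b) by move=> Aa Ab na nb /(QP a b Aa Ab)[].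
split.
- by exists 1, 1; split; rewrite ?divr1 //; exact: subring1.
- move=> _ _ [a [b [Aa Ab nb ->]]] [c [d [Ac Ad nd ->]]].
  have b0 := prime_nz pQ nb; have d0 := prime_nz pQ nd.
  exists (a * d - c * b), (b * d); split; [|exact: subringM|exact: nQM|by field; rewrite b0 d0].
  by apply: subringB => //; exact: subringM.
- move=> _ _ [a [b [Aa Ab nb ->]]] [c [d [Ac Ad nd ->]]].
  have b0 := prime_nz pQ nb; have d0 := prime_nz pQ nd.
  by exists (a * c), (b * d); split; [exact: subringM|exact: subringM|exact: nQM|field; rewrite b0 d0].
Qed.

Lemma sub_locz A Q : is_subring A -> prime_in A Q -> A `<=` locz A Q.
Proof.
by move=> As [_ _ Q1 _] a Aa; exists a, 1; split; rewrite ?divr1 //; exact: subring1.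
Qed.

Lemma loc_locz A Q : is_subring A -> prime_in A Q -> loc A (locz A Q).
Proof.
move=> As pQ; split; first exact: sub_locz.
move=> _ [a [b [Aa Ab nb ->]]]; exists a, b; split=> //; first exact: prime_nz pQ nb.
by exists 1, b; split; rewrite ?div1r //; exact: subring1.
Qed.

Definition localring O m := [/\ is_subring O, prime_in O m & forall a, O a -> ~ m a -> O a^-1].

(** The residue map is a total function on K whose laws hold on O only. Compatibility with sums and
    determinants is recorded here because it cannot be inferred from a morphism structure on K. *)
Lemma residue_field O m : localring O m -> exists (F : fieldType) (res : K -> F),
  [/\ forall a b, O a -> O b -> res (a - b) = res a - res b,
      forall a b, O a -> O b -> res (a * b) = res a * res b,
      forall n (f : 'I_n -> K), (forall i, O (f i)) -> res (\sum_i f i) = \sum_i res (f i),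
      forall n (B : 'M[K]_n), (forall i j, O (B i j)) -> res (\det B) = \det (map_mx res B)
    & [/\ res 1 = 1, forall a, O a -> (res a = 0 <-> m a) & forall y, exists2 a, O a & res a = y]].
Proof.
move=> [Os [mO mm m1 mP] Oi]; have [m0 mD mZ] := mm.
pose I : set (subr_of Os) := [set x | m (\val x)].
have Ii : is_ideal I.
  split.
  - by suff : m (\val (0 : subr_of Os)) by []; rewrite rmorph0.
  - move=> a b ma mb; suff : m (\val (a + b)) by []; rewrite rmorphD; exact: mD.
  - move=> a b mb; suff : m (\val (a * b)) by [].
    by rewrite rmorphM; apply: (submodM mm) => //; exact: subr_valP.
have I1 : ~ I 1 by move=> h; have : m (\val (1 : subr_of Os)) by []; rewrite rmorph1.
have Imax a : ~ I a -> exists b, I (b * a - 1).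
  move=> na; have Oa := subr_valP a; have Ov := Oi _ Oa na.
  exists (tosub Os (\val a)^-1); suff : m (\val (tosub Os (\val a)^-1 * a - 1)) by [].
  rewrite rmorphB rmorphM rmorph1 /= tosubK // mulVf ?subrr //.
  apply/eqP => a0; apply: na; suff : m (subr_val a) by [].
  by rewrite a0.
have [F [f [fI fs]]] := quotient_field Ii I1 Imax.
exists F, (fun a => f (tosub Os a)); split; last split.
- by move=> a b Oa Ob; rewrite tosubB // rmorphB.
- by move=> a b Oa Ob; rewrite tosubM // rmorphM.
- move=> n g Og; rewrite (_ : \sum_i g i = \val (\sum_i tosub Os (g i))) ?valtosub ?rmorph_sum //.
  by apply: eq_bigr => i _; rewrite /= tosubK.
- move=> n B OB; rewrite (_ : \det B = \val (\det (map_mx (tosub Os) B))) ?valtosub -?det_map_mx.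
    by congr (\det _); apply/matrixP => i j; rewrite !mxE.
  by congr (\det _); apply/matrixP => i j; rewrite !mxE /= tosubK.
- by rewrite tosub1 rmorph1.
- by move=> a Oa; rewrite fI /I /= tosubK.
- by move=> y; have [a <-] := fs y; exists (\val a); [exact: subr_valP|rewrite valtosub].
Qed.
End LocalSets.

(** * Rank arguments for sets of vectors *)

Section LinearAlgebra.
Context {F : fieldType} {n : nat}.

Lemma max_rows (V : set 'rV[F]_n) : exists r (M : 'M[F]_(r, n)),
  [/\ row_free M, forall i, V (row i M) & forall v, V v -> (v <= M)%MS].
Proof.
pose P r := `[< exists M : 'M[F]_(r, n), row_free M /\ forall i, V (row i M) >].
have exP : exists r, P r.
  exists 0%N; apply/asboolP; exists 0; split; last by case.
  by rewrite /row_free mxrank0.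
have Pb r : P r -> (r <= n)%N.
  by move=> /asboolP[M [/eqP + _]] => {1}<-; exact: rank_leq_col.
case: (ex_maxnP exP Pb) => r /asboolP[M [fM VM]] rmax; exists r, M; split=> // v Vv.
apply: contrapT => /negP nv; suff : P r.+1 by move=> /rmax; rewrite ltnn.
rewrite /P -addn1; apply/asboolP; exists (col_mx M v); split.
  rewrite /row_free eqn_leq rank_leq_row /= -addsmxE.
  have : (M < M + v)%MS.
    rewrite ltmxE addsmxSl /=; apply: contra nv => h; exact: submx_trans (addsmxSr M v) h.
  by move=> /rank_ltmx; rewrite addn1 (eqP fM).
move=> i; case: (split_ordP i) => j ->; first by rewrite rowKu.
by rewrite rowKd ord1 row_id.
Qed.

(** A maximal independent family in V has fewer than n rows, so a nonzero vector is orthogonal to it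
    and hence to V. *)
Lemma ann_vec (V : set 'rV[F]_n) : (forall M : 'M[F]_n, (forall i, V (row i M)) -> \det M = 0) ->
  exists2 u : 'cV[F]_n, u != 0 & forall v, V v -> v *m u = 0.
Proof.
move=> hV; have [r [M [fM VM MV]]] := max_rows V.
have rn : (r < n)%N.
  rewrite ltn_neqAle -{2}(eqP fM) rank_leq_col andbT; apply/eqP => e.
  move: M fM VM MV; rewrite e => M fM VM _.
  by have := hV M VM; move: fM; rewrite row_free_unit unitmxE unitfE => /eqP.
have k0 : kermx M^T != 0.
  by rewrite -mxrank_eq0 mxrank_ker mxrank_tr (eqP fM) subn_eq0 -ltnNge.
have [i ri] : exists i, row i (kermx M^T) != 0.
  by apply/existsP; apply: contraNT k0; rewrite negb_exists => /forallP h; apply/eqP/row_matrixP => i; rewrite row0; apply/eqP; rewrite -[_ == 0]negbK.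
exists (row i (kermx M^T))^T; first by rewrite trmx_eq0.
move=> v /MV/submxP[D ->]; rewrite -mulmxA (_ : M *m _ = 0) ?mulmx0 //.
by apply: trmx_inj; rewrite trmx_mul trmxK trmx0 -row_mul mulmx_ker row0.
Qed.
End LinearAlgebra.

(** * Criteria for a principal maximal ideal *)

Section Valuation.
Context {K : fieldType}.
Implicit Types (A O P Q m : set K).

Definition principal O m := exists2 t, m t & forall a, m a -> exists2 c, O c & a = t * c.

(** If x could be divided by t indefinitely, the quotients [a i], each t times the next, would
    generate an increasing chain of ideals. When this chain stops, 1 is a multiple of t. *)
Lemma val_exists O m t : localring O m -> noeth O -> m t -> (forall a, m a -> exists2 c, O c & a = t * c) ->
  forall x, O x -> x != 0 -> exists n u, [/\ O u, ~ m u & x = u * t ^+ n].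
Proof.
move=> [Os [mO mm m1 mP] Oi] noe mt tP x Ox x0; apply: contrapT => no.
have step (a : {a | O a}) : exists c : {a | O a}, m (sval a) -> sval a = t * sval c.
  have [/tP[c Oc e]|na] := pselect (m (sval a)); last by exists a.
  by exists (exist _ c Oc).
have [g hg] := choice step.
pose a n := sval (iter n g (exist _ x Ox)).
have ax n : x = t ^+ n * a n /\ m (a n).
  elim: n => [|n [e man]].
    split; first by rewrite mul1r.
    by apply: contrapT => na; apply: no; exists 0%N, x; rewrite mulr1.
  have e2 : a n = t * a n.+1 by apply: hg.
  have e1 : x = t ^+ n.+1 * a n.+1 by rewrite exprSr -mulrA -e2.
  split=> //; apply: contrapT => na; apply: no; exists n.+1, (a n.+1).
  by split=> //; [exact: (svalP (iter n.+1 g _))|rewrite mulrC].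
have Om : @is_submod K K^o O O by exact: subring_submod.
have [n [c hc e]] := noethm_seq Os noe Om (u := a : nat -> K^o) (fun i => svalP (iter i g _)).
have an0 : a n != 0 by apply: contraNneq x0 => h; rewrite (ax n).1 h mulr0.
have ai i : (i < n)%N -> exists2 d, O d & a i = t * d * a n.
  move=> lin; have t0 : t ^+ i != 0.
    by apply: contraNneq x0 => h; rewrite (ax i).1 h mul0r.
  exists (t ^+ (n - i.+1)); first by apply: subringX => //; exact: mO.
  by apply: (mulfI t0); rewrite -(ax i).1 {1}(ax n).1 -exprS -subSn // subSS mulrA -exprD subnKC // ltnW.
rewrite size_mkseq in e.
have [d Od e'] : exists2 d, O d & a n = t * d * a n.
  rewrite {1 2}e; rewrite -e {1}e.
  elim/big_ind: _ => [|y z [d Od ->] [d' Od' ->]|i _].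
  - by exists 0; [exact: subring0|rewrite mulr0 mul0r].
  - by exists (d + d'); [exact: subringD|ring].
  - have [d Od h] := ai i (ltn_ord i); exists (c i * d); first exact: subringM.
    by rewrite nth_mkseq // h /GRing.scale /=; ring.
apply: m1; have -> : 1 = d * t.
  by apply: (mulIf an0); rewrite mul1r [d * t]mulrC.
exact: (submodM mm).
Qed.

(** The determinant trick for a finite module inside the field, where a single nonzero element
    ensures faithfulness. *)
Lemma integral_module A (s : seq K^o) y : is_subring A -> (exists2 x, x \in s & x != 0) ->
  (forall x, x \in s -> lspan A s (y * x : K^o)) -> integral A y.
Proof.
move=> As [x xs x0] hs.
have /choice[c hc] : forall i, exists c : nat -> K, (forall j, A (c j)) /\
    ((i < size s)%N -> y * s`_i = \sum_(j < size s) c j * s`_j).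
  move=> i; have [it|it] := ltnP i (size s); last by exists (fun=> 0); split=> // _; exact: subring0.
  by have [c hc e] := hs _ (mem_nth 0 it); exists c.
pose C : 'M[K]_(size s) := \matrix_(i, j) c i j.
have root : (char_poly C).[y] = 0.
  have ix : (index x s < size s)%N by rewrite index_mem.
  have hC (i : 'I_(size s)) : y * s`_i = \sum_j C i j * s`_j.
    by rewrite (hc i).2 //; apply: eq_bigr => l _; rewrite mxE.
  have /eqP := det_trick hC (Ordinal ix).
  by rewrite /= nth_index // mulf_eq0 (negPf x0) orbF horner_char_poly => /eqP.
have CA : polyin A (char_poly C).
  apply: (subring_det (polyin_subring As)) => i j; rewrite !mxE.
  apply: (subringB (polyin_subring As)); last by apply: polyinC => //; exact: (hc i).1.
  apply: (subring_mulrn (polyin_subring As)); exact: polyinX.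
exists (size s), (fun i => - (char_poly C)`_i); split=> [i|]; first exact: subringN.
have := root; rewrite horner_coef size_char_poly big_ord_recr /=.
have := monicP (char_poly_monic C); rewrite lead_coefE size_char_poly /= => ->.
rewrite mul1r => /eqP; rewrite addrC addr_eq0 => /eqP->; rewrite -sumrN.
by apply: eq_bigr => i _; rewrite mulNr.
Qed.

(** With y = b/f, the set y m lies in O. If it were contained in m, y would be integral, hence in O,
    although b is not in (f). So some y a with a in m is a unit, and then a generates m. *)
Lemma principal_colon O m f b : localring O m -> noeth O -> (forall x, integral O x -> O x) ->
  f != 0 -> m f -> O b -> (forall c, O c -> b != f * c) ->
  (forall a, m a -> exists2 c, O c & a * b = f * c) -> principal O m.
Proof.
move=> [Os [mO mm m1 mP] Oi] noe On f0 mf Ob nb hm; pose y := b / f.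
have ny : ~ O y by move=> /nb /eqP; apply; rewrite /y mulrC divfK.
have ym a : m a -> O (y * a).
  move=> ma; have [c Oc e] := hm a ma.
  by rewrite /y mulrAC [b * a]mulrC e mulrC mulKf.
have [[a [ma nya]]|no] := pselect (exists a, m a /\ ~ m (y * a)).
  exists a => // c mc; exists (y * c / (y * a)).
    by apply: subringM; [|exact: ym|exact/Oi/nya/ym].
  have y0 : y != 0 by apply/eqP => y0; apply: ny; rewrite y0; exact: subring0.
  have a0 : a != 0 by apply/eqP => a0; apply: nya; rewrite a0 mulr0; case: mm.
  by field; rewrite y0 a0.
exfalso; apply: ny; apply: On.
have [s sm ms] := noe m mm mO.
apply: (integral_module (s := s)) => // [|x xs].
  apply: contrapT => h; move/negP: f0; apply; apply/eqP.
  have [c _ ->] := ms f mf; rewrite big1 // => i _.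
  have -> : s`_i = 0; last by rewrite scaler0.
  by apply: contrapT => /eqP si; apply: h; exists s`_i => //; exact: mem_nth.
by apply: ms; apply: contrapT => h; apply: no; exists x; split=> //; exact: sm.
Qed.

(** A colon ideal (f : b) that is maximal among the proper ones is prime. The element b is kept
    because the fraction b/f is what [principal_colon] works with. *)
Lemma assoc_prime A f : is_subring A -> noeth A -> A f -> (forall c, A c -> f * c != 1) ->
  exists b Q, [/\ A b, forall c, A c -> b != f * c, prime_in A Q & forall a, A a -> (Q a <-> exists2 c, A c & a * b = f * c)].
Proof.
move=> As noe Af nf; have Am : @is_submod K K^o A A by exact: subring_submod.
pose col b := [set a | A a /\ exists2 c, A c & a * b = f * c].
pose F (I : set K^o) := exists b, [/\ A b, forall c, A c -> b != f * c & I = col b].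
have [|I [b [Ab nb ->]]|Q [[b [Ab nb QE]] Qmax]] := noethm_max As noe Am (F := F).
- exists (col 1), 1; split=> //; first exact: subring1.
  by move=> c Ac; rewrite eq_sym; exact: nf.
- split; last by move=> a [].
  split; first by split; [exact: subring0|exists 0; [exact: subring0|rewrite mul0r mulr0]].
  + move=> x y [Ax [c Ac xc]] [Ay [d Ad yd]]; split; first exact: subringD.
    by exists (c + d); [exact: subringD|rewrite mulrDl xc yd mulrDr].
  + move=> a x Aa [Ax [c Ac xc]]; split; first exact: subringM.
    by exists (a * c); [exact: subringM|rewrite -mulrA xc mulrCA].
exists b, Q; split=> //; last by move=> a Aa; rewrite QE; split=> [[]|h].
have Qm : is_submod A (Q : set K^o).
  rewrite QE; split; first by split; [exact: subring0|exists 0; [exact: subring0|rewrite mul0r mulr0]].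
  + move=> x y [Ax [c Ac xc]] [Ay [d Ad yd]]; split; first exact: subringD.
    by exists (c + d); [exact: subringD|rewrite mulrDl xc yd mulrDr].
  + move=> a x Aa [Ax [c Ac xc]]; split; first exact: subringM.
    by exists (a * c); [exact: subringM|rewrite -mulrA xc mulrCA].
split=> //.
- by rewrite QE => a [].
- by rewrite QE => -[_ [c Ac]]; rewrite mul1r => e; have /eqP := nb c Ac.
move=> x y Ax Ay Qxy; have [Qy|nQy] := pselect (Q y); [by right|left].
have nyb c : A c -> y * b != f * c.
  by move=> Ac; apply/eqP => e; apply: nQy; rewrite QE; split=> //; exists c.
have <- : col (y * b) = Q.
  apply: Qmax; first by exists (y * b); split=> //; exact: subringM.
  rewrite QE => a [Aa [c Ac e]]; split=> //; exists (y * c); first exact: subringM.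
  by rewrite mulrCA e mulrCA.
split=> //; move: Qxy; rewrite QE => -[_ [c Ac e]].
by exists c => //; rewrite mulrA.
Qed.

Definition chain_in A n := exists P : nat -> set K,
  (forall i, (i <= n)%N -> prime_in A (P i)) /\ (forall i, (i < n)%N -> P i `<` P i.+1).

Lemma prime_zero A : is_subring A -> prime_in A ([set 0] : set K).
Proof.
move=> As; split.
- by move=> _ ->; exact: subring0.
- split=> //; first by move=> _ _ -> ->; rewrite addr0.
  by move=> a _ _ ->; rewrite scaler0.
- by move=> /eqP; rewrite oner_eq0.
- by move=> a b _ _ /eqP; rewrite mulf_eq0 => /orP[]/eqP; [left|right].
Qed.

(** A nonzero f in m has an associated prime Q. It is nonzero and contained in m, so the absence of
    a chain of length two gives Q = m. *)
Lemma principal_dim1 O m : localring O m -> noeth O -> (forall x, integral O x -> O x) ->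
  ~ chain_in O 2 -> principal O m.
Proof.
move=> lO noe On nc; have [Os [mO mm m1 mP] Oi] := lO.
have [[f [mf f0]]|no] := pselect (exists f, m f /\ f != 0); last first.
  exists 0; first by case: mm.
  move=> a ma; exists 0; first exact: subring0.
  by rewrite mulr0; apply: contrapT => /eqP a0; apply: no; exists a.
have nf c : O c -> f * c != 1.
  by move=> Oc; apply/eqP => e; apply: m1; rewrite -e mulrC; exact: (submodM mm).
have [b [Q [Ob nb pQ QE]]] := assoc_prime Os noe (mO _ mf) nf.
have [QO Qm Q1 QP] := pQ.
have Qsm : Q `<=` m.
  move=> a Qa; apply: contrapT => na; apply: Q1; rewrite -(mulVf (x := a)).
    by apply: (submodM Qm) => //; apply: Oi => //; exact: QO.
  by apply/eqP => a0; apply: na; rewrite a0; case: mm.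
have mQ : m `<=` Q.
  apply: contrapT => nmQ; apply: nc; exists (fun i => if i is 0 then [set 0] else if i is 1 then Q else m).
  split=> [[|[|[|]]]//= _|[|[|]]//= _].
  - exact: prime_zero.
  - split; first by move=> _ ->; case: Qm.
    by move=> h; move/eqP: f0; apply; apply: h; apply/QE; [exact: mO|exists b].
apply: (principal_colon lO noe On f0 mf Ob nb) => a ma; apply/QE; [exact: mO|exact: mQ].
Qed.
End Valuation.

(** * Derivatives of determinants *)

Section Determinants.
Context {K : fieldType}.

Lemma det_row_repl n (M N : 'M[K]_n) i0 : (forall i j, i != i0 -> N i j = M i j) ->
  \det N = \sum_j N i0 j * cofactor M i0 j.
Proof.
move=> h; rewrite (expand_det_row _ i0); apply: eq_bigr => j _; congr (_ * _).
rewrite /cofactor; congr (_ * \det _); apply/matrixP => x y; rewrite !mxE h //.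
by rewrite eq_sym neq_lift.
Qed.

Lemma det_col_repl n (M N : 'M[K]_n) j0 : (forall i j, j != j0 -> N i j = M i j) ->
  \det N = \sum_i N i j0 * cofactor M i j0.
Proof.
move=> h; rewrite (expand_det_col _ j0); apply: eq_bigr => j _; congr (_ * _).
rewrite /cofactor; congr (_ * \det _); apply/matrixP => x y; rewrite !mxE h //.
by rewrite eq_sym neq_lift.
Qed.

Variables (k0 : set K) (k0f : subfield k0) (D : K -> K) (dD : der k0 D).

Lemma der_prod (I : eqType) (r : seq I) (F : I -> K) : uniq r ->
  D (\prod_(i <- r) F i) = \sum_(i <- r) \prod_(l <- r) (if l == i then D (F l) else F l).
Proof.
elim: r => [|x r IH] /=; first by rewrite !big_nil (der1 k0f dD).
move=> /andP[xr ur]; rewrite !big_cons (derM dD) IH // eqxx addrC; congr (_ + _).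
  rewrite mulrC; congr (_ * _); apply: eq_big_seq => l lr.
  by case: eqP => // lx; rewrite -lx lr in xr.
rewrite mulr_sumr; apply: eq_big_seq => i ir; rewrite big_cons.
by case: eqP => // xi; rewrite xi ir in xr.
Qed.

Lemma der_det n (M : 'M[K]_n) : D (\det M) = \sum_i \sum_j D (M i j) * cofactor M i j.
Proof.
have -> : D (\det M) = \sum_i \det (\matrix_(l, j) (if l == i then D (M l j) else M l j)).
  rewrite /determinant exchange_big /=.
  rewrite (big_morph D (derD dD) (der0 k0f dD)); apply: eq_bigr => s _; rewrite -mulr_sumr.
  have -> : D ((-1) ^+ s * \prod_i M i (s i)) = (-1) ^+ s * D (\prod_i M i (s i)).
    rewrite (derM dD) [D ((-1) ^+ s)](derk dD) ?mulr0 ?addr0 //.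
    by apply: subring_sign; case: k0f.
  congr (_ * _); rewrite der_prod ?index_enum_uniq //; apply: eq_bigr => i _.
  by apply: eq_bigr => l _; rewrite mxE.
apply: eq_bigr => i _; rewrite (det_row_repl (M := M) (i0 := i)) => [|l j /negPf li].
  by apply: eq_bigr => j _; rewrite mxE eqxx.
by rewrite mxE li.
Qed.
End Determinants.

(** * Lie-closed spaces of derivations *)

Section DerivationSpaces.
Context {K : fieldType}.
Variable L : set (K -> K).

(** The coefficients range over the whole function field: this is the form that saturation takes for
    a space of derivations of K. *)
Definition comb_closed := forall n (c : 'I_n -> K) (D : 'I_n -> K -> K), (forall i, L (D i)) ->
  L (fun x => \sum_i c i * D i x).
Definition lie_closed := forall D E, L D -> L E -> L (fun x => D (E x) - E (D x)).
Definition lin_free n (e : 'I_n -> K -> K) := forall c : 'I_n -> K, (forall x, \sum_i c i * e i x = 0) -> forall i, c i = 0.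
Definition lin_gen n (e : 'I_n -> K -> K) := forall D, L D -> exists c : 'I_n -> K, forall x, D x = \sum_i c i * e i x.
End DerivationSpaces.

Section Lie.
Context {K : fieldType}.
Hypothesis char0 : forall n, n.+1%:R != 0 :> K.
Variable k0 : set K.
Hypothesis k0f : subfield k0.
Variable z : seq K.
Let A := adjs k0 z.
Hypothesis frA : forall x, fracs A x.
Variables (L : set (K -> K)) (n : nat) (e : 'I_n -> K -> K).
Hypothesis L_der : forall D, L D -> der k0 D.
Hypotheses (L_comb : comb_closed L) (L_bracket : lie_closed L).
Hypothesis eL : forall i, L (e i).
Hypotheses (e_free : lin_free e) (e_gen : lin_gen L e).

Implicit Types (O P Q m : set K) (D : K -> K).

Let k0s : is_subring k0. Proof. by case: k0f. Qed.
Let As : is_subring A. Proof. exact: adjs_subring. Qed.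
Let kA : k0 `<=` A. Proof. exact: sub_adjs. Qed.
Let Anoe : noeth A. Proof. by apply: noeth_adjs => //; exact: subfield_noeth. Qed.

Definition stab O D := forall a, O a -> O (D a).
Definition Lst O := [set D | L D /\ stab O D].

Lemma L_scale c D : L D -> L (fun x => c * D x).
Proof.
move=> LD; have := L_comb (fun _ : 'I_1 => c) (D := fun=> D) (fun _ => LD).
by congr L; apply: functional_extensionality_dep => x; rewrite big_ord1.
Qed.

Lemma stab_gen D : der k0 D -> (forall x, x \in z -> A (D x)) -> stab A D.
Proof.
move=> dD zD a; apply: (der_adjs k0f dD) => // [c kc|x xz]; first by rewrite (derk dD) //; exact: subring0.
by split; [exact: mem_adjs|exact: zD].
Qed.

Lemma scale_stab D : L D -> exists d, [/\ A d, d != 0 & Lst A (fun x => d * D x)].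
Proof.
move=> LD; have [d [Ad d0 dt]] := common_denom As (t := map D z) (fun x _ => frA x).
exists d; split=> //; split; first exact: L_scale.
by apply: stab_gen => [|x xz]; [exact/L_der/L_scale|exact/dt/map_f].
Qed.

Definition jac (D : 'I_n -> K -> K) (b : 'I_n -> K) : 'M[K]_n := \matrix_(i, j) D i (b j).

(** If every determinant built on the generators z vanished, a fixed nontrivial combination of the
    e_i would kill z and so be the zero derivation, against freeness. Denominators are then cleared
    row by row. *)
Lemma jac_nonzero : exists (D : 'I_n -> K -> K) (b : 'I_n -> K), [/\ forall i, Lst A (D i), forall j, A (b j) & \det (jac D b) != 0].
Proof.
pose V := [set v : 'rV[K]_n | exists2 x, x \in z & v = \row_i e i x].
have [b bz db] : exists2 b : 'I_n -> K, (forall j, b j \in z) & \det (jac e b) != 0.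
  apply: contrapT => no; have [|u u0 hu] := @ann_vec K n V.
    move=> M VM; have /choice[b hb] : forall j, exists x, x \in z /\ row j M = \row_i e i x.
      by move=> j; have [x xz h] := VM j; exists x.
    apply: contrapT => /eqP dM; apply: no; exists b; first by move=> j; case: (hb j).
    rewrite (_ : jac e b = M^T) ?det_tr //; apply/matrixP => i j; rewrite !mxE.
    by have /rowP/(_ i) := (hb j).2; rewrite !mxE.
  have D0 : forall x, \sum_i u i 0 * e i x = 0.
    apply: (der_gen0 k0f frA); first by apply: L_der; exact: L_comb.
    move=> x xz; have /matrixP/(_ 0 0) := hu _ (ex_intro2 _ _ x xz erefl).
    by rewrite !mxE => h; rewrite -[RHS]h; apply: eq_bigr => i _; rewrite mxE mulrC.
  move/eqP: u0; apply; apply/matrixP => i j; rewrite ord1 mxE; exact: (e_free D0).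
have /choice[d hd] : forall i, exists d, [/\ A d, d != 0 & Lst A (fun x => d * e i x)].
  by move=> i; exact: scale_stab.
exists (fun i x => d i * e i x), b; split=> [i|j|].
- by case: (hd i).
- by apply: mem_adjs.
have -> : jac (fun i x => d i * e i x) b = diag_mx (\row_i d i) *m jac e b.
  by apply/matrixP => i j; rewrite mul_diag_mx !mxE.
rewrite det_mulmx det_diag mulf_neq0 //; apply/prodf_neq0 => i _.
by rewrite mxE; case: (hd i).
Qed.

Definition mz Q : set K := [set x | exists a b, [/\ Q a, A b, ~ Q b & x = a / b]].

Lemma locz_local Q : prime_in A Q -> localring (locz A Q) (mz Q).
Proof.
move=> pQ; have [QA Qm Q1 QP] := pQ; have Os := locz_subring As pQ.
have nQM a b : A a -> A b -> ~ Q a -> ~ Q b -> ~ Q (a * b) by move=> Aa Ab na nb /(QP a b Aa Ab)[].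
have nz b : ~ Q b -> b != 0 by exact: (prime_nz pQ).
have mzQ a b : A a -> A b -> ~ Q b -> mz Q (a / b) -> Q a.
  move=> Aa Ab nb [c [d [Qc Ad nd e']]].
  have : Q (a * d).
    have -> : a * d = b * c.
      by apply: (mulIf (invr_neq0 (nz _ nb))); apply: (mulIf (invr_neq0 (nz _ nd))); move: e'; have b0 := nz _ nb; have d0 := nz _ nd => e'; transitivity (a / b); [by field; rewrite b0 d0|rewrite e'; by field; rewrite b0 d0].
    exact: (submodM Qm).
  by move=> /(QP a d Aa Ad)[].
split=> //.
- split.
  + by move=> _ [a [b [Qa Ab nb ->]]]; exists a, b; split=> //; exact: QA.
  + split.
    * by exists 0, 1; split; [exact: prime_in0 pQ|exact: subring1| |rewrite mul0r].
    * move=> _ _ [a [b [Qa Ab nb ->]]] [c [d [Qc Ad nd ->]]].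
      exists (d * a + b * c), (b * d); split; [|exact: subringM|exact: nQM|by field; rewrite !nz].
      by case: (Qm) => _ h _; apply: h; exact: (submodM Qm).
    * move=> _ _ [a [b [Aa Ab nb ->]]] [c [d [Qc Ad nd ->]]].
      exists (a * c), (b * d); split; [exact: (submodM Qm)|exact: subringM|exact: nQM|].
      by rewrite /GRing.scale /=; field; rewrite !nz.
  + by rewrite -(divr1 1) => h; apply: (Q1); apply: (mzQ 1 1) => //; exact: subring1.
  + move=> _ _ [a [b [Aa Ab nb ->]]] [c [d [Ac Ad nd ->]]].
    rewrite (_ : a / b * (c / d) = (a * c) / (b * d)); last by field; rewrite !nz.
    move=> /mzQ h; have /(QP a c Aa Ac)[Qa|Qc] : Q (a * c) by apply: h; [exact: subringM|exact: subringM|exact: nQM].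
      by left; exists a, b.
    by right; exists c, d.
move=> _ [a [b [Aa Ab nb ->]]] nm; exists b, a; split=> //; last by rewrite invf_div.
by move=> Qa; apply: nm; exists a, b.
Qed.

Lemma mz_sub Q : prime_in A Q -> Q `<=` mz Q.
Proof. by move=> [_ _ Q1 _] a Qa; exists a, 1; split; rewrite ?divr1 //; exact: subring1. Qed.

Lemma mz_in Q a : prime_in A Q -> A a -> mz Q a -> Q a.
Proof.
move=> pQ Aa [c [d [Qc Ad nd e']]]; have [QA Qm Q1 QP] := pQ.
have : Q (a * d) by rewrite e' divfK //; exact: prime_nz pQ nd.
by move=> /(QP a d Aa Ad)[].
Qed.

Lemma noeth_loc O : is_subring O -> loc A O -> noeth O.
Proof.
move=> Os [AO hO] I Im IO; have [I0 ID IZ] := Im.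
have [||s sI Is] := Anoe (I := I `&` A).
- split; first by split=> //; exact: subring0.
  + by move=> x y [Ix Ax] [Iy Ay]; split; [exact: ID|exact: subringD].
  + by move=> a x Aa [Ix Ax]; split; [apply: IZ => //; exact: AO|exact: subringM].
- by move=> x [].
exists s => [x /sI[]//|x Ix]; have [a [b [Aa Ab b0 Ob xE]]] := hO x (IO x Ix).
have Ia : I a.
  have -> : a = b *: (x : K^o) by rewrite xE /GRing.scale /= mulrC divfK.
  by apply: IZ => //; exact: AO.
have [c hc aE] := Is a (conj Ia Aa).
have -> : x = b^-1 *: (a : K^o) by rewrite xE mulrC.
case: (lspan_submod s Os) => _ _ spZ; apply: spZ => //.
by exists c => // i; exact: AO.
Qed.

Lemma der_scale c D : der k0 D -> der k0 (fun x => c * D x).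
Proof.
move=> dD; split=> [a b _ _|a b _ _|x kx]; first by rewrite (derD dD) mulrDr.
  by rewrite (derM dD); ring.
by rewrite (derk dD) // mulr0.
Qed.

(** A is finitely generated, so finitely many denominators outside Q have to be cleared. *)
Lemma stab_clear Q D : prime_in A Q -> der k0 D -> (forall a, A a -> locz A Q (D a)) ->
  exists d, [/\ A d, ~ Q d & stab A (fun x => d * D x)].
Proof.
move=> pQ dD AD; have [QA Qm Q1 QP] := pQ.
have [d [Ad nd hd]] : exists d, [/\ A d, ~ Q d & forall x, x \in z -> A (d * D x)].
  have : forall x, x \in z -> locz A Q (D x) by move=> x xz; apply: AD; exact: mem_adjs.
  elim: (z) => [|x s IH] hs; first by exists 1; split=> //; exact: subring1.
  have [d [Ad nd dt]] : exists d, [/\ A d, ~ Q d & forall x, x \in s -> A (d * D x)].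
    by apply: IH => y ys; apply: hs; rewrite inE ys orbT.
  have [a [b [Aa Ab nb xE]]] : locz A Q (D x) by apply: hs; rewrite inE eqxx.
  exists (d * b); split; [exact: subringM|by move=> /(QP d b Ad Ab)[]|move=> y].
  rewrite inE => /orP[/eqP->|/dt h]; last by rewrite mulrAC; exact: subringM.
  rewrite xE (_ : d * b * (a / b) = d * a); [exact: subringM|field; exact: prime_nz pQ nb].
by exists d; split=> //; apply: stab_gen => //; exact: der_scale.
Qed.

(** Choose D and b whose determinant has least t-order v. If v > 0, all determinants for this D
    vanish in the residue field, so a residual combination of the D_i vanishes on A. Its lift takes
    values in (t); divided by t, it is again in L and preserves the local ring. Exchanging it for
    one D_i lowers v. *)
Lemma jac_principal Q : prime_in A Q -> principal (locz A Q) (mz Q) ->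
  exists (D : 'I_n -> K -> K) (b : 'I_n -> K), [/\ forall i, Lst A (D i), forall j, A (b j) & ~ Q (\det (jac D b))].
Proof.
move=> pQ [t mt tP]; have lO := locz_local pQ; set O := locz A Q in lO tP *; set m := mz Q in lO mt tP *.
have [Os pm Oi] := lO; have [mO mm m1 mP] := pm; have AO : A `<=` O by exact: sub_locz.
have Onoe : noeth O by apply: noeth_loc => //; exact: loc_locz.
have detO (D : 'I_n -> K -> K) (b : 'I_n -> K) : (forall i, Lst O (D i)) -> (forall j, A (b j)) -> O (\det (jac D b)).
  by move=> LD Ab; apply: subring_det => // i j; rewrite mxE; apply: (LD i).2; exact: AO.
pose P v := `[< exists (D : 'I_n -> K -> K) (b : 'I_n -> K), [/\ forall i, Lst O (D i), forall j, A (b j) &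
  exists2 u, O u /\ ~ m u & \det (jac D b) = u * t ^+ v] >].
have [vv [DD [bb [LDD Abb [uu [Ouu nuu] dee] dd0]]]] : exists v (D : 'I_n -> K -> K) (b : 'I_n -> K),
    [/\ forall i, Lst O (D i), forall j, A (b j), exists2 u, O u /\ ~ m u & \det (jac D b) = u * t ^+ v
      & \det (jac D b) != 0].
  have [D [b [LD Ab d0]]] := jac_nonzero.
  have LD' i : Lst O (D i).
    split; first by case: (LD i).
    apply: (der_loc k0f _ Os (loc_locz As pQ)); first by apply: L_der; case: (LD i).
    by move=> a Aa; apply: AO; exact: (LD i).2.
  have [v [u [Ou nu e']]] := val_exists lO Onoe mt tP (detO _ _ LD' Ab) d0.
  by exists v, D, b; split=> //; exists u.
have exP : exists v, P v.
  by exists vv; apply/asboolP; exists DD, bb; split=> //; exists uu.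
case: (ex_minnP exP) => v /asboolP[D [b [LD Ab [u [Ou nu] de]]]] vmin.
case: v de vmin => [|v] de vmin.
  have /choice[d hd] : forall i, exists d, [/\ A d, ~ Q d & stab A (fun x => d * D i x)].
    move=> i; apply: stab_clear => //; first by apply: L_der; case: (LD i).
    by move=> a Aa; apply: (LD i).2; exact: AO.
  exists (fun i x => d i * D i x), b; split=> [i|//|].
    by split; [apply: L_scale; case: (LD i)|case: (hd i)].
  have -> : jac (fun i x => d i * D i x) b = diag_mx (\row_i d i) *m jac D b.
    by apply/matrixP => i j; rewrite mul_diag_mx !mxE.
  rewrite det_mulmx det_diag de expr0 mulr1 => h.
  have : m ((\prod_i (\row_i d i) 0 i) * u) by exact: mz_sub.
  move=> /mP[||h1|//] //.
    by apply: subring_prod => // i _; rewrite mxE; apply: AO; case: (hd i).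
  have nprod (r : seq 'I_n) : A (\prod_(i <- r) (\row_i d i) 0 i) /\ ~ Q (\prod_(i <- r) (\row_i d i) 0 i).
    elim: r => [|i r [IA IQ]]; first by rewrite big_nil; split; [exact: subring1|case: pQ].
    rewrite big_cons mxE; have [Ad nd _] := hd i; split; first exact: subringM.
    by case: pQ => _ _ _ h' /h'[].
  by have [Ap Np] := nprod (index_enum 'I_n); apply: Np; apply: mz_in.
exfalso; have [F [res [_ rM rsum rdet [_ r0 rs]]]] := residue_field lO.
have ODa i a : A a -> O (D i a) by move=> Aa; apply: (LD i).2; exact: AO.
pose V := [set w : 'rV[F]_n | exists2 a, A a & w = \row_i res (D i a)].
have [|w w0 hw] := @ann_vec F n V.
  move=> M VM; have /choice[c hc] : forall j, exists a, A a /\ row j M = \row_i res (D i a).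
    by move=> j; have [a Aa h] := VM j; exists a.
  have Ac j : A (c j) by case: (hc j).
  have -> : M = (map_mx res (jac D c))^T.
    by apply/matrixP => i j; rewrite !mxE; have /rowP/(_ j) := (hc i).2; rewrite !mxE.
  rewrite det_tr -rdet; last by move=> i j; rewrite mxE; exact: ODa.
  apply/r0; first exact: detO.
  apply: contrapT => nm; suff : P 0%N by move=> /vmin.
  apply/asboolP; exists D, c; split=> //; exists (\det (jac D c)); last by rewrite expr0 mulr1.
  by split=> //; exact: detO.
have /choice[w' hw'] : forall i, exists a, O a /\ res a = w i 0.
  by move=> i; have [a Oa h] := rs (w i 0); exists a.
(* A coordinate whose coefficient is a unit, so that the exchange removes exactly one factor t from
   the determinant. *)
have [i0 wi0] : exists i0, ~ m (w' i0).
  apply: contrapT => no; move/eqP: w0; apply; apply/matrixP => i j; rewrite ord1 mxE -(hw' i).2.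
  by apply/r0; [case: (hw' i)|apply: contrapT => h; apply: no; exists i].
have D'm a : A a -> m (\sum_i w' i * D i a).
  move=> Aa; apply/r0; first by apply: subring_sum => // i _; apply: subringM; [|case: (hw' i)|exact: ODa].
  rewrite rsum; last by move=> i; apply: subringM; [|case: (hw' i)|exact: ODa].
  have /matrixP/(_ 0 0) := hw _ (ex_intro2 _ _ a Aa erefl); rewrite !mxE => h.
  rewrite -[RHS]h; apply: eq_bigr => i _; rewrite mxE rM ?(hw' i).2; [by rewrite mulrC|by case: (hw' i)|exact: ODa].
(* If t were 0, a nonzero determinant could only have order 0, against v > 0. *)
have t0 : t != 0.
  apply/eqP => t0; move: dee dd0; rewrite t0; case: vv => [|vv] dee; last by rewrite dee expr0n mulr0 eqxx.
  move=> _; suff : P 0%N by move=> /vmin.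
  by apply/asboolP; exists DD, bb; split=> //; exists uu => //; rewrite dee expr0.
pose D2 x := \sum_i (t^-1 * w' i) * D i x.
have LD2 : L D2 by apply: L_comb => i; case: (LD i).
have D2E x : D2 x = t^-1 * \sum_i w' i * D i x.
  by rewrite mulr_sumr; apply: eq_bigr => i _; rewrite mulrA.
have SD2 : stab O D2.
  apply: (der_loc k0f (L_der LD2) Os (loc_locz As pQ)) => a Aa.
  by have [c Oc e2] := tP _ (D'm a Aa); rewrite D2E e2 mulKf.
pose D1 i := if i == i0 then D2 else D i.
suff : P v by move=> /vmin; rewrite ltnn.
apply/asboolP; exists D1, b; split=> [i|//|].
  by rewrite /D1; case: eqP => _; [split|].
exists (w' i0 * u).
  have Ow : O (w' i0) by case: (hw' i0).
  by split; [exact: subringM|move=> /(mP _ _ Ow Ou)[]].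
have cofE j : cofactor (jac D1 b) i0 j = cofactor (jac D b) i0 j.
  rewrite /cofactor; congr (_ * \det _); apply/matrixP => x y; rewrite !mxE /D1.
  by rewrite eq_sym (negPf (neq_lift _ _)).
rewrite (expand_det_row _ i0).
have -> : \sum_j jac D1 b i0 j * cofactor (jac D1 b) i0 j =
    t^-1 * \sum_i w' i * (jac D b *m \adj (jac D b)) i i0.
  rewrite [in RHS]mulr_sumr.
  under [RHS]eq_bigr do rewrite mxE !mulr_sumr.
  rewrite exchange_big; apply: eq_bigr => j _; rewrite cofE mxE /D1 eqxx /D2 mulr_suml.
  by apply: eq_bigr => i _; rewrite !mxE !mulrA.
rewrite mul_mx_adj (bigD1 i0) //= mxE eqxx mulr1n big1 ?addr0.
  by rewrite de exprS; field.
by move=> i /negPf ii; rewrite mxE ii mulr0n mulr0.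
Qed.

Definition idl (G : set K) : set K := [set x | forall I : set K, is_submod A (I : set K^o) -> G `<=` I -> I x].
Definition jacs : set K := [set x | exists (D : 'I_n -> K -> K) (b : 'I_n -> K),
  [/\ forall i, Lst A (D i), forall j, A (b j) & x = \det (jac D b)]].

Lemma idl_submod G : is_submod A (idl G : set K^o).
Proof.
split; first by move=> I [].
- by move=> x y hx hy I Im GI; case: (Im) => _ ID _; apply: ID; [exact: hx|exact: hy].
- by move=> a x Aa hx I Im GI; case: (Im) => _ _ IZ; apply: IZ => //; exact: hx.
Qed.

(** The derivative of a determinant splits into terms where a derivation E_i is replaced by the
    bracket of D and E_i, and terms where an argument b_j is replaced by D b_j. This is why L has to
    be closed under brackets. *)
Lemma jacs_stable D a : Lst A D -> idl jacs a -> idl jacs (D a).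
Proof.
move=> [LD SD]; have dD := L_der LD; have Nm := idl_submod jacs; have [N0 ND NZ] := Nm.
have NA : idl jacs `<=` A.
  move=> x; apply; first exact: subring_submod.
  by move=> _ [E [b [LE Ab ->]]]; apply: subring_det => // i j; rewrite mxE; exact: (LE i).2.
move=> Na; suff [//] : idl jacs a /\ idl jacs (D a).
apply: (Na [set x | idl jacs x /\ idl jacs (D x)]).
  split; first by split=> //; rewrite (der0 k0f dD).
  - by move=> x y [Nx NDx] [Ny NDy]; split; [exact: ND|rewrite (derD dD); exact: ND].
  - move=> c x Ac [Nx NDx]; split; first exact: NZ.
    rewrite /GRing.scale /= (derM dD); apply: ND; first exact: (NZ c).
    by rewrite mulrC; apply: (NZ (D c)) => //; exact: SD.
move=> _ [E [b [LE Ab ->]]]; split; first by move=> I Im; apply; exists E, b.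
have inN E' b' : (forall i, Lst A (E' i)) -> (forall j, A (b' j)) -> idl jacs (\det (jac E' b')).
  by move=> LE' Ab' I Im; apply; exists E', b'.
have -> : D (\det (jac E b)) = \sum_i \det (jac (fun l => if l == i then fun x => D (E i x) - E i (D x) else E l) b)
   + \sum_j \det (jac E (fun l => if l == j then D (b j) else b l)).
  rewrite (der_det k0f dD).
  have -> : \sum_i \sum_j D (jac E b i j) * cofactor (jac E b) i j =
     \sum_i \sum_j (D (E i (b j)) - E i (D (b j))) * cofactor (jac E b) i j +
     \sum_j \sum_i E i (D (b j)) * cofactor (jac E b) i j.
    rewrite [X in _ = _ + X]exchange_big -big_split; apply: eq_bigr => i _.
    rewrite -big_split; apply: eq_bigr => j _ /=; rewrite mxE; ring.
  congr (_ + _); apply: eq_bigr => i _.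
    rewrite (det_row_repl (M := jac E b) (i0 := i)); last first.
      by move=> l j /negPf li; rewrite !mxE li.
    by apply: eq_bigr => j _; rewrite !mxE eqxx.
  rewrite (det_col_repl (M := jac E b) (j0 := i)); last first.
    by move=> l j /negPf li; rewrite !mxE li.
  by apply: eq_bigr => j _; rewrite !mxE eqxx.
apply: ND; apply: (submod_sum (M := K^o) _ Nm) => i _; apply: inN => // l; case: eqP => // _.
  have [LEi SEi] := LE i; split; first exact: L_bracket.
  by move=> x Ax; apply: subringB => //; [apply/SD/SEi|apply/SEi/SD].
exact: SD.
Qed.

(** If all determinants were in p, a minimal prime of their ideal inside p would be stable, hence
    locally principal by hypothesis, against [jac_principal]. *)
Lemma jac_at p : prime_in A p ->
  (forall Q, prime_in A Q -> Q `<=` p -> (forall D, Lst A D -> forall a, Q a -> Q (D a)) ->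
     principal (locz A Q) (mz Q)) ->
  exists (D : 'I_n -> K -> K) (b : 'I_n -> K), [/\ forall i, Lst A (D i), forall j, A (b j) & ~ p (\det (jac D b))].
Proof.
move=> pp hQ; apply: contrapT => no.
have NA : idl jacs `<=` A.
  move=> x; apply; first exact: subring_submod.
  by move=> _ [E [b [LE Ab ->]]]; apply: subring_det => // i j; rewrite mxE; exact: (LE i).2.
have Np : idl jacs `<=` p.
  move=> x; apply; first by case: pp.
  by move=> _ [D [b [LD Ab ->]]]; apply: contrapT => np; apply: no; exists D, b.
have [Q [pQ NQ Qp Qmin]] := min_prime As Np pp.
have [D LD a Qa|D [b [LD Ab nQ]]] := jac_principal pQ (hQ Q pQ Qp _).
  apply: (min_prime_stable char0 k0f As kA (L_der LD.1) LD.2 NA (fun x => jacs_stable (a := x) LD) pQ NQ Qmin Qa).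
by apply: nQ; apply: NQ => I Im; apply; exists D, b.
Qed.

(** The Jacobian matrix has a determinant outside p, so it can be inverted over the local ring; its
    inverse turns the D_i into a family dual to the b_j. *)
Lemma dual_bases p : prime_in A p ->
  (forall Q, prime_in A Q -> Q `<=` p -> (forall D, Lst A D -> forall a, Q a -> Q (D a)) ->
     principal (locz A Q) (mz Q)) ->
  exists (D : 'I_n -> K -> K) (b : 'I_n -> K),
   [/\ forall i, Lst (locz A p) (D i), forall j, A (b j), forall i j, D i (b j) = (i == j)%:R
     & forall E, L E -> forall x, E x = \sum_j E (b j) * D j x].
Proof.
move=> pp hQ; have [D [b [LD Ab nd]]] := jac_at pp hQ.
have lO := locz_local pp; set O := locz A p in lO *; have [Os pm Oi] := lO.
have AO : A `<=` O by exact: sub_locz.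
set M := jac D b in nd; have MA i j : A (M i j) by rewrite mxE; exact: (LD i).2.
have Od : O (\det M)^-1.
  by exists 1, (\det M); split; [exact: subring1|exact: subring_det| |rewrite div1r].
have d0 : \det M != 0 by exact: (prime_nz pp).
have uM : M \in unitmx by rewrite unitmxE unitfE.
have OV i j : O (invmx M i j).
  rewrite /invmx uM !mxE; apply: subringM => //; apply: (subringM Os); first exact: (subring_sign Os).
  by apply: subring_det => // a c; rewrite !mxE; apply: AO; exact: (LD _).2.
pose D' i x := \sum_l invmx M i l * D l x.
have LD' i : L (D' i) by apply: L_comb => l; case: (LD l).
have D'b i j : D' i (b j) = (i == j)%:R.
  have /matrixP/(_ i j) := mulVmx uM; rewrite !mxE => <-.
  by apply: eq_bigr => l _; rewrite !mxE.
exists D', b; split=> // [i|E LE x].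
  split=> //; apply: (der_loc k0f (L_der (LD' i)) Os (loc_locz As pp)) => a Aa.
  by apply: subring_sum => // l _; apply: subringM => //; apply: AO; exact: (LD l).2.
have /choice[X hX] : forall i, exists c : 'I_n -> K, forall x, D' i x = \sum_l c l * e l x.
  by move=> i; exact: e_gen.
pose XM : 'M[K]_n := \matrix_(i, l) X i l.
have XB : XM *m jac e b = 1%:M.
  by apply/matrixP => i j; rewrite !mxE -D'b hX; apply: eq_bigr => l _; rewrite !mxE.
(* A one-sided inverse of a square matrix is two-sided; so the e_l are in turn combinations of the
   D'_i. *)
have BX := mulmx1C XB.
have eE l y : e l y = \sum_i jac e b l i * D' i y.
  have S l' : \sum_i jac e b l i * (X i l' * e l' y) = (l == l')%:R * e l' y.
    have /matrixP/(_ l l') := BX; rewrite mxE [RHS]mxE => <-; rewrite mulr_suml.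
    by apply: eq_bigr => i _; rewrite [XM i l']mxE mulrA.
  under eq_bigr do rewrite hX mulr_sumr.
  rewrite exchange_big /= (eq_bigr _ (fun l' _ => S l')) (bigD1 l) //= eqxx mul1r big1 ?addr0 //.
  by move=> l' /negPf l'l; rewrite eq_sym l'l mul0r.
have [c hc] := e_gen LE.
have EE y : E y = \sum_i (\sum_l c l * jac e b l i) * D' i y.
  rewrite hc; under eq_bigr do rewrite eE mulr_sumr.
  rewrite exchange_big; apply: eq_bigr => i _; rewrite mulr_suml; apply: eq_bigr => l _; ring.
rewrite [LHS]EE; apply: eq_bigr => j _; congr (_ * _).
rewrite [RHS]EE [RHS](bigD1 j) //= D'b eqxx mulr1 [X in _ = _ + X]big1 ?addr0 // => i /negPf ij.
by rewrite D'b ij mulr0.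
Qed.
End Lie.

(** * Regularity from dual bases of derivations *)

Section Regularity.
Context {K : fieldType}.
Hypothesis char0 : forall n, n.+1%:R != 0 :> K.
Variable k0 : set K.
Hypothesis k0f : subfield k0.
Variable z : seq K.
Hypothesis frA : forall x, fracs (adjs k0 z) x.
Variables (O m : set K).
Hypotheses (OL : localring O m) (On : noeth O) (AO : loc (adjs k0 z) O).
Variables (n : nat) (D : 'I_n -> K -> K) (b : 'I_n -> K).
Hypotheses (dD : forall i, der k0 (D i)) (DO : forall i a, O a -> O (D i a)).
Hypotheses (bO : forall i, O (b i)) (Db : forall i j, D i (b j) = (i == j)%:R).
Hypothesis D_gen : forall E, der k0 E -> forall x, E x = \sum_j E (b j) * D j x.

Let k0s : is_subring k0. Proof. exact: k0f.1. Qed.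
Let Os : is_subring O. Proof. by case: OL. Qed.
Let mP : prime_in O m. Proof. by case: OL. Qed.
Let mO : m `<=` O. Proof. by case: mP. Qed.
Let mm : is_submod O (m : set K^o). Proof. by case: mP. Qed.
Let kO : k0 `<=` O. Proof. by move=> c kc; apply: AO.1; exact: sub_adjs. Qed.
Let zO x : x \in z -> O x. Proof. by move=> zx; apply: AO.1; exact: mem_adjs. Qed.

Let bs := codom b.
Let R := adjs k0 bs.
Let Rs : is_subring R. Proof. exact: adjs_subring. Qed.
Let kR : k0 `<=` R. Proof. exact: sub_adjs. Qed.
Let bR i : R (b i). Proof. by apply: mem_adjs => //; exact: codom_f. Qed.
Let RO : R `<=` O. Proof. by apply: adjs_min => // x /codomP[i ->]. Qed.

(** A transcendental u would admit a derivation that kills all b_j but not u, against [D_gen]. *)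
Lemma algebraic_b u : ~ trans R u.
Proof.
move=> tr; have [E [dE Eb Eu]] := der_trans char0 k0f frA 1 tr.
have := D_gen dE u; rewrite Eu big1 => [/eqP|j _]; first by rewrite oner_eq0.
by rewrite Eb ?mul0r //; exact: codom_f.
Qed.

Lemma ntrans_poly (A : set K) u : ~ trans A u -> exists f : {poly K}, [/\ f != 0, polyin A f & f.[u] = 0].
Proof.
move=> ntr; apply: contrapT => nf; apply: ntr => f Af fu; apply: contrapT => f0.
by apply: nf; exists f; split=> //; exact/eqP.
Qed.

Section Nilpotent.
Variables (N : nat) (T : 'I_N -> K -> K).
Hypothesis dT : forall i, der k0 (T i).

(** Local nilpotency: all composites of d derivations among the T_i kill g. *)
Fixpoint nil d (g : K) : Prop := if d is d'.+1 then forall i, nil d' (T i g) else g = 0.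

Lemma nil0 d : nil d 0.
Proof. by elim: d => //= d IH i; rewrite (der0 k0f (dT i)). Qed.

Lemma nilD d g h : nil d g -> nil d h -> nil d (g + h).
Proof.
elim: d g h => [g h -> ->|d IH g h ng nh i] /=; first by rewrite addr0.
by rewrite (derD (dT i)); exact: IH.
Qed.

Lemma nilS d g : nil d g -> nil d.+1 g.
Proof. by elim: d g => [g -> i|d IH g ng i]; [exact: (nil0 1 i)|exact: IH]. Qed.

Lemma nil_le d e g : (d <= e)%N -> nil d g -> nil e g.
Proof. by move=> /subnK <-; elim: (e - d)%N => // k IH /IH; rewrite addSn; exact: nilS. Qed.

Lemma nilM d e g h : nil d g -> nil e h -> nil (d + e) (g * h).
Proof.
elim: d e g h => [e g h -> _|d IHd]; first by rewrite mul0r; exact: nil0.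
elim=> [g h _ ->|e IHe g h ng nh]; first by rewrite mulr0; exact: nil0.
move=> i; rewrite (derM (dT i)); apply: nilD; last first.
  by rewrite mulrC; apply: IHd => //; exact: ng.
by rewrite -addSnnS; apply: IHe => //; exact: nh.
Qed.

(** Elements with constant derivatives behave like coordinates, and polynomials in them die after
    finitely many differentiations. *)
Lemma nil_adjs s : (forall x, x \in s -> forall i, k0 (T i x)) -> forall g, adjs k0 s g -> exists d, nil d g.
Proof.
move=> Ts; apply: adjs_min => /=.
- split=> [|g h [d ng] [e nh]|g h [d ng] [e nh]].
  + by exists 1%N => i /=; rewrite (der1 k0f (dT i)).
  + exists (maxn d e.+1); apply: nilD; first by apply: nil_le ng; exact: leq_maxl.
    rewrite -mulN1r; apply: (@nil_le (1 + e)); first exact: leq_maxr.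
    by apply: nilM => // i /=; rewrite (derN k0f (dT i)) (der1 k0f (dT i)) oppr0.
  + by exists (d + e)%N; exact: nilM.
- by move=> c kc; exists 1%N => i /=; exact: (derk (dT i)).
- by move=> x sx; exists 2%N => i j /=; apply: (derk (dT j)); exact: Ts.
Qed.

(* Apply the derivations as long as the result is nonzero. *)
Lemma nil_descent (I : set K) d g : (forall i a, I a -> I (T i a)) -> nil d g -> I g -> g != 0 ->
  exists h, [/\ I h, h != 0 & forall i, T i h = 0].
Proof.
move=> IT; elim: d g => [g -> _ /eqP //|d IH g ng Ig g0].
have [h|none] := pselect (exists i, T i g != 0).
  by have [i Tg] := h; apply: (IH (T i g)); [exact: ng|exact: IT|].
by exists g; split=> // i; apply: contrapT => /eqP Tg; apply: none; exists i.
Qed.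

End Nilpotent.

(** An element killed by every derivation is algebraic over k0, so its inverse is a polynomial in it
    over k0. *)
Lemma der_const_unit g : g != 0 -> (forall E, der k0 E -> E g = 0) -> O g -> O g^-1.
Proof.
move=> g0 Eg Og.
have ntr : ~ trans (adjs k0 [::]) g.
  by move=> /(fun t => der_trans char0 k0f frA 1 t)[E [dE _ E1]]; move: (oner_neq0 K); rewrite -E1 (Eg _ dE) eqxx.
have [f [f0 kf fg]] := ntrans_poly ntr.
have [c [r [gc kr r0 gcr]]] := algebraic_inv k0s g0 f0 kf fg.
have Oc : O c by apply: adj_min gc => //.
have -> : g^-1 = c * r^-1 by apply: (mulfI g0); rewrite mulfV // mulrA gcr mulfV.
by apply: (subringM Os) => //; apply: kO; exact: k0f.2.
Qed.

(** Differential simplicity of O. A nonzero element of I has a nonzero multiple in k0[b]. There the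
    D_i act nilpotently, so descent ends at a nonzero constant of I, which is a unit of O. *)
Lemma der_simple (I : set K) a : is_submod O (I : set K^o) -> I `<=` O ->
  (forall i c, I c -> I (D i c)) -> I a -> a != 0 -> I 1.
Proof.
move=> Im IO ID Ia a0.
have [f [f0 kf fa]] := ntrans_poly (@algebraic_b a).
have [c [r [ac Rr r0 acr]]] := algebraic_inv Rs a0 f0 kf fa.
have Oc : O c by apply: adj_min ac => //; exact: IO.
have Ir : I r by rewrite -acr mulrC; exact: (submodM Im).
have [|d nr] := @nil_adjs n D dD bs _ r Rr.
  by move=> x /codomP[j ->] i; rewrite Db; exact: subring_nat.
have [h [Ih h0 hD]] := nil_descent ID nr Ir r0.
rewrite -(mulVf h0); apply: (submodM Im) => //; apply: der_const_unit => //; last exact: IO.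
by move=> E dE; rewrite (D_gen dE) big1 // => j _; rewrite hD mulr0.
Qed.

(** An O-module with a k0-derivation that kills the b_j. The action is a total function of K with
    laws on O only, which avoids turning O into a type. *)
Record omodder (E : zmodType) (act : K -> E -> E) (e : K -> E) : Prop := OModDer {
  act_addl : forall a c x, O a -> O c -> act (a + c) x = act a x + act c x;
  act_addr : forall a x y, O a -> act a (x + y) = act a x + act a y;
  act_mul : forall a c x, O a -> O c -> act (a * c) x = act a (act c x);
  act_one : forall x, act 1 x = x;
  md_add : forall u v, O u -> O v -> e (u + v) = e u + e v;
  md_mul : forall u v, O u -> O v -> e (u * v) = act u (e v) + act v (e u);
  md_k0 : forall c, k0 c -> e c = 0;
  md_b : forall j, e (b j) = 0 }.

(* The annihilator of the differentials of O over k0[b]. *)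
Definition dann : set K := [set c | O c /\
  forall (E : zmodType) (act : K -> E -> E) e, omodder act e -> forall u, O u -> act c (e u) = 0].

Section OModDer.
Variables (E : zmodType) (act : K -> E -> E) (e : K -> E).
Hypothesis H : omodder act e.

Lemma act_r0 a : O a -> act a 0 = 0.
Proof. by move=> Oa; apply: (addrI (act a 0)); rewrite -(act_addr H) // !addr0. Qed.

Lemma act_l0 x : act 0 x = 0.
Proof. by apply: (addrI (act 0 x)); rewrite -(act_addl H) ?addr0 //; exact: subring0. Qed.

Lemma act_rN a x : O a -> act a (- x) = - act a x.
Proof. by move=> Oa; apply/eqP; rewrite -addr_eq0 -(act_addr H) // addNr act_r0. Qed.

Lemma md_0 : e 0 = 0. Proof. by apply: (md_k0 H); exact: subring0. Qed.

Lemma md_sub u v : O u -> O v -> e (u - v) = e u - e v.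
Proof.
move=> Ou Ov; apply/eqP; rewrite eq_sym subr_eq -(md_add H) ?subrK //; exact: subringB.
Qed.

Lemma act_sub c : O c -> is_subring [set a | O a /\ act c (e a) = 0].
Proof.
move=> Oc; split=> [|u v [Ou eu] [Ov ev]|u v [Ou eu] [Ov ev]].
- by split; [exact: subring1|rewrite (md_k0 H) ?act_r0 //; exact: subring1].
- by split; [exact: subringB|rewrite md_sub // (act_addr H) // act_rN // eu ev subrr].
- split; first exact: subringM.
  rewrite (md_mul H) // (act_addr H) // -!(act_mul H) // mulrC [c * v]mulrC !(act_mul H) //.
  by rewrite eu ev !act_r0 // addr0.
Qed.

Lemma act_V c a : O c -> O a -> O a^-1 -> act c (e a) = 0 -> act c (e a^-1) = 0.
Proof.
move=> Oc Oa OV ca; have [->|a0] := eqVneq a 0; first by rewrite invr0 md_0 act_r0.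
have := md_mul H Oa OV; rewrite mulfV // (md_k0 H) ; last exact: subring1.
move=> /(congr1 (act (a^-1 * c))).
have OVc := subringM Os OV Oc.
rewrite (act_addr H) // act_r0 // -!(act_mul H) // ![_ * _ * a]mulrAC mulVf // mul1r.
by rewrite mulrAC (act_mul H) ?ca ?act_r0 ?addr0 //; exact: subringM.
Qed.

Lemma md_horner u (f : {poly K}) : O u -> polyin R f -> e f.[u] = act f^`().[u] (e u).
Proof.
move=> Ou; elim/poly_ind: f => [|f c IH Rf]; first by rewrite horner0 deriv0 horner0 act_l0 md_0.
have Rf' : polyin R f by move=> i; have := Rf i.+1; rewrite coefD coefMX coefC /= addr0.
have Rc : R c by have := Rf 0%N; rewrite coefD coefMX coefC /= add0r.
have hO (g : {poly K}) : polyin R g -> O g.[u] by move=> Rg; apply: polyin_horner Rg Ou.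
have dR : polyin R f^`() by move=> i; rewrite coef_deriv; apply: subring_mulrn.
have eR a : R a -> e a = 0.
  move=> Ra; suff [_] : [set a | O a /\ act 1 (e a) = 0] a by rewrite (act_one H).
  move: a Ra; apply: adjs_min => [|c' kc|x /codomP[j ->]].
  - by apply: act_sub; exact: subring1.
  - by split; [exact: kO|rewrite (md_k0 H) // act_r0 //; exact: subring1].
  - by split => //; rewrite (md_b H) act_r0 //; exact: subring1.
rewrite !hornerE derivD derivM derivX derivC !hornerE.
rewrite (md_add H) ?(md_mul H) //; [|exact: hO|by apply: subringM => //; exact: hO|exact: RO].
rewrite (eR _ Rc) addr0 IH // -(act_mul H) ?(act_addl H) //; try exact: hO; last first.
  by apply: subringM => //; exact: hO.
by rewrite addrC [u * _]mulrC.
Qed.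

End OModDer.

Lemma dann_submod : is_submod O (dann : set K^o).
Proof.
split=> [|x y [Ox ex] [Oy ey]|a x Oa [Ox ex]].
- by split=> [|E act e H u _]; [exact: subring0|rewrite (act_l0 H)].
- split=> [|E act e H u Ou]; first exact: subringD.
  by rewrite (act_addl H) // (ex _ _ _ H) // (ey _ _ _ H) // addr0.
- split=> [|E act e H u Ou]; first exact: subringM.
  by rewrite (act_mul H) // (ex _ _ _ H) // (act_r0 H).
Qed.

(* The derivation [D i] acts on differentials through the dual numbers [E * E]. *)
Lemma dann_stable i c : dann c -> dann (D i c).
Proof.
move=> [Oc ec]; split=> [|E act e H u Ou]; first exact: DO.
pose act2 (a : K) (x : E * E) : E * E := (act a x.1, act a x.2 + act (D i a) x.1).
pose e2 (v : K) : E * E := (e v, e (D i v)).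
have H2 : omodder act2 e2.
  have kD c' (kc : k0 c') : D i c' = 0 by rewrite (derk (dD i)).
  split.
  - move=> a d x Oa Od; rewrite /act2 (derD (dD i)) !(act_addl H) //; try exact: DO.
    by congr pair; rewrite /= addrACA.
  - move=> a x y Oa; rewrite /act2 !(act_addr H) //; last exact: DO.
    by congr pair; rewrite /= addrACA.
  - move=> a d x Oa Od; have := DO i Oa; have := DO i Od => OD1 OD2.
    rewrite /act2 (derM (dD i)) /= !(act_mul H) // (act_addr H) // (act_addl H) ?(act_mul H) //; try exact: subringM.
    by rewrite -!(act_mul H) // [d * _]mulrC addrA.
  - move=> [x y]; rewrite /act2 /= (der1 k0f (dD i)) (act_l0 H) !(act_one H) addr0 //.
  - by move=> v w Ov Ow; rewrite /e2 (derD (dD i)) !(md_add H) //; exact: DO.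
  - move=> v w Ov Ow; have := DO i Ov; have := DO i Ow => OD1 OD2.
    rewrite /e2 /act2 (derM (dD i)) (md_add H) ?(md_mul H) //; try exact: subringM.
    by congr pair; rewrite /= addrACA [RHS]addrACA; congr (_ + _); exact: addrC.
  - by move=> c' kc; rewrite /e2 kD // !(md_k0 H) //; exact: subring0.
  - move=> j; rewrite /e2 Db !(md_b H) (md_k0 H) //; exact: subring_nat.
have := ec _ _ _ H2 u Ou => /(congr1 snd) /=.
by rewrite (ec _ _ _ H _ (DO i Ou)) add0r.
Qed.

(** If q is a separable equation of u over k0[b], then q'(u) du = 0 in every such module. The
    product of these derivatives over the generators z is a nonzero element of the annihilator,
    which is stable under the D_i; differential simplicity yields 1. *)
Lemma dann1 : dann 1.
Proof.
have hp u : exists q : {poly K}, [/\ polyin R q, q.[u] = 0 & q^`().[u] != 0].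
  by have [q [Rq qu _ dq _]] := sep_poly char0 Rs (@algebraic_b u); exists q.
have [p pP] := choice hp.
have pO u : O u -> O (p u)^`().[u].
  move=> Ou; have [Rp _ _] := pP u; apply: polyin_horner RO _ Ou => // i.
  by rewrite coef_deriv; apply: subring_mulrn.
pose c := \prod_(u <- z) (p u)^`().[u].
have Oc : O c.
  by rewrite /c big_seq; apply: subring_prod => // u zu; apply: pO; exact: zO.
have c0 : c != 0 by rewrite prodf_seq_neq0; apply/allP => u _ /=; have [] := pP u.
apply: (der_simple dann_submod _ dann_stable) c0; first by move=> a [].
split=> // E act e H u Ou.
have hA : adjs k0 z `<=` [set a | O a /\ act c (e a) = 0].
  apply: adjs_min; [exact: (act_sub H)|by move=> a ka; split; [exact: kO|rewrite (md_k0 H) // (act_r0 H)]|].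
  move=> x zx; split; first exact: zO.
  have [Rp px _] := pP x; have := md_horner H (zO zx) Rp; rewrite px (md_0 H) => px0.
  rewrite /c (big_rem x) //= mulrC (act_mul H) -?px0 ?(act_r0 H) //; try exact: pO (zO zx).
  + by rewrite big_seq; apply: subring_prod => // y /mem_rem zy; apply: pO; exact: zO.
  + by rewrite big_seq; apply: subring_prod => // y /mem_rem zy; apply: pO; exact: zO.
have [a [d [Aa Ad d0 OV ->]]] := AO.2 u Ou.
have [Oa ca] := hA _ Aa; have [Od cd] := hA _ Ad.
have [_ _ Hm] := act_sub H Oc; apply: (Hm a d^-1 _ _).2 => //=.
by split=> //; exact: (act_V H).
Qed.

(** The square of the ideal m. *)
Definition m2 : set K := [set x | forall I : set K, is_submod O (I : set K^o) ->
  (forall a c, m a -> m c -> I (a * c)) -> I x].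

Lemma m2_submod : is_submod O (m2 : set K^o).
Proof.
split=> [I [] //|x y hx hy I Im h|a x Oa hx I Im h].
  by have [_ ID _] := Im; apply: ID; [exact: hx|exact: hy].
by apply: (submodM Im) => //; exact: hx.
Qed.

Lemma m2_mul a c : m a -> m c -> m2 (a * c).
Proof. by move=> ma mc I _; apply. Qed.

Lemma m2_sub : m2 `<=` m.
Proof. by move=> x; apply=> // a c ma mc; apply: (submodM mm) => //; exact: mO. Qed.

Lemma m2_subO : m2 `<=` O. Proof. by move=> x /m2_sub /mO. Qed.

Lemma m2B x y : m2 x -> m2 y -> m2 (x - y).
Proof. exact: (submodB Os m2_submod). Qed.

Lemma m2D x y : m2 x -> m2 y -> m2 (x + y).
Proof. by have [_ + _] := m2_submod; apply. Qed.

Lemma mB x y : m x -> m y -> m (x - y).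
Proof. exact: (submodB Os mm). Qed.

Lemma mD x y : m x -> m y -> m (x + y).
Proof. by have [_ + _] := mm; apply. Qed.

Lemma mM a x : O a -> m x -> m (a * x).
Proof. exact: submodM. Qed.

Lemma m_unit a : m a -> O a^-1 -> a = 0.
Proof.
move=> ma OV; apply: contrapT => /eqP a0; have [_ _ m1 _] := mP.
by apply: m1; rewrite -(mulVf a0); exact: mM.
Qed.

Lemma unitO a : O a -> ~ m a -> O a^-1.
Proof. by case: OL => _ _; apply. Qed.

Lemma poly_cong (f : {poly K}) u h : polyin O f -> O u -> m h -> m (f.[u + h] - f.[u]).
Proof.
move=> + Ou mh; elim/poly_ind: f => [_|f c IH Of]; first by rewrite !horner0 subrr; case: mm.
have Of' : polyin O f by move=> i; have := Of i.+1; rewrite coefD coefMX coefC /= addr0.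
rewrite !hornerE (_ : _ - _ = (u + h) * (f.[u + h] - f.[u]) + f.[u] * h); last by ring.
apply: mD; apply: mM => //; last by exact: polyin_horner Os _ Of' Ou.
  by apply: subringD => //; exact: mO.
exact: IH.
Qed.

Lemma poly_taylor (f : {poly K}) u h : polyin O f -> O u -> m h -> m2 (f.[u + h] - f.[u] - f^`().[u] * h).
Proof.
move=> + Ou mh; elim/poly_ind: f => [_|f c IH Of].
  by rewrite deriv0 !horner0 mul0r !subrr; case: m2_submod.
have Of' : polyin O f by move=> i; have := Of i.+1; rewrite coefD coefMX coefC /= addr0.
rewrite derivD derivM derivX derivC !hornerE.
rewrite (_ : _ - _ = (u + h) * (f.[u + h] - f.[u] - f^`().[u] * h) + f^`().[u] * (h * h)); last by ring.
apply: m2D; apply: (submodM m2_submod); last exact: m2_mul.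
- by apply: subringD => //; exact: mO.
- exact: IH.
- by apply: (polyin_horner Os (@subset_refl _ O)) => // i; rewrite coef_deriv; apply: subring_mulrn.
Qed.

(** S meets m only inside m^2, so its image modulo m^2 is a candidate for a coefficient field;
    Zorn's lemma makes it as large as possible. *)
Lemma coef_ring_max : exists S, [/\ is_subring S, S `<=` O, k0 `<=` S, forall a, S a -> m a -> m2 a &
  forall T, is_subring T -> S `<=` T -> T `<=` O -> (forall a, T a -> m a -> m2 a) -> T = S].
Proof.
pose ok S := [/\ is_subring S, S `<=` O & forall a, S a -> m a -> m2 a].
have ok0 : ok k0.
  split=> // a ka ma; have -> : a = 0 by apply: m_unit => //; apply: kO; exact: k0f.2.
  by case: m2_submod.
pose OK S := ok (S `|` k0).
have [F FP Ftot|S [okS Smax]] := @Zorn_bigcup K OK.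
  have [[S1 FS1]|none] := pselect (exists C, F C); last first.
    rewrite /OK (_ : _ `|` _ = k0) //; apply/seteqP; split=> [x [[C FC _]|//]|x]; last by right.
    by case: none; exists C.
  rewrite /OK; set U := _ `|` k0.
  have UE x y : U x -> U y -> exists2 C, F C & (C `|` k0) x /\ (C `|` k0) y.
    have UE1 w : U w -> exists2 C, F C & (C `|` k0) w.
      by move=> [[C FC Cx]|h]; [exists C => //; left|exists S1 => //; right].
    move=> /UE1[C FC Cx] /UE1[C' FC' Cy]; have [h|h] := Ftot _ _ FC FC'.
      by exists C' => //; split=> //; case: Cx => [/h|]; [left|right].
    by exists C => //; split=> //; case: Cy => [/h|]; [left|right].
  have inU C x : F C -> (C `|` k0) x -> U x by move=> FC [Cx|]; [left; exists C|right].
  split=> [|x Ux|a Ua].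
  - split=> [|a c Ua Uc|a c Ua Uc]; first by right; exact: subring1.
      have [C FC [Ca Cc]] := UE _ _ Ua Uc; have [Cs _ _] := FP _ FC.
      by apply: (inU C) => //; exact: subringB.
    have [C FC [Ca Cc]] := UE _ _ Ua Uc; have [Cs _ _] := FP _ FC.
    by apply: (inU C) => //; exact: subringM.
  - by have [C FC [Ca _]] := UE _ _ Ux Ux; have [_ + _] := FP _ FC; apply.
  - by have [C FC [Ca _]] := UE _ _ Ua Ua; have [_ _ +] := FP _ FC; apply.
exists (S `|` k0); have [Ss SO Sm] := okS; split; [exact: Ss|exact: SO|by move=> x kx; right|exact: Sm|].
move=> T Ts ST TO Tm; have kT : k0 `<=` T by move=> x kx; apply: ST; right.
apply: contrapT => ne; apply: (Smax T); last first.
  by rewrite /OK (_ : _ `|` _ = T) //; apply/seteqP; split=> [x []//|x]; [exact: kT|left].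
split; first by move=> x Sx; apply: ST; left.
move=> TS; apply: ne; apply/seteqP; split=> // x /TS; by left.
Qed.

(** Maximality makes S surject onto the residue field. For u in O, either S[u] still qualifies, or
    the residue of u is a simple root of a polynomial over S, and one Newton step moves u to an
    element that can be adjoined. *)
Lemma coef_ring : exists S, [/\ is_subring S, S `<=` O, k0 `<=` S, forall a, S a -> m a -> m2 a &
  forall u, O u -> exists2 s, S s & m (u - s)].
Proof.
have [S [Ss SO kS Sm Smax]] := coef_ring_max; exists S; split=> //.
have m20 : m2 0 by case: m2_submod.
have Sunit s : S s -> ~ m s -> S s^-1.
  move=> Ss1 nms.
  have nX i : ~ m (s ^+ i) by move=> h; apply: nms; exact: (prime_inX Os mP (SO _ Ss1)) h.
  have s0 : s != 0 by apply/eqP => s0; apply: nms; rewrite s0; case: mm.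
  have OV : O s^-1 by apply: unitO => //; exact: SO.
  pose T := [set x | exists a i, S a /\ x = a * s^-1 ^+ i].
  have V1 i : s ^+ i * s^-1 ^+ i = 1 by rewrite exprVn mulfV // expf_neq0.
  suff <- : T = S by exists 1, 1%N; split; [exact: subring1|rewrite mul1r expr1].
  apply: Smax => [|x Sx|x [a [i [Sa ->]]]|x [a [i [Sa ->]]] ma].
  - split=> [|x y [a [i [Sa ->]]] [c [j [Sc ->]]]|x y [a [i [Sa ->]]] [c [j [Sc ->]]]].
    + by exists 1, 0%N; split; [exact: subring1|rewrite expr0 mulr1].
    + exists (a * s ^+ j - c * s ^+ i), (i + j)%N; split.
        by apply: subringB => //; apply: subringM => //; exact: subringX.
      by rewrite exprD mulrBl !mulrA mulrAC -(mulrA a) V1 mulr1 -[c * _ * _]mulrA V1 mulr1.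
    + by exists (a * c), (i + j)%N; split; [exact: subringM|rewrite exprD mulrACA].
  - by exists x, 0%N; rewrite expr0 mulr1.
  - by apply: subringM => //; [exact: SO|exact: subringX].
  - rewrite mulrC; apply: (submodM m2_submod); first exact: subringX.
    apply: Sm => //; rewrite -[a]mulr1 -(V1 i) mulrCA; apply: mM => //.
    by apply: subringX => //; exact: SO.
have m2S : m2 `<=` S.
  pose T := [set x | exists s y, [/\ S s, m2 y & x = s + y]].
  suff <- : T = S by move=> x hx; exists 0, x; split=> //; [exact: subring0|rewrite add0r].
  apply: Smax => [|x Sx|x [s [y [hs hy ->]]]|x [s [y [hs hy ->]]] ms].
  - split=> [|x y [s [x' [hs hx ->]]] [t [y' [ht hy ->]]]|x y [s [x' [hs hx ->]]] [t [y' [ht hy ->]]]].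
    + by exists 1, 0; split; [exact: subring1| |rewrite addr0].
    + exists (s - t), (x' - y'); split; [exact: subringB|exact: m2B|by rewrite opprD addrACA].
    + exists (s * t), (s * y' + (t + y') * x'); split; [exact: subringM| |by ring].
      by apply: m2D; apply: (submodM m2_submod) => //; [exact: SO|apply: subringD => //; [exact: SO|exact: m2_subO]].
  - by exists x, 0; rewrite addr0.
  - by apply: subringD => //; [exact: SO|exact: m2_subO].
  - apply: m2D => //; apply: Sm => //; rewrite -(addrK y s); apply: mB => //; exact: m2_sub.
(* A bad polynomial is a nontrivial algebraic equation for the residue of u over the residues of
   S. *)
move=> u Ou; pose bad (f : {poly K}) := [/\ polyin S f, m f.[u] & ~ polyin m f].
have [ex|none] := pselect (exists f, bad f); last first.
  suff Su : S u by exists u => //; rewrite subrr; case: mm.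
  suff <- : adj S u = S by exact: mem_adj.
  apply: Smax => [|||x [f Sf <-] mf]; [exact: adj_subring|exact: sub_adj|exact: adj_min|].
  have mf' : polyin m f by apply: contrapT => nf; apply: none; exists f.
  rewrite horner_coef; apply: (submod_sum _ m2_submod) => i _ /=; rewrite mulrC.
  by apply: (submodM m2_submod); [exact: subringX|apply: Sm].
have exN : exists N, `[< exists2 f, bad f & size f = N >].
  by have [f hf] := ex; exists (size f); apply/asboolP; exists f.
case: (ex_minnP exN) => N /asboolP[f [Sf mf nf] fN] Nmin.
have fmin (g : {poly K}) : polyin S g -> m g.[u] -> (size g < size f)%N -> polyin m g.
  move=> Sg mg lt; apply: contrapT => ng; move: lt; rewrite fN ltnNge => /negP; apply.
  by apply: Nmin; apply/asboolP; exists g.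
have f0 : f != 0 by apply/eqP => f0; apply: nf; rewrite f0 => i; rewrite coef0; case: mm.
have Slead : S (lead_coef f) by exact: Sf.
have OS (g : {poly K}) : polyin S g -> polyin O g by exact: polyin_sub.
have nlead : ~ m (lead_coef f).
  move=> mlead; apply: nf; set g := f - lead_coef f *: 'X^((size f).-1).
  have Sg : polyin S g.
    move=> i; rewrite coefB coefZ coefXn; apply: subringB => //; apply: subringM => //; exact: subring_nat.
  have sg : (size g < size f)%N.
    rewrite -[X in (_ < X)%N](prednK (n := size f)) ?lt0n ?size_poly_eq0 // ltnS; apply/leq_sizeP => i.
    rewrite leq_eqVlt => /orP[/eqP <-|lt]; first by rewrite coefB coefZ coefXn eqxx mulr1 subrr.
    rewrite coefB coefZ coefXn gtn_eqF // mulr0 subr0 nth_default //.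
    by move: lt; case: (size f).
  have mg : polyin m g.
    apply: fmin => //; rewrite hornerD hornerN hornerZ hornerXn mulrC; apply: mB => //.
    by apply: mM => //; exact: subringX.
  move=> i; rewrite -(subrK (lead_coef f *: 'X^((size f).-1)) f) -/g coefD coefZ coefXn mulrC.
  by apply: mD => //; apply: mM => //; exact: subring_nat.
have sf : (1 < size f)%N.
  rewrite ltnNge; apply/negP => /size1_polyC fc; apply: nlead.
  by move: mf; rewrite fc lead_coefC hornerC.
(* Separability: if f'(u) were in m, then by minimality of f all coefficients of f' would be in m,
   among them a nonzero integer times the leading coefficient of f. *)
have nd : ~ m f^`().[u].
  move=> md; have md' : polyin m f^`().
    by apply: fmin => //; [move=> i; rewrite coef_deriv; exact: subring_mulrn|exact: lt_size_deriv].
  have := md' (size f).-2; rewrite coef_deriv.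
  have -> : (size f).-2.+1 = (size f).-1 by case: (size f) sf => [|[]].
  rewrite -lead_coefE -mulr_natl => h; apply: nlead.
  have [_ _ _ mpr] := mP; have [||/m_unit c0|//] := mpr _ _ _ _ h; [exact: subring_nat|exact: SO|].
  have nk i : k0 i%:R by exact: subring_nat.
  have := c0 (kO (k0f.2 _ (nk _))) => /eqP.
  by case: (size f) sf => [|[|q]] // _; rewrite (negPf (char0 q)).
have Of' : O f^`().[u].
  by apply: polyin_horner SO _ Ou => // i; rewrite coef_deriv; exact: subring_mulrn.
have OV := unitO Of' nd.
(* Newton's correction; by Taylor's formula, f(u + h) lies in m^2. *)
pose h := - (f.[u] / f^`().[u]).
have mh : m h by rewrite /h mulrC; apply: (submodN Os mm); apply: mM.
have Oh : O h by exact: mO.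
have d0 : f^`().[u] != 0 by apply/eqP => h0; apply: nd; rewrite h0; case: mm.
have fw : m2 f.[u + h].
  have := poly_taylor (OS _ Sf) Ou mh; rewrite /h mulrN [_ * (_ / _)]mulrC divfK // opprK => hh.
  by move: hh; rewrite addrNK.
have Ow : O (u + h) by exact: subringD.
have Sw : S (u + h).
  suff <- : adj S (u + h) = S by exact: mem_adj.
  apply: Smax => [|||x [g Sg <-] mg]; [exact: adj_subring|exact: sub_adj|exact: adj_min|].
  have [q [g' [Sq Sg' gE sg']]] := polyin_divmod Ss (Sunit _ Slead nlead) Sf Sg f0.
  have mg' : polyin m g'.
    apply: fmin => //; rewrite -(subKr g'.[u + h] g'.[u]); apply: mB; last exact: poly_cong (OS _ Sg') Ou mh.
    rewrite (_ : g'.[u + h] = (q * f + g').[u + h] - q.[u + h] * f.[u + h]); last first.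
      by rewrite hornerD hornerM addrAC subrr add0r.
    apply: mB; first by rewrite -gE.
    by apply: mM; [exact: polyin_horner SO Sq Ow|exact: m2_sub].
  rewrite gE hornerD hornerM; apply: m2D.
    by apply: (submodM m2_submod) => //; exact: polyin_horner SO Sq Ow.
  rewrite horner_coef; apply: (submod_sum _ m2_submod) => i _ /=; rewrite mulrC.
  by apply: (submodM m2_submod); [exact: subringX|apply: Sm; [exact: Sg'|exact: mg']].
exists (u + h) => //; rewrite opprD addNKr; exact: (submodN Os mm).
Qed.

(** A lift s of residues to S makes u - s(u) a derivation of O into O/m^2. Subtracting its values on
    the b_j times the D_j leaves a derivation that kills the b_j, which is 0 by [dann1]. If all D_i
    a are in m, this says that a - s(a) is in m^2; and s(a) is in m, hence in m^2. *)
Lemma m2_crit a : m a -> (forall i, m (D i a)) -> m2 a.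
Proof.
move=> ma mD'; have [S [Ss SO kS Sm Sc]] := coef_ring.
have [m20 m2d m2s] := m2_submod.
pose I : set (subr_of Os) := [set x | m2 (\val x)].
have Ii : is_ideal I.
  split.
  - by suff : m2 (\val (0 : subr_of Os)) by []; rewrite rmorph0.
  - move=> x y mx my; suff : m2 (\val (x + y)) by []; rewrite rmorphD; exact: m2D.
  - move=> x y my; suff : m2 (\val (x * y)) by [].
    by rewrite rmorphM; apply: (submodM m2_submod) => //; exact: subr_valP.
have I1 : ~ I 1.
  move=> h; have : m2 (\val (1 : subr_of Os)) by []; rewrite rmorph1 => /m2_sub.
  by case: mP.
have [Q [f [fI _]]] := quotient_ring Ii I1.
pose q x := f (tosub Os x).
have qB x y : O x -> O y -> q (x - y) = q x - q y by move=> Ox Oy; rewrite /q tosubB // rmorphB.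
have qM x y : O x -> O y -> q (x * y) = q x * q y by move=> Ox Oy; rewrite /q tosubM // rmorphM.
have q1 : q 1 = 1 by rewrite /q tosub1 rmorph1.
have q0 x : O x -> (q x = 0 <-> m2 x) by move=> Ox; rewrite /q fI /I /= tosubK.
have qD x y : O x -> O y -> q (x + y) = q x + q y.
  move=> Ox Oy; rewrite -[y in LHS]opprK qB //; last exact: subringN.
  rewrite -[- y]sub0r qB //; last exact: subring0.
  have -> : q 0 = 0 by apply/q0 => //; exact: subring0.
  by rewrite sub0r opprK.
have qE x y : O x -> O y -> m2 (x - y) -> q x = q y.
  by move=> Ox Oy /q0 h; apply/eqP; rewrite -subr_eq0 -qB // h //; exact: subringB.
have hS u : exists s, O u -> S s /\ m (u - s).
  have [/Sc[s Ss' ms]|nO] := pselect (O u); first by exists s.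
  by exists 0.
have [s sP] := choice hS.
have sS u : O u -> S (s u) by case/sP.
have sO u : O u -> O (s u) by move=> /sS /SO.
have sm u : O u -> m (u - s u) by case/sP.
have uO u : O u -> O (u - s u) by move=> Ou; exact: mO (sm u Ou).
pose e u := q (u - s u).
pose e' u := e u - \sum_i q (D i u) * e (b i).
have sE x y : S x -> S y -> m (x - y) -> m2 (x - y) by move=> Sx Sy; apply: Sm; exact: subringB.
have eD u v : O u -> O v -> e (u + v) = e u + e v.
  move=> Ou Ov; have Ouv := subringD Os Ou Ov; rewrite /e -qD //; [|exact: uO|exact: uO].
  apply: qE; [exact: uO|by apply: subringD => //; exact: uO|].
  rewrite (_ : _ - _ = (s u + s v) - s (u + v)); last by ring.
  apply: sE; [by apply: subringD => //; exact: sS|exact: sS|].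
  rewrite (_ : _ - _ = (u + v - s (u + v)) - ((u - s u) + (v - s v))); last by ring.
  by apply: mB; [exact: sm|apply: mD; exact: sm].
have eM u v : O u -> O v -> e (u * v) = q u * e v + q v * e u.
  move=> Ou Ov; have Ouv := subringM Os Ou Ov; rewrite /e -!qM -?qD //; try exact: uO; try by apply: subringM => //; exact: uO.
  apply: qE; [exact: uO|by apply: subringD => //; apply: subringM => //; exact: uO|].
  rewrite (_ : _ - _ = (s u * s v - s (u * v)) - (u - s u) * (v - s v)); last by ring.
  apply: m2B; last by apply: m2_mul; exact: sm.
  apply: sE; [by apply: subringM => //; exact: sS|exact: sS|].
  rewrite (_ : _ - _ = (u * v - s (u * v)) - (u * (v - s v) + s v * (u - s u))); last by ring.
  by apply: mB; [exact: sm|apply: mD; apply: mM => //; [exact: sm|exact: sO|exact: sm]].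
have ek c : k0 c -> e c = 0.
  move=> kc; have Oc := kO kc; apply/q0; first exact: uO.
  by apply: sE; [exact: kS|exact: sS|exact: sm].
have H : @omodder Q (fun c x => q c * x) e'.
  split.
  - by move=> x y w Ox Oy; rewrite qD // mulrDl.
  - by move=> x y w Ox; rewrite mulrDr.
  - by move=> x y w Ox Oy; rewrite qM // mulrA.
  - by move=> x; rewrite q1 mul1r.
  - move=> u v Ou Ov; rewrite /e' eD // addrACA -opprD -big_split /=; congr (_ - _).
    by apply: eq_bigr => i _; rewrite (derD (dD i)) qD ?mulrDl //; exact: DO.
  - move=> u v Ou Ov; rewrite /e' eM // !mulrBr addrACA -opprD !mulr_sumr -big_split /=; congr (_ - _).
    apply: eq_bigr => i _; rewrite (derM (dD i)) qD ?qM //; [by ring|..]; try exact: DO.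
      by apply: subringM => //; exact: DO.
    by apply: subringM => //; exact: DO.
  - move=> c kc; rewrite /e' ek // sub0r big1 ?oppr0 // => i _.
    by rewrite (derk (dD i)) // (_ : q 0 = 0) ?mul0r //; apply/q0 => //; exact: subring0.
  - move=> j; rewrite /e' (bigD1 j) //= Db eqxx q1 mul1r big1 ?addr0 ?subrr // => i ij.
    by rewrite Db (negPf ij) (_ : q 0 = 0) ?mul0r //; apply/q0 => //; exact: subring0.
have Oa := mO ma.
have := dann1.2 _ _ _ H a Oa; rewrite q1 mul1r /e' => /eqP; rewrite subr_eq0 big1 => [/eqP /q0 h|i _]; last first.
  by rewrite /e -qM; [apply/q0; [apply: subringM|apply: m2_mul] => //; [exact: DO|exact: uO|exact: sm]|exact: DO|exact: uO].
rewrite -(subrK (s a) a); apply: m2D; first by apply: h; exact: uO.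
by apply: Sm; [exact: sS|rewrite -(subKr a (s a)); apply: mB => //; exact: sm].
Qed.

(** The matrix 1 - C is invertible because C has its entries in m; its adjugate expresses the
    generators of m through elements of N. *)
Lemma nakayama (N : set K) : is_submod O (N : set K^o) ->
  (forall a, m a -> exists2 y, N y & m2 (a - y)) -> m `<=` N.
Proof.
move=> Nm mN; have [s sm ms] := On mm mO.
pose I : set K := [set x | exists c : nat -> K, (forall i, m (c i)) /\ x = \sum_(i < size s) c i * s`_i].
have m0 : m 0 by case: mm.
have Im : is_submod O (I : set K^o).
  split=> [|x y [c [mc ->]] [d [md ->]]|w x Ow [c [mc ->]]].
  - by exists (fun=> 0); split=> //; rewrite big1 // => i _; rewrite mul0r.
  - exists (fun i => c i + d i); split=> [i|]; first exact: mD.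
    by rewrite -big_split /=; apply: eq_bigr => i _; rewrite mulrDl.
  - exists (fun i => w * c i); split=> [i|]; first exact: mM.
    by rewrite [LHS]mulr_sumr; apply: eq_bigr => i _; rewrite mulrA.
have m2I : m2 `<=` I.
  move=> x; apply=> // a w ma /ms[c Oc ->]; exists (fun i => a * c i); split=> [i|].
    by rewrite mulrC; exact: mM.
  by rewrite mulr_sumr; apply: eq_bigr => i _; rewrite mulrA.
pose l := size s.
have hC (i : 'I_l) : exists yc : K * (nat -> K), [/\ N yc.1, forall j, m (yc.2 j) & s`_i - yc.1 = \sum_(j < l) yc.2 j * s`_j].
  have [y Ny /m2I[c [mc e]]] := mN _ (sm _ (mem_nth 0 (ltn_ord i))).
  by exists (y, c).
have [yc ycP] := choice hC.
pose C : 'M[K]_l := \matrix_(i, j) (yc i).2 j.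
pose M := 1%:M - C.
have OM i j : O (M i j).
  rewrite !mxE; apply: subringB => //; first exact: subring_nat.
  by apply: mO; have [_ + _] := ycP i; apply.
have [_ _ m1 _] := mP.
have ndet : ~ m (\det M).
  move=> md; apply: m1; rewrite -(det1 K l) -(subrK (\det M) (\det 1%:M)); apply: mD => //.
  apply: (det_cong Os mm mO) => // i j; rewrite !mxE; first exact: subring_nat.
  by rewrite opprB addrC subrK; have [_ + _] := ycP i; apply.
have OdV : O (\det M)^-1 by apply: unitO => //; exact: subring_det.
have d0 : \det M != 0 by apply/eqP => d0; apply: ndet; rewrite d0.
pose v : 'cV[K]_l := \col_j s`_j; pose y : 'cV[K]_l := \col_k (yc k).1.
have Mv : M *m v = y.
  apply/colP => k; rewrite mulmxBl mul1mx !mxE; have [_ _ h] := ycP k.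
  rewrite -[RHS](subKr s`_k) h; congr (_ - _); apply: eq_bigr => j _; by rewrite !mxE.
have sE (i : 'I_l) : s`_i = (\det M)^-1 * \sum_k \adj M i k * (yc k).1.
  have := congr1 (fun w : 'cV_l => w i 0) (congr1 (mulmx (\adj M)) Mv).
  rewrite mulmxA mul_adj_mx mul_scalar_mx !mxE => h.
  apply: (mulfI d0); rewrite mulrA mulfV // mul1r h; apply: eq_bigr => k _; by rewrite !mxE.
move=> a /ms; apply: (lspan_min Nm) => x xs; have xi : (index x s < l)%N by rewrite index_mem.
rewrite -(nth_index 0 xs) (sE (Ordinal xi)); apply: (submodM Nm) => //.
apply: (submod_sum _ Nm) => k _; apply: (submodM Nm); last by have [] := ycP k.
rewrite mxE /cofactor; apply: subringM => //; first exact: subring_sign.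
by apply: subring_det => // p q; rewrite !mxE; have := OM (lift k p) (lift (Ordinal xi) q); rewrite !mxE.
Qed.

(** Linear algebra that separates the derivations transversal to the maximal ideal, read off M',
    from those tangent to it, read off the kernel Z. *)
Lemma split_rank (F : fieldType) r N (M : 'M[F]_(r, N)) : row_free M ->
  exists (M' : 'M[F]_(N, r)) q (Z : 'M[F]_(N, q)) (f : 'I_q -> 'I_N),
  [/\ M *m M' = 1%:M, M *m Z = 0, forall i j, Z (f i) j = (i == j)%:R & (r + q)%N = N].
Proof.
move=> Mf; exists (pinvmx M), (\rank (cokermx M)).
pose C := col_base (cokermx M); have Cf : row_full C := col_base_full _.
exists (C *m invmx (rowsub (fullrankfun Cf) C)), (fullrankfun Cf).
have MC : M *m C = 0.
  apply: (row_free_inj (row_base_free (cokermx M))); rewrite /= -mulmxA mulmx_base mulmx_coker mul0mx.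
  by [].
split; first exact: mulmxVp.
- by rewrite mulmxA MC mul0mx.
- move=> i j; have := fullrowsub_unit Cf => /mulmxV /matrixP /(_ i j).
  rewrite !mxE => <-; apply: eq_bigr => k _; by rewrite !mxE.
- by rewrite mxrank_coker (eqP Mf) subnKC // -(eqP Mf) rank_leq_col.
Qed.

(** The matrix of the T_i(y_j) is congruent to 1 modulo m, hence invertible over O; its inverse
    corrects T without losing any stable ideal. *)
Lemma dualize N (T : 'I_N -> K -> K) (y : 'I_N -> K) :
  (forall i, der k0 (T i)) -> (forall i a, O a -> O (T i a)) -> (forall j, O (y j)) ->
  (forall i j, m (T i (y j) - (i == j)%:R)) ->
  exists T' : 'I_N -> K -> K, [/\ forall i, der k0 (T' i), forall i j, T' i (y j) = (i == j)%:R &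
   forall I : set K, is_submod O (I : set K^o) -> (forall i a, I a -> I (T i a)) -> forall i a, I a -> I (T' i a)].
Proof.
move=> dT OT Oy hT; pose M : 'M[K]_N := \matrix_(i, j) T i (y j).
have OM i j : O (M i j) by rewrite mxE; exact: OT.
have [_ _ m1 _] := mP.
have ndet : ~ m (\det M).
  move=> md; apply: m1; rewrite -(det1 K N) -(subrK (\det M) (\det 1%:M)); apply: mD => //.
  apply: (det_cong Os mm mO) => // i j; rewrite !mxE; first exact: subring_nat.
  by rewrite -opprB; apply: (submodN Os mm).
have OdV : O (\det M)^-1 by apply: unitO => //; exact: subring_det.
have d0 : \det M != 0 by apply/eqP => d0; apply: ndet; rewrite d0; case: mm.
have Oadj i k : O ((\det M)^-1 * \adj M i k).
  apply: subringM => //; rewrite mxE /cofactor; apply: subringM => //; first exact: subring_sign.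
  by apply: subring_det => // p q; have := OM (lift k p) (lift i q); rewrite !mxE.
exists (fun i a => \sum_k (\det M)^-1 * \adj M i k * T k a); split.
- move=> i; split=> [u v _ _|u v _ _|c kc].
  + by rewrite -big_split; apply: eq_bigr => k _; rewrite (derD (dT k)) mulrDr.
  + rewrite !mulr_sumr -big_split; apply: eq_bigr => k _ /=; rewrite (derM (dT k)); ring.
  + by rewrite big1 // => k _; rewrite (derk (dT k)) // mulr0.
- move=> i j; have := mul_adj_mx M => /matrixP /(_ i j); rewrite !mxE => h.
  apply: (mulfI d0); rewrite mulr_sumr; transitivity (\sum_k \adj M i k * M k j).
    by apply: eq_bigr => k _; rewrite !mxE !mulrA mulfV // mul1r.
  by rewrite h mulr_natr.
- move=> I Im IT i a Ia; apply: (submod_sum _ Im) => k _; apply: (submodM Im) => //; exact: IT.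
Qed.

(** s is the rank over the residue field of the vectors (D_i a) for a in m. By [m2_crit], s elements
    that realise this rank generate m modulo m^2, and Nakayama's lemma applies. The orthogonal
    directions give the derivations U that preserve m. *)
Lemma regular_params : exists s q (x : 'I_s -> K) (T : 'I_s -> K -> K) (y : 'I_q -> K) (U : 'I_q -> K -> K),
  [/\ (s + q)%N = n, (forall i, m (x i)) /\ m `<=` lspan O (codom x : seq K^o),
   [/\ forall i, der k0 (T i), forall i a, O a -> O (T i a) & forall i j, T i (x j) = (i == j)%:R] &
   [/\ forall j, O (y j), forall i, der k0 (U i), forall i a, O a -> O (U i a), forall i a, m a -> m (U i a)
     & forall i j, U i (y j) = (i == j)%:R]].
Proof.
have [F [res [rB rM rsum _ [r1 r0 rs]]]] := residue_field OL.
have [lift [liftO liftK]] : exists lift : F -> K, (forall c, O (lift c)) /\ forall c, res (lift c) = c.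
  have h c : exists a, O a /\ res a = c by have [a] := rs c; exists a.
  by have [l hl] := choice h; exists l; split=> c; have [] := hl c.
have res0 : res 0 = 0 by apply/r0; [exact: subring0|case: mm].
have rnat (i : bool) : res i%:R = i%:R by case: i.
pose rD' a : 'rV[F]_n := \row_i res (D i a).
pose V := [set rD' a | a in m].
have [s [M [Mf MV Vm]]] := max_rows V.
have hx i : exists a, m a /\ rD' a = row i M by have [a ma e] := MV i; exists a.
have [x xP] := choice hx.
have xm i : m (x i) by have [] := xP i.
have ME i j : M i j = res (D j (x i)) by have [_ /rowP /(_ j)] := xP i; rewrite !mxE.
have mx : m `<=` lspan O (codom x : seq K^o).
  apply: nakayama; first exact: lspan_submod.
  move=> a ma; have /submxP[c ec] : (rD' a <= M)%MS by apply: Vm; exists a.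
  have xs j : lspan O (codom x : seq K^o) (x j) by apply: mem_lspan => //; exact: codom_f.
  exists (\sum_j lift (c 0 j) * x j).
    apply: (submod_sum _ (lspan_submod _ Os)) => j _; apply: (submodM (lspan_submod _ Os)) => //.
  apply: m2_crit => [|i].
    by apply: mB => //; apply: (submod_sum _ mm) => j _; exact: mM.
  rewrite (derB k0f (dD i)) (der_sum k0f (dD i)).
  rewrite (eq_bigr (fun j => lift (c 0 j) * D i (x j) + D i (lift (c 0 j)) * x j)); last first.
    by move=> j _; rewrite (derM (dD i)) [x j * _]mulrC.
  rewrite big_split opprD addrA; apply: mB; last first.
    by apply: (submod_sum _ mm) => j _; apply: mM => //; exact: DO.
  have Ol : O (\sum_j lift (c 0 j) * D i (x j)).
    by apply: subring_sum => // j _; apply: subringM => //; apply: DO; exact: mO.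
  have ODa : O (D i a) by apply: DO; exact: mO.
  apply/r0; first exact: subringB.
  rewrite rB // rsum => [|j]; last by apply: subringM => //; apply: DO; exact: mO.
  have := congr1 (fun w : 'rV_n => w 0 i) ec; rewrite !mxE => ->.
  apply/eqP; rewrite subr_eq0; apply/eqP; apply: eq_bigr => j _.
  by rewrite ME rM ?liftK //; apply: DO; exact: mO.
have [M' [q [Z [f [MM' MZ Zf sq]]]]] := split_rank Mf.
pose T0 (l : 'I_s) a := \sum_i lift (M' i l) * D i a.
pose U0 (l : 'I_q) a := \sum_i lift (Z i l) * D i a.
have der_comb N (W : 'M[F]_(n, N)) l : der k0 (fun a => \sum_i lift (W i l) * D i a).
  split=> [u v _ _|u v _ _|c kc].
  + by rewrite -big_split; apply: eq_bigr => k _; rewrite (derD (dD k)) mulrDr.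
  + rewrite !mulr_sumr -big_split; apply: eq_bigr => k _ /=; rewrite (derM (dD k)); ring.
  + by rewrite big1 // => k _; rewrite (derk (dD k)) // mulr0.
have O_comb N (W : 'M[F]_(n, N)) l a : O a -> O (\sum_i lift (W i l) * D i a).
  by move=> Oa; apply: subring_sum => // i _; apply: subringM => //; exact: DO.
have res_comb N (W : 'M[F]_(n, N)) l a : O a -> res (\sum_i lift (W i l) * D i a) = \sum_i W i l * res (D i a).
  move=> Oa; rewrite rsum => [|i]; last by apply: subringM => //; exact: DO.
  by apply: eq_bigr => i _; rewrite rM ?liftK //; exact: DO.
have xO j : O (x j) by exact: mO.
have [|||i j|T [dT TE TI]] := @dualize s T0 x _ _ _ _.
- by move=> i; exact: der_comb.
- by move=> i; exact: O_comb.
- by [].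
- have OT := O_comb _ M' i _ (xO j).
  apply/r0; first by apply: subringB => //; exact: subring_nat.
  rewrite rB //; last exact: subring_nat.
  rewrite rnat /T0 res_comb //; have := congr1 (fun W : 'M_s => W j i) MM'.
  rewrite !mxE eq_sym => <-; apply/eqP; rewrite subr_eq0; apply/eqP.
  by apply: eq_bigr => k _; rewrite ME mulrC.
have Um i a : m a -> m (U0 i a).
  have dU0 : der k0 (U0 i) by exact: der_comb.
  move=> /mx; have mU : is_submod O ([set a | m a /\ m (U0 i a)] : set K^o).
    split=> [|u v [mu mu'] [mv mv']|w u Ow [mu mu']].
    - by rewrite /= (der0 k0f dU0); case: mm.
    - by split; [exact: mD|rewrite (derD dU0); exact: mD].
    - split; first exact: mM.
      rewrite [m _](_ : _ = m (w * U0 i u + u * U0 i w)); last by rewrite -(derM dU0).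
      by apply: mD; [exact: mM|rewrite mulrC; apply: mM => //; exact: O_comb].
  move=> h; suff [] : [set a | m a /\ m (U0 i a)] a by [].
  move: a h; apply: (lspan_min mU) => w /codomP[j ->] /=; split=> //.
  apply/r0; first exact: O_comb.
  rewrite res_comb //; have := congr1 (fun W : 'M_(s, q) => W j i) MZ.
  rewrite !mxE => h; rewrite -[RHS]h; apply: eq_bigr => k _; by rewrite ME mulrC.
have [|||i j|U [dU UE UI]] := @dualize q U0 (fun j => b (f j)) _ _ _ _.
- by move=> i; exact: der_comb.
- by move=> i; exact: O_comb.
- by [].
- have OT := O_comb _ Z i _ (bO (f j)).
  apply/r0; first by apply: subringB => //; exact: subring_nat.
  rewrite rB //; last exact: subring_nat.
  rewrite rnat /U0 res_comb //; apply/eqP; rewrite subr_eq0; apply/eqP.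
  rewrite (bigD1 (f j)) //= Db eqxx -Zf (_ : res 1 = 1) // big1 ?addr0 ?mulr1; last first.
    by move=> k kj; rewrite Db (negPf kj) res0 mulr0.
  by rewrite !Zf eq_sym.
have OO : is_submod O (O : set K^o) by exact: subring_submod.
exists s, q, x, T, (fun j => b (f j)), U; split=> //.
- by split=> // i; apply: TI => // j; exact: O_comb.
- by split=> // i a; [apply: UI => // j; exact: O_comb|apply: UI].
Qed.

(** Taking cores of m for T_0, T_1, ... in turn gives ever smaller primes: the core for T_l still
    contains the x_j with j > l, but not x_l, which T_l sends to 1. *)
Lemma chain_lower s (x : 'I_s -> K) (T : 'I_s -> K -> K) : (forall i, m (x i)) ->
  (forall i, der k0 (T i)) -> (forall i a, O a -> O (T i a)) -> (forall i j, T i (x j) = (i == j)%:R) ->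
  chain_in O s.
Proof.
move=> mx dT OT Tx.
(* [insub] turns the index into an ordinal below s; beyond s the sequence is constant. *)
pose P := fix P i := if i is j.+1 then (if insub j is Some l then core O (T l) (P j) else P j) else m.
have hP (i : 'I_s) : P i.+1 = core O (T i) (P i) by rewrite /= valK.
have Pp i : prime_in O (P i).
  elim: i => [//|i IH] /=; case: insubP => [l _ _|//].
  exact: (core_prime char0 k0f Os kO (dT l) (OT l)).
have Px i (j : 'I_s) : (i <= j)%N -> P i (x j).
  elim: i => [_|i IH ij] /=; first exact: mx.
  case: insubP => [l _ li|_]; last by apply: IH; exact: ltnW.
  split=> [|k]; first exact: mO.
  case: k => [|k]; first by apply: IH; exact: ltnW.
  have -> : iter k.+1 (T l) (x j) = 0.
    rewrite iterSr Tx -val_eqE li ltn_eqF //=; elim: k => //= k ->.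
    exact: (der0 k0f (dT l)).
  exact: prime_in0 (Pp i).
exists (fun i => P (s - i)%N); split=> [i _|i il]; first exact: Pp.
have lt : (s - i.+1 < s)%N by rewrite ltn_subrL /=; exact: leq_ltn_trans il.
pose l := Ordinal lt; have e : (s - i = l.+1)%N by rewrite /= subnSK.
rewrite e hP; split; first by move=> a [_ /(_ 0%N)].
move=> h; have := h (x l) (Px _ _ (leqnn _)) => -[_ /(_ 1%N)] /=.
by rewrite Tx eqxx; have [_ _ + _] := Pp (s - i.+1)%N; apply.
Qed.

(** If f(v) is in P', its constant term lies in P and in S, hence is 0. A factor v can then be
    cancelled, because v is not in P'. *)
Lemma drop_prime (S P P' : set K) v : is_subring S -> S `<=` O -> prime_in O P -> prime_in O P' ->
  P' `<=` P -> (forall a, S a -> P a -> a = 0) -> P v -> ~ P' v ->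
  forall f : {poly K}, polyin S f -> f != 0 -> ~ P' f.[v].
Proof.
move=> Ss SO [PO Pm _ _] [P'O P'm _ P'p] P'P SP Pv nP'v; have Ov := PO _ Pv.
elim/poly_ind => [|f c IH Sf nz]; first by rewrite eqxx.
have Sf' : polyin S f by move=> i; have := Sf i.+1; rewrite coefD coefMX coefC /= addr0.
have Sc : S c by have := Sf 0%N; rewrite coefD coefMX coefC /= add0r.
have Ofv : O f.[v] by exact: polyin_horner SO Sf' Ov.
rewrite !hornerE => h; have c0 : c = 0.
  apply: SP => //; rewrite -(addKr (f.[v] * v) c) addrC; apply: (submodB Os Pm); first exact: P'P.
  exact: (submodM Pm).
move: h nz; rewrite c0 addr0 => /(P'p _ _ Ofv Ov) [h|//] nz; apply: (IH Sf') h.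
by apply: contra nz => /eqP ->; rewrite mul0r add0r polyC0.
Qed.

Lemma trans_der s E u : der k0 E -> (forall x, x \in s -> E x = 0) -> E u != 0 -> trans (adjs k0 s) u.
Proof.
move=> dE E0 Eu; apply: contrapT => ntr; have Ss : is_subring (adjs k0 s) by exact: adjs_subring.
have [p [Sp pu _ dp _]] := sep_poly char0 Ss ntr.
have Es : adjs k0 s `<=` [set a | E a = 0].
  apply: adjs_min => [|c kc|x sx]; [|by rewrite /= (derk dE)|exact: E0].
  split=> [|a c|a c] /=; first by rewrite (der1 k0f dE).
    by rewrite (derB k0f dE) => -> ->; rewrite subrr.
  by rewrite (derM dE) => -> ->; rewrite !mulr0 addr0.
have Ts : is_subring (setT : set K) by split.
have h := der_on_horner k0f Ts dE (fun i => I : setT p`_i) (I : setT u) (erefl (E u)).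
move: h; rewrite pu (der0 k0f dE) (_ : \poly_(_ < _) _ = 0) ?horner0 ?add0r => [/esym /eqP|].
  by rewrite mulf_eq0 (negPf dp) (negPf Eu).
by apply/polyP => i; rewrite coef_poly coef0; case: ifP => // _; apply: Es.
Qed.

(** Derivations adapted to the sequence give a triangular matrix of full rank, and each of them is a
    combination of the n derivations D_l. *)
Lemma seqtr_size s : seqtr k0 s -> (size s <= n)%N.
Proof.
move=> trs; set q := size s.
have hE (i : 'I_q) : exists E, [/\ der k0 E, forall x, x \in take i s -> E x = 0 & E s`_i = 1].
  exact: (der_trans char0 k0f frA 1 (trs i (ltn_ord i))).
have [E EP] := choice hE.
pose M : 'M[K]_q := \matrix_(i, j) E i s`_j.
have M1 : \det M = 1.
  rewrite -det_tr det_trig; last first.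
    apply/is_trig_mxP => i j ij; rewrite !mxE; have [_ + _] := EP j; apply.
    rewrite -(nth_take 0 ij); apply: mem_nth; rewrite size_take ltn_ord //.
  by apply: big1 => i _; rewrite !mxE; have [] := EP i.
have rM : \rank M = q by apply: mxrank_unit; rewrite unitmxE M1 unitr1.
rewrite -rM (_ : M = (\matrix_(i, l) E i (b l)) *m (\matrix_(l, j) D l s`_j)).
  by apply: leq_trans (mxrankM_maxl _ _) _; exact: rank_leq_col.
apply/matrixP => i j; rewrite !mxE; have [dE _ _] := EP i.
by rewrite (D_gen dE); apply: eq_bigr => l _; rewrite !mxE.
Qed.

(** The y_j are algebraically independent and k0[y] meets m in 0. Each strict inclusion in a chain
    of primes adds an algebraically independent element by [drop_prime], and s + 1 of them would
    exceed the bound n = s + q. *)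
Lemma no_chain s q (y : 'I_q -> K) (U : 'I_q -> K -> K) : (s + q)%N = n -> (forall j, O (y j)) ->
  (forall i, der k0 (U i)) -> (forall i a, O a -> O (U i a)) -> (forall i a, m a -> m (U i a)) ->
  (forall i j, U i (y j) = (i == j)%:R) -> ~ chain_in O s.+1.
Proof.
move=> sq Oy dU UO Um Uy [P [Pp Plt]].
pose t0 := codom y.
have t0O x : x \in t0 -> O x by move=> /codomP[j ->].
have Us : is_subring (adjs k0 t0) by exact: adjs_subring.
have kU : k0 `<=` adjs k0 t0 by exact: sub_adjs.
have t0U i a : adjs k0 t0 a -> adjs k0 t0 (U i a).
  apply: (der_adjs k0f (dU i)) => // [c kc|x /codomP[j ->]].
    by rewrite (derk (dU i)) //; exact: subring0.
  split; first by apply: mem_adjs => //; exact: codom_f.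
  by rewrite Uy; exact: subring_nat.
(* The U_i preserve m and act nilpotently on k0[y], so a nonzero element of both would lead to a
   nonzero constant in m, although such constants are units. *)
have t0m a : adjs k0 t0 a -> m a -> a = 0.
  move=> Sa ma; apply: contrapT => /eqP a0.
  have [|d na] := @nil_adjs q U dU t0 _ a Sa.
    by move=> x /codomP[j ->] i; rewrite Uy; exact: subring_nat.
  have [||h [[Sh mh] h0 hU]] := @nil_descent q U [set a | adjs k0 t0 a /\ m a] d a _ na _ a0.
    by move=> i c [Sc mc]; split; [exact: t0U|exact: Um].
    by [].
  have /eqP := h0; apply; apply: m_unit => //; apply: der_const_unit => //; last exact: mO.
  move=> E dE.
  pose E' := fun x => E x - \sum_j E (y j) * U j x.
  have E'0 : adjs k0 t0 `<=` [set x | E' x = 0].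
    apply: adjs_min => [|c kc|x /codomP[j ->]].
    - split=> [|x w|x w] /=; rewrite /E'.
      + by rewrite (der1 k0f dE) big1 ?subrr // => j _; rewrite (der1 k0f (dU j)) mulr0.
      + move=> /eqP; rewrite subr_eq0 => /eqP e1 /eqP; rewrite subr_eq0 => /eqP e2.
        rewrite (derB k0f dE) e1 e2 -sumrB; apply/eqP; rewrite subr_eq0; apply/eqP; apply: eq_bigr => j _.
        by rewrite (derB k0f (dU j)) mulrBr.
      + move=> /eqP; rewrite subr_eq0 => /eqP e1 /eqP; rewrite subr_eq0 => /eqP e2.
        rewrite (derM dE) e1 e2 !mulr_sumr -big_split; apply/eqP; rewrite subr_eq0; apply/eqP; apply: eq_bigr => j _ /=.
        by rewrite (derM (dU j)); ring.
    - rewrite /= /E' (derk dE) // big1 ?subrr // => j _; by rewrite (derk (dU j)) ?mulr0.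
    - rewrite /= /E' (bigD1 j) //= Uy eqxx mulr1 big1 ?addr0 ?subrr // => l lj.
      by rewrite Uy (negPf lj) mulr0.
  have := E'0 _ Sh; rewrite /= /E' big1 ?subr0 // => j _; by rewrite hU mulr0.
have st0 : size t0 = q by rewrite size_codom card_ord.
have tr0 : seqtr k0 t0.
  move=> i; rewrite st0 => iq; have nthE k (kq : (k < q)%N) : t0`_k = y (Ordinal kq).
    rewrite /t0 /codom /image_mem (nth_map (Ordinal kq)) ?size_enum_ord //; congr y.
    by apply: val_inj; rewrite /= nth_enum_ord.
  rewrite nthE; apply: (trans_der (dU (Ordinal iq))); last by rewrite Uy eqxx oner_eq0.
  move=> x /(nthP 0)[k]; rewrite size_take st0 iq => ki <-; rewrite nth_take // (nthE _ (ltn_trans ki iq)).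
  by rewrite Uy -val_eqE /= gtn_eqF.
have Pm i : (i <= s.+1)%N -> P i `<=` m.
  move=> /Pp [PO PM P1 _] a Pa; apply: contrapT => nm; have OV := unitO (PO _ Pa) nm; have [a0|a0] := eqVneq a 0.
    by apply: nm; rewrite a0; case: mm.
  by apply: P1; rewrite -(mulVf a0); exact: (submodM PM).
have key i : (i <= s.+1)%N -> exists t, [/\ size t = (q + i)%N, seqtr k0 t, forall x, x \in t -> O x
    & forall a, adjs k0 t a -> P (s.+1 - i)%N a -> a = 0].
  elim: i => [_|i IH il].
    exists t0; split=> //; first by rewrite addn0.
    by rewrite subn0 => a Sa Pa; apply: t0m => //; exact: Pm Pa.
  have [t [st trt tO tP]] := IH (ltnW il).
  have e : (s.+1 - i = (s.+1 - i.+1).+1)%N by rewrite subnSK.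
  have lt : (s.+1 - i.+1 < s.+1)%N by rewrite ltn_subrL.
  have [P'P nPP'] := Plt _ lt; rewrite -e in P'P nPP'.
  have [v Pv nv] : exists2 v, P (s.+1 - i)%N v & ~ P (s.+1 - i.+1)%N v.
    by apply: contrapT => no; apply: nPP' => v Pv; apply: contrapT => nv; apply: no; exists v.
  have Ss : is_subring (adjs k0 t) by exact: adjs_subring.
  have SO : adjs k0 t `<=` O by exact: adjs_min.
  have pP := Pp _ (leq_subr i s.+1); have pP' := Pp _ (leq_subr i.+1 s.+1).
  have Ov : O v by have [+ _ _ _] := pP; apply.
  exists (rcons t v); split; [by rewrite size_rcons st addnS| | |].
  - apply/seqtr_rcons; split=> // f Sf fv; apply: contrapT => /eqP f0.
    by apply: (drop_prime Ss SO pP pP' P'P tP Pv nv Sf f0); rewrite fv; exact: prime_in0 pP'.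
  - by move=> x; rewrite mem_rcons in_cons => /orP[/eqP ->|/tO].
  - move=> a; rewrite adjs_rcons => -[f Sf <-] Pf; have [->|f0] := eqVneq f 0; first by rewrite horner0.
    by case: (drop_prime Ss SO pP pP' P'P tP Pv nv Sf f0).
have [t [st trt _ _]] := key _ (leqnn _).
have := seqtr_size trt; rewrite st -sq addnC leq_add2r ltnn //.
Qed.

Theorem regular_local : exists s (x : 'I_s -> K), [/\ chain_in O s, ~ chain_in O s.+1, forall i, m (x i)
  & forall a, m a -> exists c : 'I_s -> K, (forall i, O (c i)) /\ a = \sum_i c i * x i].
Proof.
have [s [q [x [T [y [U [sq [mx xm] [dT OT Tx] [Oy dU OU mU Uy]]]]]]]] := regular_params.
exists s, x; split=> //; [exact: chain_lower Tx|exact: no_chain Uy|].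
move=> a /xm; have Im : is_submod O ([set a | exists c : 'I_s -> K, (forall i, O (c i)) /\ a = \sum_i c i * x i] : set K^o).
  split=> [|u v [c [Oc ->]] [d [Od ->]]|w u Ow [c [Oc ->]]].
  - by exists (fun=> 0); split=> [_|]; [exact: subring0|rewrite big1 // => i _; rewrite mul0r].
  - exists (fun i => c i + d i); split=> [i|]; first exact: subringD.
    by rewrite -big_split /=; apply: eq_bigr => i _; rewrite mulrDl.
  - exists (fun i => w * c i); split=> [i|]; first exact: subringM.
    by rewrite [LHS]mulr_sumr; apply: eq_bigr => i _; rewrite mulrA.
apply: (lspan_min Im) => w /codomP[j ->]; exists (fun i => (i == j)%:R); split=> [i|]; first exact: subring_nat.
by rewrite (bigD1 j) //= eqxx mul1r big1 ?addr0 // => i /negPf ->; rewrite mul0r.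
Qed.
End Regularity.

(** * Topologies from a base, germs, charts and spectra *)

Section BaseTopology.
Variables (T : Type) (base : set (set T)).
Hypothesis baseP : base setT /\ forall A B, base A -> base B -> base (A `&` B).

(** The alias carries the base axioms as a parameter, so that the topology can be attached to it. *)
Definition bspace_ (_ : base setT /\ forall A B, base A -> base B -> base (A `&` B)) := T.
Definition bspace := bspace_ baseP.
HB.instance Definition _ := gen_eqMixin bspace.
HB.instance Definition _ := gen_choiceMixin bspace.

Definition bopen : set (set bspace) := [set V | forall x, V x -> exists B, [/\ base B, B x & B `<=` V]].

Lemma bopenT : bopen setT. Proof. by move=> x _; exists setT; split=> //; exact: baseP.1. Qed.

Lemma bopenI : setI_closed bopen.
Proof.
move=> V W oV oW x [/oV[A [bA Ax AV]] /oW[B [bB Bx BW]]]; exists (A `&` B); split=> //.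
  exact: baseP.2.
by move=> y [/AV Vy /BW Wy].
Qed.

Lemma bopen_bigU (I : Type) (f : I -> set bspace) : (forall i, bopen (f i)) -> bopen (\bigcup_i f i).
Proof. by move=> of_ x [i _ fx]; have [B [bB Bx BW]] := of_ i x fx; exists B; split=> // y /BW fy; exists i. Qed.

HB.instance Definition _ := isOpenTopological.Build bspace bopenT bopenI bopen_bigU.

Lemma bopenE (V : set bspace) : open V <-> bopen V. Proof. by []. Qed.

Lemma base_open (B : set bspace) : base B -> open B.
Proof. by move=> bB; apply/bopenE => x Bx; exists B; split. Qed.
End BaseTopology.

Section Germs.
Context {X : ringed_space}.

Lemma germ_eq (U V : set X) s t x : open U -> open V -> U x -> V x -> sec U s -> sec V t -> s x = t x ->
  exists W, [/\ open W, W x, W `<=` U `&` V & forall y, W y -> s y = t y].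
Proof.
move=> oU oV Ux Vx Us Vt e; have oUV := openI oU oV.
have Us' : sec (U `&` V) s by apply: (sec_restrict oU oUV) Us => y [].
have Vt' : sec (U `&` V) t by apply: (sec_restrict oV oUV) Vt => y [].
have e0 : s x - t x = 0 by rewrite e subrr.
have [W [oW Wx W0]] := sec_germ0 oUV (conj Ux Vx) (sec_sub oUV Us' Vt') e0.
exists (W `&` (U `&` V)); split=> //; [exact: openI|].
by move=> y [Wy _]; apply/eqP; rewrite -subr_eq0; apply/eqP; exact: W0.
Qed.

Lemma unit_near (U : set X) s x : open U -> U x -> sec U s -> s x \is a GRing.unit ->
  exists V, [/\ open V, V x, V `<=` U & forall y, V y -> s y \is a GRing.unit].
Proof.
move=> oU Ux Us us; have [V [t [oV Vx Vt tx]]] := sec_germ (s x)^-1.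
have oUV := openI oU oV.
have Us' : sec (U `&` V) s by apply: (sec_restrict oU oUV) Us => y [].
have Vt' : sec (U `&` V) t by apply: (sec_restrict oV oUV) Vt => y [].
have [|W [oW Wx WUV st]] := germ_eq oUV oUV (conj Ux Vx) (conj Ux Vx) (sec_mul oUV Us' Vt') (sec_one oUV).
  by rewrite tx mulrV.
exists W; split=> // [y /WUV [[]]//|y Wy].
by apply/unitrPr; exists (t y); exact: st.
Qed.

Section Chart.
Variables (U : set X) (A : comNzRingType) (rho : forall x : X, A -> stalk x).
Hypothesis ch : affine_chart U rho.

Lemma chart0 x : U x -> rho x 0 = 0.
Proof. by move=> Ux; rewrite -(subrr 0) (chart_sub ch) // subrr. Qed.

Lemma chartN x a : U x -> rho x (- a) = - rho x a.
Proof. by move=> Ux; rewrite -sub0r (chart_sub ch) // chart0 // sub0r. Qed.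

Lemma chartD x a b : U x -> rho x (a + b) = rho x a + rho x b.
Proof. by move=> Ux; rewrite -[b]opprK (chart_sub ch) // chartN // !opprK. Qed.

Lemma chart_point x y : U x -> U y ->
  (forall a, rho x a \is a GRing.unit <-> rho y a \is a GRing.unit) -> x = y.
Proof.
move=> Ux Uy h; have [w [_ wu]] := chart_points ch (chart_prime ch Ux).
rewrite -(wu x) ?(wu y) //; split=> //; apply/seteqP; split=> a /= na; apply: contra na; by move/h.
Qed.
End Chart.
End Germs.

(** Agreement on the functions of the chart already forces equality of points: stalk maps are local,
    so f(t) and g(t) invert the same functions. All other germs are fractions. *)
Lemma chart_mor_eq (T X : scheme) (f g : morphism T X) (U : set X) (A : comNzRingType)
    (rho : forall x : X, A -> stalk x) : affine_chart U rho ->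
  (forall t, U (f t)) -> (forall t, U (g t)) ->
  (forall t a, mor_stalk f t (rho (f t) a) = mor_stalk g t (rho (g t) a)) -> mor_eq f g.
Proof.
move=> ch Uf Ug fg.
have fE t : f t = g t.
  apply: (chart_point ch) => // a; split=> u.
    by apply: (@mor_local _ _ g t); rewrite -fg; exact: rmorph_unit.
  by apply: (@mor_local _ _ f t); rewrite fg; exact: rmorph_unit.
split=> // s t; have [a [d [ud sE]]] := chart_frac ch (s (f t)) (Uf t).
have sE' x : f t = x -> rho x d \is a GRing.unit /\ s x = rho x a / rho x d by move=> <-.
have [ud' sE''] := sE' _ (fE t).
by rewrite /pull sE sE'' !rmorphM !rmorphV // !fg.
Qed.

Lemma subr_div (R : comUnitRingType) (x y u v : R) : u \is a GRing.unit -> v \is a GRing.unit ->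
  x / u - y / v = (x * v - y * u) / (u * v).
Proof.
move=> uu uv; rewrite mulrBl invrM // mulrA mulrK //; congr (_ - _).
by rewrite [v^-1 * _]mulrC mulrA mulrK.
Qed.

Section Spec.
Variable W : comNzRingType.

Definition spt := {P : set W | is_prime P}.
Definition spD (a : W) : set spt := [set P | ~ sval P a].

Lemma sp_base : (range spD) setT /\ forall A B, (range spD) A -> (range spD) B -> (range spD) (A `&` B).
Proof.
split; first by exists 1 => //; apply/seteqP; split=> // P _; case: (svalP P).
move=> _ _ [a _ <-] [b _ <-]; exists (a * b) => //; apply/seteqP; split=> P /=.
  have [[P0 PD PM] _ _] := svalP P.
  by move=> nab; split=> h; apply: nab; [rewrite mulrC|]; exact: PM.
by have [_ _ Pp] := svalP P; move=> [na nb] /Pp[].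
Qed.

Definition sptop := bspace sp_base.
Implicit Types (P : sptop) (U V : set sptop).

Definition slocT P : comUnitRingType := locT (svalP (P : spt)).
Definition tol P (a : W) : slocT P := toloc (svalP (P : spt)) a.

Lemma tol_unit P a : tol P a \is a GRing.unit <-> ~ sval P a.
Proof. exact: toloc_unit. Qed.

Lemma spM P a b : ~ sval P a -> ~ sval P b -> ~ sval P (a * b).
Proof. by have [_ _ Pp] := svalP P; move=> na nb /Pp[]. Qed.

Lemma spMP P a b : ~ sval P (a * b) -> ~ sval P a /\ ~ sval P b.
Proof.
have [[_ _ PM] _ _] := svalP P; move=> h; split=> h'; apply: h; last exact: PM.
by rewrite mulrC; exact: PM.
Qed.

Lemma spD_open a : open (spD a : set sptop).
Proof. exact: (@base_open spt _ sp_base (spD a) (ex_intro2 _ _ a I erefl)). Qed.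

(** Sections are locally single fractions a/d over basic open sets D(e). *)
Definition ssec U : set (forall P, slocT P) := [set s | forall P, U P -> exists a d e,
  ~ sval P e /\ forall Q, U Q -> ~ sval Q e -> ~ sval Q d /\ s Q = tol Q a / tol Q d].

Lemma sp_near U P : open U -> U P -> exists e, ~ sval P e /\ forall Q, ~ sval Q e -> U Q.
Proof. by move=> oU /oU[_ [[e _ <-] Pe eU]]; exists e; split=> // Q /eU. Qed.

(** Differences and products of fractions are treated at once; num gives the numerator of the
    result. *)
Lemma ssec_op (op : forall R : comUnitRingType, R -> R -> R) (num : W -> W -> W -> W -> W) :
  (forall P a d b c, ~ sval P d -> ~ sval P c ->
     op _ (tol P a / tol P d) (tol P b / tol P c) = tol P (num a d b c) / tol P (d * c)) ->
  forall U s t, ssec U s -> ssec U t -> ssec U (fun P => op _ (s P) (t P)).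
Proof.
move=> opE U s t Us Ut P UP; have [a [d [e [Pe h]]]] := Us P UP; have [b [c [f [Pf h']]]] := Ut P UP.
exists (num a d b c), (d * c), (e * f); split; first exact: spM.
move=> Q UQ /spMP[Qe Qf]; have [Qd ->] := h Q UQ Qe; have [Qc ->] := h' Q UQ Qf.
by split; [exact: spM|exact: opE].
Qed.

Definition spec_ringed : ringed_space.
Proof.
refine (@RingedSpace sptop slocT ssec _ _ _ _ _ _ _ _).
- move=> U s t _ st Us P UP; have [a [d [e [Pe h]]]] := Us P UP; exists a, d, e; split=> // Q UQ Qe.
  by rewrite -st //; exact: h.
- move=> U V s _ _ VU Us P VP; have [a [d [e [Pe h]]]] := Us P (VU P VP); exists a, d, e; split=> // Q VQ.
  by apply: h; exact: VU.
- move=> U s oU h P UP; have [V [oV VP Vs]] := h P UP; have [a [d [e [Pe he]]]] := Vs P VP.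
  have [f [Pf fV]] := sp_near oV VP; exists a, d, (e * f); split; first exact: spM.
  by move=> Q UQ /spMP[Qe Qf]; apply: he => //; exact: fV.
- move=> U _ P UP; exists 1, 1, 1; split; first by case: (svalP P).
  by move=> Q _ Q1; split=> //; rewrite /tol toloc1 divr1.
- move=> U s t _; apply: (@ssec_op (fun R x y => x - y) (fun a d b c => a * c - b * d)).
  by move=> P a d b c /tol_unit ud /tol_unit uc; rewrite /tol tolocB !tolocM -!/(tol _ _) subr_div.
- move=> U s t _; apply: (@ssec_op (fun R x y => x * y) (fun a d b c => a * b)).
  by move=> P a d b c /tol_unit ud /tol_unit uc; rewrite /tol !tolocM -!/(tol _ _) invrM // mulrACA [_^-1 * _^-1]mulrC.
- move=> P x; have [a [d [nd ->]]] := toloc_frac x.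
  exists (spD d), (fun Q => tol Q a / tol Q d); split=> //; first exact: spD_open.
  by move=> Q Qd; exists a, d, d.
- move=> U s P oU UP Us s0; have [a [d [e [Pe h]]]] := Us P UP.
  have [Pd sP] := h P UP Pe; have ud := (tol_unit P d).2 Pd.
  have /toloc_ker[u Pu ua] : tol P a = 0 by rewrite -[LHS](divrK ud) -sP s0 mul0r.
  exists (U `&` (spD e `&` spD u)); split=> //; first by apply: openI => //; apply: openI; exact: spD_open.
  move=> Q [UQ [Qe Qu]]; have [Qd ->] := h Q UQ Qe.
  have -> : tol Q a = 0 by apply/toloc_ker; exists u.
  by rewrite mul0r.
Defined.

Lemma spec_chart : @affine_chart spec_ringed setT W tol.
Proof.
split.
- exact: openT.
- by move=> P _; exact: toloc1.
- by move=> P a b _; exact: tolocB.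
- by move=> P a b _; exact: tolocM.
- move=> a P _; exists a, 1, 1; split; first by case: (svalP P).
  by move=> Q _ Q1; split=> //; rewrite /tol toloc1 divr1.
- move=> P _; rewrite (_ : [set a | _] = sval (P : spt)); first exact: svalP.
  apply/seteqP; split=> a /=; first by move=> /negP h; apply: contrapT => /tol_unit.
  by move=> Pa; apply/negP => /tol_unit.
- move=> P pP; have PE (Q : spt) : [set a | tol Q a \isn't a GRing.unit] = sval Q.
    apply/seteqP; split=> a /=; first by move=> /negP h; apply: contrapT => /tol_unit.
    by move=> Qa; apply/negP => /tol_unit.
  exists (exist _ P pP); split; first by rewrite PE.
  by move=> Q [_]; rewrite PE; case: Q => Q hQ /= PQ; subst P; congr exist; exact: Prop_irrelevance.
- move=> V P oV VP _; have [e [Pe eV]] := sp_near oV VP; exists e; split; first exact/tol_unit.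
  by move=> Q _ /tol_unit; exact: eV.
- move=> a; rewrite (_ : [set x | _] = spD a); first exact: spD_open.
  by apply/seteqP; split=> P; [move=> [_ /tol_unit]|move=> Pa; split=> //; exact/tol_unit].
- by move=> P b _; have [a [d [Pd ->]]] := toloc_frac b; exists a, d; split=> //; exact/tol_unit.
- by move=> P a _ /toloc_ker[u Pu ua]; exists u; split=> //; exact/tol_unit.
Qed.

Definition spec : scheme.
Proof. by exists spec_ringed => P; exists setT, W, tol; split=> //; exact: spec_chart. Defined.
End Spec.

(** * Morphisms from a spectrum into an affine chart *)

Section ChartMorphism.
Variables (X : scheme) (U : set X) (A : comNzRingType) (rho : forall x : X, A -> stalk x).
Hypothesis ch : affine_chart U rho.
Variables (W : comNzRingType) (phi : {rmorphism A -> W}).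

Lemma pre_prime (P : spt W) : is_prime [set a | sval P (phi a)].
Proof.
have [[P0 PD PM] P1 Pp] := svalP P; split=> [|/=|a b /=]; last by rewrite rmorphM => /Pp.
  split=> [|a b /= Pa Pb|a b /= Pb]; first by rewrite /= rmorph0.
    by rewrite rmorphD; exact: PD.
  by rewrite rmorphM; exact: PM.
by rewrite rmorph1.
Qed.

Lemma cm_exists (P : spec W) : exists x, U x /\ forall a, rho x a \is a GRing.unit <-> ~ sval P (phi a).
Proof.
have [x [[Ux e] _]] := chart_points ch (pre_prime P); exists x; split=> // a.
have := congr1 (fun S : set A => S a) e; rewrite /= => ->; split=> [u|/negP]; first exact/negP/negPn.
by rewrite negbK.
Qed.

Definition cm (P : spec W) : X := projT1 (cid (cm_exists P)).
Lemma cmU P : U (cm P). Proof. by rewrite /cm; case: cid => x []. Qed.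
Lemma cm_unit P a : rho (cm P) a \is a GRing.unit <-> ~ sval P (phi a).
Proof. by rewrite /cm; case: cid => x []. Qed.

Section Stalk.
Variable P : spec W.

Lemma cm_frac (b : stalk (cm P)) : exists ad : A * A, rho (cm P) ad.2 \is a GRing.unit /\ b = rho (cm P) ad.1 / rho (cm P) ad.2.
Proof. by have [a [d h]] := chart_frac ch b (cmU P); exists (a, d). Qed.

(** A fraction is chosen for every germ; [cmsE] shows that the value does not depend on it. *)
Definition cms (b : stalk (cm P)) : slocT P := let ad := projT1 (cid (cm_frac b)) in tol P (phi ad.1) / tol P (phi ad.2).

Lemma tolphi_unit a : rho (cm P) a \is a GRing.unit -> tol P (phi a) \is a GRing.unit.
Proof. by move/cm_unit/tol_unit. Qed.

Lemma cmsE a d : rho (cm P) d \is a GRing.unit -> cms (rho (cm P) a / rho (cm P) d) = tol P (phi a) / tol P (phi d).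
Proof.
move=> ud; rewrite /cms; case: cid => -[b c] /= [uc e]; have Ux := cmU P.
have /(chart_ker ch Ux)[f [uf]] : rho (cm P) (b * d - a * c) = 0.
  rewrite (chart_sub ch) // !(chart_mul ch) //; apply/eqP; rewrite subr_eq0; apply/eqP.
  by rewrite -[rho _ b](divrK uc) -e mulrAC divrK.
rewrite mulrBr => /eqP; rewrite subr_eq0 => /eqP /(congr1 (fun w => tol P (phi w))).
rewrite !rmorphM /tol !tolocM -!/(tol _ _) => /(mulrI (tolphi_unit uf)) h.
have vd := tolphi_unit ud; have vc := tolphi_unit uc.
by apply: (mulIr vc); apply: (mulIr vd); rewrite divrK // h mulrAC divrK // mulrAC.
Qed.

Lemma cms_rho a : cms (rho (cm P) a) = tol P (phi a).
Proof.
have := @cmsE a 1; rewrite (chart_one ch (cmU P)) unitr1 !divr1 rmorph1 => -> //.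
by rewrite /tol toloc1 divr1.
Qed.

Lemma cmsB : zmod_morphism cms.
Proof.
move=> x y; have [[a d] [/= ud ->]] := cm_frac x; have [[b c] [/= uc ->]] := cm_frac y.
have Ux := cmU P; rewrite subr_div // -!(chart_mul ch) // -(chart_sub ch) // !cmsE ?(chart_mul ch) ?unitrM ?ud ?uc //.
by rewrite subr_div ?tolphi_unit // rmorphB !rmorphM /tol tolocB !tolocM.
Qed.

Lemma cmsM : monoid_morphism cms.
Proof.
split; first by rewrite -(chart_one ch (cmU P)) cms_rho rmorph1; exact: toloc1.
move=> x y; have [[a d] [/= ud ->]] := cm_frac x; have [[b c] [/= uc ->]] := cm_frac y.
have Ux := cmU P; rewrite mulrACA -invrM // [_ c * _ d]mulrC -!(chart_mul ch) // !cmsE ?(chart_mul ch) ?unitrM ?ud ?uc //.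
rewrite [RHS]mulrACA -invrM ?tolphi_unit // [tol P (phi c) * _]mulrC !rmorphM /tol !tolocM.
by congr (_ / _); exact: mulrC.
Qed.

HB.instance Definition _ := GRing.isZmodMorphism.Build (stalk (cm P)) (slocT P) cms cmsB.
HB.instance Definition _ := GRing.isMonoidMorphism.Build (stalk (cm P)) (slocT P) cms cmsM.
Definition cmr : {rmorphism stalk (cm P) -> slocT P} := cms.
End Stalk.

(** Maps of this kind are the test objects for the fibre products below. *)
Definition chart_mor : morphism (spec W) X.
Proof.
refine (@Morphism (spec W) X cm cmr _ _ _).
- apply/continuousP => V oV; apply/(@bopenE _ _ (sp_base W)) => P VP; have [a [ua aV]] := chart_base ch oV VP (cmU P).
  exists (spD (phi a)); split; [by exists (phi a)|exact/cm_unit|].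
  by move=> Q /cm_unit ua'; apply: aV => //; exact: cmU.
- move=> P b; have [[a d] [/= ud ->]] := cm_frac b.
  rewrite /cmr /= cmsE // unitrM unitrV (tolphi_unit ud) andbT => /tol_unit /cm_unit ua.
  by rewrite unitrM ua unitrV.
- move=> V s oV Vs P /= VP; have Ux := cmU P; have [a [d [ud sE]]] := chart_frac ch (s (cm P)) Ux.
  have oUV := openI oV (chart_open ch).
  have rs b : sec (V `&` U) (fun x => rho x b) by apply: sec_restrict (chart_open ch) oUV _ (chart_sec ch b) => x [].
  have Vs' : sec (V `&` U) s by apply: sec_restrict oV oUV _ Vs => x [].
  have [|Z [oZ ZP _ Zs]] := germ_eq oUV oUV (conj VP Ux) (conj VP Ux) (sec_mul oUV Vs' (rs d)) (rs a).
    by rewrite sE divrK.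
  have [e [ue eZ]] := chart_base ch oZ ZP Ux.
  exists (phi a), (phi d), (phi (e * d)); split.
    by apply/cm_unit; rewrite (chart_mul ch) // unitrM ue ud.
  move=> Q VQ /cm_unit; rewrite (chart_mul ch) ?unitrM; last exact: cmU.
  move=> /andP[ueQ udQ]; split; first exact/cm_unit.
  rewrite -cmsE // -(Zs (cm Q)) ?mulrK //; exact: eZ (cmU Q) ueQ.
Defined.
End ChartMorphism.

Lemma stalk_nonunitD (X : scheme) (x : X) (a b : stalk x) : a \isn't a GRing.unit -> b \isn't a GRing.unit ->
  a + b \isn't a GRing.unit.
Proof.
have [U [A [rho [Ux ch]]]] := scheme_affine x; have [[_ PD PM] _ _] := chart_prime ch Ux.
have [a1 [d [ud ->]]] := chart_frac ch a Ux; have [b1 [c [uc ->]]] := chart_frac ch b Ux.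
rewrite !unitrM !unitrV ud uc !andbT => na nb.
rewrite -[rho x b1]opprK mulNr subr_div // mulNr opprK unitrM unitrV unitrM ud uc andbT.
rewrite -!(chart_mul ch) // -(chartD ch) // andbT [a1 * c]mulrC [b1 * d]mulrC.
exact: (PD _ _ (PM c a1 na) (PM d b1 nb)).
Qed.

Section FieldModels.
Context {K : fieldType}.
Implicit Types (A S : set K).

(** The maximal ideal of a local subring S. Since the inverse of 0 is 0 in a field type, 0 has to be
    let in by the clause [c = 0]. *)
Definition nonu S : set K := [set c | S c /\ (S c^-1 -> c = 0)].

Lemma nonuE S m : localring S m -> nonu S = m.
Proof.
move=> h; have [Ss [mS mm m1 _] Si] := h; apply/seteqP; split=> [c [Sc hc]|c mc].
  apply: contrapT => nm; apply: (nm); rewrite (hc (Si _ Sc nm)); by case: mm.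
split; first exact: mS.
move=> SV; apply: contrapT => /eqP c0; apply: m1; rewrite -(mulVf c0); exact: (submodM mm).
Qed.
End FieldModels.

(** * Integral schemes inside their function field *)

Section EmbeddedRing.
Variables (R : comUnitRingType) (K : fieldType) (j : R -> K).
Hypotheses (jB : forall a b, j (a - b) = j a - j b) (jM : forall a b, j (a * b) = j a * j b) (j1 : j 1 = 1).
Let S : set K := range j.

Lemma emb0 : j 0 = 0. Proof. by rewrite -(subrr 0) jB subrr. Qed.
Lemma embN a : j (- a) = - j a. Proof. by rewrite -sub0r jB emb0 sub0r. Qed.
Lemma embD a b : j (a + b) = j a + j b. Proof. by rewrite -{1}[b]opprK jB embN opprK. Qed.

Lemma emb_subring : is_subring S.
Proof.
split=> [|_ _ [a _ <-] [b _ <-]|_ _ [a _ <-] [b _ <-]]; first by exists 1.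
  by exists (a - b).
by exists (a * b).
Qed.

Lemma embV (a : R) : a \is a GRing.unit -> j a != 0 /\ j a^-1 = (j a)^-1.
Proof.
move=> ua; have e : j a * j a^-1 = 1 by rewrite -jM mulrV.
have a0 : j a != 0 by apply/eqP => a0; move: e; rewrite a0 mul0r => /esym/eqP; rewrite oner_eq0.
by split=> //; apply: (mulfI a0); rewrite e mulfV.
Qed.

Hypothesis jI : forall a, j a = 0 -> a = 0.

Lemma emb_inj : injective j.
Proof. by move=> a b e; apply/eqP; rewrite -subr_eq0; apply/eqP/jI; rewrite jB e subrr. Qed.

Lemma emb_unit (a : R) : a \is a GRing.unit <-> ~ nonu S (j a).
Proof.
split=> [/embV[/eqP a0 e] [_ h]|nu]; first by apply/a0/h; exists a^-1.
have [b _ be] : S (j a)^-1 by apply: contrapT => h; apply: nu; split=> [|/h//]; exists a.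
apply/unitrPr; exists b; apply: emb_inj; rewrite jM be j1 mulfV //.
by apply/eqP => a0; apply: nu; rewrite a0; split=> //; exists 0 => //; exact: emb0.
Qed.

Lemma emb_nonunit a : nonu S (j a) <-> a \isn't a GRing.unit.
Proof. by split=> [h|/negP h]; [apply/negP => /emb_unit|apply: contrapT => /emb_unit]. Qed.

Lemma emb_local : (forall a b : R, a \isn't a GRing.unit -> b \isn't a GRing.unit -> a + b \isn't a GRing.unit) ->
  localring S (nonu S).
Proof.
move=> nD; split; [exact: emb_subring| |]; last first.
  by move=> _ [a _ <-] /emb_unit ua; exists a^-1 => //; case: (embV ua).
split=> [c []//||/=|_ _ [a _ <-] [b _ <-]].
- split=> [|c d nc nd|_ d [a _ <-] nd]; first by rewrite -emb0; apply/emb_nonunit; rewrite unitr0.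
    have [[[a _ ac] _] [[b _ bd] _]] := (nc, nd); move: nc nd; rewrite -ac -bd -embD.
    by move=> /emb_nonunit na /emb_nonunit nb; apply/emb_nonunit/nD.
  have [[b _ bd] _] := nd; move: nd; rewrite -bd /GRing.scale /= -jM => /emb_nonunit nb.
  by apply/emb_nonunit; rewrite unitrM (negPf nb) andbF.
- by rewrite -j1 => /emb_nonunit; rewrite unitr1.
- by rewrite -jM => /emb_nonunit; rewrite unitrM negb_and => /orP[na|nb]; [left|right]; exact/emb_nonunit.
Qed.
End EmbeddedRing.

Section FieldModels.
Context {K : fieldType}.
Implicit Types (A S : set K).

Section Charts.
Variables (T : topologicalType) (O : T -> set K).

(* The open set U is Spec A, with local rings O x inside the function field K. *)
Record kchart (U : set T) A : Prop := KChart {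
  kc_open : open U;
  kc_sub : forall x, U x -> A `<=` O x;
  kc_frac : forall x c, U x -> O x c -> exists a d, [/\ A a, A d, ~ nonu (O x) d & c = a / d];
  kc_point : forall p, prime_in A p -> exists x, U x /\ forall a, A a -> (p a <-> nonu (O x) a);
  kc_uniq : forall x y, U x -> U y -> (forall a, A a -> (nonu (O x) a <-> nonu (O y) a)) -> x = y;
  kc_base : forall V x, open V -> V x -> U x ->
    exists a, [/\ A a, ~ nonu (O x) a & forall y, U y -> ~ nonu (O y) a -> V y];
  kc_basic : forall a, A a -> open [set y | U y /\ ~ nonu (O y) a] }.

Definition dense (y : T) := forall V, open V -> V !=set0 -> V y.

(** An integral scheme with charts of finite type, reduced to its topological space and the family
    of its local rings inside K. *)
Record fmodel (k0 : set K) : Prop := FModel {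
  fm_local : forall x, localring (O x) (nonu (O x));
  fm_chart : forall x, exists U z, U x /\ kchart U (adjs k0 z);
  fm_gen : exists2 y, dense y & O y = setT }.

Variable k0 : set K.
Hypotheses (k0f : subfield k0) (fm : fmodel k0).
Let k0s : is_subring k0. Proof. exact: k0f.1. Qed.

Lemma O_sub x : is_subring (O x). Proof. by case: (fm_local fm x). Qed.

Lemma m_prime x : prime_in (O x) (nonu (O x)). Proof. by case: (fm_local fm x). Qed.

Lemma m_nz x c : ~ nonu (O x) c -> c != 0.
Proof. exact: prime_nz (m_prime x). Qed.

Lemma m_inv x c : O x c -> ~ nonu (O x) c -> O x c^-1.
Proof. by case: (fm_local fm x) => _ _; apply. Qed.

Section OneChart.
Variables (U : set T) (z : seq K).
Hypothesis kc : kchart U (adjs k0 z).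
Let A := adjs k0 z.
Let As : is_subring A. Proof. exact: adjs_subring. Qed.

Definition px x : set K := A `&` nonu (O x).

Lemma px_prime x : U x -> prime_in A (px x).
Proof. by move=> Ux; exact: (prime_contract As (kc_sub kc Ux) (m_prime x)). Qed.

Lemma O_locz x : U x -> O x = locz A (px x).
Proof.
move=> Ux; apply/seteqP; split=> c.
  by move=> /(kc_frac kc Ux)[a [d [Aa Ad md ->]]]; exists a, d; split=> // -[].
move=> [a [d [Aa Ad nd ->]]]; have AO : A `<=` O x := kc_sub kc Ux.
apply: (subringM (O_sub x)); first exact: AO.
by apply: m_inv; [exact: AO|move=> md; apply: nd].
Qed.

Lemma m_mz x : U x -> nonu (O x) = mz k0 z (px x).
Proof. by move=> Ux; apply: nonuE; rewrite (O_locz Ux); apply: (locz_local k0f); exact: px_prime. Qed.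

Lemma gen_chart y : dense y -> U !=set0 -> U y.
Proof. by move=> dy; apply: dy; exact: kc_open kc. Qed.

Lemma chart_fracs : U !=set0 -> forall c, fracs A c.
Proof.
move=> U0 c; have [y dy Oy] := fm_gen fm.
have [|a [d [Aa Ad nd ->]]] := kc_frac kc (gen_chart dy U0) (_ : O y c); first by rewrite Oy.
by exists a, d; split=> //; exact: (@m_nz y).
Qed.

Lemma O_noeth x : U x -> noeth (O x).
Proof.
move=> Ux; apply: (noeth_loc k0f (O_sub x)).
by rewrite (O_locz Ux); apply: loc_locz => //; exact: px_prime.
Qed.

Lemma O_loc x : U x -> loc A (O x).
Proof. by move=> Ux; rewrite (O_locz Ux); apply: loc_locz => //; exact: px_prime. Qed.

Lemma k0_sub x : U x -> k0 `<=` O x.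
Proof. by move=> Ux a ka; apply: (kc_sub kc Ux); exact: sub_adjs. Qed.

Lemma denoms n (c : 'I_n -> K) x : U x -> (forall i, O x (c i)) ->
  exists a, [/\ A a, ~ nonu (O x) a & forall i, A (a * c i)].
Proof.
move=> Ux Oc; have [_ _ m1 mp] := m_prime x; have AO := kc_sub kc Ux.
elim: n c Oc => [c _|n IH c Oc]; first by exists 1; split=> //; [exact: subring1|case].
have [a [Aa na ha]] := IH (fun i => c (lift ord0 i)) (fun i => Oc _).
have [b [d [Ab Ad nd e]]] := kc_frac kc Ux (Oc ord0); have d0 := m_nz nd.
exists (a * d); split; [exact: subringM|by move=> /mp[| |//|//]; exact: AO|].
move=> i; have [->|] := eqVneq i ord0; first by rewrite e -mulrA [d * _]mulrCA mulfV // mulr1; exact: subringM.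
by case: (unliftP ord0 i) => [j -> _|->]; [rewrite mulrAC; exact: subringM|rewrite eqxx].
Qed.

End OneChart.

Lemma open_germ x c : O x c -> exists V, [/\ open V, V x & forall y, V y -> O y c].
Proof.
move=> Oc; have [U [z [Ux kc]]] := fm_chart fm x; have [a [d [Aa Ad nd ->]]] := kc_frac kc Ux Oc.
exists [set y | U y /\ ~ nonu (O y) d]; split=> //; first exact: kc_basic kc _ Ad.
move=> y [Uy ndy]; apply: (subringM (O_sub y)); first exact: (kc_sub kc Uy).
by apply: m_inv => //; exact: (kc_sub kc Uy).
Qed.

Lemma O_gen x y : (forall V, open V -> V x -> V y) -> O x `<=` O y.
Proof. by move=> xy c /open_germ[V [oV Vx VO]]; apply: VO; exact: xy. Qed.

Lemma dense_gen y : dense y -> O y = setT.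
Proof.
move=> dy; have [y' dy' Oy'] := fm_gen fm; apply/seteqP; split=> // c _.
have [|V [oV Vy' VO]] := @open_germ y' c; first by rewrite Oy'.
by apply: VO; apply: dy => //; exists y'.
Qed.

(** Only the finitely many generators of a chart have to be cleared of denominators, so regularity
    of a derivation is an open condition. *)
Lemma stab_near x d : der k0 d -> stab (O x) d -> exists V, [/\ open V, V x & forall y, V y -> stab (O y) d].
Proof.
move=> dd st; have [U [z [Ux kc]]] := fm_chart fm x; have px := px_prime kc Ux.
have [|a [Aa na sa]] := stab_clear k0f px dd.
  by move=> a Aa; rewrite -(O_locz kc Ux); apply: st; exact: (kc_sub kc Ux).
exists [set y | U y /\ ~ nonu (O y) a]; split; [exact: kc_basic kc _ Aa|by split=> // h; apply: na|].
move=> y [Uy nay]; apply: (der_loc k0f dd (O_sub y) (O_loc kc Uy)) => b Ab.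
have a0 := m_nz nay; rewrite -[d b]mul1r -(mulVf a0) -mulrA; apply: (subringM (O_sub y)).
  by apply: m_inv => //; exact: (kc_sub kc Uy).
by apply: (kc_sub kc Uy); exact: sa.
Qed.

End Charts.
End FieldModels.

(** * Vector fields and foliations read in the function field *)

Section KModel.
Variables (k : fieldType) (X : kscheme k) (K : fieldType) (io : forall x : X, stalk x -> K).
Implicit Types (L : set (K -> K)).

Definition germs x : set K := range (@io x).
Definition consts : set K := [set c | exists a, forall x, io (scalar x a) = c].

(** [io] embeds all stalks in one field, and a family of germs is a section exactly when its image
    in that field is constant. *)
Record kmodel : Prop := KModel {
  md_B : forall x a b, @io x (a - b) = io a - io b;
  md_M : forall x a b, @io x (a * b) = io a * io b;
  md_1 : forall x, @io x 1 = 1;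
  md_inj : forall x a, @io x a = 0 -> a = 0;
  md_sec : forall U s, open U -> (sec U s <-> exists c, forall x, U x -> io (s x) = c);
  md_fm : fmodel germs consts }.

Hypothesis M : kmodel.
Hypothesis char0 : [pchar k] =i pred0.

Lemma io0 x : @io x 0 = 0. Proof. exact: emb0 (md_B M (x := x)). Qed.
Lemma ioD x a b : @io x (a + b) = io a + io b. Proof. exact: (embD (md_B M (x := x))). Qed.

Lemma io_sum x n (f : 'I_n -> stalk x) : io (\sum_i f i) = \sum_i io (f i).
Proof. by elim/big_rec2: _ => [|i a b _ <-]; [exact: io0|rewrite ioD]. Qed.

Lemma io_inj x : injective (@io x). Proof. exact: (emb_inj (md_B M (x := x)) (md_inj M (x := x))). Qed.

Lemma io_unit x (a : stalk x) : a \is a GRing.unit <-> ~ nonu (germs x) (io a).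
Proof. exact: (emb_unit (md_B M (x := x)) (md_M M (x := x)) (md_1 M x) (md_inj M (x := x))). Qed.

Lemma consts_subfield : subfield consts.
Proof.
have [x _ _] := fm_gen (md_fm M).
have un a y b : @io y (scalar y a) = b -> a != 0 -> b != 0 /\ @io y (scalar y a^-1) = b^-1.
  move=> <- a0; have ua : a \is a GRing.unit by rewrite unitfE.
  by rewrite rmorphV //; exact: (embV (md_M M (x := y)) (md_1 M y) (rmorph_unit (scalar y) ua)).
split=> [|c [a ac]]; last first.
  have [a0|a0] := eqVneq a 0.
    by exists 0 => y; rewrite -(ac y) a0 rmorph0 io0 invr0.
  by exists a^-1 => y; have [] := un _ _ _ (ac y) a0.
split=> [|c d [a ac] [b bd]|c d [a ac] [b bd]].
- by exists 1 => y; rewrite rmorph1 (md_1 M).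
- by exists (a - b) => y; rewrite rmorphB (md_B M) ac bd.
- by exists (a * b) => y; rewrite rmorphM (md_M M) ac bd.
Qed.

Lemma scalar_consts x a : consts (io (scalar x a)).
Proof.
have [c hc] := (md_sec M (fun y => scalar y a) (openT)).1 (@scalar_sec k X a).
by exists a => y; rewrite !hc.
Qed.

Lemma char0_model n : n.+1%:R != 0 :> K.
Proof.
have [x _ _] := fm_gen (md_fm M).
have kn : (n.+1%:R : k) != 0 by rewrite ((pcharf0P k).1 char0).
have : io (scalar x (n.+1%:R / n.+1%:R)) = 1 by rewrite mulfV // rmorph1 (md_1 M).
rewrite rmorphM (md_M M) rmorph_nat.
have -> : io (n.+1%:R : stalk x) = n.+1%:R.
  by elim: n.+1 => [|i IH]; [exact: io0|rewrite -!natr1 ioD IH (md_1 M)].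
by move=> e; apply/eqP => n0; move: e; rewrite n0 mul0r => /esym/eqP; rewrite oner_eq0.
Qed.

Lemma germs_lift n x (c : 'I_n -> K) : (forall i, germs x (c i)) -> exists b : 'I_n -> stalk x, forall i, io (b i) = c i.
Proof.
move=> gc; have h i : exists b : stalk x, io b = c i by have [b _ e] := gc i; exists b.
by have [b bE] := choice h; exists b.
Qed.

Lemma sec_on U c : open U -> (forall y, U y -> germs y c) -> exists2 s, sec U s & forall y, U y -> io (s y) = c.
Proof.
move=> oU UO; have h y : exists a : stalk y, U y -> io a = c.
  by have [/UO[a _ ac]|nU] := pselect (U y); [exists a|exists 0].
exists (fun y => projT1 (cid (h y))); have e y : U y -> io (projT1 (cid (h y))) = c by case: cid.
  by apply/(md_sec M) => //; exists c.
exact: e.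
Qed.

Lemma sec_at x c : germs x c -> exists U s, [/\ open U, U x, sec U s & forall y, U y -> io (s y) = c].
Proof.
by move=> /(open_germ (md_fm M))[U [oU Ux /(sec_on oU)[s Us sc]]]; exists U, s.
Qed.

(* A point y specialises to x. *)
Definition gen_of (x y : X) := forall V, open V -> V x -> V y.

Lemma near_secP x y a : gen_of x y -> (near_sec x y a <-> germs x (io a)).
Proof.
move=> xy; split=> [[U [s [oU Ux Uy Us ->]]]|/sec_at[U [s [oU Ux Us sc]]]].
  by have [c hc] := (md_sec M s oU).1 Us; rewrite hc // -(hc x Ux); exists (s x).
have Uy := xy U oU Ux; exists U, s; split=> //; apply: io_inj; by rewrite sc.
Qed.

(* Vector fields over U are the derivations of K that preserve all O_x, x in U. *)
Definition repr (U : set X) (D : vfield X) (d : K -> K) : Prop := forall x, U x -> forall a, io (D x a) = d (io a).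

Lemma repr_stab U D d x : repr U D d -> U x -> stab (germs x) d.
Proof. by move=> r Ux _ [a _ <-]; exists (D x a) => //; exact: r. Qed.

(** A vector field is determined by its derivation at the generic point: a germ and its derivative
    extend to a common neighbourhood, which contains that point. *)
Lemma tangentP U D : open U -> (tangent U D <-> exists2 d, der consts d & repr U D d).
Proof.
move=> oU; have [y dy Oy] := fm_gen (md_fm M); split=> [[Dd Ds]|[d [dD dM dk] r]].
  have [[x Ux]|U0] := pselect (U !=set0); last first.
    exists (fun=> 0) => [|x Ux]; last by case: U0; exists x.
    by split=> // *; rewrite ?addr0 ?mulr0 ?addr0.
  have Uy : U y by apply: dy => //; exists x.
  have h c : exists a : stalk y, io a = c.
    have gc : germs y c by rewrite Oy.
    by have [a _ e] := gc; exists a.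
  have [g gK] := choice h; have [DyD DyM Dyk] := Dd y Uy.
  have gD a b : g (a + b) = g a + g b by apply: io_inj; rewrite ioD !gK.
  have gM a b : g (a * b) = g a * g b by apply: io_inj; rewrite (md_M M) !gK.
  exists (fun c => io (D y (g c))).
    split=> [a b _ _|a b _ _|c [a ac]].
    - by rewrite gD DyD ioD.
    - by rewrite gM DyM ioD !(md_M M) !gK.
    - have -> : g c = scalar y a by apply: io_inj; rewrite gK ac.
      by rewrite Dyk io0.
  move=> w Uw a; have [V [s [oV Vw Vs sa]]] := sec_germ a.
  have oUV := openI oU oV; have UVw : (U `&` V) w by [].
  have UVs : sec (U `&` V) s by apply: (sec_restrict oV oUV) Vs => v [].
  have [c hc] := (md_sec M s oUV).1 UVs.
  have [|c' hc'] := (md_sec M _ oUV).1 (Ds _ s oUV _ UVs); first by move=> v [].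
  have UVy : (U `&` V) y by apply: dy => //; exists w.
  rewrite -sa (hc' w UVw) -(hc' y UVy) (hc w UVw) -(hc y UVy); congr (io (D y _)).
  by apply: io_inj; rewrite gK.
split=> [x Ux|V s oV VU Vs].
  split=> [a b|a b|c]; apply: io_inj; rewrite r //.
  - by rewrite !ioD dD // !r.
  - by rewrite (md_M M) dM // ioD !(md_M M) !r.
  - by rewrite dk ?io0 //; exact: scalar_consts.
have [c hc] := (md_sec M s oV).1 Vs; apply/(md_sec M) => //; exists (d c) => x Vx.
by rewrite r ?hc //; exact: VU.
Qed.

Lemma repr_uniq U D E d : repr U D d -> repr U E d -> vf_eq_on U D E.
Proof. by move=> r r' x Ux a; apply: io_inj; rewrite r // r'. Qed.

Lemma repr_gen U D d d' x : open U -> U x -> repr U D d -> repr U D d' -> d =1 d'.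
Proof.
move=> oU Ux r r' c; have [y dy Oy] := fm_gen (md_fm M).
have Uy : U y by apply: dy => //; exists x.
have gc : germs y c by rewrite Oy.
by have [a _ <-] := gc; rewrite -r ?r'.
Qed.

Lemma repr_exists (U : set X) (d : K -> K) : (forall x, U x -> stab (germs x) d) -> exists D, repr U D d.
Proof.
move=> st; have h x : exists D : stalk x -> stalk x, U x -> forall a, io (D a) = d (io a).
  have [Ux|nU] := pselect (U x); last by exists (fun=> 0).
  have h a : exists b : stalk x, io b = d (@io x a).
    by have [b _ e] := st x Ux _ (ex_intro2 _ _ a I erefl); exists b.
  by have [D hD] := choice h; exists D.
by exists (fun x => projT1 (cid (h x))) => x Ux a; case: cid => D /= ->.
Qed.

Lemma lift_stab n x (d : 'I_n -> K -> K) : (forall i, stab (germs x) (d i)) ->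
  exists v : 'I_n -> stalk x -> stalk x, forall i a, io (v i a) = d i (io a).
Proof.
move=> sd; have h i : exists v : stalk x -> stalk x, forall a, io (v a) = d i (io a).
  by have [|D rD] := @repr_exists [set x] (d i); [move=> y ->|exists (D x); exact: rD].
by have [v vE] := choice h; exists v.
Qed.

Section Fol.
Variable L : set (K -> K).
Hypothesis L_der : forall d, L d -> der consts d.
Hypotheses (L_comb : comb_closed L) (L_bracket : lie_closed L).

(** The saturated sheaf of vector fields with generic stalk L. *)
Definition Fol (U : set X) : set (vfield X) := [set D | exists2 d, L d & repr U D d].

Lemma L_zero : L (fun=> 0).
Proof.
have := @L_comb 0%N (fun=> 0) (fun=> (fun=> 0)) (fun i => False_ind _ (notF (valP i))).
by congr (L _); apply/funext => x; rewrite big_ord0.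
Qed.

Lemma L_lin c d e : L d -> L e -> L (fun x => c * d x + e x).
Proof.
move=> Ld Le; have := @L_comb 2 (fun i => if val i is 0%N then c else 1) (fun i => if val i is 0%N then d else e).
have h (i : 'I_2) : L (if val i is 0%N then d else e) by case: i => [[|i] lt].
move=> /(_ h); congr (L _); apply/funext => x; by rewrite !big_ord_recl big_ord0 /= mul1r addr0.
Qed.

Lemma L_scaler c d : L d -> L (fun x => c * d x).
Proof.
move=> Ld; have := L_lin c Ld L_zero; congr (L _); apply/funext => x; by rewrite addr0.
Qed.

Lemma Fol_submodule : tangent_submodule Fol.
Proof.
split.
- by move=> U oU D [d Ld r]; apply/tangentP => //; exists d => //; exact: L_der.
- by move=> U D E _ DE [d Ld r]; exists d => // x Ux a; rewrite -DE ?r.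
- by move=> U V D _ _ VU [d Ld r]; exists d => // x /VU Ux; exact: r.
(* The local derivations coincide, because any two nonempty open sets share the generic point. *)
- move=> U D oU h; have [[x0 Ux0]|U0] := pselect (U !=set0); last first.
    by exists (fun=> 0); [exact: L_zero|move=> x Ux; case: U0; exists x].
  have [V [oV Vx0 [d Ld r]]] := h x0 Ux0; exists d => // x Ux a.
  have [W [oW Wx [e Le r']]] := h x Ux; rewrite r' //.
  have [y dy _] := fm_gen (md_fm M).
  have VWy : (V `&` W) y by split; apply: dy => //; [exists x0|exists x].
  apply: (repr_gen (openI oV oW) VWy (D := D)) => v [Vv Wv]; [exact: r'|exact: r].
- by move=> U oU; exists (fun=> 0); [exact: L_zero|move=> x _ a; rewrite io0].
- move=> U D E oU [d Ld r] [e Le r']; exists (fun x => 1 * d x + e x); first exact: L_lin.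
  by move=> x Ux a; rewrite /vadd ioD r // r' // mul1r.
- move=> U s D oU Us [d Ld r]; have [c hc] := (md_sec M s oU).1 Us.
  by exists (fun x => c * d x); [exact: L_scaler|move=> x Ux a; rewrite /vscale (md_M M) r // hc].
Qed.

Lemma repr_comb n U (s : 'I_n -> germ_family X) (D : 'I_n -> vfield X) (c : 'I_n -> K) (d : 'I_n -> K -> K) :
  (forall i x, U x -> io (s i x) = c i) -> (forall i, repr U (D i) (d i)) ->
  repr U (vcomb s D) (fun a => \sum_i c i * d i a).
Proof.
move=> hs r x Ux a; rewrite /vcomb io_sum; apply: eq_bigr => i _; by rewrite (md_M M) hs // r.
Qed.

Lemma consts_sec n U (s : 'I_n -> germ_family X) : open U -> (forall i, sec U (s i)) ->
  exists c : 'I_n -> K, forall i x, U x -> io (s i x) = c i.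
Proof.
move=> oU Us; have h i : exists c, forall x, U x -> io (s i x) = c by exact: (md_sec M (s i) oU).1.
by have [c hc] := choice h; exists c.
Qed.

Lemma secs_at n x (c : 'I_n -> K) : (forall i, germs x (c i)) -> exists U (s : 'I_n -> germ_family X),
  [/\ open U, U x, forall i, sec U (s i) & forall i y, U y -> io (s i y) = c i].
Proof.
move=> gc; have h i : exists Us : set X * germ_family X, [/\ open Us.1, Us.1 x, sec Us.1 Us.2 & forall y, Us.1 y -> io (Us.2 y) = c i].
  by have [U [s hs]] := sec_at (gc i); exists (U, s).
have [Us hU] := choice h; pose U := [set y | forall i, (Us i).1 y].
have oU : open U.
  rewrite openE => y Uy; apply: filter_forall => i; have [oUi _ _ _] := hU i.
  by apply: open_nbhs_nbhs; split=> //; exact: Uy.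
exists U, (fun i => (Us i).2); split=> // [i|i|i y Uy]; have [oUi Ux Usec e] := hU i => //.
  by apply: (sec_restrict oUi oU) Usec => y; apply.
exact: e.
Qed.

(** Values on the generators z embed the regular derivations of L in a free module over the
    noetherian coordinate ring of a chart, and relations between sections are vectors over that
    ring. Both modules are finitely generated, and clearing denominators shows that their generators
    generate all stalks. *)
Lemma Fol_coherent : coherent Fol.
Proof.
have k0f := consts_subfield; have k0s := k0f.1; have fm := md_fm M; split.
- move=> x; have [U [z [Ux kc]]] := fm_chart fm x; have oU := kc_open kc.
  set A := adjs consts z in kc; have As : is_subring A by exact: adjs_subring.
  have frA := chart_fracs fm kc (ex_intro _ x Ux).
  have An : noeth A by apply: noeth_adjs => //; exact: subfield_noeth.
  pose ev (d : K -> K) : 'rV[K]_(size z) := \row_j d z`_j.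
  pose N := [set ev d | d in Lst L A].
  have Nm : is_submod A N.
    split=> [|_ _ [d [Ld sd] <-] [e [Le se] <-]|a _ Aa [d [Ld sd] <-]].
    + exists (fun=> 0); first by split; [exact: L_zero|move=> a Aa; exact: subring0].
      by apply/rowP => j; rewrite !mxE.
    + exists (fun x => 1 * d x + e x); last by apply/rowP => j; rewrite !mxE mul1r.
      by split; [exact: L_lin|move=> a Aa; rewrite mul1r; apply: subringD => //; [exact: sd|exact: se]].
    + exists (fun x => a * d x); last by apply/rowP => j; rewrite !mxE.
      by split; [exact: L_scaler|move=> b Ab; apply: subringM => //; exact: sd].
  have [|s sN Ns] := noethm_rV As An Nm.
    by move=> _ [d [Ld sd] <-] j; rewrite mxE; apply: sd; apply: mem_adjs => //; exact: mem_nth.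
  have hd (i : 'I_(size s)) : exists d, Lst L A d /\ ev d = s`_i.
    by have [|d] := sN s`_i; [exact: mem_nth|exists d].
  have [d dP] := choice hd.
  have dO i y : U y -> stab (germs y) (d i).
    move=> Uy; have [[Ld sd] _] := dP i.
    by apply: (der_loc k0f (L_der Ld) (O_sub fm y) (O_loc k0f fm kc Uy)) => a Aa; apply: (kc_sub kc Uy); exact: sd.
  have hD i : exists D, repr U D (d i) by apply: repr_exists => y Uy; exact: dO.
  have [D DP] := choice hD.
  exists U, (size s), D; split=> // [i|V E oV VU [e Le r] y Vy].
    by have [[Ld _] _] := dP i; exists (d i).
  have Uy := VU y Vy; have py := px_prime k0f fm kc Uy.
  have [|a [Aa na sa]] := stab_clear k0f py (L_der Le).
    by move=> a Aa; rewrite -(O_locz fm kc Uy); apply: (repr_stab r Vy); exact: (kc_sub kc Uy).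
  have [c Ac ec] : lspan A s (ev (fun x => a * e x)) by apply: Ns; exists (fun x => a * e x) => //; split=> //; exact: L_scaler.
  have nma : ~ nonu (germs y) a by move=> h; apply: na.
  have a0 := m_nz fm nma.
  have eE v : e v = \sum_(i < size s) c i / a * d i v.
    apply: (mulfI a0); rewrite mulr_sumr (eq_bigr (fun i : 'I_(size s) => c i * d i v)); last first.
      by move=> i _; rewrite mulrA [a * _]mulrC divfK.
    have Lg : L (fun v => 1 * (a * e v) + - 1 * (\sum_(i < size s) c i * d i v)).
      apply: L_lin; first exact: L_scaler.
      by apply: L_scaler; apply: L_comb => i; have [[]] := dP i.
    apply/eqP; rewrite -subr_eq0 -mulN1r -[X in X + _]mul1r; apply/eqP.
    apply: (der_gen0 k0f frA (L_der Lg)) => w zw.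
    have iw : (index w z < size z)%N by rewrite index_mem.
    have := congr1 (fun r : 'rV_(size z) => r 0 (Ordinal iw)) ec.
    rewrite !mxE summxE nth_index // => ->; rewrite mul1r mulN1r; apply/eqP; rewrite subr_eq0; apply/eqP.
    by apply: eq_bigr => i _; rewrite mxE -(dP i).2 !mxE nth_index.
  have gc i : germs y (c i / a).
    apply: (subringM (O_sub fm y)); first exact: (kc_sub kc Uy).
    by apply: (m_inv fm) => //; exact: (kc_sub kc Uy).
  have [W [t [oW Wy Wt et]]] := @secs_at (size s) y (fun i => c i / a) (fun i => gc i); have oWV := openI oW oV.
  exists (W `&` V), t; split=> // [i|]; first by apply: (sec_restrict oW oWV) (Wt i) => w [].
  apply: (repr_uniq (d := e)); first by move=> w [_ Vw]; exact: r.
  move=> w [Ww Vw] u; rewrite eE; apply: (@repr_comb _ [set w] t D (fun i => c i / a) d _ _ w erefl u) => i _ ->; first exact: et.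
  by apply: (DP i); exact: VU.
- move=> U n D oU UD x Ux; have [U' [z [U'x kc]]] := fm_chart fm x; have oU' := kc_open kc.
  set A := adjs consts z in kc; have As : is_subring A by exact: adjs_subring.
  have An : noeth A by apply: noeth_adjs => //; exact: subfield_noeth.
  have hd i : exists d, L d /\ repr U (D i) d by have [d Ld r] := UD i; exists d.
  have [d dP] := choice hd.
  pose N := [set v : 'rV[K]_n | (forall j, A (v 0 j)) /\ forall w, \sum_j v 0 j * d j w = 0].
  have Nm : is_submod A N.
    split=> [|u v [Au hu] [Av hv]|a v Aa [Av hv]].
    + by split=> [j|w]; [rewrite mxE; exact: subring0|rewrite big1 // => j _; rewrite mxE mul0r].
    + split=> [j|w]; first by rewrite mxE; exact: subringD.
      rewrite (eq_bigr (fun j => u 0 j * d j w + v 0 j * d j w)) => [|j _]; last by rewrite mxE mulrDl.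
      by rewrite big_split /= hu hv addr0.
    + split=> [j|w]; first by rewrite mxE; exact: subringM.
      by rewrite (eq_bigr (fun j => a * (v 0 j * d j w))) -?mulr_sumr ?hv ?mulr0 // => j _; rewrite mxE mulrA.
  have [|s sN Ns] := noethm_rV As An Nm; first by move=> v [].
  have oV := openI oU oU'; have sA (j : 'I_(size s)) i : A (s`_j 0 i) by have [] := sN _ (mem_nth 0 (ltn_ord j)).
  have ht (ji : 'I_(size s) * 'I_n) : exists t, sec (U `&` U') t /\ forall y, (U `&` U') y -> io (t y) = s`_(ji.1) 0 ji.2.
    have [|t Vt et] := @sec_on (U `&` U') (s`_(ji.1) 0 ji.2) oV; last by exists t.
    by move=> y [_ U'y]; exact: (kc_sub kc U'y).
  have [t tP] := choice ht.
  exists (U `&` U'), (size s), (fun j i => t (j, i)); split=> // [j|W s' oW WV [Ws rel] y Wy].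
    split=> [i|]; first by have [] := tP (j, i).
    have rj : repr (U `&` U') (vcomb (fun i => t (j, i)) D) (fun a => \sum_i s`_j 0 i * d i a).
      apply: repr_comb => [i v Vv|i v [Uv _]]; first by have [_ ->] := tP (j, i).
      by have [_ r] := dP i; exact: r.
    apply: (repr_uniq rj) => v _ a; have [_ ->] := sN _ (mem_nth 0 (ltn_ord j)); exact: io0.
  have [c hc] := consts_sec oW Ws; have [Uy U'y] := WV y Wy.
  have c0 w : \sum_i c i * d i w = 0.
    have rW : repr W (vcomb s' D) (fun a => \sum_i c i * d i a).
      apply: repr_comb => // i v /WV[Uv _]; by have [_ r] := dP i; exact: r.
    have r0 : repr W (vcomb s' D) (fun=> 0) by move=> v Wv a; rewrite rel // io0.
    exact: (repr_gen oW Wy rW r0).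
  have [|a [Aa na Aac]] := denoms k0f fm kc (c := c) U'y.
    by move=> i; rewrite -(hc i y Wy); exists (s' i y).
  have a0 := m_nz fm na.
  have [f Af ef] : lspan A s (\row_i (a * c i)).
    apply: Ns; split=> [i|w]; first by rewrite mxE; exact: Aac.
    rewrite (eq_bigr (fun i => a * (c i * d i w))) -?mulr_sumr ?c0 ?mulr0 // => i _.
    by rewrite mxE mulrA.
  have ce i : c i = \sum_(j < size s) f j / a * s`_j 0 i.
    have := congr1 (fun r : 'rV_n => r 0 i) ef; rewrite mxE summxE => e.
    apply: (mulfI a0); rewrite e mulr_sumr; apply: eq_bigr => j _.
    by rewrite mxE mulrA [a * _]mulrC divfK.
  have gf (j : 'I_(size s)) : germs y (f j / a).
    apply: (subringM (O_sub fm y)); first exact: (kc_sub kc U'y).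
    by apply: (m_inv fm) => //; exact: (kc_sub kc U'y).
  have [W' [u [oW' W'y W'u eu]]] := secs_at gf; have oWW := openI oW' oW.
  exists (W' `&` W), u; split=> // [j|i v [W'v Wv]].
    by apply: (sec_restrict oW' oWW) (W'u j) => v [].
  apply: io_inj; rewrite io_sum (hc i v Wv) ce; apply: eq_bigr => j _.
  by rewrite (md_M M) eu //; have [_ ->] := tP (j, i) => //; exact: WV.
Qed.

Lemma Fol_foliation : foliation Fol.
Proof.
split; [exact: Fol_submodule|exact: Fol_coherent|].
move=> U D E oU [d Ld r] [e Le r']; exists (fun x => d (e x) - e (d x)); first exact: L_bracket.
by move=> x Ux a; rewrite /lie_bracket (md_B M) r // r' // r' // r.
Qed.

(** The section s is a nonzero constant of K, and it can be divided out on all of U because L is a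
    K-space. *)
Lemma Fol_saturated : saturated Fol.
Proof.
move=> U x s D oU Ux Us sx /(tangentP _ oU)[d dd r] [e Le r']; have [c hc] := (md_sec M s oU).1 Us.
have c0 : c != 0 by rewrite -(hc x Ux); apply: contra sx => /eqP /(md_inj M) ->.
exists U; split=> //; exists d => //; have -> : d = (fun w => c^-1 * e w); last exact: L_scaler.
apply/funext => w; apply: (mulfI c0); rewrite mulVKf //.
have rs : repr U (vscale s D) (fun w => c * d w) by move=> v Uv a; rewrite (md_M M) hc // r.
exact: (repr_gen oU Ux rs r').
Qed.

Lemma near_FolP x y (d : stalk y -> stalk y) : gen_of x y ->
  (near_fol Fol x y d <-> exists2 e, Lst L (germs x) e & forall a, io (d a) = e (io a)).
Proof.
move=> xy; split=> [[U [D [oU Ux Uy [e Le r] ->]]]|[e [Le st] h]].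
  by exists e; [split=> //; exact: (repr_stab r Ux)|exact: r].
have [U [oU Ux sU]] := stab_near consts_subfield (md_fm M) (L_der Le) st.
have [D r] := repr_exists sU; have Uy := xy U oU Ux.
exists U, D; split=> //; first by exists e.
by apply/funext => a; apply: io_inj; rewrite r.
Qed.

End Fol.
End KModel.

(** * The function field of an integral scheme *)

Section FunctionField.
Variables (k : fieldType) (X : kscheme k).
Hypotheses (Xi : integral_scheme X) (Xft : finite_type_over X).
Implicit Types (U V : set X).

(** Two disjoint nonempty open sets would carry indicator sections on their union, both nonzero and
    with product 0. *)
Lemma irreducible U V : open U -> open V -> U !=set0 -> V !=set0 -> U `&` V !=set0.
Proof.
move=> oU oV [x Ux] [y Vy]; apply: contrapT => UV0.
have nUV w : U w -> ~ V w by move=> Uw Vw; apply: UV0; exists w.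
pose ind W : germ_family X := fun w => if `[< W w >] then 1 else 0.
have z (W : set X) : open W -> sec W (fun w => 0 : stalk w).
  by move=> oW; apply: (sec_ext oW) (sec_sub oW (sec_one oW) (sec_one oW)) => w _; rewrite subrr.
have h W W' : open W -> open W' -> (forall w, W w -> ~ W' w) -> sec (W `|` W') (ind W).
  move=> oW oW' d; have oWW := openU oW oW'; apply: (sec_glue oWW) => w [Ww|W'w].
    by exists W; split=> //; apply: (sec_ext oW) (sec_one oW) => v Wv; rewrite /ind asboolT.
  by exists W'; split=> //; refine (sec_ext oW' _ (z W' oW')) => v W'v; rewrite /ind asboolF // => /d.
have oUV := openU oU oV.
have hV : sec (U `|` V) (ind V) by rewrite setUC; apply: h => // w Vw Uw; exact: (nUV w).
have [||s0|t0] := Xi.2 _ oUV _ _ _ (h _ _ oU oV nUV) hV; first by exists x; left.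
- move=> w [Uw|Vw]; rewrite /ind.
    by rewrite (asboolF (nUV _ Uw)) mulr0.
  have nU : ~ U w by move=> /nUV.
  by rewrite (asboolF nU) mul0r.
- by have := s0 x (or_introl Ux); rewrite /ind asboolT // => /eqP; rewrite oner_eq0.
- by have := t0 y (or_intror Vy); rewrite /ind asboolT // => /eqP; rewrite oner_eq0.
Qed.

Lemma prime_inT (R : comNzRingType) (q : set R) : prime_in setT q -> is_prime q.
Proof. by move=> [_ [q0 qD qM] q1 qp]; split=> // [|a b]; [split=> // a b; exact: qM|exact: qp]. Qed.

(** The annihilator of a is contained in no prime of the chart. *)
Lemma chart_eq0 U (A : comNzRingType) (rho : forall x : X, A -> stalk x) a : affine_chart U rho ->
  (forall x, U x -> rho x a = 0) -> a = 0.
Proof.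
move=> ch a0; pose I : set A := [set d | d * a = 0].
suff: I 1 by rewrite /I /= mul1r.
apply: contrapT => I1; have Ts : is_subring (setT : set A) by [].
have Im : is_submod setT (I : set A^o).
  split=> [|b c hb hc|b c _ hc]; rewrite /I /= ?mul0r //.
    by rewrite mulrDl hb hc addr0.
  by rewrite [b *: c]/(b * c) -mulrA hc mulr0.
have [|||||q [qP Iq _]] := @prime_avoid A setT I [set 1] Ts Im => //.
- by move=> b c -> ->; rewrite mulr1.
- by move=> b Ib b1; apply: I1; rewrite -b1.
have [x [[Ux qE] _]] := chart_points ch (prime_inT qP).
have [d [ud da]] := chart_ker ch Ux (a0 x Ux).
by have := Iq d da; rewrite qE /= ud.
Qed.

Lemma chart_domain U (A : comNzRingType) (rho : forall x : X, A -> stalk x) (a b : A) : affine_chart U rho ->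
  U !=set0 -> a * b = 0 -> a = 0 \/ b = 0.
Proof.
move=> ch U0 ab; have [x Ux|h|h] := Xi.2 U (chart_open ch) U0 _ _ (chart_sec ch a) (chart_sec ch b).
- by rewrite -(chart_mul ch) // ab (chart0 ch).
- by left; exact: chart_eq0 ch h.
- by right; exact: chart_eq0 ch h.
Qed.

(** The zero ideal of the coordinate ring of a chart is prime and defines the generic point. *)
Lemma generic_exists : exists y : X, dense y /\ forall b : stalk y, b != 0 -> b \is a GRing.unit.
Proof.
have [x0 _] := Xi.1; have [U [A [rho [h [ch Ux0 _ _]]]]] := Xft.2 x0.
have p0 : is_prime [set 0 : A].
  split=> [|/= /eqP|a b /= /(chart_domain ch (ex_intro _ x0 Ux0))//]; last by rewrite oner_eq0.
  by split=> [//|a b /= -> ->|a b /= ->]; rewrite ?addr0 ?mulr0.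
have [y [[Uy yE] _]] := chart_points ch p0.
have uy a : a != 0 -> rho y a \is a GRing.unit.
  move=> a0; apply: contrapT => /negP na; have : [set a | rho y a \isn't a GRing.unit] a by [].
  by rewrite -yE /= => a0'; rewrite a0' eqxx in a0.
exists y; split=> [V oV [v Vv]|b b0].
  have [w [Vw Uw]] : V `&` U !=set0 by apply: irreducible => //; [exact: chart_open ch|exists v|exists x0].
  have [a [ua aV]] := chart_base ch oV Vw Uw; apply: aV => //; apply: uy.
  by apply/eqP => a0; move: ua; rewrite a0 (chart0 ch) // unitr0.
have [a [d [ud bE]]] := chart_frac ch b Uy; rewrite bE unitrM unitrV ud andbT; apply: uy.
by apply/eqP => a0; move: b0; rewrite bE a0 (chart0 ch) // mul0r eqxx.
Qed.

Section GenericStalk.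
Variables (y : X) (dy : dense y) (Ky : forall b : stalk y, b != 0 -> b \is a GRing.unit).

Definition ffield : fieldType := HB.pack (GRing.ComUnitRing.sort (stalk y))
  (GRing.ComUnitRing_isField.Build (GRing.ComUnitRing.sort (stalk y)) Ky).

Lemma ff_exists x (a : stalk x) : exists c : ffield, exists U (s : germ_family X), [/\ open U, U x, sec U s, s x = a & c = s y].
Proof. by have [U [s [oU Ux Us sa]]] := sec_germ a; exists (s y), U, s. Qed.

(** A germ at x is carried to the generic point by any section that extends it; [ffE] gives
    independence of the choice. *)
Definition ff x (a : stalk x) : ffield := projT1 (cid (ff_exists a)).

Lemma ffE x U (s : germ_family X) : open U -> U x -> sec U s -> ff (s x) = s y.
Proof.
move=> oU Ux Us; rewrite /ff; case: cid => c hc; have [V [t [oV Vx Vt e /= ->]]] := hc.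
have [W [oW Wx _ h]] := germ_eq oV oU Vx Ux Vt Us e.
by apply: h; apply: dy => //; exists x.
Qed.

Lemma ff_sec2 x (a b : stalk x) : exists U (s t : germ_family X), [/\ open U, U x, sec U s, sec U t & s x = a /\ t x = b].
Proof.
have [U [s [oU Ux Us sa]]] := sec_germ a; have [V [t [oV Vx Vt tb]]] := sec_germ b.
have oUV := openI oU oV; exists (U `&` V), s, t; split=> //.
  by apply: (sec_restrict oU oUV) Us => w [].
by apply: (sec_restrict oV oUV) Vt => w [].
Qed.

Lemma ffB x (a b : stalk x) : ff (a - b) = ff a - ff b.
Proof.
have [U [s [t [oU Ux Us Ut [<- <-]]]]] := ff_sec2 a b.
by rewrite (ffE oU Ux Us) (ffE oU Ux Ut) (ffE oU Ux (sec_sub oU Us Ut)).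
Qed.

Lemma ffM x (a b : stalk x) : ff (a * b) = ff a * ff b.
Proof.
have [U [s [t [oU Ux Us Ut [<- <-]]]]] := ff_sec2 a b.
by rewrite (ffE oU Ux Us) (ffE oU Ux Ut) (ffE oU Ux (sec_mul oU Us Ut)).
Qed.

Lemma ff1 x : ff (1 : stalk x) = 1.
Proof. exact: (@ffE x setT (fun w => 1) openT I (sec_one openT)). Qed.

Lemma chart_ff U (A : comNzRingType) (rho : forall x : X, A -> stalk x) x a : affine_chart U rho -> U x ->
  ff (rho x a) = rho y a.
Proof. by move=> ch Ux; exact: (ffE (chart_open ch) Ux (chart_sec ch a)). Qed.

Lemma chart_inj U (A : comNzRingType) (rho : forall x : X, A -> stalk x) a : affine_chart U rho -> U y ->
  rho y a = 0 -> a = 0.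
Proof.
move=> ch Uy /(chart_ker ch Uy)[d [ud]] /(chart_domain ch (ex_intro _ y Uy))[d0|//].
by move: ud; rewrite d0 (chart0 ch) // unitr0.
Qed.

Lemma ff_div x U (A : comNzRingType) (rho : forall x : X, A -> stalk x) a d : affine_chart U rho -> U x ->
  rho x d \is a GRing.unit -> (rho y d : ffield) != 0 /\ ff (rho x a / rho x d) = (rho y a : ffield) / rho y d.
Proof.
move=> ch Ux ud; have [d0 dV] := embV (@ffM x) (ff1 x) ud.
by rewrite -!(chart_ff _ ch Ux); split=> //; rewrite ffM dV.
Qed.

Lemma ff_inj x (a : stalk x) : ff a = 0 -> a = 0.
Proof.
have [U [A [rho [_ [ch Ux _ _]]]]] := Xft.2 x; have Uy : U y by apply: dy; [exact: chart_open ch|exists x].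
have [b [d [ud ->]]] := chart_frac ch a Ux; have [d0 ->] := ff_div b ch Ux ud.
move=> /eqP; rewrite mulf_eq0 invr_eq0 (negPf d0) orbF => /eqP /(chart_inj ch Uy) ->.
by rewrite (chart0 ch) // mul0r.
Qed.

Lemma ff_sec U s : open U -> (sec U s <-> exists c, forall x, U x -> ff (s x) = c).
Proof.
move=> oU; split=> [Us|[c hc]]; first by exists (s y) => x Ux; exact: (ffE oU).
apply: (sec_glue oU) => x Ux; have [V [t [oV Vx Vt tx]]] := sec_germ (s x).
have oUV := openI oU oV; exists (U `&` V); split=> //.
apply: (@sec_ext _ _ t) => // [w [Uw Vw]|]; last by apply: (sec_restrict oV oUV) Vt => w [].
apply/eqP; rewrite -subr_eq0; apply/eqP/ff_inj; rewrite ffB (hc w Uw) (ffE oV Vw Vt) -(hc x Ux) -tx.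
by rewrite (ffE oV Vx Vt) subrr.
Qed.

Let ff_nonunit x (a : stalk x) : nonu (range (@ff x)) (ff a) <-> a \isn't a GRing.unit.
Proof. exact: (emb_nonunit (@ffB x) (@ffM x) (ff1 x) (@ff_inj x)). Qed.

Lemma ff_model : kmodel (@ff).
Proof.
split; [exact: ffB|exact: ffM|exact: ff1|exact: ff_inj|exact: ff_sec|].
split=> [x||]; [exact: (emb_local (@ffB x) (@ffM x) (ff1 x) (@ff_inj x) (@stalk_nonunitD X x))| |]; last first.
  exists y => //; apply/seteqP; split=> // c _; have [U [s [oU Uy Us sc]]] := sec_germ (c : stalk y).
  by exists (s y) => //; rewrite (ffE oU Uy Us).
move=> x; have [U [A [rho [h [ch Ux hs [n [b bg]]]]]]] := Xft.2 x.
have Uy : U y by apply: dy; [exact: chart_open ch|exists x].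
pose al a : ffield := rho y a.
have alE a w : U w -> ff (rho w a) = al a by exact: (chart_ff a ch).
exists U, (codom (al \o b)); split=> //.
have c0s : is_subring (consts (@ff)).
  split=> [|c d [a ac] [a' ad]|c d [a ac] [a' ad]].
  - by exists 1 => w; rewrite rmorph1 ff1.
  - by exists (a - a') => w; rewrite rmorphB ffB ac ad.
  - by exists (a * a') => w; rewrite rmorphM ffM ac ad.
have alB a a' : al (a - a') = al a - al a' by exact: (chart_sub ch).
have alM a a' : al (a * a') = al a * al a' by exact: (chart_mul ch).
have al1 : al 1 = 1 by exact: (chart_one ch).
have As := adjs_subring (codom (al \o b)) c0s.
have alA a : adjs (consts (@ff)) (codom (al \o b)) (al a).
  have := bg [set a | adjs (consts (@ff)) (codom (al \o b)) (al a)].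
  move=> e; suff -> : adjs (consts (@ff)) (codom (al \o b)) (al a) = setT a by [].
  rewrite -(e _ _ _) //.
  - split=> /= [|u v Au Av|u v Au Av]; rewrite ?al1 ?alB ?alM; [exact: subring1|exact: subringB|exact: subringM].
  - move=> c /=; apply: sub_adjs => //; have [c' hc'] := (ff_sec _ openT).1 (@scalar_sec k X c).
    exists c => w; rewrite hc' // -(hc' y) // -hs // alE //.
  - by move=> i /=; apply: mem_adjs => //; exact: codom_f.
have Aal c : adjs (consts (@ff)) (codom (al \o b)) c -> exists a, c = al a.
  move: c; apply: adjs_min => [|c [a ac]|c /codomP[i ->]]; last by exists (b i).
  - split=> [|_ _ [a ->] [a' ->]|_ _ [a ->] [a' ->]]; first by exists 1.
      by exists (a - a').
    by exists (a * a').
  - by exists (h a); rewrite /al hs // -(ac y) -hs // alE.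
have nu w a : U w -> (nonu (range (@ff w)) (al a) <-> rho w a \isn't a GRing.unit).
  by move=> Uw; rewrite -(alE a w Uw); exact: ff_nonunit.
have nnu w a : U w -> (~ nonu (range (@ff w)) (al a) <-> rho w a \is a GRing.unit).
  by move=> Uw; rewrite nu //; split=> [/negP/negPn|->].
split.
- exact: chart_open ch.
- by move=> w Uw c /Aal[a ->]; exists (rho w a) => //; exact: alE.
- move=> w _ Uw [c _ <-]; have [a [d [ud ->]]] := chart_frac ch c Uw.
  by exists (al a), (al d); split=> //; [exact/nnu|have [] := ff_div a ch Uw ud].
- move=> p [_ pm p1 pp]; have [p0 pD pM] := pm.
  have al0 : al 0 = 0 by rewrite -(subrr 0) alB subrr.
  have alD a a' : al (a + a') = al a + al a' by rewrite -{1}[a']opprK -[- a']sub0r !alB al0 sub0r opprK.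
  have [|w [[Uw e] _]] := chart_points ch (_ : is_prime [set a | p (al a)]).
    split=> [|/=|a a' /=]; [|by rewrite al1|by rewrite alM => /(pp _ _ (alA _) (alA _))].
    split=> [|a a' /= pa pa'|a a' /= pa']; rewrite /= ?al0 ?alD ?alM //; first exact: pD.
    exact: (submodM pm).
  exists w; split=> // c /Aal[a ->]; rewrite nu //.
  by have := congr1 (fun S : set A => S a) e; rewrite /= => ->.
- move=> w v Uw Uv e; apply: (chart_point ch) => // a.
  by rewrite -!nnu //; have := e _ (alA a); tauto.
- move=> V w oV Vw Uw; have [a [ua aV]] := chart_base ch oV Vw Uw.
  by exists (al a); split=> //; [exact/nnu|move=> v Uv /nnu uv; apply: aV => //; exact: uv].
- move=> c /Aal[a ->]; rewrite (_ : [set w | _] = [set w | U w /\ rho w a \is a GRing.unit]).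
    exact: (chart_basic_open ch).
  by apply/seteqP; split=> w [Uw h']; split=> //; exact/nnu.
Qed.
End GenericStalk.

Theorem model_exists : exists (K : fieldType) (io : forall x : X, stalk x -> K), kmodel io.
Proof. by have [y [dy Ky]] := generic_exists; exists (ffield Ky), (@ff y Ky); exact: ff_model. Qed.
End FunctionField.

(** * Schemes realised from families of local subrings *)

Section ModelChart.
Variables (X : ringed_space) (K : fieldType) (io : forall x : X, stalk x -> K).
Let O (x : X) : set K := range (@io x).
Hypotheses (iB : forall x a b, @io x (a - b) = io a - io b) (iM : forall x a b, @io x (a * b) = io a * io b)
  (i1 : forall x, @io x 1 = 1) (i0 : forall x a, @io x a = 0 -> a = 0)
  (isec : forall U s c, open U -> (forall x, U x -> io (s x) = c) -> sec U s)
  (il : forall x, localring (O x) (nonu (O x))).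

Lemma mi0 x : @io x 0 = 0. Proof. exact: emb0 (@iB x). Qed.
Lemma mi_inj x : injective (@io x). Proof. exact: (emb_inj (@iB x) (@i0 x)). Qed.
Lemma nonu_pr x : prime_in (O x) (nonu (O x)). Proof. by case: (il x). Qed.
Lemma mi_unit x (a : stalk x) : a \is a GRing.unit <-> ~ nonu (O x) (io a).
Proof. exact: (emb_unit (@iB x) (@iM x) (@i1 x) (@i0 x)). Qed.

Variables (U : set X) (A : set K) (As : is_subring A).
Hypothesis kc : kchart O U A.

Lemma crho_exists (x : X) (a : subr_of As) : exists b : stalk x, U x -> io b = \val a.
Proof.
have [Ux|nU] := pselect (U x); last by exists 0.
by have [b _ e] := kc_sub kc Ux (subr_valP a); exists b.
Qed.

Definition crho (x : X) (a : subr_of As) : stalk x := projT1 (cid (crho_exists x a)).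

Lemma crhoK x a : U x -> io (crho x a) = \val a.
Proof. by rewrite /crho; case: cid. Qed.

Lemma crho_unit x a : U x -> crho x a \is a GRing.unit <-> ~ nonu (O x) (\val a).
Proof. by move=> Ux; rewrite mi_unit crhoK. Qed.

Lemma kchart_affine : affine_chart U crho.
Proof.
have nU (x : X) (a : subr_of As) : U x -> (crho x a \isn't a GRing.unit) = true <-> nonu (O x) (\val a).
  move=> Ux; split=> [/negP h|h]; first by apply: contrapT => /(crho_unit _ Ux).
  by apply/negP => /(crho_unit _ Ux).
split.
- exact: kc_open kc.
- by move=> x Ux; apply: mi_inj; rewrite crhoK // rmorph1 i1.
- by move=> x a b Ux; apply: mi_inj; rewrite iB !crhoK // rmorphB.
- by move=> x a b Ux; apply: mi_inj; rewrite iM !crhoK // rmorphM.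
- by move=> a; apply: (isec (c := \val a) (kc_open kc)) => x Ux; exact: crhoK.
- move=> x Ux; have [mO [m0 mD mM] m1 mp] := nonu_pr x; have AO := kc_sub kc Ux.
  have Ax (a : subr_of As) : O x (\val a) by apply: AO; exact: subr_valP.
  have e : [set a | crho x a \isn't a GRing.unit] = [set a : subr_of As | nonu (O x) (\val a)].
    by apply/seteqP; split=> a /= /(nU _ _ Ux).
  rewrite e; split; last 2 first.
  + by move=> h; have : nonu (O x) (\val (1 : subr_of As)) by []; rewrite rmorph1.
  + by move=> a b h; have : nonu (O x) (\val (a * b)) by []; rewrite rmorphM => /mp[]; [exact: Ax|exact: Ax|left|right].
  split=> [|a b na nb|a b nb].
  + by suff : nonu (O x) (\val (0 : subr_of As)) by []; rewrite rmorph0.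
  + by suff : nonu (O x) (\val (a + b)) by []; rewrite rmorphD; exact: mD.
  + by suff : nonu (O x) (\val (a * b)) by []; rewrite rmorphM; apply: (mM (\val a)) => //; exact: Ax.
- move=> P [[P0 PD PM] P1 Pp]; pose p : set K := [set c | exists2 a : subr_of As, P a & \val a = c].
  have pP (a : subr_of As) : p (\val a) <-> P a by split=> [[b Pb /val_inj <-]|Pa]; last exists a.
  have AS c : A c -> exists a : subr_of As, \val a = c by move=> Ac; exists (tosub As c); exact: tosubK.
  have pp : prime_in A p.
    split=> [_ [a _ <-]||[a Pa a1]|a b /AS[a' <-] /AS[b' <-]].
    - exact: subr_valP.
    - split=> [|_ _ [a Pa <-] [b Pb <-]|c _ /AS[c' <-] [a Pa <-]].
      + by exists 0 => //; rewrite rmorph0.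
      + by exists (a + b); [exact: PD|rewrite rmorphD].
      + by exists (c' * a); [exact: PM|rewrite rmorphM].
    - by apply: P1; suff <- : a = 1 by []; apply: val_inj; rewrite a1.
    - by rewrite -rmorphM => /pP /Pp[h|h]; [left|right]; apply/pP.
  have [x [Ux xp]] := kc_point kc pp.
  have xP (a : subr_of As) : P a <-> nonu (O x) (\val a) by rewrite -pP; apply: xp; exact: subr_valP.
  exists x; split=> [|x' [Ux' e]]; first by split=> //; apply/seteqP; split=> a /=; [move/xP/(nU _ _ Ux)|move/(nU _ _ Ux)/xP].
  apply: (kc_uniq kc) => // c /AS[a <-]; rewrite -xP e; split=> [/(nU _ _ Ux')//|].
  by move=> h; apply/(nU x' a Ux').
- move=> V x oV Vx Ux; have [a [Aa na aV]] := kc_base kc oV Vx Ux; have ta := tosubK As Aa.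
  exists (tosub As a); split; first by apply/(crho_unit _ Ux); rewrite ta.
  by move=> y Uy /(crho_unit _ Uy); rewrite ta; exact: aV.
- move=> a; rewrite (_ : [set x | _] = [set x | U x /\ ~ nonu (O x) (\val a)]).
    by apply: (kc_basic kc); exact: subr_valP.
  by apply/seteqP; split=> x [Ux h]; split=> //; apply/(crho_unit _ Ux).
- move=> x b Ux; have [a [d [Aa Ad nd e]]] := kc_frac kc Ux (ex_intro2 _ _ b I erefl : O x (io b)).
  have ud : crho x (tosub As d) \is a GRing.unit by apply/(crho_unit _ Ux); rewrite tosubK.
  exists (tosub As a), (tosub As d); split=> //; apply: (mulIr ud); rewrite divrK //; apply: mi_inj.
  by rewrite iM !crhoK // !tosubK // e divfK //; exact: prime_nz (nonu_pr x) nd.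
- move=> x a Ux /(congr1 (@io x)); rewrite crhoK // mi0 => a0; exists 1; split; last by rewrite mul1r; exact: val_inj.
  by apply/(crho_unit _ Ux); rewrite rmorph1; case: (nonu_pr x).
Qed.
End ModelChart.

Section Realisation.
Variables (k K : fieldType) (sg : {rmorphism k -> K}) (T : topologicalType) (O : T -> set K).
Hypothesis fm : fmodel O (range sg).
Let Os x : is_subring (O x) := O_sub fm x.

Definition rstalk (x : T) : comUnitRingType := subr_of (Os x).
Definition rsec (U : set T) : set (forall x, rstalk x) :=
  [set s | exists c, forall x, U x -> \val (s x) = c].

Lemma rstalk_in x (a : rstalk x) : O x (\val a). Proof. exact: subr_valP. Qed.

Lemma k0_subfield : subfield (range sg).
Proof.
split=> [|_ [a _ <-]]; last by exists a^-1 => //; exact: fmorphV.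
split=> [|_ _ [a _ <-] [b _ <-]|_ _ [a _ <-] [b _ <-]]; first by exists 1 => //; exact: rmorph1.
  by exists (a - b) => //; exact: rmorphB.
by exists (a * b) => //; exact: rmorphM.
Qed.

Lemma sg_in x c : O x (sg c).
Proof. by have [U [z [Ux kc]]] := fm_chart fm x; apply: (k0_sub k0_subfield kc Ux); exists c. Qed.

(** Sections over U are families with one common value in K. They glue because all nonempty open
    sets contain the generic point. *)
Definition real_ringed : ringed_space.
Proof.
refine (@RingedSpace T rstalk rsec _ _ _ _ _ _ _ _).
- by move=> U s t _ st [c hc]; exists c => x Ux; rewrite -st //; exact: hc.
- by move=> U V s _ _ VU [c hc]; exists c => x /VU; exact: hc.
- move=> U s oU h; have [y dy Oy] := fm_gen fm; exists (\val (s y)) => x Ux; have [V [oV Vx [c hc]]] := h x Ux.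
  by rewrite hc // hc //; apply: dy => //; exists x.
- by move=> U _; exists 1.
- by move=> U s t _ [c hc] [d hd]; exists (c - d) => x Ux; rewrite rmorphB /= hc // hd.
- by move=> U s t _ [c hc] [d hd]; exists (c * d) => x Ux; rewrite rmorphM /= hc // hd.
- move=> x a; have [V [oV Vx VO]] := open_germ fm (rstalk_in a).
  exists V, (fun y => tosub (Os y) (\val a)); split=> //; last exact: valtosub.
  by exists (\val a) => w Vw; apply: tosubK; exact: VO.
- move=> U s x oU Ux [c hc] s0; exists U; split=> // w Uw; apply: val_inj.
  by rewrite /= hc // -(hc x Ux) s0.
Defined.

Lemma rval_unit x (a : rstalk x) : a \is a GRing.unit <-> ~ nonu (O x) (\val a).
Proof.
split=> [/subr_unitP[y Oy ya] [_ h]|nu].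
  have a0 : \val a != 0 by apply/eqP => a0; move: ya; rewrite a0 mulr0 => /esym/eqP; rewrite oner_eq0.
  by move/eqP: (a0); apply; apply: h; rewrite -[_^-1]mul1r -ya mulfK.
apply/subr_unitP; exists (\val a)^-1; first by apply: (m_inv fm) => //; exact: rstalk_in.
by rewrite mulVf //; exact: (m_nz fm nu).
Qed.

Lemma rstalk_range : (fun x => range (fun a : rstalk x => \val a)) = O.
Proof.
apply/funext => x; apply/seteqP; split=> c; first by move=> [a _ <-]; exact: rstalk_in.
by move=> Oc; exists (tosub (Os x) c) => //; exact: tosubK.
Qed.

Definition real_scheme : scheme.
Proof.
exists real_ringed => x; have [U [z [Ux kc]]] := fm_chart fm x.
have As := adjs_subring z k0_subfield.1.
have kc' : kchart (fun y : real_ringed => range (fun a : rstalk y => \val a)) U (adjs (range sg) z) by rewrite rstalk_range.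
exists U, (subr_of As), (crho (As := As) kc'); split=> //; apply: kchart_affine => //.
- by move=> y a a0; exact: val_inj.
- by move=> V s c _ h; exists c.
- move=> y; have e := congr1 (fun f => f y) rstalk_range; rewrite e; exact: fm_local fm y.
Defined.

Section Scalar.
Variable x : T.
Definition rscal (c : k) : rstalk x := tosub (Os x) (sg c).
Lemma rscalK c : \val (rscal c) = sg c. Proof. by apply: tosubK; exact: sg_in. Qed.
Lemma rscalB : zmod_morphism rscal.
Proof. by move=> a b; apply: val_inj; rewrite rmorphB /= !rscalK rmorphB. Qed.
Lemma rscalM : monoid_morphism rscal.
Proof. by split=> [|a b]; apply: val_inj; rewrite ?rmorphM /= !rscalK ?rmorph1 ?rmorphM. Qed.
HB.instance Definition _ := GRing.isZmodMorphism.Build k (rstalk x) rscal rscalB.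
HB.instance Definition _ := GRing.isMonoidMorphism.Build k (rstalk x) rscal rscalM.
Definition rscalr : {rmorphism k -> rstalk x} := rscal.
End Scalar.

Definition realisation : kscheme k.
Proof. by exists real_scheme rscalr => c; exists (sg c) => x _; exact: rscalK. Defined.

Lemma real_model : @kmodel k realisation K (fun x a => \val a).
Proof.
have [y dy Oy] := fm_gen fm.
have e : consts (fun (x : realisation) (a : stalk x) => \val a) = range sg.
  apply/seteqP; split=> c [a]; first by move=> /(_ y); rewrite rscalK => <-; exists a.
  by move=> _ <-; exists a => x; rewrite rscalK.
have g x : germs (fun (x : realisation) (a : stalk x) => \val a) x = O x.
  apply/seteqP; split=> c; first by move=> [a _ <-]; exact: rstalk_in.
  by move=> Oc; exists (tosub (Os x) c) => //; exact: tosubK.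
split=> //; first by move=> x a a0; exact: val_inj.
rewrite e; have -> : germs (fun (x : realisation) (a : stalk x) => \val a) = (O : realisation -> set K).
  exact/funext.
exact: fm.
Qed.

Lemma real_integral : integral_scheme realisation.
Proof.
have [y dy Oy] := fm_gen fm; split; first by exists y.
move=> U oU U0 s t [c hc] [d hd] st; have Uy := dy U oU U0.
have := congr1 val (st y Uy); rewrite rmorphM /= hc // hd // => /eqP; rewrite mulf_eq0 => /orP[/eqP e|/eqP e]; [left|right].
  by move=> x Ux; apply: val_inj; rewrite /= hc.
by move=> x Ux; apply: val_inj; rewrite /= hd.
Qed.

Lemma real_normal : (forall x, integral (O x) `<=` O x) -> normal_scheme realisation.
Proof.
move=> On x; split=> [a b /(congr1 val)|a b n c b0 h].
  by rewrite rmorphM /= => /eqP; rewrite mulf_eq0 => /orP[]/eqP e; [left|right]; exact: val_inj.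
have vb : \val b != 0 by apply: contra b0 => /eqP e; apply/eqP; exact: val_inj.
pose c' i := if insub i is Some j then \val (c j) else 0.
have c'E (i : 'I_n) : c' i = \val (c i) by rewrite /c' (valK i).
have Od : O x (\val a / \val b).
  apply: On; exists n, c'; split=> [i|].
    by rewrite /c'; case: insub => [j|]; [exact: rstalk_in|exact: subring0].
  rewrite expr_div_n; have := congr1 val h; rewrite rmorphXn rmorph_sum => ->.
  rewrite mulr_suml; apply: eq_bigr => i _; rewrite c'E !rmorphM !rmorphXn expr_div_n -!mulrA; congr (_ * (_ * _)).
  rewrite -[in _ ^- n](subnK (ltnW (ltn_ord i))) exprD invfM mulrA mulfV ?mul1r //.
  by rewrite expf_neq0.
exists (tosub (Os x) (\val a / \val b)); apply: val_inj.
by rewrite rmorphM /= tosubK // mulrC divfK.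
Qed.

End Realisation.

(** * The normalised blow-up *)

Section LocalRings.
Context {K : fieldType}.
Implicit Types (B S q : set K).

Lemma locz_integral B q : is_subring B -> integral B `<=` B -> prime_in B q -> integral (locz B q) `<=` locz B q.
Proof.
move=> Bs iB qp x [n [c [Lc xn]]]; have [_ qm q1 qpr] := qp.
have [b [Bb nb hb]] : exists b, [/\ B b, ~ q b & forall i, (i < n)%N -> B (b * c i)].
  elim: {xn} n => [|n [b [Bb nb hb]]]; first by exists 1; split=> //; exact: subring1.
  have [u [v [Bu Bv nv e]]] := Lc n; exists (b * v); split; [exact: subringM|by move=> /qpr[]|].
  move=> i; rewrite ltnS leq_eqVlt => /orP[/eqP ->|/hb Bi]; last by rewrite mulrAC; exact: subringM.
  by rewrite e -mulrA [v * _]mulrC divfK ?(prime_nz qp nv) //; exact: subringM.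
have b0 := prime_nz qp nb; exists (b * x), b; split=> //; last by rewrite mulrC mulKf.
apply: iB; exists n, (fun i => if (i < n)%N then b * c i * b ^+ (n - i).-1 else 0); split=> [i|].
  by case: ifP => [/hb Bi|_]; [apply: subringM => //; exact: subringX|exact: subring0].
rewrite exprMn xn mulr_sumr; apply: eq_bigr => i _; rewrite ltn_ord exprMn.
rewrite (expr_split b (ltnW (ltn_ord i))) -[in b ^+ (n - i)](prednK (n := n - i)) ?subn_gt0 // exprS.
by ring.
Qed.

Lemma nonu_prime S : localring S (nonu S) -> prime_in S (nonu S). Proof. by case. Qed.

Lemma nonuP S c : localring S (nonu S) -> S c -> c != 0 -> ~ nonu S c <-> S c^-1.
Proof.
move=> [_ _ Si] Sc c0; split=> [|SV [_ /(_ SV)]]; [exact: Si|by move/eqP: c0].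
Qed.

Variables (k0 : set K) (k0f : subfield k0) (z : seq K).
Let B := adjs k0 z.
Hypothesis iB : integral B `<=` B.
Let Bs : is_subring B. Proof. by apply: adjs_subring; exact: k0f.1. Qed.

Lemma nonu_sub S : localring S (nonu S) -> B `<=` S -> prime_in B (B `&` nonu S).
Proof. by move=> Sl BS; exact: (prime_contract Bs BS (nonu_prime Sl)). Qed.

Lemma locz_nonu q : prime_in B q -> nonu (locz B q) = mz k0 z q.
Proof. by move=> qp; apply: nonuE; exact: (locz_local k0f). Qed.

(** The localization at the centre of S is the local normal ring over B against which the minimality
    clause [bl_min] is tested. *)
Lemma locz_min S (q := B `&` nonu S) : localring S (nonu S) -> B `<=` S ->
  [/\ localring (locz B q) (nonu (locz B q)), integral (locz B q) `<=` locz B q, locz B q `<=` S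
    & forall c, nonu (locz B q) c -> nonu S c].
Proof.
move=> Sl BS; have qp := nonu_sub Sl BS; have [Ss _ Si] := Sl; have [_ [_ _ mM] _ _] := nonu_prime Sl.
have inv b : B b -> ~ q b -> S b^-1 by move=> Bb nq; apply: Si; [exact: BS|move=> h; apply: nq].
rewrite locz_nonu //; split; [exact: (locz_local k0f)|exact: locz_integral| |].
  by move=> _ [a [b [Ba Bb nb ->]]]; apply: subringM => //; [exact: BS|exact: inv].
by move=> _ [a [b [[_ ma] Bb nb ->]]]; rewrite mulrC; apply: (mM b^-1) => //; exact: inv.
Qed.
End LocalRings.

Section BlowUp.
Context {K : fieldType}.
Hypothesis char0 : forall n, n.+1%:R != 0 :> K.
Variables (k0 : set K) (k0f : subfield k0) (T : topologicalType) (O : T -> set K).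
Hypothesis fm : fmodel O k0.
Variable xi : T.
Hypothesis xi_nz : exists2 t, nonu (O xi) t & t != 0.
Implicit Types (x : T) (S : set K).
Let k0s : is_subring k0. Proof. exact: k0f.1. Qed.
Let Os x : is_subring (O x). Proof. exact: (O_sub fm). Qed.

(** x lies in the closure of xi. *)
Definition spz x := forall V, open V -> V x -> V xi.
(** The stalk at x of the ideal of the closure of xi; away from this closure it is the whole local
    ring. *)
Definition bideal x : set K := [set a | O x a /\ (spz x -> nonu (O xi) a)].

Lemma spz_sub x : spz x -> O x `<=` O xi. Proof. by move=> s; exact: (O_gen fm s). Qed.

(* Points of the normalised blow-up of the ideal sheaf bideal above x: the local
   rings at the points above x of the normalisation of Spec (O x)[bideal x / f],
   singled out as the smallest local normal rings with given domination. *)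
Record blpt x S : Prop := BlPt {
  bl_local : localring S (nonu S);
  bl_normal : integral S `<=` S;
  bl_sub : O x `<=` S;
  bl_dom : forall a, nonu (O x) a -> nonu S a;
  bl_min : exists f, [/\ bideal x f, f != 0, forall a, bideal x a -> S (a / f) &
    forall S', localring S' (nonu S') -> integral S' `<=` S' -> O x `<=` S' ->
      (forall a, bideal x a -> S' (a / f)) -> S' `<=` S -> (forall c, nonu S' c -> nonu S c) -> S `<=` S'] }.

Definition bpt := {p : T * set K | blpt p.1 p.2}.
Implicit Types p : bpt.
Definition bpi p : T := (sval p).1.
Definition bO p : set K := (sval p).2.
Definition bbase (V : set T) (bs : seq K) : set bpt := [set p | V (bpi p) /\ forall b, b \in bs -> bO p b].
Definition bbases : set (set bpt) := [set B | exists V bs, open V /\ B = bbase V bs].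

Lemma bbasesP : bbases setT /\ forall A B, bbases A -> bbases B -> bbases (A `&` B).
Proof.
split; first by exists setT, [::]; split; [exact: openT|apply/seteqP; split].
move=> _ _ [V [bs [oV ->]]] [W [cs [oW ->]]]; exists (V `&` W), (bs ++ cs); split; first exact: openI.
apply/seteqP; split=> p.
  by move=> [[Vp hb] [Wp hc]]; split=> // b; rewrite mem_cat => /orP[/hb|/hc].
by move=> [[Vp Wp] h]; split; split=> // b bb; apply: h; rewrite mem_cat bb ?orbT.
Qed.

Definition bspc := bspace bbasesP.

Lemma blP p : blpt (bpi p) (bO p). Proof. exact: (svalP p). Qed.

Lemma bdomP p a : O (bpi p) a -> (nonu (O (bpi p)) a <-> nonu (bO p) a).
Proof.
have [l _ s d _] := blP p; move=> Oa; split=> [|na]; first exact: d.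
apply: contrapT => nn; have OV := m_inv fm Oa nn; have a0 := m_nz fm nn.
exact: ((nonuP l (s _ Oa) a0).2 (s _ OV)).
Qed.

Section BChart.
Variables (U : set T) (z : seq K).
Hypothesis kc : kchart O U (adjs k0 z).
Hypothesis U0 : U !=set0.
Let A := adjs k0 z.
Let As : is_subring A. Proof. exact: adjs_subring. Qed.
Let frA : forall c, fracs A c. Proof. exact: (chart_fracs fm kc). Qed.

(** The ideal of the closure of xi in the chart; it is all of A when xi is not in U. *)
Definition chideal : set K := [set a | A a /\ (U xi -> nonu (O xi) a)].

Lemma chideal_submod : is_submod A (chideal : set K^o).
Proof.
have [_ [m0 mD mM] _ _] := m_prime fm xi.
split=> [|a b [Aa ha] [Ab hb]|a b Aa [Ab hb]]; first by split=> //; exact: subring0.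
  by split=> [|s]; [exact: subringD|apply: mD; [exact: ha|exact: hb]].
by split=> [|s]; [exact: subringM|apply: (mM a); [exact: (kc_sub kc s)|exact: hb]].
Qed.

Lemma chideal_bideal x : U x -> chideal `<=` bideal x.
Proof.
move=> Ux a [Aa ha]; split=> [|s]; first exact: (kc_sub kc Ux).
by apply: ha; apply: s => //; exact: kc_open kc.
Qed.

Lemma bidealE x a : U x -> bideal x a -> exists u v, [/\ chideal u, A v, ~ nonu (O x) v & a = u / v].
Proof.
move=> Ux [Oa ha]; have [u [v [Au Av nv e]]] := kc_frac kc Ux Oa; have v0 := m_nz fm nv.
have [_ [_ _ mM] _ mp] := m_prime fm xi.
have [s|ns] := pselect (spz x).
  exists u, v; split=> //; split=> // Uxi; rewrite -(divfK v0 u) -e mulrC; apply: (mM v) => //; last exact: ha.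
  exact: (kc_sub kc Uxi).
have [V [oV Vx nVxi]] : exists V, [/\ open V, V x & ~ V xi].
  by apply: contrapT => h; apply: ns => V oV Vx; apply: contrapT => nV; apply: h; exists V.
have [c [Ac nc cV]] := kc_base kc oV Vx Ux; have c0 := m_nz fm nc.
have [_ _ _ mpx] := m_prime fm x.
exists (u * c), (v * c); split; [split; first exact: subringM| exact: subringM| |].
- move=> Uxi; apply: (mM u); first exact: (kc_sub kc Uxi).
  by apply: contrapT => h; apply: nVxi; exact: cV.
- by move=> /mpx[||//|//]; exact: (kc_sub kc Ux).
- by rewrite e invfM mulrACA mulfV // mulr1.
Qed.

Variable fs : seq K.
Hypothesis fsI : forall f, f \in fs -> chideal f.
Hypothesis Ifs : chideal `<=` lspan A (fs : seq K^o).
Variable f0 : K.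
Hypotheses (f0fs : f0 \in fs) (f00 : f0 != 0).

Definition bfrac := [seq f / f0 | f <- fs].
Definition brees := adjs A bfrac.
(** The normalisation of the affine blow-up algebra A[I/f0]. *)
Definition bring := integral brees.
Let Rs : is_subring brees. Proof. exact: adjs_subring. Qed.
Let Bs : is_subring bring. Proof. exact: integral_subring. Qed.
Lemma sub_bring : A `<=` bring.
Proof. by move=> a Aa; apply: sub_integral => //; exact: sub_adjs. Qed.
Lemma bfrac_bring f : f \in fs -> bring (f / f0).
Proof. by move=> ff; apply: sub_integral => //; apply: mem_adjs => //; exact: map_f. Qed.

(** Finiteness of normalization keeps the charts of the blow-up of finite type. *)
Lemma bring_adjs : exists z', bring = adjs k0 z'.
Proof.
have e : brees = adjs k0 (z ++ bfrac) by rewrite /brees /adjs foldl_cat.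
have [|g [_ eg]] := finite_normalization char0 k0f (s := z ++ bfrac).
  move=> c; have [a [b [Aa Ab b0 ->]]] := frA c; exists a, b; split=> //; rewrite -e; exact: sub_adjs.
by exists (z ++ bfrac ++ g); rewrite /bring e eg /adjs !foldl_cat.
Qed.

Lemma bring_normal : integral bring `<=` bring. Proof. exact: integral_trans. Qed.

Lemma bideal_div x S a : U x -> is_subring S -> O x `<=` S -> (forall f, f \in fs -> S (f / f0)) ->
  bideal x a -> S (a / f0).
Proof.
move=> Ux Ss OS Sf /(bidealE Ux)[u [v [/Ifs[c Ac ->] Av nv ->]]].
have AS : A `<=` S by move=> b Ab; apply: OS; exact: (kc_sub kc Ux).
rewrite mulrAC; apply: subringM => //; last by apply: OS; apply: (m_inv fm) => //; exact: (kc_sub kc Ux).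
rewrite mulr_suml; apply: subring_sum => // i _; rewrite [c i *: _]/(c i * _) -mulrA.
by apply: subringM => //; [exact: AS|apply: Sf; exact: mem_nth].
Qed.

Definition bD : set bpt := bbase U bfrac.

Lemma bD_frac p f : bD p -> f \in fs -> bO p (f / f0).
Proof. by move=> [_ h] ff; apply: h; exact: map_f. Qed.

Lemma bring_sub p : bD p -> bring `<=` bO p.
Proof.
move=> Dp; have [[Ss _ _] n s _ _] := blP p; move=> c h; apply: n; move: c h; apply: integral_mono.
apply: adjs_min => // [a Aa|b]; last by case: Dp => _; apply.
by apply: s; apply: (kc_sub kc) => //; case: Dp.
Qed.

Lemma O_in_locz q x : U x -> prime_in bring q -> (forall a, A a -> q a -> nonu (O x) a) -> O x `<=` locz bring q.
Proof.
move=> Ux qp h c /(kc_frac kc Ux)[a [d [Aa Ad nd ->]]].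
by exists a, d; split=> //; [exact: sub_bring|exact: sub_bring|move=> qd; apply: nd; exact: h].
Qed.

(** The witness f of the point and the generator f0 of the chart differ by a unit, so the
    localization of [bring] at the centre of the point satisfies the premises of [bl_min]. *)
Lemma bO_locz p : bD p -> bO p = locz bring (bring `&` nonu (bO p)).
Proof.
move=> Dp; have [l n s d [f [If nf0 Sf min]]] := blP p; have [Ux _] := Dp; have [Ss _ Si] := l.
have [z' ez] := bring_adjs; have BS := bring_sub Dp.
have iB := bring_normal; rewrite ez in BS iB.
have qp := nonu_sub k0f l BS; have [Ll Ln LS Ld] := locz_min k0f iB l BS.
rewrite -ez in qp Ll Ln LS Ld; apply/seteqP; split=> //; have [Ls _ Li] := Ll.
have OL : O (bpi p) `<=` locz bring (bring `&` nonu (bO p)).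
  by apply: O_in_locz => // a Aa [_ na]; apply/bdomP => //; exact: (kc_sub kc Ux).
have Lf a : bideal (bpi p) a -> locz bring (bring `&` nonu (bO p)) (a / f0).
  by apply: bideal_div => // f' ff; apply: sub_locz => //; exact: bfrac_bring.
have Lu : locz bring (bring `&` nonu (bO p)) (f / f0)^-1.
  apply: Li; first exact: Lf.
  move=> /Ld; have If0 : bideal (bpi p) f0 by apply: chideal_bideal => //; exact: fsI.
  apply/nonuP => //; [by apply: LS; exact: Lf|by rewrite mulf_neq0 ?invr_eq0|].
  by rewrite invf_div; exact: Sf.
apply: min => // a Ia; have -> : a / f = (a / f0) * (f / f0)^-1 by rewrite invf_div mulrA divfK.
exact: (subringM Ls (Lf _ Ia) Lu).
Qed.

Lemma bpt_of_prime q : prime_in bring q -> exists p, bD p /\ bring `&` nonu (bO p) = q.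
Proof.
move=> qp; have [z' ez] := bring_adjs; have [qB qm q1 qpr] := qp.
have Aq : prime_in A (A `&` q).
  have [q0 qD qM] := qm; split=> [a []//||[]//|a b Aa Ab [_ /qpr[]]]; try by [exact: sub_bring|left|right].
  split=> [|a b [Aa qa] [Ab qb]|a b Aa [Ab qb]]; first by split=> //; exact: subring0.
    by split; [exact: subringD|exact: qD].
  by split; [exact: subringM|apply: (qM a) => //; exact: sub_bring].
have [x [Ux xq]] := kc_point kc Aq.
have iB := bring_normal; rewrite ez in qp iB.
have Ll := locz_local k0f qp; have Ln := nonuE Ll; rewrite -Ln in Ll.
have Li := locz_integral (adjs_subring z' k0s) iB qp; rewrite -ez in qp Li Ll Ln.
have [Ls _ _] := Ll; have Iq : bring `&` nonu (locz bring q) = q.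
  apply/seteqP; split=> a; last by move=> qa; split; [exact: qB|rewrite Ln; rewrite ez in qp; exact: (mz_sub k0f qp)].
  by move=> [Ba]; rewrite Ln => ma; rewrite ez in qp Ba; exact: (mz_in qp Ba ma).
have OL : O x `<=` locz bring q by apply: O_in_locz => // a Aa qa; apply/(xq _ Aa).
have Lfs f : f \in fs -> locz bring q (f / f0) by move=> ff; apply: sub_locz => //; exact: bfrac_bring.
have b : blpt x (locz bring q).
  split=> // [a na|].
    have [Oa _] := na; have [u [v [Au Av nv e]]] := kc_frac kc Ux Oa; have v0 := m_nz fm nv.
    have nu : nonu (O x) u.
      have [_ [_ _ mM] _ _] := m_prime fm x; rewrite -(divfK v0 u) -e mulrC.
      by apply: (mM v) => //; exact: (kc_sub kc Ux).
    have [_ qu] := (xq u Au).2 nu; rewrite Ln; exists u, v; split=> //; first by rewrite -ez; exact: sub_bring.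
    by move=> qv; apply: nv; apply/(xq _ Av).
  exists f0; split=> // [|a|S' S'l S'n OS' IS' S'L S'd]; first by apply: chideal_bideal => //; exact: fsI.
    exact: bideal_div.
  have [S's _ S'i] := S'l; have BS' : bring `<=` S'.
    move=> c h; apply: S'n; move: c h; apply: integral_mono; apply: adjs_min => // [a Aa|c /mapP[f ff ->]].
      by apply: OS'; exact: (kc_sub kc Ux).
    by apply: IS'; apply: chideal_bideal => //; exact: fsI.
  move=> _ [u [v [Bu Bv nv ->]]]; apply: subringM => //; first exact: BS'.
  apply: S'i; first exact: BS'.
  by move=> /S'd nv'; apply: nv; rewrite -Iq.
exists (exist (fun p : T * set K => blpt p.1 p.2) (x, locz bring q) b); split=> //; split=> // c /mapP[f ff ->]; exact: Lfs.
Qed.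

Lemma bD_open : open (bD : set bspc).
Proof. by apply: (@base_open bpt _ bbasesP); exists U, bfrac; split=> //; exact: kc_open kc. Qed.

Lemma bkchart : @kchart K bspc bO bD bring.
Proof.
have BS := bring_sub.
split; [exact: bD_open|exact: bring_sub| | | | |].
- move=> p c Dp; rewrite {1}(bO_locz Dp) => -[a [d [Ba Bd nd ->]]]; exists a, d; split=> //.
  by move=> md; apply: nd.
- move=> q qp; have [p [Dp <-]] := bpt_of_prime qp; exists p; split=> // a Ba.
  by split=> [[]//|]; split.
- move=> p p' Dp Dp' e; have eO : bO p = bO p'.
    rewrite (bO_locz Dp) (bO_locz Dp') (_ : bring `&` nonu (bO p) = bring `&` nonu (bO p')) //.
    by apply/seteqP; split=> a [Ba /(e _ Ba)].
  have ex : bpi p = bpi p'.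
    have [Ux _] := Dp; have [Ux' _] := Dp'; apply: (kc_uniq kc) => // a Aa.
    by rewrite !bdomP ?eO //; apply: (kc_sub kc).
  case: p p' {e Dp Dp'} eO ex => [[x S] h] [[x' S'] h']; rewrite /bO /bpi /= => e e'; subst x' S'.
  by congr exist; exact: Prop_irrelevance.
- move=> V p oV Vp Dp; have [_ [[W [bs [oW ->]]] [Wp hb] BV]] := oV p Vp; have [Ux _] := Dp.
  have [l _ _ _ _] := blP p; have mp := nonu_prime l; have [_ _ m1 mpr] := mp.
  have [a [Aa na aW]] := kc_base kc oW Wp Ux.
  have [b [Bb nb hB]] : exists b, [/\ bring b, ~ nonu (bO p) b & forall u, u \in bs -> bring (b * u)].
    elim: bs hb {BV} => [_|u bs IH hb]; first by exists 1; split=> //; exact: subring1.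
    have [|b [Bb nb hB]] := IH; first by move=> v vb; apply: hb; rewrite in_cons vb orbT.
    have [c [d [Bc Bd nd e]]] : locz bring (bring `&` nonu (bO p)) u.
      by rewrite -(bO_locz Dp); apply: hb; exact: mem_head.
    have d0 : d != 0.
      by apply/eqP => d0; apply: nd; split; [|rewrite d0; case: mp => _ []].
    exists (b * d); split; [exact: subringM|by move=> /mpr[||//|md]; [exact: BS|exact: BS|apply: nd]|].
    move=> v; rewrite in_cons => /orP[/eqP ->|/hB Bv]; last by rewrite mulrAC; exact: subringM.
    by rewrite e -mulrA [d * _]mulrC divfK //; exact: subringM.
  have Ba := sub_bring Aa; exists (b * a); split; [exact: subringM| |].
    move=> /mpr[||//|]; [exact: BS|exact: BS|]; rewrite -bdomP //; exact: (kc_sub kc Ux).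
  move=> p' Dp' nba; apply: BV; have [Ux' _] := Dp'; have [l' _ _ _ _] := blP p'.
  have [S's [_ [_ _ mM] _ _] S'i] := l'; split.
    apply: aW => // na'; apply: nba; apply: (mM b); first exact: BS.
    by rewrite -bdomP //; exact: (kc_sub kc Ux').
  have nb' : ~ nonu (bO p') b by move=> nb'; apply: nba; rewrite mulrC; apply: (mM a) => //; exact: BS.
  have b0 := prime_nz (nonu_prime l') nb'.
  move=> u /hB Bu; rewrite -(mulKf b0 u); apply: subringM => //; last exact: BS.
  by apply: S'i => //; exact: BS.
- move=> b Bb; have [->|b0] := eqVneq b 0.
    rewrite (_ : [set y | _] = set0); first exact: open0.
    apply/seteqP; split=> // p [_]; apply; have [l _ _ _ _] := blP p; by case: (nonu_prime l) => _ [].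
  rewrite (_ : [set y | _] = bbase U (bfrac ++ [:: b^-1])).
    by apply: (@base_open bpt _ bbasesP); exists U, (bfrac ++ [:: b^-1]); split=> //; exact: kc_open kc.
  apply/seteqP; split=> p.
    move=> [Dp nb]; have [l _ _ _ _] := blP p; have [Ux hb] := Dp; split=> // c.
    rewrite mem_cat => /orP[/hb//|]; rewrite inE => /eqP ->.
    by apply/(nonuP l) => //; exact: BS.
  move=> [Ux h]; have Dp : bD p by split=> // c bc; apply: h; rewrite mem_cat bc.
  have [l _ _ _ _] := blP p; split=> //; apply/(nonuP l) => //; first exact: BS.
  by apply: h; rewrite mem_cat inE eqxx orbT.
Qed.

End BChart.

Lemma chart_gens U z : kchart O U (adjs k0 z) -> exists fs : seq K,
  (forall f, f \in fs -> chideal U z f) /\ chideal U z `<=` lspan (adjs k0 z) (fs : seq K^o).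
Proof.
move=> kc; have An : noeth (adjs k0 z) by apply: noeth_adjs => //; exact: subfield_noeth.
by have [|fs h1 h2] := An _ (chideal_submod kc); [move=> a []|exists fs].
Qed.

(** The witness f is a combination of the generators with coefficients regular at the point, so
    their ratios to f cannot all be in the maximal ideal. A generator whose ratio is a unit can
    replace f. *)
Lemma bD_cover U z fs p : kchart O U (adjs k0 z) -> U (bpi p) ->
  (forall f, f \in fs -> chideal U z f) -> chideal U z `<=` lspan (adjs k0 z) (fs : seq K^o) ->
  exists f0, [/\ f0 \in fs, f0 != 0 & bD U fs f0 p].
Proof.
move=> kc Ux fsI Ifs; have [l n s d [f [If nf0 Sf _]]] := blP p; have [Ss [mS [_ mD mM] m1 _] Si] := l.
have Sfs g : g \in fs -> bO p (g / f) by move=> /fsI /(chideal_bideal kc Ux); exact: Sf.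
have [g gf ng] : exists2 g, g \in fs & ~ nonu (bO p) (g / f).
  apply: contrapT => no; apply: m1; have [u [v [/Ifs[c Ac e] Av nv ef]]] := bidealE kc Ux If.
  rewrite -(divff nf0) {1}ef e mulrAC mulrC; apply: (mM v^-1).
    by apply: s; apply: (m_inv fm) => //; exact: (kc_sub kc Ux).
  rewrite mulr_suml; have [_ mm _ _] := nonu_prime l; apply: (submod_sum _ mm) => i _.
  rewrite [c i *: _]/(c i * _) -mulrA; apply: (mM (c i)); first by apply: s; exact: (kc_sub kc Ux).
  by apply: contrapT => ng; apply: no; exists fs`_i => //; exact: mem_nth.
have gf0 := prime_nz (nonu_prime l) ng; have SV := Si _ (Sfs _ gf) ng; exists g; split=> //.
  by apply: contra gf0 => /eqP ->; rewrite mul0r.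
split=> // b /mapP[h hf ->]; have -> : h / g = (h / f) * (g / f)^-1 by rewrite invf_div mulrA divfK.
by apply: subringM => //; exact: Sfs.
Qed.

Lemma bl_generic : exists2 p : bpt, dense (bpi p) & bO p = setT.
Proof.
have [y dy Oy] := fm_gen fm.
have nT : nonu (setT : set K) = [set 0].
  by apply/seteqP; split=> c; [case=> _ /(_ I)|move=> ->; split].
have b : blpt y setT.
  split=> //.
  - by rewrite nT; split=> //; exact: prime_zero.
  - by rewrite Oy.
  - exists 1; split=> //; [|exact: oner_neq0|by move=> S' _ _ OS' _ _ _ c _; apply: OS'; rewrite Oy].
    split; first by rewrite Oy.
    move=> s; have [t nt t0] := xi_nz; have [_ /(_ _)] := nt; have := spz_sub s; rewrite Oy => h /(_ (h _ I)) e.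
    by rewrite e eqxx in t0.
by exists (exist (fun p : T * set K => blpt p.1 p.2) (y, setT) b).
Qed.

Lemma bfmodel : @fmodel K bspc bO k0.
Proof.
split=> [p|p|]; first by have [] := blP p.
  have [U [z [Ux kc]]] := fm_chart fm (bpi p); have [fs [fsI Ifs]] := chart_gens kc.
  have [f0 [ff0 f00 Dp]] := bD_cover kc Ux fsI Ifs.
  have [z' e] := bring_adjs kc (ex_intro _ _ Ux) fs f0.
  by exists (bD U fs f0), z'; split=> //; rewrite -e; exact: (bkchart kc (ex_intro _ _ Ux) fsI Ifs ff0 f00).
have [p dp Op] := bl_generic; exists p => // V oV [p' Vp']; have [_ [[W [bs [oW ->]]] [Wp' _] BV]] := oV p' Vp'.
by apply: BV; split=> [|b _]; [apply: dp => //; exists (bpi p')|rewrite Op].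
Qed.
(** By the quotient rule, d preserves O_x[I/f0], since it preserves I. Seidenberg's theorem passes
    to the integral closure, of which the local ring of the blow-up is a localization. *)
Lemma bl_lift p d : der k0 d -> stab (O (bpi p)) d -> (forall a, bideal (bpi p) a -> bideal (bpi p) (d a)) ->
  stab (bO p) d.
Proof.
move=> dd st sI; have [U [z [Ux kc]]] := fm_chart fm (bpi p); have [fs [fsI Ifs]] := chart_gens kc.
have [f0 [ff0 f00 Dp]] := bD_cover kc Ux fsI Ifs; have U0 := ex_intro U _ Ux.
pose C := adjs (O (bpi p)) (bfrac fs f0); have Cs : is_subring C by exact: adjs_subring.
have OC : O (bpi p) `<=` C by exact: sub_adjs.
have kO := k0_sub k0f kc Ux.
have Cf f : f \in fs -> C (f / f0) by move=> ff; apply: mem_adjs => //; exact: map_f.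
have bI f : f \in fs -> bideal (bpi p) f by move=> /fsI; exact: chideal_bideal.
have Cd f : f \in fs -> C (d f / f0) by move=> /bI /sI; apply: (bideal_div kc Ifs).
have sC a : C a -> C (d a).
  apply: (der_adjs k0f dd) => // [b Ob|b /mapP[f ff ->]]; first by apply: OC; exact: st.
  split; first exact: Cf.
  by rewrite (der_div k0f dd) //; apply: subringB => //; [exact: Cd|apply: subringM => //; [exact: Cf|exact: Cd]].
have frC c : fracs C c.
  have [a [b [Aa Ab b0 ->]]] := chart_fracs fm kc U0 c.
  by exists a, b; split=> //; apply: OC; exact: (kc_sub kc Ux).
have kC : k0 `<=` C by move=> c /kO; exact: OC.
have Cn : noeth C by apply: noeth_adjs => //; exact: (O_noeth k0f fm kc Ux).
have sei := seidenberg char0 k0f Cs Cn kC frC dd sC.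
have [l n s _ _] := blP p; have [Ss _ _] := l.
have CS : integral C `<=` bO p.
  move=> c h; apply: n; move: c h; apply: integral_mono; apply: adjs_min => // b; case: Dp => _; exact.
have BC : bring z fs f0 `<=` integral C.
  by apply: integral_mono; apply: adjs_mono => //; [exact: adjs_subring|move=> a Aa; exact: (kc_sub kc Ux)].
apply: (der_loc k0f dd Ss (A := integral C)) => [|c /sei]; last exact: CS.
split=> // u; rewrite {1}(bO_locz kc U0 fsI Ifs ff0 f00 Dp) => -[a [b [Ba Bb nb ->]]].
have nb' : ~ nonu (bO p) b by move=> h; apply: nb.
exists a, b; split=> //; [exact: BC|exact: BC|exact: prime_nz (nonu_prime l) nb'|].
by apply/(nonuP l) => //; [exact: CS _ (BC _ Bb)|exact: prime_nz (nonu_prime l) nb'].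
Qed.

Lemma prime_sub_max S m P : localring S m -> prime_in S P -> P `<=` m.
Proof.
move=> [Ss mP Si] [PS Pm P1 _] a Pa; apply: contrapT => nm; apply: P1.
by rewrite -(mulVf (prime_nz mP nm)); apply: (submodM Pm) => //; apply: Si => //; exact: PS.
Qed.

Lemma principal_dim S m : localring S m -> noeth S -> principal S m -> ~ chain_in S 2.
Proof.
move=> l Sn [t mt tm] [P [Pp Plt]]; have [Ss mP _] := l.
have [P01 n01] := Plt 0%N isT; have [P12 n12] := Plt 1%N isT.
have [P1S P1m _ P1p] := Pp 1%N isT; have P1M := prime_sub_max l (Pp 1%N isT).
have [_ P0m _ _] := Pp 0%N isT; have Pm2 := prime_sub_max l (Pp 2%N isT).
have [tP|ntP] := pselect (P 1%N t).
  apply: n12 => a /Pm2 /tm[c Sc ->]; rewrite mulrC; exact: (submodM P1m).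
apply: n01 => a Pa; have [->|a0] := eqVneq a 0; first by case: P0m.
have [n [u [Su nu e]]] := val_exists l Sn mt tm (P1S _ Pa) a0.
case: nu; apply: P1M; move: Pa; rewrite e => /P1p[//||//|h].
  by apply: subringX => //; case: mP => + _ _ _; apply.
by case: ntP; apply: (prime_inX Ss (Pp 1%N isT)) h; case: mP => + _ _ _; apply.
Qed.

(** An associated prime of f0 in a normal noetherian chart gives a local ring with principal maximal
    ideal. The chart is chosen through a valuation centred at xi, so that f0 is not a unit in it. *)
Lemma bl_divisor : exists p : bpt, [/\ spz (bpi p), noeth (bO p), principal (bO p) (nonu (bO p))
  & exists2 f, nonu (bO p) f & f != 0].
Proof.
have [U [z [Ux kc]]] := fm_chart fm xi; have [fs [fsI Ifs]] := chart_gens kc; have U0 := ex_intro U _ Ux.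
set A := adjs k0 z in kc Ifs; have As : is_subring A by exact: adjs_subring.
have pp := px_prime k0f fm kc Ux; have [W [P [WP [AW dW]]]] := manis_exists As pp.
have [Ws Pp _] := WP; have [PW Pm P1 Ppr] := Pp.
have [f1 ff1 f10] : exists2 f, f \in fs & f != 0.
  apply: contrapT => no; have [t mt t0] := xi_nz.
  have := mt; rewrite (m_mz k0f fm kc Ux) => -[u [v [[Au mu] Av nv e]]].
  have /Ifs[c Ac ec] : chideal U z u by [].
  move/eqP: t0; apply; rewrite e ec big1 ?mul0r // => i _.
  have [->|fi0] := eqVneq fs`_i 0; first by rewrite scaler0.
  by case: no; exists fs`_i => //; exact: mem_nth.
have [y [Wy Wyg h]] := manis_min WP [seq f / f1 | f <- fs].
(* f0 is a generator of least value, so that all ratios f/f0 lie in W. *)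
have [f0 ff0 nf0] : exists2 f0, f0 \in fs & ~ P (y * (f0 / f1)).
  case: h => [nPy|[_ /mapP[f ff ->] nP]]; last by exists f.
  by exists f1 => //; rewrite divff // mulr1.
have f00 : f0 != 0 by apply/eqP => e; apply: nf0; rewrite e mul0r mulr0; case: Pm.
have Wf f : f \in fs -> W (f / f0).
  move=> ff; have y0 : y != 0 by apply/eqP => e; apply: nf0; rewrite e mul0r; case: Pm.
  have -> : f / f0 = (y * (f / f1)) * (y * (f0 / f1))^-1 by field; rewrite f10 y0 f00.
  apply: subringM => //; first by apply: Wyg; exact: map_f.
  by apply: (manis_unit WP) => //; apply: Wyg; exact: map_f.
have BW : bring z fs f0 `<=` W.
  move=> c hc; apply: (manis_integral WP); move: c hc; apply: integral_mono; apply: adjs_min => // b /mapP[f ff ->]; exact: Wf.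
have Pf0 : P f0 by have [Af hf] := fsI _ ff0; apply/(dW _ Af); split=> //; exact: hf.
set B := bring z fs f0 in BW; have Bs : is_subring B by apply: integral_subring; exact: adjs_subring.
have AB : A `<=` B by exact: sub_bring.
have Bn : noeth B.
  by have [z' e] := bring_adjs kc U0 fs f0; rewrite /B e; apply: noeth_adjs => //; exact: subfield_noeth.
have Bf0 : B f0 by apply: AB; case: (fsI _ ff0).
have [|b [Q [Bb nb Qp QE]]] := assoc_prime Bs Bn Bf0.
  by move=> c /BW Wc; apply/eqP => e; apply: P1; rewrite -e mulrC; exact: (submodM Pm).
have [p [Dp pQ]] := bpt_of_prime kc U0 fsI Ifs ff0 f00 Qp.
have [l n s d _] := blP p; have BS := bring_sub kc Dp.
have Qf0 : Q f0 by apply/(QE _ Bf0); exists b.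
have mf0 : nonu (bO p) f0 by move: Qf0; rewrite -pQ => -[].
have pn : noeth (bO p).
  have [z' ez] := bring_adjs kc U0 fs f0; have kc' := bkchart kc U0 fsI Ifs ff0 f00; rewrite ez in kc'.
  exact: (O_noeth k0f bfmodel kc' Dp).
exists p; split=> //; last by exists f0.
  (* Away from the closure of xi the ideal is trivial, so 1/f0 would be regular at p, although f0 is
     in the maximal ideal. *)
  apply: contrapT => ns; have [Ss _ _] := l; have [_ [_ _ mM] m1 _] := nonu_prime l; apply: m1.
  rewrite -(mulVf f00); apply: (mM f0^-1) => //; rewrite -[f0^-1]mul1r; have [Dx hb] := Dp.
  apply: (bideal_div kc Ifs Dx Ss s) => [f ff|]; first by apply: hb; exact: map_f.
  by split=> [|/ns //]; exact: (subring1 (Os _)).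
have BE : bO p = locz B Q by rewrite (bO_locz kc U0 fsI Ifs ff0 f00 Dp) pQ.
apply: (principal_colon l pn n f00 mf0 (BS _ Bb)).
  rewrite {1}BE => _ [u [v [Bu Bv nv ->]]]; apply/eqP => e; apply: (nv); apply/(QE _ Bv); exists u => //.
  by rewrite e mulrCA [v * _]mulrC divfK // (prime_nz Qp nv).
move=> a ma; have Sa : bO p a by case: ma.
have [u [v [Bu Bv nv e]]] : locz B Q a by rewrite -BE.
have v0 := prime_nz Qp nv; have Sv : bO p v^-1.
  by apply/(nonuP l) => // [|mv]; [exact: BS|apply: nv; rewrite -pQ; split].
have Qu : Q u.
  rewrite -pQ; split=> //; have [_ [_ _ mM] _ _] := nonu_prime l.
  by rewrite -(divfK v0 u) -e mulrC; apply: (mM v) => //; exact: BS.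
have [c Bc ec] := (QE _ Bu).1 Qu; exists (c / v); first by case: l => Ss _ _; apply: subringM => //; exact: BS.
by rewrite e mulrAC ec mulrA.
Qed.
End BlowUp.

(** * Ultrafilters and ultraproducts of fields *)

Lemma ultra_seq (E : eqType) (T : Type) (F : set_system T) (s : seq E) (Q : E -> set T) : UltraFilter F ->
  F [set y | exists2 f, f \in s & Q f y] -> exists2 f, f \in s & F (Q f).
Proof.
move=> FU; have FF : ProperFilter F by exact: ultra_proper.
elim: s => [h|g s IH h]; first by have [y []] := filter_ex h.
have [Fg|nFg] := in_ultra_setVsetC (Q g) FU; first by exists g; rewrite ?mem_head.
have [|f fs Ff] := IH; last by exists f; rewrite // in_cons fs orbT.
apply: filterS (filterI h nFg) => y [[f fs Qf] nQ]; exists f => //.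
by move: fs; rewrite in_cons => /orP[/eqP e|//]; case: nQ; rewrite -e.
Qed.

(** The families that vanish on a set of U form a maximal ideal, because U decides for each family
    whether it vanishes on such a set; inverses are taken pointwise. *)
Lemma ultraproduct (I : Type) (i0 : I) (kap : I -> fieldType) (U : set_system I) : UltraFilter U ->
  exists (L : fieldType) (th : {rmorphism @dprod I i0 (fun i => kap i : comNzRingType) -> L}),
    forall t, th t = 0 <-> U [set i | t i = 0].
Proof.
move=> FU; have FF : ProperFilter U by exact: ultra_proper.
set D := dprod _ _; pose n : set D := [set t | U [set i | t i = 0]].
have ni : is_ideal n.
  split=> [|a b na nb|a b nb]; first by apply: filterS filterT.
    by apply: filterS (filterI na nb) => i [/= ea eb]; rewrite -[LHS]/(a i + b i) ea eb addr0.
  by apply: filterS nb => i /= eb; rewrite -[LHS]/(a i * b i) eb mulr0.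
have n1 : ~ n 1 by move=> h; have [i e] := filter_ex h; move: (oner_neq0 (kap i)); rewrite (e : (1 : kap i) = 0) eqxx.
have [|L [th [thn _]]] := quotient_field ni n1; last by exists L, th => t; rewrite thn.
move=> a na; exists (fun i => (a i)^-1); have [//|h] := in_ultra_setVsetC [set i | a i = 0] FU.
by apply: filterS h => i /= /eqP ai; rewrite -[LHS]/((a i)^-1 * a i - 1) mulVf // subrr.
Qed.

(** * The projection from a birational model *)

Section Projection.
Variables (k : fieldType) (X : kscheme k) (K : fieldType) (io : forall x : X, stalk x -> K).
Hypothesis M : kmodel io.

Lemma embed_exists : exists sg : {rmorphism k -> K}, (forall x c, io (scalar x c) = sg c) /\ range sg = consts io.
Proof.
have [y dy Oy] := fm_gen (md_fm M); pose f (c : k) : K := io (scalar y c).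
have fB : zmod_morphism f by move=> a b; rewrite /f rmorphB (md_B M).
have fM : monoid_morphism f by split=> [|a b]; rewrite /f ?rmorph1 ?(md_1 M) // rmorphM (md_M M).
pose fr : {rmorphism k -> K} := HB.pack f (GRing.isZmodMorphism.Build k K f fB) (GRing.isMonoidMorphism.Build k K f fM).
have e x c : io (scalar x c) = fr c.
  have [c' h] := (md_sec M _ openT).1 (@scalar_sec k X c).
  by rewrite (_ : fr c = io (scalar y c)) // !h.
exists fr; split=> //; apply/seteqP; split=> c; first by move=> [a _ <-]; exists a => x; rewrite e.
by move=> [a h]; exists a => //; rewrite -(e y).
Qed.

Variables (sg : {rmorphism k -> K}) (T : topologicalType) (O : T -> set K) (pi0 : T -> X).
Hypotheses (sgE : forall x c, io (scalar x c) = sg c) (sgr : range sg = consts io).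
Hypotheses (fm : fmodel O (range sg)) (pi0c : continuous pi0).
Hypotheses (pi_sub : forall y, germs io (pi0 y) `<=` O y).
Hypotheses (pi_dom : forall y a, nonu (germs io (pi0 y)) a -> nonu (O y) a).

Let Y := realisation fm.

Section PiStalk.
Variable y : T.
Definition pist (a : stalk (pi0 y)) : rstalk fm y := tosub (O_sub fm y) (io a).
Lemma pistK a : \val (pist a) = io a.
Proof. by apply: tosubK; apply: pi_sub; exists a. Qed.
Lemma pistB : zmod_morphism pist.
Proof. by move=> a b; apply: val_inj; rewrite rmorphB /= !pistK (md_B M). Qed.
Lemma pistM : monoid_morphism pist.
Proof. by split=> [|a b]; apply: val_inj; rewrite ?rmorphM /= !pistK ?(md_1 M) ?rmorph1 ?(md_M M). Qed.
HB.instance Definition _ := GRing.isZmodMorphism.Build (stalk (pi0 y)) (rstalk fm y) pist pistB.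
HB.instance Definition _ := GRing.isMonoidMorphism.Build (stalk (pi0 y)) (rstalk fm y) pist pistM.
Definition pistr : {rmorphism stalk (pi0 y) -> rstalk fm y} := pist.
End PiStalk.

Definition proj : morphism Y X.
Proof.
refine (@Morphism Y X pi0 pistr pi0c _ _).
- move=> y a /rval_unit; rewrite pistK => na; apply/(io_unit M) => h; apply: na; exact: pi_dom.
- move=> U s oU /(md_sec M _ oU)[c hc]; exists c => y Uy; rewrite -(hc (pi0 y)) //; exact: pistK.
Defined.

Lemma projK y (a : stalk (proj y)) : \val (mor_stalk proj y a : rstalk fm y) = io a.
Proof. exact: pistK. Qed.

Lemma proj_k : is_kmorphism proj.
Proof. by move=> y c; apply: val_inj; rewrite projK sgE rscalK. Qed.

Lemma generic_dense (Z : scheme) (y : Z) : generic_point y -> dense y.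
Proof.
move=> gy V oV [v Vv]; have : closure [set y] v by rewrite gy.
by move=> /(_ V (open_nbhs_nbhs (conj oV Vv)))[w [-> ]].
Qed.

Lemma pi_gen y : dense y -> dense (pi0 y) /\ germs io (pi0 y) = setT.
Proof.
move=> dy; have Oy := dense_gen fm dy.
have dx : dense (pi0 y).
  have [x dx Ox] := fm_gen (md_fm M) => V oV V0; have Vx := dx V oV V0.
  have [U [z [Ux kc]]] := fm_chart (md_fm M) (pi0 y).
  have Ux' : U x by apply: dx; [exact: kc_open kc|exists (pi0 y)].
  have [a [Aa na aV]] := kc_base kc oV Vx Ux'; apply: aV => // /pi_dom.
  by rewrite Oy => -[_ /(_ I)] a0; move/eqP: (m_nz (md_fm M) na).
by split=> //; have := dense_gen (md_fm M) dx.
Qed.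

Lemma proj_birational : birational proj.
Proof.
move=> y /generic_dense dy; have [dx gx] := pi_gen dy; split.
  apply/seteqP; split=> // x _ V; rewrite nbhsE => -[W [oW Wx] WV].
  by exists (pi0 y); split=> //; apply: WV; apply: dx => //; exists x.
have h (b : rstalk fm y) : exists a : stalk (pi0 y), io a = \val b.
  have [a _ e] : germs io (pi0 y) (\val b) by rewrite gx.
  by exists a.
have [g gK] := choice h; exists g => a; last by apply: val_inj; rewrite projK gK.
by apply: (io_inj M); rewrite gK projK.
Qed.

Let MY := real_model fm.
Let ioY := fun (y : Y) (a : stalk y) => \val a.

(** Both schemes have the function field K, so the pulled back foliation is given by the same space
    L of derivations. *)
Lemma pullback_Fol L : (forall d, L d -> der (consts io) d) -> comb_closed L -> lie_closed L ->
  pullback_foliation proj (Fol io L) (Fol ioY L).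
Proof.
move=> Ld Lc Lb; have cE : consts ioY = consts io.
  apply/seteqP; split=> c [a ac].
    by exists a => x; rewrite sgE; have [y _ _] := fm_gen fm; rewrite -(ac y); symmetry; exact: rscalK.
  by exists a => y; rewrite -(ac (pi0 y)) sgE; exact: rscalK.
have Ld' d : L d -> der (consts ioY) d by rewrite cE; exact: Ld.
split; [exact: (Fol_foliation MY Ld' Lc Lb)|exact: (Fol_saturated MY Lc)|].
move=> U [oU Uy _ Ub] D E DE; split=> -[d Ldd r]; exists d => //.
  move=> y Uyy b; have [g _ gK] := Ub y Uyy; rewrite -(gK b) DE // /ioY projK r //; congr d; symmetry; exact: projK.
move=> x Ux a; have [y [yx _]] := Uy x Ux; move: (Ux) a; rewrite -yx => Uyy a.
by rewrite -projK -(DE y Uyy) -[LHS]/(ioY _) (r y Uyy); congr d; exact: projK.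
Qed.

End Projection.

Section ModelCharts.
Variables (k : fieldType) (X : kscheme k) (K : fieldType) (io : forall x : X, stalk x -> K).
Hypothesis M : kmodel io.
Variables (U : set X) (A : set K) (As : is_subring A).
Hypothesis kc : kchart (germs io) U A.

Definition mrho : forall x : X, subr_of As -> stalk x := crho (io := io) kc (As := As).

Lemma mrhoK x a : U x -> io (mrho x a) = \val a. Proof. exact: crhoK. Qed.

Lemma model_chart : affine_chart U mrho.
Proof.
apply: kchart_affine => //; [exact: md_B|exact: md_M|exact: md_1|exact: md_inj| |exact: (fm_local (md_fm M))].
by move=> V s c oV h; apply/(md_sec M) => //; exists c.
Qed.
End ModelCharts.

(** * Equality of morphisms and residue points *)

Section MorphismEquality.
Variables (W Z Y X : scheme).

Lemma mor_eq_trans (f g h : morphism Y X) : mor_eq f g -> mor_eq g h -> mor_eq f h.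
Proof. by move=> [h1 h2] [h3 h4]; split=> [y|s y]; rewrite ?h1 ?h2. Qed.

Lemma mor_eq_compl (f f' : morphism Y X) (g : morphism Z Y) : mor_eq f f' -> mor_eq (mor_comp f g) (mor_comp f' g).
Proof.
move=> [h1 h2]; split=> [z|s z]; first exact: h1.
by have := h2 s (g z) => /(congr1 (mor_stalk g z)).
Qed.

Lemma mor_eq_compr (f : morphism Y X) (g g' : morphism Z Y) : mor_eq g g' -> mor_eq (mor_comp f g) (mor_comp f g').
Proof.
move=> [h1 h2]; split=> [z|s z]; first by rewrite /= h1.
exact: (h2 (pull f s) z).
Qed.
End MorphismEquality.

Definition residue_map (X : scheme) (x : X) (F : fieldType) (r : stalk x -> F) :=
  forall a, r a = 0 <-> a \isn't a GRing.unit.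

Lemma point_field (X : scheme) (x : X) : exists (F : fieldType) (r : {rmorphism stalk x -> F}), residue_map r.
Proof.
have Ii : is_ideal [set a : stalk x | a \isn't a GRing.unit].
  split=> /= [|a b|a b nb]; [by rewrite unitr0|exact: stalk_nonunitD|by rewrite unitrM (negPf nb) andbF].
have [|a na|F [r [rI _]]] := quotient_field Ii; [by rewrite /= unitr1| |by exists F, r].
exists a^-1; have ua : a \is a GRing.unit by apply: contrapT => /negP.
by rewrite /= mulVr // subrr unitr0.
Qed.

Lemma hom_exists (A W : comNzRingType) (f : A -> W) : f 1 = 1 -> (forall a b, f (a - b) = f a - f b) ->
  (forall a b, f (a * b) = f a * f b) -> exists g : {rmorphism A -> W}, g =1 f.
Proof.
move=> f1 fB fM; have fmm : monoid_morphism f by split.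
pose g : {rmorphism A -> W} := HB.pack f (GRing.isZmodMorphism.Build A W f fB) (GRing.isMonoidMorphism.Build A W f fmm).
by exists g.
Qed.

Lemma chart_mor_ex (X : scheme) (U : set X) (A : comNzRingType) (rho : forall x : X, A -> stalk x) (W : comNzRingType)
    (f : A -> W) : affine_chart U rho -> f 1 = 1 -> (forall a b, f (a - b) = f a - f b) ->
  (forall a b, f (a * b) = f a * f b) -> exists u : morphism (spec W) X, forall Q,
  [/\ U (u Q), forall a, rho (u Q) a \is a GRing.unit <-> ~ sval Q (f a)
    & forall a, mor_stalk u Q (rho (u Q) a) = tol Q (f a)].
Proof.
move=> ch f1 fB fM; have [g gf] := hom_exists f1 fB fM; exists (chart_mor ch g) => Q.
split=> [|a|a]; [exact: cmU|by rewrite -gf; exact: cm_unit|by rewrite -gf; exact: (cms_rho ch g)].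
Qed.

Lemma spec_field0 (F : fieldType) (Q : spec F) a : sval Q a -> a = 0.
Proof.
have [[_ _ QM] Q1 _] := svalP Q; move=> Qa; apply: contrapT => /eqP a0; apply: Q1.
by rewrite -(mulVf a0); exact: QM.
Qed.

Lemma spec_field_unit (F : fieldType) (Q : spec F) (b : stalk Q) : b \isn't a GRing.unit -> b = 0.
Proof.
have [a [d [nd ->]]] := toloc_frac b => nu; have [->|a0] := eqVneq a 0.
  have -> : toloc (svalP Q) 0 = 0 by apply/toloc_ker; exists d; rewrite ?mulr0.
  by rewrite mul0r.
move/negP: nu; case; rewrite unitrM unitrV; apply/andP; split; apply/toloc_unit => //.
by move=> /spec_field0 /eqP; rewrite (negPf a0).
Qed.

Lemma spec_point (F : fieldType) : exists Q : spec F, True.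
Proof.
have p0 : is_prime ([set 0] : set F).
  split=> /= [|/eqP|a b /eqP]; [|by rewrite oner_eq0|by rewrite mulf_eq0 => /orP[]/eqP; [left|right]].
  by split=> // [a b -> ->|a b ->]; rewrite ?addr0 ?mulr0.
by exists (exist _ _ p0).
Qed.

(** The canonical morphism from the spectrum of the residue field. Its image is x, because a
    function is invertible at x exactly when its residue is nonzero. *)
Lemma point_mor (X : scheme) (x : X) (F : fieldType) (r : {rmorphism stalk x -> F}) : residue_map r ->
  exists u : morphism (spec F) X, (forall Q, u Q = x) /\ forall s Q, pull u s Q = tol Q (r (s x)).
Proof.
move=> rr; have [U [A [rho [Ux ch]]]] := scheme_affine x.
have [|||u uP] := @chart_mor_ex X U A rho F (fun a => r (rho x a)) ch.
- by rewrite (chart_one ch) // rmorph1.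
- by move=> a b; rewrite (chart_sub ch) // rmorphB.
- by move=> a b; rewrite (chart_mul ch) // rmorphM.
have ux Q : u Q = x.
  have [UQ uu _] := uP Q; apply: (chart_point ch) => // a; rewrite uu.
  split=> [n|ua /spec_field0 /rr/negP//]; first by apply: contrapT => /negP /rr ra; apply: n; rewrite ra; case: (svalP Q) => -[].
exists u; split=> // s Q; have [UQ _ us] := uP Q; have [a [d [ud sE]]] := chart_frac ch (s x) Ux.
have sE' w : w = x -> rho w d \is a GRing.unit /\ s w = rho w a / rho w d by move=> ->.
have [ud' sE''] := sE' _ (ux Q); rewrite /pull sE'' rmorphM rmorphV // !us sE rmorphM rmorphV //.
have td : tol Q (r (rho x d)) \is a GRing.unit by rewrite -us; exact: rmorph_unit.
apply: (mulIr td); rewrite divrK // -[RHS]/(tol Q _ * tol Q _) /tol -tolocM; congr (toloc _ _).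
by rewrite divfK //; apply/eqP => /rr; rewrite ud.
Qed.

(** * The blow-up morphism is proper *)

Section BlowUpScheme.
Variables (k : fieldType) (X : kscheme k) (K : fieldType) (io : forall x : X, stalk x -> K).
Hypotheses (M : kmodel io) (char0 : forall n, n.+1%:R != 0 :> K).
Variables (sg : {rmorphism k -> K}) (xi : X).
Hypothesis sgr : range sg = consts io.
Hypothesis xi_nz : exists2 t, nonu (germs io xi) t & t != 0.

Let k0 := consts io.
Let k0f : subfield k0 := consts_subfield M.
Let fmX := md_fm M.
Let O := germs io.

Lemma bfm : @fmodel K (bspc O xi) (@bO K X O xi) (range sg).
Proof. by rewrite sgr; exact: (bfmodel char0 k0f fmX xi_nz). Qed.

Definition bl : kscheme k := realisation bfm.

Lemma bpi_continuous : continuous (@bpi K X O xi : bspc O xi -> X).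
Proof. by apply/continuousP => V oV; apply: (@base_open _ _ (bbasesP O xi)); exists V, [::]; split=> //; apply/seteqP; split=> p // []. Qed.

Lemma bpi_sub (y : bspc O xi) : O (bpi y) `<=` bO y. Proof. by have [] := blP y. Qed.
Lemma bpi_dom (y : bspc O xi) a : nonu (O (bpi y)) a -> nonu (bO y) a. Proof. by have [_ _ _ + _] := blP y; apply. Qed.

Definition blpi : morphism bl X := proj M bfm bpi_continuous bpi_sub bpi_dom.

Lemma bl_io : @kmodel k bl K (fun x a => \val a). Proof. exact: real_model. Qed.
Lemma bl_germs : germs (fun (x : bl) (a : stalk x) => \val a) = @bO K X O xi. Proof. exact: rstalk_range. Qed.

Local Notation bDs U fs f := (bD U fs f : set (bspc O xi)).

Section OverChart.
Variables (U : set X) (z fs : seq K).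
Hypotheses (kc : kchart O U (adjs k0 z)) (U0 : U !=set0).
Hypotheses (fsI : forall f, f \in fs -> chideal k0 O xi U z f)
  (Ifs : chideal k0 O xi U z `<=` lspan (adjs k0 z) (fs : seq K^o)).
Variables (f0 : K) (f0fs : f0 \in fs) (f00 : f0 != 0).
Let A := adjs k0 z.
Let B := bring k0 z fs f0.
Lemma chart_subring : is_subring A. Proof. exact: adjs_subring _ k0f.1. Qed.
Let As := chart_subring.
Lemma bring_subring : is_subring B. Proof. by apply: integral_subring; apply: adjs_subring; exact: As. Qed.
Let kcB : @kchart K (bspc O xi) (@bO K X O xi) (bD U fs f0) B := bkchart char0 k0f fmX kc U0 fsI Ifs f0fs f00.

Lemma kcB' : @kchart K bl (germs (fun (x : bl) (a : stalk x) => \val a)) (bDs U fs f0) B.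
Proof. by rewrite bl_germs. Qed.

Definition brho := mrho (As := bring_subring) kcB'.
Lemma bchart : affine_chart (bD U fs f0 : set bl) brho. Proof. exact: (model_chart bl_io). Qed.

Definition binc (a : subr_of As) : subr_of bring_subring := tosub bring_subring (\val a).
Lemma bincK a : \val (binc a) = \val a.
Proof. by apply: tosubK; apply: (sub_bring k0f); exact: subr_valP. Qed.
Lemma bincB : zmod_morphism binc.
Proof. by move=> a b; apply: val_inj; rewrite rmorphB /= !bincK rmorphB. Qed.
Lemma bincM : monoid_morphism binc.
Proof. by split=> [|a b]; apply: val_inj; rewrite ?rmorphM /= !bincK ?rmorph1 ?rmorphM. Qed.
HB.instance Definition _ := GRing.isZmodMorphism.Build (subr_of As) (subr_of bring_subring) binc bincB.
HB.instance Definition _ := GRing.isMonoidMorphism.Build (subr_of As) (subr_of bring_subring) binc bincM.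
Definition bincr : {rmorphism subr_of As -> subr_of bring_subring} := binc.

Lemma brho_rho (y : bl) (a : subr_of As) : (bDs U fs f0) y ->
  brho y (binc a) = mor_stalk blpi y (mrho (As := As) kc (blpi y) a).
Proof.
move=> Dy; apply: (io_inj bl_io); rewrite [LHS](mrhoK kcB' (binc a) Dy) bincK [RHS]projK mrhoK //.
by case: Dy.
Qed.

Lemma binc_fg : finitely_generated_algebra bincr.
Proof.
have [z' ez] := bring_adjs char0 k0f fmX kc U0 fs f0.
have Bz (i : 'I_(size z')) : B z'`_i by rewrite /B ez; apply: mem_adjs; [exact: k0f.1|exact: mem_nth].
exists (size z'), (fun i => tosub bring_subring z'`_i) => S [S1 SB SM] Sh Sz.
pose S' : set K := [set c | exists2 b, S b & \val b = c].
have BS : B `<=` S'.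
  rewrite /B ez; apply: adjs_min => [|c kc0|c cz].
  - split=> [|_ _ [b Sb <-] [b' Sb' <-]|_ _ [b Sb <-] [b' Sb' <-]]; first by exists 1; rewrite ?rmorph1.
      by exists (b - b'); [exact: SB|rewrite rmorphB].
    by exists (b * b'); [exact: SM|rewrite rmorphM].
  - exists (binc (tosub As c)); first exact: Sh.
    by rewrite bincK tosubK //; exact: (sub_adjs z k0f.1).
  - have ic : (index c z' < size z')%N by rewrite index_mem.
    exists (tosub bring_subring z'`_(Ordinal ic)); first exact: Sz.
    by have Bc := Bz (Ordinal ic); rewrite tosubK // nth_index.
by apply/seteqP; split=> // b _; have [b' Sb' /val_inj <-] := BS _ (subr_valP b).
Qed.
End OverChart.

(** The image of an ultrafilter converges to some x. Finitely many charts cover the preimage of a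
    neighbourhood of x, so one of them belongs to F. On it the functions that are nonunits at F-many
    points form a prime, whose point is the limit. *)
Lemma bl_compact (U : set X) : open U -> compact U -> compact (blpi @^-1` U).
Proof.
move=> oU cU; rewrite compact_ultra => F FU FpU; have FF : ProperFilter F by exact: ultra_proper.
have [x [Ux cx]] := cU (fmap blpi F) _ FpU.
have near V : open V -> V x -> F (blpi @^-1` V).
  move=> oV Vx; have [//|h] := in_ultra_setVsetC (blpi @^-1` V) FU.
  by have [y [nVy Vy]] := cx (~` V) V h (open_nbhs_nbhs (conj oV Vx)).
have [W [z [Wx kc]]] := fm_chart fmX x; have W0 := ex_intro W _ Wx.
have [fs [fsI Ifs]] := chart_gens k0f fmX xi kc; set A := adjs _ z in kc fsI Ifs.
have FW := near W (kc_open kc) Wx.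
have [f0 f0fs [f00 FD]] : exists2 f, f \in fs & f != 0 /\ F (bDs W fs f).
  have [|f ff h] := @ultra_seq K bl F fs (fun f => [set y | f != 0 /\ (bDs W fs f) y]) FU.
    by apply: filterS FW => y Wy; have [f [ff fn Dy]] := bD_cover k0f fmX kc Wy fsI Ifs; exists f.
  exists f => //; split; first by have [y []] := filter_ex h.
  by apply: filterS h => y [].
have kcB := bkchart char0 k0f fmX kc W0 fsI Ifs f0fs f00; set B := bring _ z fs f0 in kcB.
have mp (y : bl) : prime_in (bO (y : bspc O xi)) (nonu (bO (y : bspc O xi))).
  by have [l _ _ _ _] := blP (y : bspc O xi); exact: nonu_prime l.
pose N b : set bl := [set y | nonu (bO (y : bspc O xi)) b].
have Dmin y : (bDs W fs f0) y -> B `<=` bO y by exact: (kc_sub kcB).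
have qp : prime_in B [set b | B b /\ F (N b)].
  have Bs := bring_subring z fs f0; split=> [b []//||[_ h]|a b Ba Bb [_ h]].
  - split=> [|a b [Ba ha] [Bb hb]|a b Ba [Bb hb]].
    + split; first exact: subring0.
      by apply: filterS filterT => y _; exact: prime_in0 (mp y).
    + split; first exact: subringD.
      by apply: filterS (filterI ha hb) => y [na nb]; have [_ [_ mD _] _ _] := mp y; exact: mD.
    + split; first exact: subringM.
      apply: filterS (filterI FD hb) => y [Dy nb]; have [_ [_ _ mM] _ _] := mp y.
      by apply: (mM a) => //; exact: (Dmin y Dy).
  - by have [y n1] := filter_ex h; case: (mp y) => _ _ + _; apply.
  - have [ha|ha] := in_ultra_setVsetC (N a) FU; [by left|right; split=> //].
    apply: filterS (filterI FD (filterI h ha)) => y [Dy [nab na]]; have [_ _ _ mpr] := mp y.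
    by have [] := mpr a b (Dmin y Dy _ Ba) (Dmin y Dy _ Bb) nab.
have [p [Dp pE]] := kc_point kcB qp; exists (p : bl); split.
  (* The limit must still lie over U: a function on the base that is a unit at x is a unit at F-many
     points, hence is not in the prime. *)
  have [a [Aa na aU]] := kc_base kc oU Ux Wx; have [Wp _] := Dp; apply: aU => // na'.
  have Ba : B a by exact: (sub_bring k0f).
  have /(pE _ Ba)[_ Na] : nonu (bO p) a by exact: bpi_dom.
  have oa := kc_basic kc Aa; have [y [[Wy nay] Nay]] := filter_ex (filterI (near _ oa (conj Wx na)) Na).
  by apply: nay; apply/(bdomP fmX); [exact: (kc_sub kc Wy)|exact: Nay].
move=> V; rewrite nbhsE => -[V' [oV' V'p] V'V]; apply: filterS V'V _.
have [b [Bb nb bV]] := kc_base kcB oV' V'p Dp.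
have [h|h] := in_ultra_setVsetC (N b) FU; first by case: nb; apply/(pE _ Bb).
by apply: filterS (filterI FD h) => y [Dy ny]; exact: bV.
Qed.

Lemma bl_finite_type : finite_type blpi.
Proof.
split=> [|y]; first exact: bl_compact.
have [U [z [Uy kc]]] := fm_chart fmX (blpi y); have U0 := ex_intro U _ Uy.
have [fs [fsI Ifs]] := chart_gens k0f fmX xi kc.
have [f0 [f0fs f00 Dy]] := bD_cover k0f fmX kc Uy fsI Ifs.
pose As := chart_subring z.
exists U, (subr_of As), (mrho (As := As) kc), (bDs U fs f0), (subr_of (bring_subring z fs f0)), (brho kc U0 fsI Ifs f0fs f00).
exists (bincr z fs f0); split; [exact: (model_chart M)|exact: bchart|exact: Dy|by move=> w []|].
split; last by apply: binc_fg; [exact: kc|exact: U0].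
by move=> w a Dw; have := brho_rho kc U0 fsI Ifs f0fs f00 a Dw.
Qed.
Let Y := bl.
Let pi : morphism Y X := blpi.
Let jo := fun (y : Y) (a : stalk y) => \val a : K.
Let MY : kmodel jo := bl_io.
Let jg : germs jo = @bO K X O xi := bl_germs.
Implicit Types y : Y.

Lemma bD_change (U : set X) (fs : seq K) (f1 f2 : K) y (a : stalk y) : (bDs U fs f1) y -> f2 \in fs ->
  f1 != 0 -> f2 != 0 -> jo a = f2 / f1 -> a \is a GRing.unit -> (bDs U fs f2) y.
Proof.
move=> D1 f2fs f10 f20 e1 ua; have [Ux _] := D1; have [[Ss _ _] _ _ _ _] := blP (y : bspc O xi).
have f12 : bO (y : bspc O xi) (f1 / f2).
  have := ex_intro2 _ _ a^-1 I erefl : germs jo y (jo a^-1).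
  rewrite jg; congr (bO _ _); rewrite -invf_div -e1.
  have n1 : jo a * jo a^-1 = 1 by rewrite -(md_M MY) mulrV // (md_1 MY).
  have n0 : jo a != 0 by rewrite e1 mulf_neq0 ?invr_eq0.
  by apply: (mulfI n0); rewrite n1 mulfV.
split=> // _ /mapP[f ff ->]; have -> : f / f2 = (f / f1) * (f1 / f2) by rewrite mulrA divfK.
by apply: subringM => //; exact: (bD_frac D1).
Qed.

Section Separated.
Variables (P : scheme) (p q : morphism P Y) (delta : morphism Y P).
Hypotheses (H : is_fibre_product pi pi p q) (pd : mor_eq (mor_comp p delta) (mor_id Y))
  (qd : mor_eq (mor_comp q delta) (mor_id Y)).

Lemma delta_pull s y : mor_stalk delta y (pull p s (delta y)) = s y /\ mor_stalk delta y (pull q s (delta y)) = s y.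
Proof. by split; [exact: (pd.2 s y)|exact: (qd.2 s y)]. Qed.

(** If t were a unit at x, it would be one on a neighbourhood, and this meets the diagonal, where t
    pulls back to 0. *)
Lemma diag_nonunit (V : set P) t x : open V -> V x -> sec V t -> (forall W, open W -> W x -> exists y, W (delta y)) ->
  (forall y, V (delta y) -> mor_stalk delta y (t (delta y)) = 0) -> t x \isn't a GRing.unit.
Proof.
move=> oV Vx Vt cx t0; apply/negP => /(unit_near oV Vx Vt)[W [oW Wx WV uW]].
have [y Wy] := cx W oW Wx; have := rmorph_unit (mor_stalk delta y) (uW _ Wy).
by rewrite t0 ?unitr0 //; exact: WV.
Qed.

Lemma diag_const (op : forall R : comUnitRingType, R -> R -> R) x (c1 c2 : K) (a1 : stalk (p x)) (a2 : stalk (q x)) :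
  (forall U s t, open U -> sec U s -> sec U t -> sec U (fun z : P => op (stalk z) (s z) (t z))) ->
  (forall (R S : comUnitRingType) (f : {rmorphism R -> S}) a b, f (op R a b) = op S (f a) (f b)) ->
  (forall y (b1 b2 : stalk y), jo b1 = c1 -> jo b2 = c2 -> op _ b1 b2 = 0) ->
  (forall W, open W -> W x -> exists y, W (delta y)) -> jo a1 = c1 -> jo a2 = c2 ->
  op _ (mor_stalk p x a1) (mor_stalk q x a2) \isn't a GRing.unit.
Proof.
move=> ops opm op0 cx e1 e2.
have [|V1 [s1 [oV1 V1x V1s h1]]] := sec_at MY (_ : germs jo (p x) c1); first by exists a1.
have [|V2 [s2 [oV2 V2x V2s h2]]] := sec_at MY (_ : germs jo (q x) c2); first by exists a2.
have -> : a1 = s1 (p x) by apply: (io_inj MY); rewrite e1 h1.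
have -> : a2 = s2 (q x) by apply: (io_inj MY); rewrite e2 h2.
have o1 : open (p @^-1` V1) by move: oV1; apply: open_comp => y _; exact: mor_continuous.
have o2 : open (q @^-1` V2) by move: oV2; apply: open_comp => y _; exact: mor_continuous.
have o12 := openI o1 o2.
have S1 : sec (p @^-1` V1 `&` q @^-1` V2) (pull p s1) by apply: (sec_restrict o1 o12) (mor_sec p oV1 V1s) => z [].
have S2 : sec (p @^-1` V1 `&` q @^-1` V2) (pull q s2) by apply: (sec_restrict o2 o12) (mor_sec q oV2 V2s) => z [].
apply: (diag_nonunit o12 _ (ops _ _ _ o12 S1 S2)) => // y [V1y V2y].
have [d1 _] := delta_pull s1 y; have [_ d2] := delta_pull s2 y.
have py : p (delta y) = y := pd.1 y; have qy : q (delta y) = y := qd.1 y.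
by rewrite opm d1 d2; apply: op0; [apply: h1; rewrite -py|apply: h2; rewrite -qy].
Qed.

(** Functions on Y pulled back by p and by q differ by nonunits at x, so p and q agree on the
    residue point of x. Uniqueness in the fibre product then identifies this point with its image
    under p followed by delta. *)
Lemma closure_diagonal x : (forall W, open W -> W x -> exists y, W (delta y)) -> exists y, delta y = x.
Proof.
move=> cx; have pq : pi (p x) = pi (q x) := H.1.1 x.
have [U [z [Ux kc]]] := fm_chart fmX (pi (p x)); have U0 := ex_intro U _ Ux.
have Ux' : U (pi (q x)) by rewrite -pq.
have [fs [fsI Ifs]] := chart_gens k0f fmX xi kc.
have [f1 [f1fs f10 D1]] := bD_cover k0f fmX kc Ux fsI Ifs; have [f2 [f2fs f20 D2]] := bD_cover k0f fmX kc Ux' fsI Ifs.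
have [b1 e1] : exists b : stalk (p x), jo b = f2 / f1.
  have [b _ e] : germs jo (p x) (f2 / f1) by rewrite jg; exact: (bD_frac D1).
  by exists b.
have [b2 e2] : exists b : stalk (q x), jo b = f1 / f2.
  have [b _ e] : germs jo (q x) (f1 / f2) by rewrite jg; exact: (bD_frac D2).
  by exists b.
(* f2/f1 pulled back by p and f1/f2 pulled back by q have product 1 on the diagonal. Hence f2/f1 is
   a unit at p x, and p x lies in the chart of q x. *)
have nu : mor_stalk p x b1 * mor_stalk q x b2 - 1 \isn't a GRing.unit.
  apply: (@diag_const (fun R a b => a * b - 1) x _ _ b1 b2 _ _ _ cx e1 e2) => [V s t oV Vs Vt|R S f a b|y a b ea eb].
  - by apply: sec_sub => //; [exact: sec_mul|exact: sec_one].
  - by rewrite rmorphB rmorphM rmorph1.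
  - by apply: (io_inj MY); rewrite (md_B MY) (md_M MY) (md_1 MY) (io0 MY) ea eb -invf_div mulVf ?subrr // mulf_neq0 ?invr_eq0.
have ub : b1 \is a GRing.unit.
  apply: (@mor_local _ _ p x); apply: contrapT => /negP nb.
  have := @stalk_nonunitD P x (mor_stalk p x b1 * mor_stalk q x b2) (- (mor_stalk p x b1 * mor_stalk q x b2 - 1)).
  by rewrite unitrM (negPf nb) unitrN nu opprB addrC subrK unitr1 => /(_ isT isT).
have D1' := bD_change D1 f2fs f10 f20 e1 ub.
have [F [r rr]] := point_field x; have [eps [epsx _]] := point_mor rr.
have ch := bchart kc U0 fsI Ifs f2fs f20.
have pqe : mor_eq (mor_comp p eps) (mor_comp q eps).
  apply: (chart_mor_eq ch) => [t|t|t a]; rewrite /= ?epsx //.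
  apply/eqP; rewrite -subr_eq0; apply/eqP; apply: spec_field_unit.
  rewrite -rmorphB; apply/negP => /(@mor_local _ _ eps t); apply/negP.
  have h x' : x' = x -> mor_stalk p x' (brho kc U0 fsI Ifs f2fs f20 (p x') a) -
    mor_stalk q x' (brho kc U0 fsI Ifs f2fs f20 (q x') a) \isn't a GRing.unit; last exact: h (epsx t).
  move=> ->; apply: (@diag_const (fun R a b => a - b) x (\val a) (\val a)) => // [V s t' oV Vs Vt|R S f u v|y u v eu ev||].
  - exact: sec_sub.
  - by rewrite rmorphB.
  - by apply: (io_inj MY); rewrite (md_B MY) eu ev subrr (io0 MY).
  - exact: (mrhoK (kcB' kc U0 fsI Ifs f2fs f20) a D1').
  - exact: (mrhoK (kcB' kc U0 fsI Ifs f2fs f20) a D2).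
have [Q _] := spec_point F; exists (p (eps Q)).
have hu : mor_eq (mor_comp pi (mor_comp p eps)) (mor_comp pi (mor_comp q eps)) by exact: mor_eq_compr.
have [w [_ _ wu]] := H.2 _ _ _ hu.
have h1 : mor_eq eps w by exact: wu.
have h2 : mor_eq (mor_comp delta (mor_comp p eps)) w.
  apply: wu; first exact: (mor_eq_compl (mor_comp p eps) pd).
  exact: (mor_eq_trans (mor_eq_compl (mor_comp p eps) qd) pqe).
by have := h2.1 Q; rewrite -(h1.1 Q) /= => ->; exact: epsx.
Qed.
End Separated.

Lemma bl_separated : separated pi.
Proof.
move=> P p q delta H pd qd; split.
- by move=> y y' e; have := pd.1 y; have := pd.1 y'; rewrite /= e => -> ->.
- move=> C cC; rewrite -[X in closed X]setCK; apply: open_closedC; rewrite openE => x nx.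
  have [cx|ncx] := pselect (forall W, open W -> W x -> exists y, W (delta y)).
    have [y e] := closure_diagonal H pd qd cx; have py : p (delta y) = y := pd.1 y.
    have oC : open (p @^-1` (~` C)) by apply: open_comp; [move=> w _; exact: mor_continuous|exact: closed_openC].
    apply: (@filterS _ _ _ (p @^-1` (~` C))); last by apply: open_nbhs_nbhs; split=> //; rewrite /preimage /= -e py => Cy; apply: nx; exists y.
    by move=> w nw [y' Cy' e']; apply: nw; rewrite -e' (pd.1 y' : p (delta y') = y').
  have [W [oW Wx Wd]] : exists W, [/\ open W, W x & forall y, ~ W (delta y)].
    apply: contrapT => no; apply: ncx => W oW Wx; apply: contrapT => h; apply: no; exists W; split=> // y Wy; apply: h; by exists y.
  apply: (@filterS _ _ _ W); last by apply: open_nbhs_nbhs.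
  by move=> w Ww [y Cy e]; apply: (Wd y); rewrite e.
(* Any family of germs with value b at y can be used, since pulling back by p and then by delta is
   the identity on all families. *)
- move=> y b; pose s : germ_family Y := fun y' => if pselect (y = y') is left e then eq_rect y (fun w => stalk w) b y' e else 0.
  have sy : s y = b by rewrite /s; case: pselect => // e; rewrite (Prop_irrelevance e erefl).
  by exists (pull p s (delta y)); rewrite (delta_pull pd qd s y).1.
Qed.

Section UniversallyClosed.
Variables (Z P : scheme) (g : morphism Z X) (p : morphism P Y) (q : morphism P Z).
Hypothesis H : is_fibre_product pi g p q.
Variables (C : set P) (z0 : Z).
Hypotheses (cC : closed C) (cz : closure (q @` C) z0).

Let kap (c : P) : fieldType := projT1 (cid (point_field c)).
Let res (c : P) : {rmorphism stalk c -> kap c} := projT1 (cid (projT2 (cid (point_field c)))).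
Let resP c : residue_map (res c). Proof. exact: (projT2 (cid (projT2 (cid (point_field c))))). Qed.

Let res_neq0 c (a : stalk c) : a \is a GRing.unit -> res c a != 0.
Proof. by move=> ua; apply/eqP => /resP; rewrite ua. Qed.

(** The ultrafilter contains C and its image under q converges to z0; it stands for a point of C
    that specialises to z0. *)
Lemma uc_ultra : exists F : set_system P, [/\ UltraFilter F, F C & forall V, open V -> V z0 -> F (q @^-1` V)].
Proof.
pose G : set_system P := [set A | exists V, [/\ open V, V z0 & C `&` q @^-1` V `<=` A]].
have FG : ProperFilter G.
  apply: Build_ProperFilter_ex => [A [V [oV Vz VA]]|].
    have [z [[c Cc e] Vc]] := cz (open_nbhs_nbhs (conj oV Vz)).
    by exists c; apply: VA; split=> //; rewrite /preimage /= e.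
  split=> [|A B [V [oV Vz VA]] [W [oW Wz WB]]|A B AB [V [oV Vz VA]]].
  - by exists setT; split=> //; exact: openT.
  - exists (V `&` W); split=> //; first exact: openI.
    by move=> c [Cc [Vc Wc]]; split; [apply: VA|apply: WB].
  - by exists V; split=> // c /VA /AB.
have [F [FU GF]] := ultraFilterLemma FG; exists F; split=> // [|V oV Vz].
  by apply: GF; exists setT; split=> //; exact: openT.
by apply: GF; exists V; split=> // c [].
Qed.

Section Ultra.
Variables (F : set_system P) (FU : UltraFilter F) (FC : F C) (Fz : forall V, open V -> V z0 -> F (q @^-1` V)).
Let FF : ProperFilter F. Proof. exact: ultra_proper. Qed.
Variable c0 : P.
Let D := @dprod P c0 (fun c => kap c : comNzRingType).
Variables (L : fieldType) (th : {rmorphism D -> L}).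
Hypothesis thP : forall t : D, th t = 0 <-> F [set c | t c = 0].

Lemma th_eq (t t' : D) : F [set c | t c = t' c] -> th t = th t'.
Proof.
move=> h; apply/eqP; rewrite -subr_eq0 -rmorphB; apply/eqP/thP.
by apply: filterS h => c /= e; rewrite -[LHS]/(t c - t' c) e subrr.
Qed.

(** The values of a section of Z in the residue fields at the points of P. *)
Definition tz (s : germ_family Z) : D := fun c => res c (pull q s c).

Lemma tzB s s' : tz (fun z => s z - s' z) = tz s - tz s'.
Proof. by apply: functional_extensionality_dep => c; rewrite -[RHS]/(tz s c - tz s' c) /tz /pull !rmorphB. Qed.

Lemma tzM s s' : tz (fun z => s z * s' z) = tz s * tz s'.
Proof. by apply: functional_extensionality_dep => c; rewrite -[RHS]/(tz s c * tz s' c) /tz /pull !rmorphM. Qed.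

Lemma tz1 : tz (fun z => 1) = 1.
Proof. by apply: functional_extensionality_dep => c; rewrite -[RHS]/(1 : kap c) /tz /pull !rmorph1. Qed.

Definition near_z0 (s : germ_family Z) := exists V, [/\ open V, V z0 & sec V s].
(** [S0] and [M0] are the images in the ultraproduct of the local ring at z0 and of its maximal
    ideal. *)
Definition S0 : set L := [set w | exists2 s, near_z0 s & w = th (tz s)].
Definition M0 : set L := [set w | exists s, [/\ near_z0 s, s z0 \isn't a GRing.unit & w = th (tz s)]].

Lemma near_op (op : forall R : comUnitRingType, R -> R -> R) s s' :
  (forall U s t, open U -> sec U s -> sec U t -> sec U (fun z : Z => op (stalk z) (s z) (t z))) ->
  near_z0 s -> near_z0 s' -> near_z0 (fun z => op (stalk z) (s z) (s' z)).
Proof.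
move=> ops [V [oV Vz Vs]] [V' [oV' Vz' Vs']]; have oVV := openI oV oV'; exists (V `&` V'); split=> //.
by apply: ops => //; [apply: (sec_restrict oV oVV) Vs => z []|apply: (sec_restrict oV' oVV) Vs' => z []].
Qed.
Let nearB s s' : near_z0 s -> near_z0 s' -> near_z0 (fun z => s z - s' z).
Proof. by apply: (near_op (op := fun R a b => a - b)); exact: sec_sub. Qed.
Let nearM s s' : near_z0 s -> near_z0 s' -> near_z0 (fun z => s z * s' z).
Proof. by apply: (near_op (op := fun R a b => a * b)); exact: sec_mul. Qed.
Let near1 : near_z0 (fun z => 1).
Proof. by exists setT; split=> //; [exact: openT|exact: sec_one openT]. Qed.

(** A unit at z0 is a unit nearby, hence at F-many points of P. So the maximal ideal of z0 stays
    proper in the ultraproduct. *)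
Lemma tz_unit s : near_z0 s -> s z0 \is a GRing.unit -> th (tz s) != 0.
Proof.
move=> [V [oV Vz Vs]] us; have [W [oW Wz _ uW]] := unit_near oV Vz Vs us; apply/eqP => /thP h.
have [c [/= e Wc]] := filter_ex (filterI h (Fz oW Wz)).
by have := res_neq0 (rmorph_unit (mor_stalk q c) (uW _ Wc)); rewrite -[res c _]/(tz s c) e eqxx.
Qed.

Lemma M0P s : near_z0 s -> M0 (th (tz s)) <-> s z0 \isn't a GRing.unit.
Proof.
move=> ns; split=> [[s' [ns' nu e]]|nu]; last by exists s.
apply/negP => us; have nu2 : s z0 - s' z0 \isn't a GRing.unit.
  by apply/negP => u; have := tz_unit (nearB ns ns') u; rewrite tzB rmorphB e subrr eqxx.
by have := stalk_nonunitD nu2 nu; rewrite subrK us.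
Qed.

Lemma S0_subring : is_subring S0.
Proof.
split=> [|_ _ [s ns ->] [s' ns' ->]|_ _ [s ns ->] [s' ns' ->]].
- by exists (fun z => 1) => //; rewrite tz1 rmorph1.
- by exists (fun z => s z - s' z); [exact: nearB|rewrite tzB rmorphB].
- by exists (fun z => s z * s' z); [exact: nearM|rewrite tzM rmorphM].
Qed.

Lemma M0_prime : prime_in S0 M0.
Proof.
have e0 : th (tz (fun z => 1 - 1)) = 0 by rewrite tzB subrr rmorph0.
split=> [_ [s [ns _ ->]]||h|_ _ [s ns ->] [s' ns' ->]]; first by exists s.
- split=> [|_ _ [s [ns us ->]] [s' [ns' us' ->]]|_ _ [s ns ->] [s' [ns' us' ->]]].
  + by exists (fun z => 1 - 1); split=> //; [exact: nearB|rewrite subrr unitr0].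
  + exists (fun z => s z - ((1 - 1) - s' z)); split; [by apply: nearB => //; apply: nearB => //; exact: nearB| |].
      by rewrite subrr sub0r opprK; exact: stalk_nonunitD.
    by rewrite !tzB !rmorphB subrr sub0r opprK.
  + exists (fun z => s z * s' z); split; [exact: nearM|by rewrite unitrM (negPf us') andbF|by rewrite tzM rmorphM].
- by have := (M0P near1).1; rewrite tz1 rmorph1 unitr1 => /(_ h).
- rewrite -rmorphM -tzM => /(M0P (nearM ns ns')); rewrite unitrM negb_and => /orP[us|us]; [left|right]; exact/M0P.
Qed.

Section Manis.
Variables (W Pw : set L).
Hypotheses (WP : manis W Pw) (dW : dominates S0 M0 W Pw).
Let Ws : is_subring W. Proof. by case: WP. Qed.
Let Pp : prime_in W Pw. Proof. by case: WP. Qed.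

Variables (U : set X) (z fs : seq K).
Hypotheses (kc : kchart O U (adjs k0 z)) (U0 : U !=set0) (Ugz : U (g z0)).
Hypotheses (fsI : forall f, f \in fs -> chideal k0 O xi U z f)
  (Ifs : chideal k0 O xi U z `<=` lspan (adjs k0 z) (fs : seq K^o)).

Section FunctionsOnD.
Variables (f0 : K) (f0fs : f0 \in fs) (f00 : f0 != 0).
Let B := bring k0 z fs f0.
Let Bs := bring_subring z fs f0.
Let rho := brho kc U0 fsI Ifs f0fs f00.
Definition bval (b : subr_of Bs) (c : P) : kap c := res c (mor_stalk p c (rho (p c) b)).

Lemma rhoB c : (bDs U fs f0) (p c) ->
  [/\ bval 1 c = 1, forall a b, bval (a - b) c = bval a c - bval b c & forall a b, bval (a * b) c = bval a c * bval b c].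
Proof.
have ch := bchart kc U0 fsI Ifs f0fs f00; move=> Dc; rewrite /bval /rho; split=> [|a b|a b].
- by rewrite (chart_one ch Dc) !rmorph1.
- by rewrite (chart_sub ch _ _ Dc) !rmorphB.
- by rewrite (chart_mul ch _ _ Dc) !rmorphM.
Qed.

Lemma bval_A c a : (bDs U fs f0) (p c) ->
  bval (binc fs f0 a) c = tz (fun x => mor_stalk g x (mrho (As := chart_subring z) kc (g x) a)) c.
Proof.
move=> Dc; rewrite /bval /rho (brho_rho kc U0 fsI Ifs f0fs f00 a Dc) /tz; congr (res c _).
exact: (H.1.2 (fun x => mrho (As := chart_subring z) kc x a) c).
Qed.
End FunctionsOnD.
Definition bv (f0 : K) (f0fs : f0 \in fs) (f00 : f0 != 0) b : D := fun c => bval f0fs f00 b c.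

Lemma frac_bring (f f0 : K) : f \in fs -> \val (tosub (bring_subring z fs f0) (f / f0)) = f / f0.
Proof. by move=> ff; apply: tosubK; exact: (bfrac_bring k0f). Qed.

(** The same choice as in [bl_divisor], now for the valuation ring W of the ultraproduct: f2 has
    least value among the generators, so all ratios f/f2 take values in W. *)
Lemma uc_select : exists (f2 : K) (f2fs : f2 \in fs) (f20 : f2 != 0), F [set c | (bDs U fs f2) (p c)] /\
  forall f, f \in fs -> W (th (bv f2fs f20 (tosub (bring_subring z fs f2) (f / f2)))).
Proof.
have oU : open (g @^-1` U) by move: (kc_open kc); apply: open_comp => ? _; exact: mor_continuous.
have [f1 f1fs [f10 F1]] : exists2 f, f \in fs & f != 0 /\ F [set c | (bDs U fs f) (p c)].
  have [|f ff h] := @ultra_seq K P F fs (fun f => [set c | f != 0 /\ (bDs U fs f) (p c)]) FU.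
    apply: filterS (Fz oU Ugz) => c Uc; have Upc : U (pi (p c)) by rewrite (H.1.1 c : pi (p c) = g (q c)).
    by have [f [ff fn Dy]] := bD_cover k0f fmX kc Upc fsI Ifs; exists f.
  exists f => //; split; first by have [y []] := filter_ex h.
  by apply: filterS h => y [].
pose ga f := th (bv f1fs f10 (tosub (bring_subring z fs f1) (f / f1))).
have ga1 : ga f1 = 1.
  rewrite -(rmorph1 th); apply: th_eq; apply: filterS F1 => c Dc /=.
  rewrite -[RHS]/(1 : kap c) /bv divff //.
  by have [<- _ _] := rhoB f1fs f10 Dc; congr (bval _ _ _ c); apply: val_inj; rewrite tosubK ?rmorph1 //; exact: (subring1 (bring_subring z fs f1)).
have [y [Wy Wyg h]] := manis_min WP [seq ga f | f <- fs].
have [f2 f2fs nP] : exists2 f, f \in fs & ~ Pw (y * ga f).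
  by case: h => [nPy|[_ /mapP[f ff ->] nP]]; [exists f1; rewrite ?ga1 ?mulr1|exists f].
have [PW Pm P1 _] := Pp.
have ygn : y * ga f2 != 0 by apply/eqP => e; apply: nP; rewrite e; case: Pm.
have gn : ga f2 != 0 by apply: contra ygn => /eqP ->; rewrite mulr0.
have f20 : f2 != 0.
  apply: contra gn => /eqP e; rewrite /ga e mul0r -(rmorph0 th); apply/eqP; apply: th_eq; apply: filterS F1 => c Dc /=.
  rewrite -[RHS]/(0 : kap c) /bv; have [_ rB _] := rhoB f1fs f10 Dc.
  have e0 : tosub (bring_subring z fs f1) 0 = 1 - 1.
    by apply: val_inj; rewrite subrr rmorph0 tosubK //; exact: (subring0 (bring_subring z fs f1)).
  by rewrite e0 rB subrr.
have F2 : F [set c | (bDs U fs f2) (p c)].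
  have [h0|h0] := in_ultra_setVsetC [set c | bv f1fs f10 (tosub (bring_subring z fs f1) (f2 / f1)) c = 0] FU.
    by move/thP: h0 => h0; move: gn; rewrite /ga h0 eqxx.
  apply: filterS (filterI F1 h0) => c [Dc /= nz].
  set b := tosub _ _ in nz; have ub : brho kc U0 fsI Ifs f1fs f10 (p c) b \is a GRing.unit.
    apply: (@mor_local _ _ p c); apply: contrapT => /negP nu; apply: nz; exact/resP.
  apply: (bD_change Dc f2fs f10 f20 _ ub).
  by rewrite [LHS](mrhoK (kcB' kc U0 fsI Ifs f1fs f10) b Dc) frac_bring.
exists f2, f2fs, f20; split=> // f ff.
have -> : th (bv f2fs f20 (tosub (bring_subring z fs f2) (f / f2))) = (y * ga f) * (y * ga f2)^-1.
  apply: (mulIf gn); transitivity (ga f); last first.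
    have y0 : y != 0 by apply: contra ygn => /eqP ->; rewrite mul0r.
    by field; rewrite y0 gn.
  rewrite -rmorphM; apply: th_eq; apply: filterS (filterI F1 F2) => c [D1c D2c] /=.
  rewrite -[LHS]/(bval _ _ _ c * bval _ _ _ c) /bv /bval -!rmorphM; congr (res c (mor_stalk p c _)).
  apply: (io_inj MY); rewrite (md_M MY).
  rewrite [X in X * _](mrhoK (kcB' kc U0 fsI Ifs f2fs f20) _ D2c).
  rewrite [X in _ * X](mrhoK (kcB' kc U0 fsI Ifs f1fs f10) _ D1c).
  rewrite [RHS](mrhoK (kcB' kc U0 fsI Ifs f1fs f10) _ D1c).
  by rewrite !frac_bring // mulrA divfK.
apply: subringM => //; first by apply: Wyg; exact: map_f.
by apply: (manis_unit WP) => //; apply: Wyg; exact: map_f.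
Qed.
(** W consists of classes of families, which have no values at single points of P. It is therefore
    replaced by the ring [what] of families over a set J of F whose class is in W. The spectrum of
    [what] maps compatibly to Y and Z, hence to P, and the prime of W gives the required point. *)
Lemma uc_point : exists2 c, C c & q c = z0.
Proof.
have [f2 [f2fs [f20 [F2 Wf]]]] := uc_select.
have [N [R [rho [Nz chN]]]] := scheme_affine z0.
have oU : open (g @^-1` U) by move: (kc_open kc); apply: open_comp => ? _; exact: mor_continuous.
have [r [ur rU]] := chart_base chN oU Ugz Nz.
(* J collects the points of C at which the chosen charts of Y and Z apply. It belongs to F, so
   classes are determined by the values on J. *)
pose J c := [/\ C c, (bDs U fs f2) (p c), N (q c) & rho (q c) r \is a GRing.unit].
have FJ : F J.
  have Fr := Fz (chart_basic_open chN r) (conj Nz ur).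
  by apply: filterS (filterI FC (filterI F2 Fr)) => c [Cc [Dc [Nc uc]]].
pose I := {c | J c}; have [c1 Jc1] := filter_ex FJ.
pose E := @dprod I (exist _ c1 Jc1) (fun i => kap (sval i) : comNzRingType).
pose ext (t : E) : D := fun c => if pselect (J c) is left h then t (exist _ c h) else 0.
have extE t c (h : J c) : ext t c = t (exist _ c h).
  by rewrite /ext; case: pselect => // h'; rewrite (Prop_irrelevance h' h).
pose tj t := th (ext t).
have tjB a b : tj (a - b) = tj a - tj b.
  rewrite /tj -rmorphB; apply: th_eq; apply: filterS FJ => c h /=.
  by rewrite -[RHS]/(ext a c - ext b c) !(extE _ c h).
have tjM a b : tj (a * b) = tj a * tj b.
  rewrite /tj -rmorphM; apply: th_eq; apply: filterS FJ => c h /=.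
  by rewrite -[RHS]/(ext a c * ext b c) !(extE _ c h).
have tj1 : tj 1 = 1.
  rewrite /tj -(rmorph1 th); apply: th_eq; apply: filterS FJ => c h /=; by rewrite (extE _ c h).
pose what : set E := [set t | W (tj t)].
have ws : is_subring what.
  split=> [|a b Wa Wb|a b Wa Wb]; rewrite /what /= ?tj1 ?tjB ?tjM; [exact: subring1|exact: subringB|exact: subringM].
have Efun (t t' : E) : (forall i, t i = t' i) -> t = t' by exact: functional_extensionality_dep.
set Bs := bring_subring z fs f2 in Wf.
pose fY (b : subr_of Bs) : E := fun i => bval f2fs f20 b (sval i).
have tfY b : tj (fY b) = th (bv f2fs f20 b).
  by apply: th_eq; apply: filterS FJ => c h /=; rewrite (extE _ c h).
have hY (i : I) := let: And4 _ Dc _ _ := svalP i in rhoB f2fs f20 Dc.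
have fYB a b : fY (a - b) = fY a - fY b by apply: Efun => i; have [_ h _] := hY i; exact: h.
have fYM a b : fY (a * b) = fY a * fY b by apply: Efun => i; have [_ _ h] := hY i; exact: h.
have fY1 : fY 1 = 1 by apply: Efun => i; have [h _ _] := hY i; exact: h.
have [gY gYE] : exists gY : {rmorphism subr_of Bs -> L}, gY =1 (fun b => tj (fY b)).
  by apply: hom_exists => [|a b|a b]; rewrite ?fY1 ?fYB ?fYM ?tj1 ?tjB ?tjM.
have YA a : adjs k0 z a -> W (gY (tosub Bs a)).
  move=> Aa; have [S0W _] := dW; apply: S0W; have Ba := sub_bring (k0f) fs f2 Aa.
  exists (fun x => mor_stalk g x (mrho (As := chart_subring z) kc (g x) (tosub (chart_subring z) a))).
    exists (g @^-1` U); split=> //; exact: (mor_sec g (kc_open kc) (chart_sec (model_chart M (chart_subring z) kc) (tosub (chart_subring z) a))).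
  rewrite gYE tfY; apply: th_eq; apply: filterS F2 => c Dc /=; rewrite -(bval_A f2fs f20 (tosub (chart_subring z) a) Dc).
  by congr (bval _ _ _ c); apply: val_inj; rewrite bincK !tosubK.
have YR a : brees k0 z fs f2 a -> W (gY (tosub Bs a)).
  pose G : set K := [set c | bring k0 z fs f2 c /\ W (gY (tosub Bs c))].
  have Gs : is_subring G.
    split=> [|a' b [Ba Wa] [Bb Wb]|a' b [Ba Wa] [Bb Wb]].
    - by split; [exact: (subring1 Bs)|rewrite tosub1 rmorph1; exact: subring1].
    - by split; [exact: (subringB Bs)|rewrite tosubB // rmorphB; exact: subringB].
    - by split; [exact: (subringM Bs)|rewrite tosubM // rmorphM; exact: subringM].
  suff GB : brees k0 z fs f2 `<=` G by move=> /GB[].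
  apply: adjs_min => // [b Ab|_ /mapP[f ff ->]]; first by split; [exact: (sub_bring k0f)|exact: YA].
  by split; [exact: (bfrac_bring k0f)|rewrite gYE tfY; exact: Wf].
(* Elements of [bring] are integral over [brees], whose values are in W, and W is integrally
   closed. *)
have YW b : what (fY b).
  rewrite /what /= -gYE; apply: (manis_integral WP); have [n [c [Rc e]]] := subr_valP b.
  exists n, (fun i => gY (tosub Bs (c i))); split=> [i|]; first exact: YR.
  have -> : gY b ^+ n = gY (\sum_(i < n) tosub Bs (c i) * b ^+ i).
    rewrite -rmorphXn; congr (gY _); apply: val_inj; rewrite rmorphXn e rmorph_sum; apply: eq_bigr => i _.
    rewrite rmorphM rmorphXn; congr (_ * _); symmetry; apply: tosubK.
    by apply: sub_integral => //; apply: adjs_subring; exact: chart_subring z.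
  by rewrite rmorph_sum; apply: eq_bigr => i _; rewrite rmorphM rmorphXn.
pose fZ a : E := fun i => res (sval i) (pull q (fun z => rho z a) (sval i)).
have nz a : near_z0 (fun z => rho z a) by exists N; split=> //; [exact: chart_open chN|exact: chart_sec chN a].
have tfZ a : tj (fZ a) = th (tz (fun z => rho z a)).
  by apply: th_eq; apply: filterS FJ => c h /=; rewrite (extE _ c h).
have hN (i : I) : N (q (sval i)) by case: (svalP i).
have fZB a b : fZ (a - b) = fZ a - fZ b.
  by apply: Efun => i; rewrite /fZ /pull (chart_sub chN _ _ (hN i)) !rmorphB.
have fZM a b : fZ (a * b) = fZ a * fZ b.
  by apply: Efun => i; rewrite /fZ /pull (chart_mul chN _ _ (hN i)) !rmorphM.
have fZ1 : fZ 1 = 1 by apply: Efun => i; rewrite /fZ /pull (chart_one chN (hN i)) !rmorph1.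
have ZW a : what (fZ a) by rewrite /what /= tfZ; have [S0W _] := dW; apply: S0W; exists (fun z => rho z a).
have Zu a : rho z0 a \is a GRing.unit <-> ~ Pw (tj (fZ a)).
  have [S0W SP] := dW; have Sa : S0 (tj (fZ a)) by rewrite tfZ; exists (fun z => rho z a).
  rewrite -(SP _ Sa) tfZ; have := M0P (nz a); case: (rho z0 a \is a GRing.unit) => h; split=> //; [by move=> _ /h.1|by case; apply/h.2].
have [|a b|a b|u uP] := chart_mor_ex (f := fun b => tosub ws (fY b)) (bchart kc U0 fsI Ifs f2fs f20).
- by rewrite fY1 tosub1.
- by rewrite fYB tosubB.
- by rewrite fYM tosubM.
have [|a b|a b|v vP] := chart_mor_ex (f := fun a => tosub ws (fZ a)) chN.
- by rewrite fZ1 tosub1.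
- by rewrite fZB tosubB.
- by rewrite fZM tosubM.
(* r is invertible in [what]: its values on J are nonzero and its class is a unit of W. This keeps
   the image of v over the chart U. *)
have vr Q : rho (v Q) r \is a GRing.unit.
  have [_ -> _] := vP Q; have nPr := (Zu r).1 ur; have WV := manis_unit WP (ZW r) nPr.
  have r0 i : fZ r i != 0 by have [_ _ _ ui] := svalP i; apply: res_neq0; exact: rmorph_unit.
  pose ri : E := fun i => (fZ r i)^-1.
  have rri : fZ r * ri = 1 by apply: Efun => i; rewrite -[LHS]/(fZ r i * (fZ r i)^-1) mulfV //; exact: r0.
  have Wri : what ri.
    rewrite /what /=; have e : tj (fZ r) * tj ri = 1 by rewrite -tjM rri.
    have n0 : tj (fZ r) != 0 by apply/eqP => n0; move: e; rewrite n0 mul0r => /esym/eqP; rewrite oner_eq0.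
    by rewrite -[tj ri](mulKf n0) e mulr1.
  have [[_ _ QM] Q1 _] := svalP Q; move=> h; apply: Q1.
  by have := QM (tosub ws ri) _ h; rewrite -tosubM // mulrC rri tosub1.
have vU Q : U (g (v Q)) by have [NQ _ _] := vP Q; exact: rU.
have hu : mor_eq (mor_comp pi u) (mor_comp g v).
  apply: (chart_mor_eq (model_chart M (chart_subring z) kc)) => [Q|Q|Q a]; [by have [[]] := uP Q|exact: vU|].
  pose s (x : Z) := mor_stalk g x (mrho (As := chart_subring z) kc (g x) a).
  have Vs : sec (g @^-1` U) s := mor_sec g (kc_open kc) (chart_sec (model_chart M (chart_subring z) kc) a).
  have [DQ _ uQ] := uP Q; have [NQ vu vQ] := vP Q; have [a1 [d [ud sE]]] := chart_frac chN (s (v Q)) NQ.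
  have oUN := openI oU (chart_open chN); have UNQ : (g @^-1` U `&` N) (v Q) by split=> //; exact: vU.
  have rs b : sec (g @^-1` U `&` N) (fun x => rho x b) by apply: sec_restrict (chart_open chN) oUN _ (chart_sec chN b) => x [].
  have Vs' : sec (g @^-1` U `&` N) s by apply: sec_restrict oU oUN _ Vs => x [].
  have [|W' [oW' W'Q _ eW']] := germ_eq oUN oUN UNQ UNQ (sec_mul oUN Vs' (rs d)) (rs a1); first by rewrite sE divrK.
  have [e [ue eV]] := chart_base chN oW' W'Q NQ.
  (* The identity d s = a1 holds at the points where e is invertible, and e has residue 0 at the
     others; so it holds in [what] after multiplication by e. *)
  have key : tosub ws (fZ e) * (tosub ws (fZ d) * tosub ws (fY (binc fs f2 a)) - tosub ws (fZ a1)) = 0.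
    apply: val_inj; rewrite [LHS]rmorphM rmorphB rmorphM /= (tosubK ws (ZW e)) (tosubK ws (ZW d)) (tosubK ws (YW _)) (tosubK ws (ZW a1)).
    apply: Efun => i; have [Ci Di Ni ui] := svalP i.
    rewrite -[LHS]/(fZ e i * (fZ d i * fY (binc fs f2 a) i - fZ a1 i)) -[RHS]/(0 : kap (sval i)).
    have [uei|nei] := boolP (rho (q (sval i)) e \is a GRing.unit).
      have := eW' _ (eV _ Ni uei); rewrite /fY (bval_A f2fs f20 a Di) => E1.
      have -> : fZ d i * tz s (sval i) = fZ a1 i; last by rewrite subrr mulr0.
      by rewrite /fZ /tz /pull -rmorphM -rmorphM mulrC E1.
    have -> : fZ e i = 0; last by rewrite mul0r.
    by apply/resP/negP => uq; move: nei; rewrite (mor_local uq).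
  have t1 : tol Q (tosub ws (fZ e)) \is a GRing.unit by apply/tol_unit/vu.
  have t2 : tol Q (tosub ws (fZ d)) \is a GRing.unit by apply/tol_unit/vu.
  have e2 : tol Q (tosub ws (fZ d)) * tol Q (tosub ws (fY (binc fs f2 a))) = tol Q (tosub ws (fZ a1)).
    apply/eqP; rewrite -subr_eq0 /tol -tolocM -tolocB; apply/eqP; apply: (mulrI t1).
    rewrite /tol -tolocM key mulr0; apply/toloc_ker; exists 1; rewrite ?mulr0 //; by case: (svalP Q).
  transitivity (tol Q (tosub ws (fY (binc fs f2 a)))).
    rewrite -uQ (brho_rho kc U0 fsI Ifs f2fs f20 a DQ) //.
  transitivity (mor_stalk v Q (s (v Q))); last by [].
  rewrite sE rmorphM rmorphV // !vQ; apply: (mulrI t2); rewrite e2 mulrCA mulrV ?mulr1 //.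
have [w [pw qw _]] := H.2 _ _ _ hu.
have pp : is_prime [set t : subr_of ws | Pw (tj (\val t))].
  have [PW [P0 PD PM] P1 Ppr] := Pp; have tW (t : subr_of ws) : W (tj (\val t)) := subr_valP t.
  have tj0 : tj 0 = 0 by rewrite -(subrr 0) tjB subrr.
  have tjD (a b : E) : tj (a + b) = tj a + tj b by rewrite -{1}[b]opprK -[- b]sub0r !tjB tj0 sub0r opprK.
  split=> [|h|a b h].
  - split=> [|a b Pa Pb|a b Pb].
    + suff : Pw (tj (\val (0 : subr_of ws))) by []; by rewrite rmorph0 -(subrr 0) tjB subrr.
    + suff : Pw (tj (\val (a + b))) by []; rewrite rmorphD tjD; exact: PD.
    + suff : Pw (tj (\val (a * b))) by []; rewrite rmorphM tjM; exact: (PM _ _ (tW a)).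
  - by have : Pw (tj (\val (1 : subr_of ws))) by []; rewrite rmorph1 tj1.
  - by have : Pw (tj (\val (a * b))) by []; rewrite rmorphM tjM => /(Ppr _ _ (tW a) (tW b)).
pose Q0 : spec (subr_of ws) := exist _ _ pp.
exists (w Q0); last first.
  rewrite (qw.1 Q0 : q (w Q0) = v Q0); have [NQ vu _] := vP Q0.
  by apply: (chart_point chN) => // a; rewrite vu Zu /= tosubK.
(* If the point were outside C, a basic neighbourhood D(t) of the prime would map outside C. But t
   is nonzero at some c of J, and evaluation at c is a point of D(t) that maps to c, which is in
   C. *)
apply: contrapT => nC; have oC : open (w @^-1` (~` C)).
  by apply: open_comp; [move=> ? _; exact: mor_continuous|exact: closed_openC].
have [t [nt tC]] := sp_near oC nC.
have [h|h] := in_ultra_setVsetC [set c | ext (\val t) c = 0] FU.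
  by apply: nt; rewrite /= /tj (thP _).2 //; case: Pp => _ [].
have [c [Jc /= nc]] := filter_ex (filterI FJ h); pose i : I := exist _ c Jc.
have ti : \val t i != 0 by apply/eqP => e; apply: nc; rewrite (extE _ c Jc).
have [eps [epsc epsE]] := point_mor (@resP c).
have [|a b|a b|ev evP] := chart_mor_ex (X := spec (subr_of ws)) (f := fun t : subr_of ws => \val t i : kap c) (spec_chart (subr_of ws)).
- by rewrite rmorph1.
- by rewrite rmorphB.
- by rewrite rmorphM.
have [_ Dc Nc _] := Jc.
have h1 : mor_eq (mor_comp u ev) (mor_comp p eps).
  apply: (chart_mor_eq (bchart kc U0 fsI Ifs f2fs f20)) => [Q|Q|Q b].
  - by have [] := uP (ev Q).
  - by rewrite /= epsc.
  - have [_ _ uQ] := uP (ev Q); have [_ _ eQ] := evP Q.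
    transitivity (mor_stalk ev Q (tol (ev Q) (tosub ws (fY b)))); first by rewrite -uQ.
    rewrite eQ tosubK //; symmetry.
    exact: (epsE (fun x => mor_stalk p x (brho kc U0 fsI Ifs f2fs f20 (p x) b)) Q).
have h2 : mor_eq (mor_comp v ev) (mor_comp q eps).
  apply: (chart_mor_eq chN) => [Q|Q|Q b].
  - by have [] := vP (ev Q).
  - by rewrite /= epsc.
  - have [_ _ vQ] := vP (ev Q); have [_ _ eQ] := evP Q.
    transitivity (mor_stalk ev Q (tol (ev Q) (tosub ws (fZ b)))); first by rewrite -vQ.
    rewrite eQ tosubK //; symmetry; exact: (epsE (fun x => mor_stalk q x (rho (q x) b)) Q).
(* [eps] and the composite of [ev] and w are morphisms to P with the same projections, so they agree
   by uniqueness. *)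
have h3 : mor_eq (mor_comp pi (mor_comp p eps)) (mor_comp g (mor_comp q eps)) := mor_eq_compl eps H.1.
have [w' [_ _ wu]] := H.2 _ _ _ h3; have [Q _] := spec_point (kap c).
have e1 : mor_eq eps w' by exact: wu.
have e2 : mor_eq (mor_comp w ev) w'.
  apply: wu; first exact: (mor_eq_trans (mor_eq_compl ev pw) h1).
  exact: (mor_eq_trans (mor_eq_compl ev qw) h2).
have we : w (ev Q) = c by rewrite (e2.1 Q : w (ev Q) = w' Q) -e1.1 epsc.
have [Cc _ _ _] := Jc; apply: (tC (ev Q)) => /=; last by rewrite we.
have [_ uQ _] := evP Q; apply/tol_unit/uQ; move=> /spec_field0 /eqP; by rewrite (negPf ti).
Qed.
End Manis.
End Ultra.

Lemma uc_lift : (q @` C) z0.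
Proof.
have [F [FU FC Fz]] := uc_ultra; have FF : ProperFilter F by exact: ultra_proper.
have [c0 _] := filter_ex FC; have [L [th thP]] := ultraproduct c0 kap FU.
have [W [Pw [WP dW]]] := manis_exists (S0_subring th) (M0_prime FU Fz thP).
have [U [z [Ugz kc]]] := fm_chart fmX (g z0); have [fs [fsI Ifs]] := chart_gens k0f fmX xi kc.
by have [c Cc e] := uc_point FU FC Fz thP WP dW kc (ex_intro _ _ Ugz) Ugz fsI Ifs; exists c.
Qed.
End UniversallyClosed.

Lemma bl_proper : proper_morphism pi.
Proof.
split; [exact: bl_separated|exact: bl_finite_type|].
by move=> Z P g p q H C cC z0 cz; exact: (uc_lift H cC cz).
Qed.
End BlowUpScheme.

(** * Terminal foliations *)

Section DerivationSpace.
Context {K : fieldType}.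
Variable k0 : set K.
Hypothesis k0f : subfield k0.

Lemma der_zero : der k0 (fun=> 0). Proof. by split=> *; ring. Qed.

Lemma der_lin c d e : der k0 d -> der k0 e -> der k0 (fun x => c * d x + e x).
Proof.
move=> dd de; split=> [a b _ _|a b _ _|a ka].
- by rewrite (derD dd) (derD de); ring.
- by rewrite (derM dd) (derM de); ring.
- by rewrite (derk dd ka) (derk de ka) mulr0 addr0.
Qed.

Lemma comb_of_lin (L : set (K -> K)) : L (fun=> 0) -> (forall c d e, L d -> L e -> L (fun x => c * d x + e x)) ->
  comb_closed L.
Proof.
move=> L0 Ll; elim=> [|n IH] c d Ld.
  by rewrite (_ : (fun _ => _) = fun=> 0) //; apply/funext => x; rewrite big_ord0.
rewrite (_ : (fun _ => _) = fun x => c ord0 * d ord0 x + \sum_i c (lift ord0 i) * d (lift ord0 i) x).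
  by apply: Ll => //; exact: IH.
by apply/funext => x; rewrite big_ord_recl.
Qed.

Lemma der_comb : comb_closed (der k0). Proof. exact: comb_of_lin der_zero der_lin. Qed.

Lemma der_bracket : lie_closed (der k0).
Proof.
move=> d e dd de; split=> [a b _ _|a b _ _|a ka].
- by rewrite !(derD dd, derD de); ring.
- by rewrite !(derM dd, derM de, derD dd, derD de); ring.
- by rewrite (derk dd ka) (derk de ka) (der0 k0f dd) (der0 k0f de) subrr.
Qed.
End DerivationSpace.

(** * Translation between stalks and local subrings *)

Section Transfer.
Variables (k : fieldType) (X : kscheme k) (K : fieldType) (io : forall x : X, stalk x -> K).
Hypothesis M : kmodel io.
Variable x : X.
Let O := germs io x.
Let k0f := consts_subfield M.
Let fm := md_fm M.
Let Os : is_subring O := O_sub fm x.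
Let iOr (a : stalk x) : O (io a). Proof. by exists a. Qed.

Lemma germs_chart : exists z, [/\ forall c, fracs (adjs (consts io) z) c, loc (adjs (consts io) z) O & noeth O].
Proof.
have [U [z [Ux kc]]] := fm_chart fm x; exists z; split; last exact: (O_noeth k0f fm kc).
  by apply: (chart_fracs fm kc); exists x.
exact: (O_loc k0f fm kc).
Qed.

Lemma prime_germs (P : set (stalk x)) : is_prime P -> prime_in O [set io a | a in P].
Proof.
move=> [[P0 PD PM] P1 Pp]; split=> [_ [a _ <-]||[a Pa e]|_ _ [a _ <-] [b _ <-] [c Pc e]] //.
- split=> [|_ _ [a Pa <-] [b Pb <-]|_ _ [a _ <-] [b Pb <-]].
  + by exists 0 => //; exact: io0.
  + by exists (a + b); [exact: PD|exact: ioD].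
  + by exists (a * b); [exact: PM|exact: (md_M M)].
- by apply: P1; rewrite -(io_inj M (etrans e (esym (md_1 M x)))).
- move: e; rewrite -(md_M M) => /(io_inj M) e; rewrite e in Pc.
  by have [Pa|Pb] := Pp _ _ Pc; [left; exists a|right; exists b].
Qed.

Lemma germs_prime (Q : set K) : prime_in O Q -> is_prime [set a : stalk x | Q (io a)].
Proof.
move=> [QO [Q0 QD QM] Q1 Qp]; split=> [|/= h|a b /= h].
- split=> [|a b /= Qa Qb|a b /= Qb]; first by rewrite /= (io0 M).
    by rewrite (ioD M); exact: QD.
  by rewrite (md_M M); exact: (QM (io a)).
- by apply: Q1; rewrite -(md_1 M x).
- by apply: Qp => //; rewrite -(md_M M).
Qed.

Lemma germs_chain n : has_prime_chain (stalk x) n <-> chain_in O n.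
Proof.
split=> [[P [Pp Plt]]|[Q [Qp Qlt]]].
  exists (fun i => [set io a | a in P i]); split=> [i /Pp|i /Plt[ss ns]]; first exact: prime_germs.
  split=> [_ [a Pa <-]|h]; first by exists a => //; exact: ss.
  by apply: ns => a Pa; have [b Pb /(io_inj M) <-] := h _ (imageP _ Pa).
exists (fun i => [set a | Q i (io a)]); split=> [i /Qp|i ln]; first exact: germs_prime.
have [ss ns] := Qlt _ ln; split=> [a|h]; first exact: ss.
by apply: ns => c Qc; have [QO _ _ _] := Qp _ ln; have [a _ e] := QO _ Qc; move: Qc; rewrite -e => /h.
Qed.

Lemma germs_dim n : chain_in O n -> ~ chain_in O n.+1 -> krull_dim (stalk x) n.
Proof. by move=> h1 h2; split; [exact/germs_chain|move/germs_chain]. Qed.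

Lemma germs_noeth : noeth O -> is_noetherian (stalk x).
Proof.
move=> On P [P0 PD PM]; have Im : is_submod O ([set io a | a in P] : set K^o).
  split=> [|_ _ [a Pa <-] [b Pb <-]|_ _ [a _ <-] [b Pb <-]].
  - by exists 0 => //; exact: io0.
  - by exists (a + b); [exact: PD|exact: ioD].
  - by exists (a * b); [exact: PM|exact: (md_M M)].
have [_ [a _ <-] //|s sP Ps] := On _ Im.
have h (i : 'I_(size s)) : exists a, P a /\ io a = s`_i by have [a Pa e] := sP _ (mem_nth 0 (ltn_ord i)); exists a.
have [g gP] := choice h; exists (size s), g; apply/seteqP; split=> [a Pa|_ [c ->]]; last first.
  by apply: (big_ind P) => // i _; apply: PM; case: (gP i).
have [c Oc e] := Ps _ (imageP _ Pa).
have [d dP] := germs_lift (n := size s) (fun i => Oc i); exists d; apply: (io_inj M); rewrite e (io_sum M); apply: eq_bigr => i _.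
by rewrite (md_M M) dP; case: (gP i) => _ ->.
Qed.

Lemma germs_normal : is_normal_domain (stalk x) -> integral O `<=` O.
Proof.
move=> [_ ic] c [n [a [Oa e]]]; have [z [frA [AO _] _]] := germs_chart.
have [u [v [/AO[u' _ uE] /AO[v' _ vE] v0 cE]]] := frA c.
have [b bP] := germs_lift (n := n) (fun i => Oa i).
have ioX t m : io (t ^+ m) = io t ^+ m.
  by elim: m => [|m IH]; rewrite ?expr0 ?(md_1 M) // !exprS (md_M M) IH.
have v'0 : v' != 0 by apply: contra v0 => /eqP v'0; rewrite -vE v'0 (io0 M).
have [|d ud] := ic u' v' n b v'0; last first.
  by exists d => //; rewrite cE -uE -vE ud (md_M M) mulrAC mulfV ?mul1r // vE.
apply: (io_inj M); rewrite ioX (io_sum M) uE; have -> : u = c * v by rewrite cE divfK.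
rewrite exprMn e mulr_suml; apply: eq_bigr => i _; rewrite !(md_M M) !ioX uE vE bP cE.
have -> : v ^+ n = v ^+ i * v ^+ (n - i) by rewrite -exprD subnKC // ltnW.
by rewrite expr_div_n -!mulrA; congr (_ * (_ * _)); rewrite mulKf // expf_neq0.
Qed.

Lemma germs_regular n (g : 'I_n -> K) : noeth O -> chain_in O n -> ~ chain_in O n.+1 ->
  (forall i, nonu O (g i)) ->
  (forall a, nonu O a -> exists c : 'I_n -> K, (forall i, O (c i)) /\ a = \sum_i c i * g i) ->
  is_regular_local (stalk x).
Proof.
move=> On c1 c2 gn gen; split; first exact: germs_noeth.
exists n; split; first exact: germs_dim.
have [b bP] := germs_lift (fun i => (gn i).1); exists b; apply/seteqP; split=> [a /= nu|_ [c ->]] /=.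
  have /gen[c [Oc e]] : nonu O (io a) by apply: contrapT => /(io_unit M); exact/negP.
  have [d dP] := germs_lift Oc; exists d; apply: (io_inj M); rewrite e (io_sum M); apply: eq_bigr => i _.
  by rewrite (md_M M) dP bP.
apply/negP => /(io_unit M); apply; have [mO mm _ _] := m_prime fm x; have [m0 mD _] := mm.
rewrite (io_sum M); apply: (big_ind (nonu O)) => // i _; rewrite (md_M M) bP.
by apply: (submodM mm); [exact: iOr|exact: gn].
Qed.
End Transfer.

(** * Rational forms and their local equations *)

Section RationalForms.
Variables (k : fieldType) (X : kscheme k) (r : nat) (F : set X -> set (vfield X)) (x eta : X).
Implicit Types (w : ('I_r -> (stalk eta -> stalk eta)) -> stalk eta).

Lemma rational_scale w c : rational_form F w -> rational_form F (fun v => c * w v).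
Proof.
move=> [wl wa]; split=> [u i a d d' hu' hd hd'|u i j hu' ij uij]; last by rewrite (wa u i j) ?mulr0.
by rewrite wl //; ring.
Qed.

(** The section h^-1 w is 1 times itself, so the definition of a local equation places it in the
    canonical stalk. *)
Lemma divisor_regular w h v : divisor_at F x w h -> (forall i, near_fol F x eta (v i)) -> near_sec x eta (h^-1 * w v).
Proof.
move=> [wr hu hw]; have n1 : near_sec x eta (1 : stalk eta).
  by exists setT, (fun=> 1); split=> //; [exact: openT|exact: sec_one openT].
by have [_ h1] := (hw _ (rational_scale h^-1 wr)).2 (ex_intro _ 1 (conj n1 (fun v _ => esym (mul1r _)))); exact: h1.
Qed.

Lemma near_secM (K : fieldType) (io : forall x : X, stalk x -> K) (a c : stalk eta) : kmodel io -> gen_of x eta ->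
  near_sec x eta a -> near_sec x eta c -> near_sec x eta (a * c).
Proof.
move=> M g /(near_secP M _ g) ha /(near_secP M _ g) hc; apply/(near_secP M _ g).
by rewrite (md_M M); apply: subringM => //; exact: (O_sub (md_fm M)).
Qed.
End RationalForms.

(** * Terminal foliations as spaces of derivations *)

Section Terminal.
Variables (k : fieldType) (X : kscheme k) (K : fieldType) (io : forall x : X, stalk x -> K).
Hypotheses (M : kmodel io) (char0 : [pchar k] =i pred0).
Variables (r : nat) (F : set X -> set (vfield X)).
Hypotheses (F_fol : foliation F) (F_sat : saturated F) (F_free : locally_free r F).
Let fm := md_fm M.
Let k0 := consts io.
Let k0f : subfield k0 := consts_subfield M.

(* The stalk of F at the generic point, inside Der_k(K). *)
Definition gfol : set (K -> K) :=
  [set d | der k0 d /\ exists U D, [/\ open U, U !=set0, F U D & repr io U D d]].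

Let Fs : tangent_submodule F. Proof. by case: F_fol. Qed.

Lemma gfol_der d : gfol d -> der k0 d. Proof. by case. Qed.

Lemma gfol_zero : gfol (fun=> 0).
Proof.
split; first exact: der_zero.
have [y _ _] := fm_gen fm; exists setT, (fun x a => 0).
split; [exact: openT|by exists y|exact: (fol_zero Fs openT)|by move=> x _ a; exact: io0].
Qed.

Lemma gfol_lin c d e : gfol d -> gfol e -> gfol (fun x => c * d x + e x).
Proof.
move=> [dd [U [D [oU U0 FD rD]]]] [de [V [E [oV V0 FE rE]]]].
have [y dy Oy] := fm_gen fm; split; first exact: der_lin.
have [|W [s [oW Wy Ws se]]] := sec_at M (x := y) (c := c); first by rewrite Oy.
have oI : open (U `&` V `&` W) by apply: openI => //; exact: openI.
exists (U `&` V `&` W), (vadd (vscale s D) E); split=> //.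
- by exists y; split=> //; split; [exact: (dy _ oU U0)|exact: (dy _ oV V0)].
- apply: (fol_add Fs oI); last by apply: (fol_restrict Fs oV oI) FE => x [[]].
  apply: (fol_scale Fs oI); first by apply: (sec_restrict oW oI) Ws => x [].
  by apply: (fol_restrict Fs oU oI) FD => x [[]].
- by move=> x [[Ux Vx] Wx] a; rewrite (ioD M) (md_M M) se // rD // rE.
Qed.

Lemma gfol_comb : comb_closed gfol. Proof. exact: comb_of_lin gfol_zero gfol_lin. Qed.

Lemma gfol_bracket : lie_closed gfol.
Proof.
move=> d e [dd [U [D [oU U0 FD rD]]]] [de [V [E [oV V0 FE rE]]]].
have [y dy Oy] := fm_gen fm; split; first exact: der_bracket.
have oI : open (U `&` V) by exact: openI.
exists (U `&` V), (lie_bracket D E); split=> //.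
- by exists y; split; [exact: (dy _ oU U0)|exact: (dy _ oV V0)].
- case: F_fol => _ _; apply=> //; [by apply: (fol_restrict Fs oU oI) FD => x []|].
  by apply: (fol_restrict Fs oV oI) FE => x [].
- by move=> x [Ux Vx] a; rewrite (md_B M) !(rD, rE).
Qed.

Lemma F_comb n U (s : 'I_n -> germ_family X) (D : 'I_n -> vfield X) : open U -> (forall i, sec U (s i)) ->
  (forall i, F U (D i)) -> F U (vcomb s D).
Proof.
move=> oU; elim: n s D => [|n IH] s D Us FD.
  by apply: (fol_ext Fs oU _ (fol_zero Fs oU)) => x _ a; rewrite /vcomb big_ord0.
have h : F U (vadd (vscale (s ord0) (D ord0)) (vcomb (fun i => s (lift ord0 i)) (fun i => D (lift ord0 i)))).
  by apply: (fol_add Fs oU); [exact: (fol_scale Fs oU)|exact: IH].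
by apply: (fol_ext Fs oU _ h) => x _ a; rewrite /vcomb big_ord_recl.
Qed.

Lemma F_repr U D : open U -> F U D -> exists2 d, gfol d & repr io U D d.
Proof.
move=> oU FD; have [U0|/nonemptyPn U0] := pselect (U !=set0); last first.
  by exists (fun=> 0); [exact: gfol_zero|move=> x; rewrite U0].
have [d dd rd] := (tangentP M D oU).1 (fol_tangent Fs oU FD).
by exists d => //; split=> //; exists U, D.
Qed.

(** A local frame of F is a basis of its generic stalk over K. The last clause records that sections
    of F near x have coefficients regular at x in this basis. *)
Lemma local_basis x : exists e : 'I_r -> K -> K,
  [/\ forall i, Lst gfol (germs io x) (e i), lin_free e, lin_gen gfol e,
      exists U D, [/\ open U, U x, forall i, F U (D i) & forall i, repr io U (D i) (e i)]
    & forall V D d, open V -> V x -> F V D -> repr io V D d ->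
        exists c : 'I_r -> K, (forall i, germs io x (c i)) /\ forall a, d a = \sum_i c i * e i a].
Proof.
have [U [D [oU Ux FD gen rel]]] := F_free x; have [y dy Oy] := fm_gen fm.
have Uy : U y by apply: dy => //; exists x.
have h i : exists d, gfol d /\ repr io U (D i) d by have [d Ld rd] := F_repr oU (FD i); exists d.
have [e eP] := choice h; have re i : repr io U (D i) (e i) by case: (eP i).
have span V E d : open V -> V `<=` U -> V y -> F V E -> repr io V E d ->
    exists c : 'I_r -> K, (forall x, V x -> forall i, germs io x (c i)) /\ forall a, d a = \sum_i c i * e i a.
  move=> oV VU Vy FE rE; have [s [Vs sE]] := gen _ _ oV VU FE.
  have [c cP] := consts_sec M oV Vs; exists c; split=> [z Vz i|]; first by exists (s i z) => //; exact: cP.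
  apply: (repr_gen M oV Vy rE) => z Vz a; rewrite (sE _ Vz).
  have rV i : repr io V (D i) (e i) by move=> w /VU; exact: re.
  exact: (repr_comb M cP rV).
exists e; split=> [i|c hc i|d [dd [V [E [oV V0 FE rE]]]]||V E d oV Vx FE rE].
- by split; [case: (eP i)|exact: repr_stab (re i) Ux].
- have [|V [s [oV Vy Vs sc]]] := secs_at M (x := y) (c := c); first by move=> j; rewrite Oy.
  have oI := openI oU oV; have UVy : (U `&` V) y by [].
  have rs : relation D (U `&` V) s.
    split=> [j|z [Uz Vz] a]; first by apply: (sec_restrict oV oI) (Vs j) => z [].
    have rz j : repr io (U `&` V) (D j) (e j) by move=> w [Uw _]; exact: re.
    apply: (io_inj M); rewrite (repr_comb M (c := c) _ rz (conj Uz Vz)); last by move=> j w [_ Vw]; exact: sc.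
    by rewrite hc (io0 M).
  have := rel _ _ oI (@subIsetl _ _ _) rs i y UVy => s0; by rewrite -(sc i y Vy) s0 (io0 M).
- have oI := openI oU oV; have [|||c [_ cE]] := span (U `&` V) E d oI (@subIsetl _ _ _); last by exists c.
  + by split=> //; exact: dy.
  + by apply: (fol_restrict Fs oV oI) FE => z [].
  + by move=> z [_ Vz]; exact: rE.
- by exists U, D.
- have oI := openI oU oV; have [|||c [cO cE]] := span (U `&` V) E d oI (@subIsetl _ _ _).
  + by split=> //; apply: dy => //; exists x.
  + by apply: (fol_restrict Fs oV oI) FE => z [].
  + by move=> z [_ Vz]; exact: rE.
  by exists c; split=> //; exact: cO.
Qed.

(** Saturation recovers F from its generic stalk: a derivation of [gfol] regular on U becomes a
    section of F after multiplication by a common denominator b of its coefficients. *)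
Lemma F_Fol U D : open U -> F U D <-> Fol io gfol U D.
Proof.
move=> oU; split=> [/(F_repr oU)//|[d gd rD]]; have [dd _] := gd.
apply: (fol_glue Fs oU) => x Ux; have [e [eL _ eg [V [E [oV Vx FE rE]]] _]] := local_basis x.
have [c cE] := eg _ gd; have [z [frA [AO _] _]] := germs_chart M x.
have As : is_subring (adjs k0 z) by apply: adjs_subring; exact: k0f.1.
have [b [/AO Ob b0 bc]] := common_denom (t := codom c) As (fun u _ => frA u).
have Oc i : germs io x (b * c i) by apply/AO/bc; exact: codom_f.
have [W [s [oW Wx Ws sE]]] := secs_at M Oc; have [W' [t [oW' W'x Wt tE]]] := sec_at M Ob.
have oI : open (U `&` V `&` (W `&` W')) by apply: openI; exact: openI.
have Ix : (U `&` V `&` (W `&` W')) x by [].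
apply: (F_sat (s := t) oI Ix).
- by apply: (sec_restrict oW' oI) Wt => w [_ []].
- by apply: contra b0 => /eqP t0; rewrite -(tE _ W'x) t0 (io0 M).
- apply/(tangentP M D oI); exists d => //; by move=> w [[Uw _] _]; exact: rD.
have FI : F (U `&` V `&` (W `&` W')) (vcomb s E).
  apply: F_comb => // i; first by apply: (sec_restrict oW oI) (Ws i) => w [_ []].
  by apply: (fol_restrict Fs oV oI) (FE i) => w [[]].
apply: (fol_ext Fs oI _ FI) => w [[Uw Vw] [Ww W'w]] a; apply: (io_inj M).
have sI i w' : (U `&` V `&` (W `&` W')) w' -> io (s i w') = b * c i by move=> [_ [? _]]; exact: sE.
have rI i : repr io (U `&` V `&` (W `&` W')) (E i) (e i) by move=> w' [[_ ?] _]; exact: rE.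
rewrite (repr_comb M sI rI) // (md_M M) tE // rD // cE mulr_sumr.
by apply: eq_bigr => i _; rewrite mulrA.
Qed.

Lemma near_Fol x y : near_fol F x y = near_fol (Fol io gfol) x y.
Proof.
by apply/seteqP; split=> _ [U [D [oU Ux Uy FD ->]]]; exists U, D; split=> //; exact/(F_Fol D oU).
Qed.

Lemma near_gfolP x y (d : stalk y -> stalk y) : gen_of x y ->
  near_fol F x y d <-> exists2 e, Lst gfol (germs io x) e & forall a, io (d a) = e (io a).
Proof. by move=> g; rewrite near_Fol; exact: (near_FolP M gfol_der). Qed.

Lemma stab_basis x e : Lst gfol (germs io x) e -> exists V D, [/\ open V, V x, F V D & repr io V D e].
Proof.
move=> [ge se]; have [V [oV Vx Ve]] := stab_near k0f fm (gfol_der ge) se.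
have [D rD] := repr_exists Ve; exists V, D; split=> //; apply/(F_Fol D oV); by exists e.
Qed.

Let L := gfol.
Let L_der d : L d -> der k0 d. Proof. exact: gfol_der. Qed.
Let L_comb := gfol_comb.
Let ch0 := char0_model M char0.

Lemma lst_basis x : exists e : 'I_r -> K -> K,
  [/\ forall i, Lst L (germs io x) (e i), lin_free e, lin_gen L e
    & forall d, Lst L (germs io x) d ->
        exists c : 'I_r -> K, (forall i, germs io x (c i)) /\ forall a, d a = \sum_i c i * e i a].
Proof.
have [e [eL ef eg _ gen]] := local_basis x; exists e; split=> // d Ld.
by have [V [D [oV Vx FD rD]]] := stab_basis Ld; exact: gen rD.
Qed.

Section Forms.
Variables (x eta : X) (e : 'I_r -> K -> K).
Hypothesis deta : dense eta.
Hypothesis eL : forall i, Lst L (germs io x) (e i).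
Hypotheses (e_free : lin_free e) (e_gen : lin_gen L e).
Hypothesis e_loc : forall d, Lst L (germs io x) d ->
  exists c : 'I_r -> K, (forall i, germs io x (c i)) /\ forall a, d a = \sum_i c i * e i a.

Let ioT c : exists a : stalk eta, io a = c.
Proof. by have : germs io eta c; [rewrite (dense_gen fm deta)|case=> a _ <-; exists a]. Qed.

Let geta : gen_of x eta. Proof. by move=> V oV Vx; apply: deta => //; exists x. Qed.

Lemma io_det n (A : 'M[stalk eta]_n) : io (\det A) = \det (\matrix_(i, j) io (A i j)).
Proof.
have [g gE] := hom_exists (md_1 M eta) (md_B M (x := eta)) (md_M M (x := eta)).
rewrite -gE -det_map_mx; congr (\det _); apply/matrixP => i j; by rewrite !mxE gE.
Qed.

Lemma jac_basis : exists b : 'I_r -> K, \det (jac e b) != 0.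
Proof.
have [z [frA _ _]] := germs_chart M x; have eL' i : L (e i) by case: (eL i).
have [D [b [DL _ db]]] := jac_nonzero k0f frA L_der L_comb eL' e_free.
exists b; apply: contra db => /eqP d0.
have h i : exists c : 'I_r -> K, forall a, D i a = \sum_l c l * e l a by apply: e_gen; case: (DL i).
have [c cE] := choice h; have -> : jac D b = (\matrix_(i, l) c i l) *m jac e b.
  by apply/matrixP => i j; rewrite !mxE cE; apply: eq_bigr => l _; rewrite !mxE.
by rewrite det_mulmx d0 mulr0.
Qed.

(** The form det(v_i(b_j)), divided by its value on the basis e. It is regular at x because the
    coefficients of regular derivations in this basis are. *)
Lemma det_form : exists w : ('I_r -> (stalk eta -> stalk eta)) -> stalk eta,
  [/\ rational_form F w, canonical_stalk F x w
    & forall v, (forall i a, io (v i a) = e i (io a)) -> w v = 1].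
Proof.
have [b b0] := jac_basis; have [be beE] := choice (fun j => ioT (b j)).
have [dl dlE] := ioT (\det (jac e b))^-1.
pose w (v : 'I_r -> stalk eta -> stalk eta) := dl * \det (\matrix_(i, j) v i (be j)).
have wr : rational_form F w.
  split=> [v i c d d' _ _ _|v i j _ ij e_ij].
    rewrite /w [\det _](determinant_multilinear (B := \matrix_(l, j) [eta v with i |-> d] l (be j))
      (C := \matrix_(l, j) [eta v with i |-> d'] l (be j)) (i0 := i) (b := c) (c := 1)); first by ring.
    - by apply/rowP => j; rewrite !mxE /= eqxx mul1r.
    - by apply/matrixP => l j; rewrite !mxE /= eq_sym (negPf (neq_lift _ _)).
    - by apply/matrixP => l j; rewrite !mxE /= eq_sym (negPf (neq_lift _ _)).
  by rewrite /w (determinant_alternate ij) ?mulr0 // => l; rewrite !mxE e_ij.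
exists w; split=> // [|v ve].
  split=> // v vn; apply/(near_secP M _ geta).
  have h' i : exists c : 'I_r -> K, (forall l, germs io x (c l)) /\ forall a, io (v i a) = \sum_l c l * e l (io a).
    have [d /e_loc[c [cO cE]] vE] := (near_gfolP (v i) geta).1 (vn i).
    by exists c; split=> // a; rewrite vE cE.
  have [c cE] := choice h'; rewrite /w (md_M M) dlE io_det.
  have -> : \matrix_(i, j) io ((\matrix_(i0, j0) v i0 (be j0)) i j) = (\matrix_(i, l) c i l) *m jac e b.
    apply/matrixP => i j; rewrite !mxE (cE i).2 beE; apply: eq_bigr => l _; by rewrite !mxE.
  rewrite det_mulmx mulrCA mulVf // mulr1; apply: subring_det; first exact: (O_sub fm).
  by move=> i j; rewrite mxE; case: (cE i).
apply: (io_inj M); rewrite /w (md_M M) dlE io_det (md_1 M).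
rewrite (_ : \matrix_(i, j) _ = jac e b) ?mulVf //.
by apply/matrixP => i j; rewrite !mxE ve beE.
Qed.

(* The value of h^-1 w on a local basis is a unit: the section h^-1 w generates the canonical
   sheaf at x, and so does the determinant form. *)
Lemma divisor_unit (w : ('I_r -> (stalk eta -> stalk eta)) -> stalk eta) (h : stalk eta)
    (v : 'I_r -> stalk eta -> stalk eta) : divisor_at F x w h -> (forall i a, io (v i a) = e i (io a)) ->
  exists g, [/\ near_sec x eta g, near_sec x eta (h^-1 * w v) & g * (h^-1 * w v) = 1].
Proof.
move=> dw ve; have [wr hu hw] := dw; have [w0 [w0r w0c w01]] := det_form.
have vn i : near_fol F x eta (v i).
  by apply/(near_gfolP) => //; exists (e i).
have vn' i : near_fol F eta eta (v i).
  by have [U [D [oU Ux Uy FD ->]]] := vn i; exists U, D.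
have [g [ng gE]] := (hw _ w0r).1 w0c; exists g; split=> //; last by rewrite -gE // w01.
exact: (divisor_regular dw vn).
Qed.
End Forms.

(** The local ring at xi is a localization of the coordinate ring of a chart around x, so distinct
    primes of it keep distinct contractions at x. *)
Lemma gen_chain (x xi : X) n : gen_of x xi -> chain_in (germs io xi) n -> chain_in (germs io x) n.
Proof.
move=> g [P [Pp Plt]]; have OO := O_gen fm g; have Os := O_sub fm x.
have [U [z [Ux kc]]] := fm_chart fm x; have Uxi : U xi by apply: g Ux; exact: (kc_open kc).
exists (fun i => germs io x `&` P i); split=> [i /Pp|i lin]; first exact: prime_contract Os OO.
have [ss ns] := Plt _ lin; have [P'O P'm _ _] := Pp _ lin; have [PO Pm _ _] := Pp _ (ltnW lin).
split=> [a [Oa Pa]|h]; first by split=> //; exact: ss.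
apply: ns => c Pc; have [a [d [Aa Ad nd cE]]] := kc_frac kc Uxi (P'O _ Pc).
have d0 := m_nz fm nd; have Od := kc_sub kc Uxi Ad.
have Pa : P i.+1 a by rewrite -[a](divfK d0) -cE mulrC; exact: (submodM P'm).
have [_ Pia] := h _ (conj (kc_sub kc Ux Aa) Pa).
by rewrite cE mulrC; apply: (submodM Pm) => //; exact: (m_inv fm).
Qed.

Lemma Lst_gen (x xi : X) d : gen_of x xi -> Lst L (germs io x) d -> Lst L (germs io xi) d.
Proof.
by move=> g [Ld sd]; split=> //; have [V [oV Vx Vs]] := stab_near k0f fm (L_der Ld) sd; apply: Vs; exact: g.
Qed.

Hypotheses (X_normal : normal_scheme X) (F_terminal : terminal r F).

(* If the maximal ideal at xi were invariant and of height at least two, blowing it up would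
   produce an exceptional divisor of discrepancy at most zero: derivations lift to the
   normalised blow-up, so that F pulls back without zeros along it. *)
Lemma no_stable_chain xi : (forall D, Lst L (germs io xi) D -> forall a, nonu (germs io xi) a -> nonu (germs io xi) (D a)) ->
  ~ chain_in (germs io xi) 2.
Proof.
move=> st ch; have L_bracket := gfol_bracket.
have xi_nz : exists2 t, nonu (germs io xi) t & t != 0.
  have [P [Pp Plt]] := ch; have [_ ns] := Plt 0%N erefl.
  have [t Pt nt] : exists2 t, P 1%N t & ~ P 0%N t.
    by apply: contrapT => h; apply: ns => t Pt; apply: contrapT => nt; apply: h; exists t.
  exists t; first exact: (prime_sub_max (fm_local fm xi) (Pp 1%N erefl)).
  by apply/eqP => t0; apply: nt; rewrite t0; exact: prime_in0 (Pp 0%N erefl).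
have [sg [sgE sgr]] := embed_exists M.
pose Y := bl M ch0 sgr xi_nz; pose pi : morphism Y X := blpi M ch0 sgr xi_nz.
pose jo := fun (y : Y) (a : stalk y) => \val a : K.
have MY : kmodel jo := bl_io M ch0 sgr xi_nz.
have gj : germs jo = @bO K X (germs io) xi := bl_germs M ch0 sgr xi_nz.
have fmY := md_fm MY.
pose G := Fol jo L.
have pb : pullback_foliation pi F G.
  have [h1 h2 h3] := pullback_Fol M sgE (bfm M ch0 sgr xi_nz) (@bpi_continuous _ _ _ _ _) (@bpi_sub _ _ _ _ _) (@bpi_dom _ _ _ _ _) L_der L_comb L_bracket.
  split=> // U iU D E rel; apply: (iff_trans _ (h3 U iU D E rel)); by apply: F_Fol; case: iU.
have [p [sp np pp [t tn t0]]] := bl_divisor ch0 k0f fm xi_nz.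
have lp : localring (bO p) (nonu (bO p)) := bl_local (blP p).
have ex : exceptional_prime_divisor pi (p : Y).
  split; last by apply/(germs_chain M); exact: (gen_chain sp ch).
  apply: (germs_dim MY); rewrite gj; last exact: principal_dim lp np pp.
  have [bs bp _] := lp; exists (fun i => if i is 0%N then [set 0] else nonu (bO p)); split=> [[|i] _|[|i] // _].
  - exact: prime_zero bs.
  - exact: bp.
  - split=> [_ ->|h]; first by case: bp => _ [].
    by move: t0; rewrite (h _ tn) eqxx.
have bi : birational pi by exact: proj_birational.
have Ynorm : normal_scheme Y by apply: real_normal => y; exact: bl_normal (blP y).
have [a [eta [w [w' [h [h' [geta sf dF dG [t1 [u [Ot hO [Ou [u2 Ou2 uu2]] hE]]]]]]]]] a0] :=
  F_terminal (proj_k M sgE _ _ _) (real_integral _) Ynorm (bl_proper M ch0 sgr xi_nz)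
    bi pb ex.
have deta : dense eta by exact: generic_dense.
have dpi : dense (pi eta) by exact: (generic_dense (bi _ geta).1).
have gx : gen_of (pi p) (pi eta) by move=> V oV Vx; apply: dpi => //; exists (pi p).
have gpe : gen_of (p : Y) eta by move=> V oV Vp; apply: deta => //; exists p.
have [e [eL ef eg el]] := lst_basis (pi p).
have [|v vE] := lift_stab (io := io) (x := pi eta) (d := e); first by move=> i b _; rewrite (dense_gen fm dpi).
have [|v' vE'] := lift_stab (io := jo) (x := eta) (d := e); first by move=> i b _; rewrite (dense_gen fmY deta).
have [g [ng nw gw]] := divisor_unit dpi eL ef eg el dF vE.
(* Stability of the maximal ideal at xi makes the blown-up ideal stable, so a basis of F at the
   image point stays regular on the blow-up. *)
have lift i : Lst L (germs jo p) (e i).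
  have [Le se] := eL i; split=> //; rewrite gj; apply: (bl_lift ch0 k0f fm (L_der Le) se) => b [Ob nb].
  by split=> [|_]; [exact: se|apply: st (nb sp); exact: Lst_gen (eL i)].
have L_derY d : L d -> der (consts jo) d.
  move=> /L_der[hD hM hk]; split=> // c [b /(_ p) <-]; apply: hk; rewrite /k0 -sgr; exists b => //.
  by symmetry; exact: rscalK.
have vn i : near_fol G (p : Y) eta (v' i).
  by apply/(near_FolP MY L_derY (v' i) gpe); exists (e i).
have piE b : jo eta (mor_stalk pi eta b) = io b := projK b.
have w'v : w' v' = mor_stalk pi eta (w v).
  apply: sf => [i|i|i b].
  - have [U [D [oU Ux Uy FD ->]]] : near_fol F (pi p) (pi eta) (v i); last by exists U, D.
    by apply/(near_gfolP (v i) gx); exists (e i).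
  - by have [U [D [oU Ux Uy FD ->]]] := vn i; exists U, D.
  - by apply: (io_inj MY); rewrite vE' !piE vE.
have n1 := divisor_regular dG vn.
(* If the discrepancy were n + 1, the uniformiser t1 would be a unit: h^-1 w takes a unit value on
   the basis, while h'^-1 w' takes a regular one, and their quotient is u t1^(n+1). *)
case: a a0 hE => [[|n]|] // _ hE; have [_ hu _] := dF; have [_ hu' _] := dG.
have secP b := near_secP MY b gpe.
have ng' : near_sec (p : Y) eta (mor_stalk pi eta g).
  apply/secP; rewrite piE gj; apply: bpi_sub.
  exact/(near_secP M _ gx).
have [ntu _] := hO _ Ot; apply: ((hO _ Ot).2 (ex_intro2 _ _ 1 _ (esym (mulr1 _)))).
  by apply/secP; rewrite (md_1 MY); exact: subring1 (O_sub fmY p).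
split=> //; exists (h'^-1 * w' v' * mor_stalk pi eta g * u * t1 ^+ n).
  have nM b c := @near_secM _ _ (p : Y) eta _ _ b c MY gpe; apply: (nM); first by apply: (nM) => //; apply: (nM).
  apply/secP; elim: n {hE} => [|n IH]; first by rewrite expr0 (md_1 MY); exact: subring1 (O_sub fmY p).
  by rewrite exprS (md_M MY); apply: subringM => //; [exact: (O_sub fmY)|exact/secP].
have {}hE : u * t1 ^+ n.+1 = h' / mor_stalk pi eta h by rewrite hE.
transitivity (h'^-1 * w' v' * mor_stalk pi eta g * (u * t1 ^+ n.+1)); first by rewrite exprS; ring.
transitivity (mor_stalk pi eta (g * (h^-1 * w v)) * (h' * h'^-1)).
  by rewrite hE w'v !rmorphM rmorphV //; ring.
by rewrite gw rmorph1 mulrV // mulr1.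
Qed.

(** A prime stable under the regular derivations of L' belongs to a point xi whose maximal ideal is
    stable under those of L. [no_stable_chain] bounds its height and normality makes it locally
    principal, as [dual_bases] requires. *)
Lemma dual_at (L' : set (K -> K)) n (e : 'I_n -> K -> K) x :
  (forall d, L' d -> der k0 d) -> comb_closed L' -> lie_closed L' -> (forall i, L' (e i)) ->
  lin_free e -> lin_gen L' e -> L `<=` L' ->
  exists (D : 'I_n -> K -> K) (b : 'I_n -> K),
   [/\ forall i, Lst L' (germs io x) (D i), forall j, germs io x (b j), forall i j, D i (b j) = (i == j)%:R
     & forall E, L' E -> forall a, E a = \sum_j E (b j) * D j a].
Proof.
move=> L'd L'c L'b eL ef eg LL; have [U [z [Ux kc]]] := fm_chart fm x.
have frA := chart_fracs fm kc (ex_intro _ _ Ux).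
have [|D [b [DL Ab Db DE]]] := dual_bases ch0 k0f frA L'd L'c L'b eL ef eg (px_prime k0f fm kc Ux); last first.
  by exists D, b; split=> // [i|j]; [rewrite (O_locz fm kc Ux)|exact: (kc_sub kc Ux (Ab j))].
move=> Q QP _ Qst; have [xi [Uxi Qxi]] := kc_point kc QP.
have QE : Q = px (germs io) k0 z xi.
  apply/seteqP; split=> a; first by have [QA _ _ _] := QP; move=> Qa; split; [exact: QA|apply/Qxi => //; exact: QA].
  by move=> [Aa /(Qxi _ Aa)].
rewrite QE -(O_locz fm kc Uxi) -(m_mz k0f fm kc Uxi).
apply: (principal_dim1 (fm_local fm xi) (O_noeth k0f fm kc Uxi) (germs_normal M (X_normal xi))).
apply: no_stable_chain => D [LD sD] c nc; have Os := O_sub fm xi.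
have [mO mm _ _] := m_prime fm xi; have dD := L_der LD.
(* Q is known to be stable only under derivations that preserve the whole chart; the multiple of D
   by some d outside Q is of this kind. *)
have [|d [Ad nQ sdD]] := stab_clear k0f QP dD.
  by move=> a Aa; rewrite QE -(O_locz fm kc Uxi); apply: sD; exact: (kc_sub kc Uxi).
have AO := kc_sub kc Uxi; have inv a : adjs k0 z a -> ~ nonu (germs io xi) a -> germs io xi a^-1.
  by move=> Aa na; apply: (m_inv fm) => //; exact: AO.
have [a [b [Aa Ab nb cE]]] := kc_frac kc Uxi (mO _ nc).
have b0 := m_nz fm nb; have nd : ~ nonu (germs io xi) d by move/(Qxi _ Ad).
have na : nonu (germs io xi) a by rewrite -[a](divfK b0) -cE mulrC; apply: (submodM mm) => //; exact: AO.
have nDa : nonu (germs io xi) (D a).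
  have [_ _ h _] := QP; have Q1 : Q (d * D a).
    apply: (Qst (fun a => d * D a)); last exact/(Qxi _ Aa).
    by split=> //; apply: LL; exact: (L_scaler L_comb).
  rewrite -[D a](mulKf (m_nz fm nd)); apply: (submodM mm); first exact: inv.
  by apply/Qxi => //; exact: sdD.
rewrite cE (der_div k0f dD) //; apply: (submodB Os mm).
  by rewrite mulrC; apply: (submodM mm) => //; exact: inv.
rewrite mulrC; apply: (submodM mm); last by rewrite -cE.
by apply: subringM => //; [apply: sD; exact: AO|exact: inv].
Qed.

(** With dual bases D_j and b_j, the sum of the phi(D_j) db_j represents phi; the remaining work is
    linearity over the local ring. *)
Lemma foliation_regular : regular_foliation F.
Proof.
move=> x phi lin; have [e [eL ef eg _]] := lst_basis x; have eL' i : L (e i) by case: (eL i).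
have [D [b [DL Ob _ DE]]] := dual_at x L_der L_comb (gfol_bracket) eL' ef eg (fun _ => id).
have g : gen_of x x by [].
have [be beE] := germs_lift Ob.
have [|d dE] := lift_stab (io := io) (x := x) (d := D); first by move=> i; case: (DL i).
have nd j : near_fol F x x (d j).
  by apply/(near_gfolP (d j) g); exists (D j).
have n0 : near_fol F x x (fun=> 0).
  apply/(near_gfolP (fun=> 0) g); exists (fun=> 0); last by move=> a; exact: io0.
  by split=> [|a _]; [exact: (gfol_zero)|exact: subring0 (O_sub fm x)].
have p0 : phi (fun=> 0) = 0.
  have := lin (-1) _ _ n0 n0; rewrite (_ : (fun _ => _) = fun=> 0); first by move=> ->; ring.
  by apply/funext => a; ring.
have comb n (c : 'I_n -> stalk x) (f : 'I_n -> stalk x -> stalk x) : (forall i, near_fol F x x (f i)) ->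
    near_fol F x x (fun a => \sum_i c i * f i a) /\ phi (fun a => \sum_i c i * f i a) = \sum_i c i * phi (f i).
  elim: n c f => [|n IH] c f nf.
    by rewrite (_ : (fun _ => _) = fun=> 0) ?big_ord0 //; apply/funext => a; rewrite big_ord0.
  rewrite (_ : (fun _ => _) = fun a => c ord0 * f ord0 a + \sum_i c (lift ord0 i) * f (lift ord0 i) a); last first.
    by apply/funext => a; rewrite big_ord_recl.
  have [nh hE] := IH (fun i => c (lift ord0 i)) (fun i => f (lift ord0 i)) (fun i => nf _).
  rewrite lin // hE big_ord_recl; split=> //.
  have [d1 [L1 s1] E1] := (near_gfolP (f ord0) g).1 (nf ord0).
  have [d2 [L2 s2] E2] := (near_gfolP _ g).1 nh.
  apply/(near_gfolP _ g); exists (fun a => io (c ord0) * d1 a + d2 a).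
    split=> [|a Oa]; first exact: (gfol_lin).
    have Os := O_sub fm x; apply: subringD => //; [apply: subringM => //; [by exists (c ord0)|exact: s1]|exact: s2].
  by move=> a; rewrite (ioD M) (md_M M) E1 E2.
exists r, (fun j => phi (d j)), be => f /(near_gfolP f g)[E [LE sE] fE].
transitivity (phi (fun a => \sum_j f (be j) * d j a)); first congr (phi _).
  apply/funext => a; apply: (io_inj M); rewrite fE (DE _ LE) (io_sum M); apply: eq_bigr => j _.
  by rewrite (md_M M) fE beE dE.
by rewrite (comb _ _ _ nd).2; apply: eq_bigr => j _; rewrite mulrC.
Qed.

(** A derivation is determined by its values on z, so a maximal independent family of vectors of
    values gives a basis of Der_k(K). *)
Lemma der_basis z : (forall c, fracs (adjs k0 z) c) -> exists n (e : 'I_n -> K -> K),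
  [/\ forall i, der k0 (e i), lin_free e & lin_gen (der k0) e].
Proof.
move=> frA; have [n [B [fB rB gB]]] := max_rows [set v : 'rV[K]_(size z) | exists d, der k0 d /\ forall j, v 0 j = d z`_j].
have h i : exists d, der k0 d /\ forall j : 'I_(size z), B i j = d z`_j.
  by have [d [dd dE]] := rB i; exists d; split=> // j; rewrite -dE mxE.
have [e eP] := choice h; have de i : der k0 (e i) by case: (eP i).
exists n, e; split=> // [c c0 i|D dD].
  have : (\row_i c i) *m B = 0.
    apply/rowP => j; rewrite !mxE -[RHS](c0 z`_j); apply: eq_bigr => l _; rewrite mxE; congr (_ * _).
    by case: (eP l).
  by move/eqP; rewrite mulmx_free_eq0 // => /eqP/rowP/(_ i); rewrite !mxE.
have [|C CE] := submxP (gB (\row_j D z`_j) _); first by exists D; split=> // j; rewrite mxE.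
exists (fun i => C 0 i) => a; apply/eqP; rewrite -subr_eq0; apply/eqP.
have dE : der k0 (fun a => D a - \sum_i C 0 i * e i a).
  have := der_lin (-1) (der_comb (fun i => C 0 i) de) dD; congr (der k0 _); apply/funext => b.
  by rewrite mulN1r addrC.
apply: (der_gen0 k0f frA dE) => u /(nthP 0)[j lj <-].
have /rowP/(_ (Ordinal lj)) := CE; rewrite !mxE /= => ->; rewrite -sumrB big1 // => i _.
by case: (eP i) => _ ->; rewrite subrr.
Qed.

(** Here [dual_at] is applied to all of Der_k(K). A prime stable under its regular derivations is in
    particular stable under those of L, so the bound obtained from F applies. *)
Lemma scheme_regular : regular_scheme X.
Proof.
move=> x; have [z [frA AO On]] := germs_chart M x; have [n [e [de ef eg]]] := der_basis frA.
have [|D [b [DL Ob Db DE]]] := dual_at x (fun _ => id) (der_comb (k0 := k0)) _ de ef eg L_der.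
  exact: der_bracket.
have [s [g [c1 c2 gm gen]]] := regular_local ch0 k0f frA (fm_local fm x) On AO
  (fun i => (DL i).1) (fun i => (DL i).2) Ob Db DE.
exact: (germs_regular M On c1 c2 gm gen).
Qed.
End Terminal.

Theorem proposition5p17 (k : fieldType) (char0 : [pchar k] =i pred0)
  (X : kscheme k) (X_integral : integral_scheme X)
  (X_normal : normal_scheme X) (X_ft : finite_type_over X)
  (r : nat) (F : set X -> set (vfield X))
  (F_foliation : foliation F) (F_saturated : saturated F)
  (F_locally_free : locally_free r F) (F_terminal : terminal r F) :
  regular_scheme X /\ regular_foliation F.
Proof.
have [K [io M]] := model_exists X_integral X_ft.
split; first exact: (scheme_regular M char0 F_foliation F_saturated F_locally_free X_normal F_terminal).
exact: (foliation_regular M char0 F_foliation F_saturated F_locally_free X_normal F_terminal).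
Qed.
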